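(* Fix integers $k\ge1$ and $1\le q_1<\dots<q_k$ (not depending on $n$), and for each $n\ge1$ let $F^{(n)}=\sum_{i=1}^k I_{q_i}(f_i^{(n)})$, where each $f_i^{(n)}$ is a nonzero symmetric square-integrable kernel and, for each $n$, the family $\{f_i^{(n)}:i=1,\dots,k\}$ satisfies the technical assumptions (i)–(iii) listed in the context (the underlying Poisson measure and its control measure $\mu=\mu_n$ may depend on $n$). Let $\sigma^2(n)=E[(F^{(n)})^2]$ with $\sigma(n)>0$, assume that $\lim_{n\to\infty}\sigma^2(n)=\sigma^2$ for some $\sigma^2>0$ ($\sigma>0$), and let $N\sim\mathscr N(0,\sigma^2)$. Let $B_3(F^{(n)};\sigma(n))$ be the quantity defined in the context. 1. There is a constant $C_0=C_0(q_1,\dots,q_k)\in(0,\infty)$, depending only on $q_1,\dots,q_k$, such that for every $n$ $$d_W(F^{(n)},N)\le C_0\,B_3(F^{(n)};\sigma(n))+\frac{\sqrt{2/\pi}}{\sigma(n)\vee\sigma}\,|\sigma^2(n)-\sigma^2|.$$ In particular, if $B_3(F^{(n)};\sigma(n))\to0$ as $n\to\infty$, then $d_W(F^{(n)},N)\to0$ and therefore $F^{(n)}$ converges in law to $N$. 2. Assume that $f_i^{(n)}\ge0$ for every $i,n$. Then a sufficient condition for $B_3(F^{(n)};\sigma(n))\to0$ is that $E[(F^{(n)})^4]-3\sigma^4(n)\to0$. 3. Assume that $f_i^{(n)}\ge0$ for every $i,n$, and that the sequence $(F^{(n)})^4$, $n\ge1$, is uniformly integrable. Then the following conditions are equivalent,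 as $n\to\infty$: (a) $d_W(F^{(n)},N)\to0$; (b) $B_3(F^{(n)};\sigma(n))\to0$; (c) $E[(F^{(n)})^4]-3\sigma^4(n)\to0$.
   Context: $(Z,\mathscr Z,\mu)$ is a Borel space with its Borel $\sigma$-field and a $\sigma$-finite measure $\mu$ without atoms. $\eta$ is a Poisson measure on $Z$ with control $\mu$: $\eta(B)$ is Poisson with mean $\mu(B)$ whenever $\mu(B)<\infty$, and $\eta(B),\eta(C)$ are independent for disjoint $B,C$; $\hat\eta=\eta-\mu$. $L^2_s(\mu^q)$ is the space of $\mu^q$-a.e. symmetric functions in $L^2(\mu^q)$, and $I_q(f)$ is the multiple Wiener–Itô integral of order $q$ of $f\in L^2_s(\mu^q)$ with respect to $\hat\eta$, normalized so that $E[I_q(f)I_m(g)]=q!\langle f,g\rangle_{L^2(\mu^q)}\mathbf 1_{q=m}$. For integrable $U,Y$, $d_W(U,Y)=\sup|E[h(U)]-E[h(Y)]|$, the supremum being over Lipschitz $h:\mathbb R\to\mathbb R$ with Lipschitz constant $\le1$. Contractions: for $f$ and $g$ symmetric functions of $p$ and $q$ variables, $0\le l\le r\le p\wedge q$, $$f\star_r^l g(\gamma_1,\dots,\gamma_{r-l},t_1,\dots,t_{p-r},s_1,\dots,s_{q-r})=\int_{Z^l}f(z_1,\dots,z_l,\gamma_1,\dots,\gamma_{r-l},t_1,\dots,t_{p-r})\,g(z_1,\dots,z_l,\gamma_1,\dots,\gamma_{r-l},s_1,\dots,s_{q-r})\,\mu^l(dz_1,\dots,dz_l),$$ with no integration when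 $l=0$. For $F=\sum_{i=1}^kI_{q_i}(f_i)$ and $s>0$, $$B_3(F;s)=\frac1s\Big\{\max_1\|f_i\star_r^l f_i\|_{L^2(\mu^{2q_i-r-l})}+\max_2\|f_i\star_r^l f_j\|_{L^2(\mu^{q_i+q_j-r-l})}+\max_{i=1,\dots,k}\|f_i\|^2_{L^4(\mu^{q_i})}\Big\},$$ where $\max_1$ ranges over all $1\le i\le k$ with $q_i>1$ and all $(r,l)$ with $r\in\{1,\dots,q_i\}$, $1\le l\le r\wedge(q_i-1)$, and $\max_2$ ranges over all $1\le i<j\le k$ and all $(r,l)$ with $r\in\{1,\dots,q_i\}$, $l\in\{1,\dots,r\}$ (a maximum over an empty set is $0$). Technical assumptions on $\{f_i:i=1,\dots,k\}$: (i) for every $i$ and every $r=1,\dots,q_i$, the kernel $f_i\star_{q_i}^{q_i-r}f_i$ is in $L^2(\mu^r)$; (ii) for every $i$ with $q_i\ge2$, every $r=1,\dots,q_i$ and $l=1,\dots,r$, the contraction $|f_i|\star_r^l|f_i|(z_1,\dots,z_{2q_i-r-l})$ is well defined and finite at every $(z_1,\dots,z_{2q_i-r-l})\in Z^{2q_i-r-l}$; (iii) for every $i,j$ with $\max(q_i,q_j)>1$, every integer $m$ with $|q_i-q_j|\vee1\le m\le q_i+q_j-2$, and every $(r,l)$ (with $0\le l\le r\le q_i\wedge q_j-1$) such that $m=q_i+q_j-2-r-l$, $$\int_Z\Big[\int_{Z^m}(f_i(z,\cdot)\star_r^l f_j(z,\cdot))^2\,d\mu^m\Big]^{1/2}\mu(dz)<\infty,$$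 where $f_i(z,\cdot)$ is the function of $q_i-1$ variables obtained by fixing one argument equal to $z$. *)

(* Defs.v *)
From HB Require Import structures.
From mathcomp Require Import all_boot all_order all_algebra perm.
From mathcomp Require Import all_classical all_reals all_analysis measurable_realfun.

Set Implicit Arguments.
Unset Strict Implicit.
Unset Printing Implicit Defensive.
Import Order.TTheory GRing.Theory Num.Theory.
Import numFieldNormedType.Exports.
Local Open Scope classical_set_scope.
Local Open Scope ring_scope.
Local Open Scope ereal_scope.

Section power_measure.
Context d (Z : measurableType d) (R : realType).
Variable mu : {sigma_finite_measure set Z -> \bar R}.

Section step.
Variables (n : nat) (nu : {sigma_finite_measure set (n.-tuple Z) -> \bar R}).

Definition tuple_cons (x : Z * n.-tuple Z) : n.+1.-tuple Z :=
  [the n.+1.-tuple Z of x.1 :: x.2].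

Definition tuple_uncons (x : n.+1.-tuple Z) : Z * n.-tuple Z :=
  (thead x, [tuple of behead x]).

Lemma tuple_consK : cancel tuple_cons tuple_uncons.
Proof.
move=> [z t]; rewrite /tuple_cons /tuple_uncons/= theadE; congr pair.
exact/val_inj.
Qed.

Lemma tuple_unconsK : cancel tuple_uncons tuple_cons.
Proof. by move=> x; rewrite /tuple_cons/= [RHS]tuple_eta; apply/val_inj. Qed.

Lemma measurable_tuple_cons : measurable_fun [set: Z * n.-tuple Z] tuple_cons.
Proof. exact: measurable_cons. Qed.

Lemma measurable_tuple_uncons : measurable_fun setT tuple_uncons.
Proof.
apply/measurable_fun_pairP; split; first exact: measurable_tnth.
exact: measurable_behead.
Qed.

Definition power_step : set (n.+1.-tuple Z) -> \bar R :=
  pushforward (mu \x nu) tuple_cons.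

Let power_step0 : power_step set0 = 0.
Proof. by rewrite /power_step /pushforward preimage_set0 measure0. Qed.

Let power_step_ge0 A : 0 <= power_step A.
Proof. by rewrite /power_step /pushforward; exact: measure_ge0. Qed.

Let measurable_preimage_cons A :
  measurable A -> measurable (tuple_cons @^-1` A).
Proof.
by move=> mA; rewrite -[X in measurable X]setTI; exact: measurable_tuple_cons.
Qed.

Let power_step_sigma_additive : semi_sigma_additive power_step.
Proof.
move=> F mF tF mUF; rewrite /power_step /pushforward preimage_bigcup.
apply: measure_semi_sigma_additive.
- by move=> k; exact: measurable_preimage_cons.
- apply/trivIsetP => /= i j _ _ ij; rewrite -preimage_setI.
  by move/trivIsetP : tF => /(_ _ _ _ _ ij) ->//; rewrite preimage_set0.
- by rewrite -preimage_bigcup; exact: measurable_preimage_cons.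
Qed.

HB.instance Definition _ := isMeasure.Build _ _ _ power_step
  power_step0 power_step_ge0 power_step_sigma_additive.

Lemma power_step_box (A : set Z) (B : set (n.-tuple Z)) :
  measurable A -> measurable B ->
  power_step (tuple_uncons @^-1` (A `*` B)) = mu A * nu B.
Proof.
move=> mA mB; rewrite /power_step /pushforward -comp_preimage.
rewrite (_ : _ \o _ = id) ?preimage_id ?product_measure1E//.
by apply/funext => x /=; rewrite tuple_consK.
Qed.

Lemma power_step_sigma_finite : sigma_finite setT power_step.
Proof.
have /sigma_finiteP[F [TF ndF Foo]] := sigma_finiteT mu.
have /sigma_finiteP[G [TG ndG Goo]] := sigma_finiteT nu.
exists (fun k => tuple_uncons @^-1` (F k `*` G k)).
  rewrite -preimage_bigcup (_ : \bigcup_k (F k `*` G k) = setT).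
    by rewrite preimage_setT.
  rewrite -setXTT TF TG; apply/seteqP; split => [[x y] [k _ []]|[x y]].
    by move=> Fx Gy; split; exists k.
  move=> [/= [k _ Fx] [l _ Gy]]; exists (maxn k l) => //; split.
    by move: x Fx; exact/subsetPset/ndF/leq_maxl.
  by move: y Gy; exact/subsetPset/ndG/leq_maxr.
move=> k; have [mF Fk] := Foo k; have [mG Gk] := Goo k; split.
  rewrite -[X in measurable X]setTI; apply: measurable_tuple_uncons => //.
  exact: measurableX.
by rewrite power_step_box// lte_mul_pinfty// ge0_fin_numE.
Qed.

HB.instance Definition _ :=
  Measure_isSigmaFinite.Build _ _ _ power_step power_step_sigma_finite.

End step.

(* The product measure mu^n on Z^n = n.-tuple Z; mu^0 is the unit mass. *)
Fixpoint power_measure (n : nat) :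
    {sigma_finite_measure set (n.-tuple Z) -> \bar R} :=
  match n with
  | 0%N => (\d_([tuple] : 0.-tuple Z) : {sigma_finite_measure set _ -> \bar R})
  | m.+1 => power_step (power_measure m)
  end.

End power_measure.

Lemma power_measure_box d (Z : measurableType d) (R : realType)
    (mu : {sigma_finite_measure set Z -> \bar R}) n (A : 'I_n -> set Z) :
  (forall i, measurable (A i)) ->
  power_measure mu n [set x | forall i, A i (tnth x i)] = \prod_(i < n) mu (A i).
Proof.
elim: n A => [|n IH] A mA.
  rewrite big_ord0/= (_ : [set _ | _] = setT) ?diracT//.
  by apply/seteqP; split => // x _ [].
rewrite big_ord_recl -IH//= /power_step /pushforward.
rewrite (_ : _ @^-1` _ =
    A ord0 `*` [set x | forall i, A (lift ord0 i) (tnth x i)]).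
  rewrite product_measure1E//.
  rewrite (_ : [set x | _] =
      \bigcap_(i in [set: 'I_n]) ((@tnth n Z ^~ i) @^-1` A (lift ord0 i))).
    apply: fin_bigcap_measurable => // i _.
    by rewrite -[X in measurable X]setTI; exact: measurable_tnth.
  by apply/seteqP; split => x /= H i; [move=> _|]; exact: H.
apply/seteqP; split => [[z t]/= H|[z t]/= [H0 H] i].
  by split => [|i]; [exact: (H ord0)|have := H (lift ord0 i); rewrite tnthS].
by case: (unliftP ord0 i) => [j|] ->; rewrite ?tnthS//; exact: H.
Qed.

Section kernels.
Context d (Z : measurableType d) (R : realType).

(* f applied to a sequence of arguments; the value 0 on sequences of the wrong
   length is never reached in the uses below. *)
Definition app_seq n (f : n.-tuple Z -> R) (s : seq Z) : R :=
  oapp f 0%R (insub s).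

(* f(z, .) *)
Definition fix_first n (f : n.-tuple Z -> R) (z : Z) : n.-1.-tuple Z -> R :=
  fun t => app_seq f (z :: t).

Variable mu : {sigma_finite_measure set Z -> \bar R}.

Definition L2s n (f : n.-tuple Z -> R) : Prop :=
  f \in Lfun (power_measure mu n) 2%:E /\
  forall s : 'S_n, {ae power_measure mu n,
    forall x, f [tuple tnth x (s i) | i < n] = f x}.

(* The contraction f *_r^l g.  The argument x is the concatenation of gamma
   (r - l variables), t (p - r) and s (q - r); take and drop recover the three
   blocks.  Values are extended reals so that the finiteness of a contraction
   is meaningful. *)
Definition star p q (f : p.-tuple Z -> R) (g : q.-tuple Z -> R)
    (r l : nat) : (p + q - r - l).-tuple Z -> \bar R :=
  fun x =>
    let gamma := take (r - l) x in
    let t := take (p - r) (drop (r - l) x) in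
    let s := drop (p - l) x in
    \int[power_measure mu l]_z
      (app_seq f (z ++ gamma ++ t) * app_seq g (z ++ gamma ++ s))%:E.
Arguments star {p q} f g r l x.

Definition star_norm p q (f : p.-tuple Z -> R) (g : q.-tuple Z -> R)
    (r l : nat) : \bar R :=
  'N[power_measure mu (p + q - r - l)]_(2%:E)[star f g r l].

Section family.
Variables (k : nat) (q : 'I_k -> nat) (f : forall i, (q i).-tuple Z -> R).
Arguments f : clear implicits.

(* star is a function of q i + q i - q i - (q i - r) = r variables. *)
Definition assumption_i : Prop :=
  forall i r, (1 <= r <= q i)%N ->
    measurable_fun setT (star (f i) (f i) (q i) (q i - r)) /\
    star_norm (f i) (f i) (q i) (q i - r) < +oo.

Definition assumption_ii : Prop :=
  forall i r l, (2 <= q i)%N -> (1 <= r <= q i)%N -> (1 <= l <= r)%N ->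
    let af := fun x => `|f i x|%R in
    forall x, star af af r l x < +oo.

(* Kernels f i (z, .) have q i - 1 variables, and
   (q i - 1) + (q j - 1) - r - l = m. *)
Definition assumption_iii : Prop :=
  forall i j m r l, (1 < maxn (q i) (q j))%N ->
    (maxn `|(q i)%:Z - (q j)%:Z| 1 <= m <= q i + q j - 2)%N ->
    (l <= r <= minn (q i) (q j) - 1)%N -> m = (q i + q j - 2 - r - l)%N ->
    \int[mu]_z star_norm (fix_first (f i) z) (fix_first (f j) z) r l
      < +oo.

Definition B3 (s : R) : \bar R :=
  (s^-1)%:E *
  (\big[maxe/0]_(i < k | (1 < q i)%N)
     \big[maxe/0]_(1 <= r < (q i).+1)
       \big[maxe/0]_(1 <= l < (minn r (q i).-1).+1)
         star_norm (f i) (f i) r l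
   + \big[maxe/0]_(i < k) \big[maxe/0]_(j < k | (i < j)%N)
       \big[maxe/0]_(1 <= r < (q i).+1) \big[maxe/0]_(1 <= l < r.+1)
         star_norm (f i) (f j) r l
   + \big[maxe/0]_(i < k)
       ('N[power_measure mu (q i)]_(4%:E)[EFin \o f i]) ^+ 2).

End family.

End kernels.
Arguments star {d Z R} mu {p q} f g r l x.
Arguments star_norm {d Z R} mu {p q} f g r l.

Section poisson_chaos.
Context d (Z : measurableType d) (R : realType).

(* Standard Borel space: Borel isomorphic to a Borel subset of the line. *)
Definition borel_space : Prop :=
  exists f : Z -> R, [/\ measurable_fun setT f, injective f &
    forall A, measurable A -> measurable (f @` A)].

Definition no_atoms (mu : {measure set Z -> \bar R}) : Prop :=
  forall z, mu [set z] = 0.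

Context d' (Omega : measurableType d') (P : probability Omega R).

Definition independent_ext (X Y : Omega -> \bar R) : Prop :=
  forall A B : set (\bar R), measurable A -> measurable B ->
    P (X @^-1` A `&` Y @^-1` B) = P (X @^-1` A) * P (Y @^-1` B).

(* The second argument of poisson_prob is a dummy. *)
Definition poisson_measure (mu : {measure set Z -> \bar R})
    (eta : R.-ker Omega ~> Z) : Prop :=
  (forall B, measurable B -> mu B < +oo -> forall n : nat,
     P [set w | eta w B = n%:R%:E] = poisson_prob (fine (mu B)) 0 [set n]) /\
  (forall B C, measurable B -> measurable C -> B `&` C = set0 ->
     independent_ext (eta ^~ B) (eta ^~ C)).

Variable mu : {sigma_finite_measure set Z -> \bar R}.

(* sum_c a_c 1_{A_c1} x ... x 1_{A_cq}, where for each c the sets A_c1, ...,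
   A_cq are pairwise disjoint with finite measure. *)
Record elementary (q : nat) := Elementary {
  elem_size : nat ;
  elem_coef : 'I_elem_size -> R ;
  elem_set : 'I_elem_size -> 'I_q -> set Z ;
  elem_measurable : forall c j, measurable (elem_set c j) ;
  elem_finite : forall c j, mu (elem_set c j) < +oo ;
  elem_disjoint : forall c, trivIset setT (elem_set c) }.

Definition elem_kernel q (e : elementary q) (x : q.-tuple Z) : R :=
  (\sum_(c < elem_size e)
    elem_coef c * \prod_(j < q) \1_(elem_set c j) (tnth x j))%R.

Definition compensated (eta : R.-ker Omega ~> Z) (w : Omega) (A : set Z) : R :=
  (fine (eta w A) - fine (mu A))%R.

Definition elem_integral (eta : R.-ker Omega ~> Z) q (e : elementary q)
    (w : Omega) : R :=
  (\sum_(c < elem_size e)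
    elem_coef c * \prod_(j < q) compensated eta w (elem_set c j))%R.

(* X is a version of I_q(f): the L^2(P)-limit of the integrals of elementary
   kernels converging to f in L^2(mu^q).  For symmetric f this has the
   normalization E[I_q(f)^2] = q! |f|^2, and it determines X almost surely. *)
Definition is_multiple_integral (eta : R.-ker Omega ~> Z) q
    (f : q.-tuple Z -> R) (X : Omega -> R) : Prop :=
  exists e : nat -> elementary q,
    ('N[power_measure mu q]_(2%:E)[EFin \o (elem_kernel (e n) \- f)%R]
       @[n --> \oo] --> 0) /\
    ('N[P]_(2%:E)[EFin \o (elem_integral eta (e n) \- X)%R]
       @[n --> \oo] --> 0).

End poisson_chaos.

Definition wasserstein (R : realType) d (Omega : measurableType d)
    (P : probability Omega R) d' (Omega' : measurableType d')
    (P' : probability Omega' R) (U : Omega -> R) (Y : Omega' -> R) : \bar R :=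
  ereal_sup [set `|'E_P[h \o U] - 'E_P'[h \o Y]|
            | h in [set h : R -> R | 1.-lipschitz (h : R^o -> R^o)]].

Definition cvg_in_law (R : realType) d (Omega : nat -> measurableType d)
    (P : forall n, probability (Omega n) R) d' (Omega' : measurableType d')
    (P' : probability Omega' R) (X : forall n, Omega n -> R) (Y : Omega' -> R)
    : Prop :=
  forall h : R -> R, continuous h -> bounded_fun h ->
    'E_(P n)[h \o X n] @[n --> \oo] --> 'E_P'[h \o Y].

Definition uniformly_integrable (R : realType) d
    (Omega : nat -> measurableType d) (P : forall n, probability (Omega n) R)
    (X : forall n, Omega n -> R) : Prop :=
  forall eps : R, (0 < eps)%R -> exists M : R, forall n,
    \int[P n]_(w in [set w | (M < `|X n w|)%R]) `|X n w|%:E <= eps%:E.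

(* Main.v *)
(** Every kernel is approximated, at the same time in L^2 and in the mixed norms
that dominate the contractions, by symmetric elementary kernels, which may be
taken constant on the products of a common finite family of disjoint cells.
The corresponding integrals are polynomials in the compensated counts of the
cells.  Independence is assumed for two disjoint sets only; the joint Poisson
law of the counts is recovered by Renyi's argument, through the void
probabilities of finer and finer meshes, which is where the absence of atoms
enters.

For polynomials in independent Poisson variables, the product formula in the
Charlier basis is a finite computation.  It bounds the variance of the carre du
champ and the second order remainder in Stein's equation by squared norms of
contractions, hence the distance to the normal law of variance s^2.  When the
kernels are nonnegative nothing cancels in the square of the polynomial, and
every contraction norm is bounded by the fourth cumulant E F^4 - 3 s^4.  Both
estimates pass to the limit, the fourth moments through a Cauchy argument with
the same product formula.

Conversely, convergence in Wasserstein distance gives convergence in law, since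
a bounded continuous function is the increasing limit of its Lipschitz
envelopes; uniform integrability of the fourth powers then gives
E F^4 --> 3 sigma^4. *)

Require Import Defs.
From HB Require Import structures.
From mathcomp Require Import all_boot all_order all_algebra.
From mathcomp Require Import ring lra zify.

Set Implicit Arguments.
Unset Strict Implicit.
Unset Printing Implicit Defensive.
Import Order.TTheory GRing.Theory Num.Theory.
Local Open Scope ring_scope.

(** * Polynomials in independent Poisson variables *)

(** The number of cells grows without bound along the approximation, so every constant in the finite
    computation may depend on the orders only. This rests on a support argument: a Charlier
    coefficient of a product of orders p and q receives contributions from at most [8 ^ (p + q)]
    triples of sets, all inside a support of at most [p + q] cells. Elementary kernels vanish on
    diagonals, so the polynomials are affine in each count, their products have degree at most two
    in each, and three Charlier polynomials suffice. The finite part is algebra over an ordered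
    field: expectation is replaced by a monotone linear functional satisfying the Mecke identity,
    which yields orthogonality and integration by parts. The norm of a contraction is not continuous
    for the L^2 norm of the kernels. It is continuous for the mixed norms, integrals over some
    variables of the square of an L^2 mass in the others: Cauchy-Schwarz bounds any contraction by
    two of them, and assumption (i) is what makes them finite. *)

Lemma sqr_sum_le (R : realFieldType) (I : finType) (A : pred I) (y : I -> R) :
  (\sum_(i | A i) y i) ^+ 2 <= #|A|%:R * \sum_(i | A i) y i ^+ 2.
Proof.
rewrite expr2 big_distrlr /=.
have -> : #|A|%:R * \sum_(i | A i) y i ^+ 2 =
    \sum_(i | A i) \sum_(j | A j) ((y i ^+ 2 + y j ^+ 2) / 2).
  transitivity (\sum_(i | A i) \sum_(j | A j) (y i ^+ 2 / 2) +
                \sum_(i | A i) \sum_(j | A j) (y j ^+ 2 / 2)).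
    rewrite [X in _ + X]exchange_big /= -big_split mulr_sumr.
    by apply: eq_bigr => i _ /=; rewrite sumr_const -mulr_natl; field.
  rewrite -big_split; apply: eq_bigr => i _; rewrite -big_split.
  by apply: eq_bigr => j _ /=; rewrite -mulrDl.
apply: ler_sum => i _; apply: ler_sum => j _.
by rewrite ler_pdivlMr//; have := sqr_ge0 (y i - y j); lra.
Qed.

Lemma discriminant_le (R : realFieldType) (a b c : R) : 0 <= a ->
  (forall x, 0 <= x ^+ 2 * a - x * b *+ 2 + c) -> b ^+ 2 <= a * c.
Proof.
rewrite le_eqVlt => /predU1P[<- H|a0 H].
  have [->|b0] := eqVneq b 0; first by rewrite mul0r expr0n.
  (* Without quadratic term a nonzero slope makes the form negative somewhere: at this point it
     equals - c - 2, while its value c at 0 is nonnegative. *)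
  have := H ((c + 1) / b); rewrite mulr0 divfK//.
  have := H 0; rewrite !mul0r expr0n mul0r mul0rn => ? ?; lra.
have := H (b / a); rewrite expr_div_n.
have -> : b ^+ 2 / a ^+ 2 * a - b / a * b *+ 2 + c = c - b ^+ 2 / a.
  by field; rewrite gt_eqF.
by rewrite subr_ge0 ler_pdivrMr// mulrC.
Qed.

Lemma sqr_sum_ge (R : realDomainType) (I : finType) (A : pred I) (y : I -> R) :
  (forall i, A i -> 0 <= y i) ->
  \sum_(i | A i) y i ^+ 2 <= (\sum_(i | A i) y i) ^+ 2.
Proof.
move=> y0; rewrite expr2 big_distrlr /=; apply: ler_sum => i Ai.
rewrite (bigD1 i)//= expr2 lerDl sumr_ge0// => j /andP[Aj _].
by rewrite mulr_ge0 ?y0.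
Qed.

(** * Functionals with the Mecke identity, and Charlier polynomials *)

Section poisson_functional.
Variables (R : realFieldType) (T : finType) (lam : T -> R).

Definition config := {ffun T -> nat}.

Definition add_point (t : T) (n : config) : config :=
  [ffun s => (n s + (s == t))%N].

(** The class has to contain more than polynomials, since the solution of Stein's equation evaluated
    at a polynomial is fed to the functional. Polynomial growth is stable under sums, products,
    absolute values and the addition of a point. *)
Definition tame (g : config -> R) := exists (C : R) (m : nat),
  forall n, `|g n| <= C * (1 + (\sum_t n t)%:R) ^+ m.

(** The Mecke identity characterises independent Poisson counts of means [lam]; with linearity,
    monotonicity and normalisation it is all that the finite computations use. Keeping the
    functional abstract keeps measure theory out of them; the mean over the counts of a Poisson
    measure is an instance ([counts_poisson]). *)
Record poisson_functional (E : (config -> R) -> R) : Prop := {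
  pf_linear : forall a g h, tame g -> tame h ->
    E (fun n => a * g n + h n) = a * E g + E h ;
  pf_mono : forall g h, tame g -> tame h ->
    (forall n, g n <= h n) -> E g <= E h ;
  pf_one : E (fun=> 1) = 1 ;
  pf_mecke : forall t g, tame g ->
    E (fun n => (n t)%:R * g n) = lam t * E (fun n => g (add_point t n)) }.

Lemma one_le_total (n : config) : 1 <= 1 + (\sum_t n t)%:R :> R.
Proof. by rewrite lerDl. Qed.
Hint Resolve one_le_total : core.

Lemma total_ge0 (n : config) m : 0 <= (1 + (\sum_t n t)%:R) ^+ m :> R.
Proof. by rewrite exprn_ge0// addr_ge0. Qed.
Hint Resolve total_ge0 : core.

Lemma tameP g : tame g -> exists2 C : R, 0 <= C &
  exists m, forall n, `|g n| <= C * (1 + (\sum_t n t)%:R) ^+ m.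
Proof.
move=> [C [m H]]; exists `|C| => //; exists m => n.
by apply: le_trans (H n) _; rewrite ler_wpM2r// ler_norm.
Qed.

Lemma tame_le g h : tame h -> (forall n, `|g n| <= `|h n|) -> tame g.
Proof. by move=> [C [m H]] gh; exists C, m => n; apply: le_trans (H n). Qed.

Lemma tame_ext g h : tame g -> g =1 h -> tame h.
Proof. by move=> tg gh; apply: tame_le tg _ => n; rewrite gh. Qed.

Lemma tame_norm g : tame g -> tame (fun n => `|g n|).
Proof. by move=> tg; apply: tame_le tg _ => n; rewrite normr_id. Qed.

Lemma tame_cst c : tame (fun=> c).
Proof. by exists `|c|, 0%N => n; rewrite expr0 mulr1. Qed.

Lemma tame_coord t : tame (fun n => (n t)%:R).
Proof.
exists 1, 1%N => n; rewrite mul1r expr1 ger0_norm// natr_sum (bigD1 t)//=.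
by rewrite addrCA lerDl addr_ge0// sumr_ge0.
Qed.

Lemma tame_add g h : tame g -> tame h -> tame (fun n => g n + h n).
Proof.
move=> /tameP[C C0 [m H]] /tameP[D D0 [m' H']]; exists (C + D), (m + m')%N => n.
apply: le_trans (ler_normD _ _) _; rewrite mulrDl lerD//.
- by apply: le_trans (H n) _; rewrite ler_wpM2l// ler_weXn2l// leq_addr.
- by apply: le_trans (H' n) _; rewrite ler_wpM2l// ler_weXn2l// leq_addl.
Qed.

Lemma tame_mul g h : tame g -> tame h -> tame (fun n => g n * h n).
Proof.
move=> /tameP[C C0 [m H]] /tameP[D D0 [m' H']]; exists (C * D), (m + m')%N => n.
by rewrite normrM exprD mulrACA ler_pM.
Qed.

Lemma tame_scale c g : tame g -> tame (fun n => c * g n).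
Proof. exact/tame_mul/tame_cst. Qed.

Lemma tame_opp g : tame g -> tame (fun n => - g n).
Proof. by move=> tg; apply: tame_le tg _ => n; rewrite normrN. Qed.

Lemma tame_sub g h : tame g -> tame h -> tame (fun n => g n - h n).
Proof. by move=> tg th; apply: tame_add => //; exact: tame_opp. Qed.

Lemma tame_exp k g : tame g -> tame (fun n => g n ^+ k).
Proof.
move=> tg; elim: k => [|k IH]; first exact: tame_cst.
by apply: tame_ext (tame_mul tg IH) _ => n; rewrite exprS.
Qed.

Lemma tame_sum (I : Type) (r : seq I) (A : pred I) (g : I -> config -> R) :
  (forall i, A i -> tame (g i)) -> tame (fun n => \sum_(i <- r | A i) g i n).
Proof.
move=> tg; elim: r => [|i r IH].
  by apply: tame_ext (tame_cst 0) _ => n; rewrite big_nil.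
case Ai: (A i); last by apply: tame_ext IH _ => n; rewrite big_cons Ai.
by apply: tame_ext (tame_add (tg _ Ai) IH) _ => n; rewrite big_cons Ai.
Qed.

Lemma tame_prod (I : Type) (r : seq I) (A : pred I) (g : I -> config -> R) :
  (forall i, A i -> tame (g i)) -> tame (fun n => \prod_(i <- r | A i) g i n).
Proof.
move=> tg; elim: r => [|i r IH].
  by apply: tame_ext (tame_cst 1) _ => n; rewrite big_nil.
case Ai: (A i); last by apply: tame_ext IH _ => n; rewrite big_cons Ai.
by apply: tame_ext (tame_mul (tg _ Ai) IH) _ => n; rewrite big_cons Ai.
Qed.

Lemma tame_add_point t g : tame g -> tame (fun n => g (add_point t n)).
Proof.
move=> /tameP[C C0 [m H]]; exists (C * 2 ^+ m), m => n.
apply: le_trans (H _) _; rewrite -mulrA ler_wpM2l// -exprMn lerXn2r ?nnegrE ?mulr_ge0 ?addr_ge0//.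
have -> : (\sum_s add_point t n s = \sum_s n s + 1)%N.
  under eq_bigr do rewrite ffunE.
  by rewrite big_split /= [X in (_ + X)%N](bigD1 t)//= eqxx [X in (_ + (_ + X))%N]big1 // => s /negPf ->.
by rewrite natrD mulrDr mulr1 addrA; have := ler0n R (\sum_s n s); lra.
Qed.

Section theory.
Variable E : (config -> R) -> R.
Hypothesis pfE : poisson_functional E.

Lemma pf_ext g h : tame g -> g =1 h -> E g = E h.
Proof.
move=> tg gh; have th := tame_ext tg gh.
by apply/eqP; rewrite eq_le !(pf_mono pfE)// => n; rewrite gh.
Qed.

Lemma pf_cst c : E (fun=> c) = c.
Proof.
have t0 := tame_cst 0; have t1 := tame_cst 1.
have E0 : E (fun=> 0) = 0.
  have /(_ (tame_cst _) (tame_cst _)) := pf_linear pfE (-1) (g := fun=> 0) (h := fun=> 0).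
  rewrite (pf_ext (h := fun=> 0)) => [||n]; [|exact: tame_cst|by rewrite mulr0 addr0].
  by rewrite mulN1r addNr.
rewrite (pf_ext (h := fun=> c * 1 + 0)) => [||n]; [|exact: tame_cst|by rewrite mulr1 addr0].
by rewrite (pf_linear pfE)// (pf_one pfE) E0 mulr1 addr0.
Qed.

Lemma pf_add g h : tame g -> tame h -> E (fun n => g n + h n) = E g + E h.
Proof.
move=> tg th; rewrite -[E g]mul1r -(pf_linear pfE)//; apply: pf_ext => [|n].
  exact: tame_add.
by rewrite mul1r.
Qed.

Lemma pf_scale c g : tame g -> E (fun n => c * g n) = c * E g.
Proof.
move=> tg; rewrite -[RHS]addr0 -[X in _ + X]pf_cst -(pf_linear pfE)//.
  by apply: pf_ext => [|n]; [exact: tame_scale|rewrite addr0].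
exact: tame_cst.
Qed.

Lemma pf_sub g h : tame g -> tame h -> E (fun n => g n - h n) = E g - E h.
Proof.
move=> tg th; rewrite -mulN1r -pf_scale// -pf_add//; last exact: tame_scale.
by apply: pf_ext => [|n]; [exact: tame_sub|rewrite mulN1r].
Qed.

Lemma pf_sum (I : Type) (r : seq I) (A : pred I) (g : I -> config -> R) :
  (forall i, A i -> tame (g i)) ->
  E (fun n => \sum_(i <- r | A i) g i n) = \sum_(i <- r | A i) E (g i).
Proof.
move=> tg; elim: r => [|i r IH].
  rewrite big_nil -[RHS]pf_cst; apply: pf_ext => [|n]; last by rewrite big_nil.
  exact: tame_sum.
rewrite big_cons -IH; case Ai: (A i).
  rewrite -pf_add; [|exact: tg|exact: tame_sum].
  by apply: pf_ext => [|n]; [exact: tame_sum|rewrite big_cons Ai].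
by apply: pf_ext => [|n]; [exact: tame_sum|rewrite big_cons Ai].
Qed.

Lemma pf_ge0 g : tame g -> (forall n, 0 <= g n) -> 0 <= E g.
Proof. by move=> tg g0; rewrite -[leLHS]pf_cst (pf_mono pfE)//; exact: tame_cst. Qed.

Lemma pf_norm g : tame g -> `|E g| <= E (fun n => `|g n|).
Proof.
move=> tg; have tn := tame_norm tg; rewrite ler_norml (pf_mono pfE) ?andbT//; last first.
  by move=> n; exact: ler_norm.
rewrite -mulN1r -pf_scale// (pf_mono pfE)//; first exact: tame_scale.
by move=> n; rewrite mulN1r lerNl ler_normr lexx orbT.
Qed.

(** The index i lets a weighted sum over cells and the mean act as a single integral, as the
    remainder in Stein's equation requires; one index of weight 1 gives the usual inequality. *)
Lemma pf_cauchy_schwarz (I : finType) (w : I -> R) (g h : I -> config -> R) :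
  (forall i, 0 <= w i) -> (forall i, tame (g i)) -> (forall i, tame (h i)) ->
  (\sum_i w i * E (fun n => g i n * h i n)) ^+ 2 <=
  (\sum_i w i * E (fun n => g i n ^+ 2)) * \sum_i w i * E (fun n => h i n ^+ 2).
Proof.
move=> w0 tg th; apply: discriminant_le.
  by apply: sumr_ge0 => i _; rewrite mulr_ge0// pf_ge0// => [|n];
    [exact: tame_exp|exact: sqr_ge0].
move=> x; rewrite -mulrnAr mulr_sumr -sumrMnl mulr_sumr -sumrB -big_split /=.
apply: sumr_ge0 => i _.
rewrite (_ : _ + _ = w i * E (fun n => (x * g i n - h i n) ^+ 2)).
  by rewrite mulr_ge0// pf_ge0// => [|n]; [apply/tame_exp/tame_sub => //; exact: tame_scale|exact: sqr_ge0].
have tgg := tame_exp 2 (tg i); have thh := tame_exp 2 (th i).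
have tgh := tame_mul (tg i) (th i).
rewrite (pf_ext (g := fun n => (_ - _) ^+ 2)
  (h := fun n => x ^+ 2 * g i n ^+ 2 - x *+ 2 * (g i n * h i n) + h i n ^+ 2)).
- rewrite pf_add//; last by apply: tame_sub; exact: tame_scale.
  by rewrite pf_sub ?pf_scale//; [ring|exact: tame_scale|exact: tame_scale].
- by apply/tame_exp/tame_sub => //; exact: tame_scale.
- by move=> n; ring.
Qed.

(** The monic Charlier polynomials of degrees 0, 1 and 2 for the Poisson law of mean l. Higher
    degrees never occur, and the default branch serves degree two only, the indices being taken in
    ['I_3]. *)
Definition charlier (j : nat) (l x : R) : R :=
  match j with
  | 0 => 1
  | 1 => x - l
  | _ => x ^+ 2 - x - l * x *+ 2 + l ^+ 2
  end.

Lemma tame_charlier j t : tame (fun n => charlier j (lam t) (n t)%:R).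
Proof.
have tt := tame_coord t.
case: j => [|[|j]] /=; [exact: tame_cst|by apply: tame_sub => //; exact: tame_cst|].
apply: tame_add; last exact: tame_cst.
apply: tame_sub; first by apply: tame_sub => //; exact: tame_exp.
apply: (@tame_ext (fun n => (lam t *+ 2) * (n t)%:R)) => [|n]; last by rewrite mulrnAl.
exact: tame_scale.
Qed.

Definition constant_along (t : T) (g : config -> R) :=
  forall n, g (add_point t n) = g n.

Definition falling m (x : R) : R := \prod_(i < m) (x - i%:R).

(** Each use of the Mecke identity removes one factor: adding a point shifts the other factors of
    the product by one. *)
Lemma pf_falling m t g : tame g -> constant_along t g ->
  E (fun n => falling m (n t)%:R * g n) = lam t ^+ m * E g.
Proof.
move=> tg cg; elim: m => [|m IH].
  rewrite expr0 mul1r; apply: pf_ext => [|n]; last by rewrite /falling big_ord0 mul1r.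
  by apply: tame_mul => //; apply: tame_prod => i _; apply: tame_sub (tame_coord _) (tame_cst _).
have tf m' : tame (fun n => \prod_(i < m') ((n t)%:R - i.+1%:R) * g n).
  by apply: tame_mul => //; apply: tame_prod => i _; apply: tame_sub (tame_coord _) (tame_cst _).
transitivity (E (fun n => (n t)%:R * (\prod_(i < m) ((n t)%:R - i.+1%:R) * g n))).
  apply: pf_ext => [|n]; last by rewrite /falling big_ord_recl subr0 mulrA.
  by apply: tame_mul => //; apply: tame_prod => i _; apply: tame_sub (tame_coord _) (tame_cst _).
rewrite (pf_mecke pfE)// exprS -mulrA -IH; congr (_ * _); apply: pf_ext => [|n].
  exact: (tame_add_point t (tf m)).
rewrite cg; congr (_ * _); apply: eq_bigr => i _.
by rewrite ffunE eqxx natrD -addn1 natrD opprD addrACA subrr addr0.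
Qed.

Lemma pf_charlier (j j' : 'I_3) t g : tame g -> constant_along t g ->
  E (fun n => charlier j (lam t) (n t)%:R * charlier j' (lam t) (n t)%:R * g n) =
  (j == j')%:R * (j`!%:R * lam t ^+ j) * E g.
Proof.
move=> tg cg; have tf m : tame (fun n => falling m (n t)%:R * g n).
  by apply: tame_mul => //; apply: tame_prod => i _; apply: tame_sub (tame_coord _) (tame_cst _).
set l := lam t.
(* The mean of a polynomial in [n t] is read off its expansion in falling factorials by putting
   [l ^+ m] for the m-th one. It remains to exhibit the five coefficients for each pair of
   degrees. *)
suff [c cE cV] : exists2 c : nat -> R,
    forall x, charlier j l x * charlier j' l x = \sum_(m < 5) c m * falling m x &
    \sum_(m < 5) c m * l ^+ m = (j == j')%:R * (j`!%:R * l ^+ j).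
  rewrite -cV mulr_suml.
  under [RHS]eq_bigr do rewrite -mulrA -pf_falling// -pf_scale//.
  rewrite -pf_sum => [|m _]; last exact: tame_scale.
  apply: pf_ext => [|n].
    by apply: tame_mul => //; apply: tame_mul; exact: tame_charlier.
  by rewrite cE mulr_suml; apply: eq_bigr => m _; rewrite mulrA.
have mk (a b c d e : R) x : \sum_(m < 5) nth 0 [:: a; b; c; d; e] m * falling m x =
    a + b * x + c * (x * (x - 1)) + d * (x * (x - 1) * (x - 2)) +
    e * (x * (x - 1) * (x - 2) * (x - 3)).
  rewrite !big_ord_recl big_ord0 /falling /= !big_ord_recl !big_ord0 /= /bump /= ?addn0 ?add1n; ring.
have mk' (a b c d e : R) : \sum_(m < 5) nth 0 [:: a; b; c; d; e] m * l ^+ m =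
    a + b * l + c * l ^+ 2 + d * l ^+ 3 + e * l ^+ 4.
  by rewrite !big_ord_recl big_ord0 /=; ring.
suff [[[[[a b] c] d] e] H1 H2] : exists2 c : R * R * R * R * R,
    forall x, charlier j l x * charlier j' l x =
      \sum_(m < 5) nth 0 [:: c.1.1.1.1; c.1.1.1.2; c.1.1.2; c.1.2; c.2] m * falling m x &
    \sum_(m < 5) nth 0 [:: c.1.1.1.1; c.1.1.1.2; c.1.1.2; c.1.2; c.2] m * l ^+ m =
      (j == j')%:R * (j`!%:R * l ^+ j).
  by eexists; [exact: H1|exact: H2].
case: j => -[|[|[|//]]] ?; case: j' => -[|[|[|//]]] ?; rewrite /eq_op /= ?factS ?fact0 ?muln1.
- by exists (1, 0, 0, 0, 0) => [x|]; rewrite ?mk ?mk' /=; ring.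
- by exists (- l, 1, 0, 0, 0) => [x|]; rewrite ?mk ?mk' /=; ring.
- by exists (l ^+ 2, - l *+ 2, 1, 0, 0) => [x|]; rewrite ?mk ?mk' /=; ring.
- by exists (- l, 1, 0, 0, 0) => [x|]; rewrite ?mk ?mk' /=; ring.
- by exists (l ^+ 2, 1 - l *+ 2, 1, 0, 0) => [x|]; rewrite ?mk ?mk' /=; ring.
- by exists (- l ^+ 3, l ^+ 2 *+ 3 - l *+ 2, 2 - l *+ 3, 1, 0) => [x|]; rewrite ?mk ?mk' /=; ring.
- by exists (l ^+ 2, - l *+ 2, 1, 0, 0) => [x|]; rewrite ?mk ?mk' /=; ring.
- by exists (- l ^+ 3, l ^+ 2 *+ 3 - l *+ 2, 2 - l *+ 3, 1, 0) => [x|]; rewrite ?mk ?mk' /=; ring.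
- by exists (l ^+ 4, - l ^+ 3 *+ 4 + l ^+ 2 *+ 4, l ^+ 2 *+ 6 - l *+ 8 + 2, 4 - l *+ 4, 1) => [x|];
    rewrite ?mk ?mk' /=; ring.
Qed.

Definition basis (d : {ffun T -> 'I_3}) (n : config) : R :=
  \prod_t charlier (d t) (lam t) (n t)%:R.

Definition weight (d : {ffun T -> 'I_3}) : R := \prod_t ((d t)`!%:R * lam t ^+ d t).

Lemma tame_basis d : tame (basis d).
Proof. by apply: tame_prod => t _; exact: tame_charlier. Qed.

Lemma pf_basis d d' : E (fun n => basis d n * basis d' n) = (d == d')%:R * weight d.
Proof.
have H s : uniq s -> E (fun n => \prod_(t <- s)
    (charlier (d t) (lam t) (n t)%:R * charlier (d' t) (lam t) (n t)%:R)) =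
    \prod_(t <- s) ((d t == d' t)%:R * ((d t)`!%:R * lam t ^+ d t)).
  elim: s => [_|t s IH /= /andP[ts us]].
    rewrite big_nil -[RHS]pf_cst; apply: pf_ext => [|n]; last by rewrite big_nil.
    by apply: tame_ext (tame_cst 1) _ => n; rewrite big_nil.
  have tg : tame (fun n => \prod_(t <- s)
    (charlier (d t) (lam t) (n t)%:R * charlier (d' t) (lam t) (n t)%:R)).
    by apply: tame_prod => u _; apply: tame_mul; exact: tame_charlier.
  rewrite big_cons -IH// -pf_charlier//.
    apply: pf_ext => [|n]; last by rewrite big_cons.
    by apply: tame_prod => u _; apply: tame_mul; exact: tame_charlier.
  move=> n; apply: eq_big_seq => u us'; rewrite ffunE.
  by have [ut|_] := eqVneq u t; [rewrite -ut us' in ts|rewrite addn0].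
have := H (index_enum T) (index_enum_uniq T).
rewrite big_split /= -/(weight d) => H'.
transitivity (E (fun n => \prod_t
    (charlier (d t) (lam t) (n t)%:R * charlier (d' t) (lam t) (n t)%:R))).
  by apply: pf_ext => [|n]; [apply: tame_mul; exact: tame_basis|rewrite big_split].
rewrite H'; congr (_ * _); have [->|dd'] := eqVneq d d'.
  by apply: big1 => t _; rewrite eqxx.
suff [t /negPf tt] : exists t, d t != d' t by rewrite (bigD1 t)//= tt mul0r.
by apply/existsP; apply: contraNT dd'; rewrite negb_exists => /forallP H0;
  apply/eqP/ffunP => t; have := H0 t; rewrite negbK => /eqP.
Qed.

Lemma pf_parseval (c c' : {ffun T -> 'I_3} -> R) :
  E (fun n => (\sum_d c d * basis d n) * \sum_d c' d * basis d n) =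
  \sum_d weight d * (c d * c' d).
Proof.
have tb d d' : tame (fun n => basis d n * basis d' n) by apply: tame_mul; exact: tame_basis.
transitivity (E (fun n => \sum_d \sum_d' (c d * c' d') * (basis d n * basis d' n))).
  apply: pf_ext => [|n].
    by apply: tame_mul; apply: tame_sum => d _; exact/tame_scale/tame_basis.
  by rewrite big_distrlr; apply: eq_bigr => d _; apply: eq_bigr => d' _; rewrite mulrACA.
rewrite pf_sum => [|d _]; last by apply: tame_sum => d' _; exact: tame_scale.
apply: eq_bigr => d _; rewrite pf_sum => [|d' _]; last exact: tame_scale.
rewrite (bigD1 d)//= pf_scale// pf_basis eqxx mul1r big1 ?addr0 1?mulrC// => d' d'd.
by rewrite pf_scale// pf_basis eq_sym (negPf d'd) mul0r mulr0.
Qed.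

End theory.
End poisson_functional.

(** * The product formula in the Charlier basis *)

Section product_formula.
Variables (R : realFieldType) (T : finType) (lam : T -> R).
Notation config := (config T).
Notation multi := {ffun T -> 'I_3}.

Definition lamS (S : {set T}) : R := \prod_(t in S) lam t.

Definition walsh (S : {set T}) (n : config) : R :=
  \prod_(t in S) ((n t)%:R - lam t).

Lemma tame_walsh S : tame (walsh S).
Proof. by apply: tame_prod => t _; apply: tame_sub (tame_coord _ _) (tame_cst _ _). Qed.

Definition compatible (s s' : bool) (j : 'I_3) : bool :=
  match (j : nat) with 0 => s == s' | 1 => s || s' | _ => s && s' end.

(** The coefficients of the products in one count: with X = x - l one has 1 = C_0, X = C_1 and X^2 =
    C_2 + C_1 + l C_0. *)
Definition theta (t : T) (s s' : bool) (j : 'I_3) : R :=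
  if compatible s s' j then if [&& s, s' & j == 0 :> nat] then lam t else 1 else 0.

Definition Theta (S S' : {set T}) (d : multi) : R :=
  \prod_t theta t (t \in S) (t \in S') (d t).

Lemma walshM S S' n : walsh S n * walsh S' n = \sum_d Theta S S' d * basis lam d n.
Proof.
pose F t (j : 'I_3) := theta t (t \in S) (t \in S') j * charlier j (lam t) (n t)%:R.
transitivity (\prod_t \sum_j F t j).
  rewrite /walsh (big_mkcond (fun t => t \in S)) (big_mkcond (fun t => t \in S')) -big_split.
  apply: eq_bigr => t _ /=; rewrite !big_ord_recl big_ord0 /F /theta /compatible /=.
  by case: (t \in S); case: (t \in S') => /=; ring.
by rewrite bigA_distr_bigA; apply: eq_bigr => d _; rewrite big_split.
Qed.

(* A term of the expansion of X_S X_S' in the Charlier basis: K, A and B play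
   the role of the variables gamma, t and s of a contraction. *)
Definition triple := ({set T} * {set T} * {set T})%type.
Implicit Type kap : triple.

Definition delta1 (k a b : bool) : 'I_3 :=
  if a && b then @Ordinal 3 2 isT else if [|| k, a | b] then @Ordinal 3 1 isT
  else @Ordinal 3 0 isT.

Definition delta kap : multi :=
  [ffun t => delta1 (t \in kap.1.1) (t \in kap.1.2) (t \in kap.2)].

(** K avoids A and B, but A and B may meet: a common point carries the Charlier polynomial of degree
    two, as recorded by [delta1]. *)
Definition admissible kap : bool :=
  [forall t, ~~ ((t \in kap.1.1) && ((t \in kap.1.2) || (t \in kap.2)))].

Definition apart (L : {set T}) kap : bool :=
  [forall t, ~~ ((t \in L) && [|| t \in kap.1.1, t \in kap.1.2 | t \in kap.2])].

Definition multi_coef (d : multi) (c : {set T} -> {set T} -> R) : R :=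
  \sum_(kap : triple | admissible kap && (delta kap == d))
    \sum_(L : {set T} | apart L kap)
      lamS L * c (L :|: kap.1.1 :|: kap.1.2) (L :|: kap.1.1 :|: kap.2).

(** A pair (S, S') compatible with d is split according to the value of d on the intersection of S
    and S': degree 0 gives L, whose points are integrated out, degree 1 gives K, and a point of
    degree 2 stays in both A and B. Points of one set only go to A or to B. This is a bijection onto
    quadruples (K, A, B, L), and [Theta] becomes the weight of L. *)
Lemma Theta_reindex (d : multi) (c : {set T} -> {set T} -> R) :
  \sum_(S : {set T}) \sum_(S' : {set T}) c S S' * Theta S S' d = multi_coef d c.
Proof.
pose P (x : {set T} * {set T}) := [forall t, compatible (t \in x.1) (t \in x.2) (d t)].
pose h (y : triple * {set T}) := (y.2 :|: y.1.1.1 :|: y.1.1.2, y.2 :|: y.1.1.1 :|: y.1.2).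
pose D j := [set t | d t == j :> nat].
pose h' (x : {set T} * {set T}) : triple * {set T} :=
  ((x.1 :&: x.2 :&: D 1%N, x.1 :\: (x.1 :&: x.2 :&: (D 0%N :|: D 1%N)),
    x.2 :\: (x.1 :&: x.2 :&: (D 0%N :|: D 1%N))), x.1 :&: x.2 :&: D 0%N).
have d3 t : [|| d t == 0 :> nat, d t == 1 :> nat | d t == 2 :> nat].
  by case: (d t) => -[|[|[|]]].
rewrite pair_big /= (bigID P) /= [X in _ + X]big1 ?addr0; last first.
  move=> [S S'] /= /forallPn[t] nc; rewrite /Theta (bigD1 t)//= /theta (negPf nc).
  by rewrite mul0r mulr0.
rewrite (reindex_onto h h'); last first.
  move=> [S S'] /forallP /= H; congr pair; apply/setP => t; rewrite !inE /=;
    have := H t; have := d3 t; rewrite /compatible;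
    by case: (d t) => -[|[|[|]]]//= _; case: (t \in S); case: (t \in S').
rewrite /multi_coef pair_big_dep /=; symmetry; apply: eq_big => [[[[K A] B] L]|[[[K A] B] L] H0] /=;
  [apply/esym|].
  apply/andP/andP => /= [[/forallP H /eqP]|[/andP[/forallP ok /eqP dE] /forallP ap]].
    case=> /setP eK /setP eA /setP eB /setP eL; split; first (apply/andP; split).
    - apply/forallP => t /=; move: (H t) (d3 t) (eK t) (eA t) (eB t) (eL t).
      rewrite !inE /compatible; case: (d t) => -[|[|[|]]]//= _; 
      by case: (t \in K); case: (t \in A); case: (t \in B); case: (t \in L).
    - apply/eqP/ffunP => t /=; move: (H t) (d3 t) (eK t) (eA t) (eB t) (eL t).
      rewrite !inE /compatible ffunE /=; case: (d t) => -[|[|[|]]]//= ?;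
      by case: (t \in K); case: (t \in A); case: (t \in B); case: (t \in L) => //= *; apply/val_inj.
    - apply/forallP => t /=; move: (H t) (d3 t) (eK t) (eA t) (eB t) (eL t).
      rewrite !inE /compatible; case: (d t) => -[|[|[|]]]//= _; 
      by case: (t \in K); case: (t \in A); case: (t \in B); case: (t \in L).
  have dt t : d t = delta1 (t \in K) (t \in A) (t \in B) by rewrite -dE ffunE.
  split; [apply/forallP|apply/eqP; congr (_, _, _, _); apply/setP] => t;
    move: (ok t) (ap t); rewrite !inE /= dt /compatible /=;
    by case: (t \in K); case: (t \in A); case: (t \in B); case: (t \in L).
rewrite mulrC; congr (_ * _); rewrite /Theta /lamS [LHS]big_mkcond; apply: eq_bigr => t _.
case/andP: H0 => /andP[/forallP/= ok /eqP dE] /forallP/= ap; move: (ok t) (ap t).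
rewrite -dE ffunE /= /theta !inE /compatible /delta1.
by case: (t \in K); case: (t \in A); case: (t \in B); case: (t \in L).
Qed.
End product_formula.

(** * Contractions of kernels on sets *)

Section set_contractions.
Variables (R : realFieldType) (T : finType) (lam : T -> R).
Hypothesis lam_ge0 : forall t, 0 <= lam t.
Notation config := (config T).
Notation multi := {ffun T -> 'I_3}.
Implicit Types (kap : triple T) (alpha beta : {set T} -> R).

Lemma lamS_ge0 S : 0 <= lamS lam S.
Proof. exact: prodr_ge0. Qed.

Definition lam3 kap : R := lamS lam kap.1.1 * lamS lam kap.1.2 * lamS lam kap.2.

Lemma lam3_ge0 kap : 0 <= lam3 kap.
Proof. by rewrite !mulr_ge0 ?lamS_ge0. Qed.

Lemma weight_ge0 d : 0 <= weight lam d.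
Proof. by apply: prodr_ge0 => t _; rewrite mulr_ge0 ?exprn_ge0. Qed.

(** A point of both A and B has degree two and norm 2 lam^2; the factor lam^2 is already counted,
    once in A and once in B. *)
Lemma weight_delta kap : admissible kap ->
  weight lam (delta kap) = 2 ^+ #|kap.1.2 :&: kap.2| * lam3 kap.
Proof.
case: kap => [[K A] B] /forallP/= ok.
rewrite /weight /lam3 /lamS /= -prodr_const (big_mkcond (fun t => t \in K))
  (big_mkcond (fun t => t \in A)) (big_mkcond (fun t => t \in B)) [X in X * _]big_mkcond.
rewrite -!big_split; apply: eq_bigr => t _; rewrite ffunE /= inE; move: (ok t).
by rewrite /delta1; case: (t \in K); case: (t \in A); case: (t \in B) => //= _;
  rewrite ?(fact0, factS) /= ?muln1 ?expr0 ?expr1 ?mulr1 ?mul1r.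
Qed.

Definition multi0 : multi := [ffun=> ord0].

Lemma delta_eq0 kap : (delta kap == multi0) = (kap == (set0, set0, set0)).
Proof.
case: kap => [[K A] B]; apply/eqP/eqP => [/ffunP H|[-> -> ->]].
  congr (_, _, _); apply/setP => t; have := H t; rewrite !ffunE inE /delta1 /=;
  by case: (t \in K); case: (t \in A); case: (t \in B).
by apply/ffunP => t; rewrite !ffunE /delta1 /= !inE; apply/val_inj.
Qed.

Definition sstar alpha beta l kap : R :=
  \sum_(L : {set T} | apart L kap && (#|L| == l))
    lamS lam L * (alpha (L :|: kap.1.1 :|: kap.1.2) * beta (L :|: kap.1.1 :|: kap.2)).

Definition sizes p q r l kap :=
  [&& #|kap.1.1| == (r - l)%N, #|kap.1.2| == (p - r)%N & #|kap.2| == (q - r)%N].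

Definition setstar p q r l alpha beta : R :=
  \sum_(kap | admissible kap && sizes p q r l kap) lam3 kap * sstar alpha beta l kap ^+ 2.

Lemma setstar_ge0 p q r l alpha beta : 0 <= setstar p q r l alpha beta.
Proof. by apply: sumr_ge0 => kap _; rewrite mulr_ge0 ?lam3_ge0 ?sqr_ge0. Qed.

Definition homogeneous p alpha := forall S : {set T}, #|S| != p -> alpha S = 0.

Lemma apart_card (L K A B : {set T}) : apart L (K, A, B) -> admissible (K, A, B) ->
  #|L :|: K :|: A| = (#|L| + #|K| + #|A|)%N /\
  #|L :|: K :|: B| = (#|L| + #|K| + #|B|)%N.
Proof.
move=> /forallP/= ap /forallP/= ok.
have LK : L :&: K = set0.
  by apply/setP => t; move: (ap t); rewrite !inE; case: (t \in L); case: (t \in K).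
have LKA : (L :|: K) :&: A = set0.
  apply/setP => t; move: (ap t) (ok t); rewrite !inE.
  by case: (t \in L); case: (t \in K); case: (t \in A).
have LKB : (L :|: K) :&: B = set0.
  apply/setP => t; move: (ap t) (ok t); rewrite !inE.
  by case: (t \in L); case: (t \in K); case: (t \in B); case: (t \in A).
by rewrite !cardsU LKA LKB LK cards0 !subn0.
Qed.

Lemma sstar_sizes p q alpha beta l kap :
  homogeneous p alpha -> homogeneous q beta -> admissible kap ->
  sstar alpha beta l kap != 0 ->
  [/\ (l + #|kap.1.1| <= minn p q)%N & sizes p q (l + #|kap.1.1|) l kap].
Proof.
case: kap => [[K A] B] ha hb ok.
rewrite /sstar => /negP nz.
have [L /andP[/andP[ap /eqP Ll] nL]] : exists L : {set T},
    (apart L (K, A, B) && (#|L| == l)) && (alpha (L :|: K :|: A) * beta (L :|: K :|: B) != 0).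
  apply/existsP; apply: contra_notT nz => /existsPn H.
  rewrite big1// => L PL; have := H L; rewrite PL /= negbK => /eqP ->; exact: mulr0.
move: nL; rewrite mulf_eq0 negb_or => /andP[nA nB].
have [cA cB] := apart_card ap ok.
have pE : #|L :|: K :|: A| = p by apply/eqP; apply: contraNT nA => /ha ->.
have qE : #|L :|: K :|: B| = q by apply/eqP; apply: contraNT nB => /hb ->.
rewrite /sizes /= -pE -qE cA cB Ll !addKn.
by split; rewrite ?leq_min ?leq_addr ?eqxx.
Qed.

Variables (p q : nat) (alpha beta : {set T} -> R) (om : nat -> R).
Hypotheses (ha : homogeneous p alpha) (hb : homogeneous q beta).

(** The argument of [om] is the number of common points that are integrated out. The weight 1 gives
    the product of two chaoses, the weight l their carre du champ ([chaosM], [carreE]). *)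
Definition product_coef (d : multi) : R :=
  multi_coef lam d (fun S S' => om #|S :&: S' :&: [set t | d t == 0 :> nat]| * (alpha S * beta S')).

Lemma product_coefE d : product_coef d =
  \sum_(kap | admissible kap && (delta kap == d))
    \sum_(l < p.+1) om l * sstar alpha beta l kap.
Proof.
rewrite /product_coef /multi_coef; apply: eq_bigr => [[[K A] B]] /andP[ok /eqP dE].
rewrite (bigID (fun L : {set T} => (#|L| < p.+1)%N)) /= [X in _ + X]big1 ?addr0; last first.
  move=> L /andP[ap]; rewrite -leqNgt => Lp; have [cA cB] := apart_card ap ok.
  rewrite ha ?mul0r ?mulr0// cA gtn_eqF//; apply: leq_trans Lp _.
  by rewrite -addnA leq_addr.
rewrite (partition_big (fun L : {set T} => inord #|L| : 'I_p.+1) predT)//=.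
apply: eq_bigr => l _; rewrite /sstar mulr_sumr; apply: eq_big => [L|L] /=.
  case: (apart L (K, A, B)) => //=; case: ltnP => Lp /=.
    by rewrite -val_eqE /= inordK.
  by apply/esym; rewrite gtn_eqF// (leq_trans (ltn_ord l)).
move=> /andP[/andP[ap Lp] /eqP lE]; rewrite mulrCA; congr (om _ * _).
rewrite -lE inordK//; congr #|pred_of_set _|; apply/setP => t; rewrite !inE -dE ffunE /=.
move: (forallP ap t) (forallP ok t) => /=; rewrite /delta1.
by case: (t \in L); case: (t \in K); case: (t \in A); case: (t \in B).
Qed.

Lemma card_support kap : admissible kap ->
  \sum_(l < p.+1) om l * sstar alpha beta l kap != 0 ->
  (#|[set t | delta kap t != 0 :> nat]| <= p + q)%N.
Proof.
move=> ok /negP nz.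
have [l nl] : exists l : 'I_p.+1, sstar alpha beta l kap != 0.
  apply/existsP; apply: contra_notT nz => /existsPn H.
  rewrite big1// => l _; have := H l; rewrite negbK => /eqP ->; exact: mulr0.
have [+ /and3P[_ /eqP A /eqP B]] := sstar_sizes ha hb ok nl.
rewrite leq_min => /andP[rp rq].
rewrite (_ : [set t | _] = kap.1.1 :|: kap.1.2 :|: kap.2); last first.
  apply/setP => t; rewrite !inE ffunE /delta1.
  by case: (t \in kap.1.1); case: (t \in kap.1.2); case: (t \in kap.2).
rewrite (leq_trans (leq_card_setU _ _))// (leq_trans (leq_add (leq_card_setU _ _) (leqnn _)))//.
rewrite A B; lia.
Qed.

(** A contributing triple has K, A and B inside the support of d, which has at most p + q points:
    hence at most [(2 ^ (p + q)) ^ 3] triples, whatever the size of T. *)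
Lemma card_fiber (d : multi) :
  (#|[pred kap | admissible kap && (delta kap == d) &&
     (\sum_(l < p.+1) om l * sstar alpha beta l kap != 0)%R]| <= 8 ^ (p + q))%N.
Proof.
set P := [pred kap | _].
case: (pickP P) => [k0 /= /andP[/andP[ok0 /eqP d0] nz0]|P0]; last by rewrite eq_card0.
set D := [set t | d t != 0 :> nat].
have Dpq : (#|D| <= p + q)%N by have := card_support ok0 nz0; rewrite d0.
apply: (@leq_trans #|setX (setX (powerset D) (powerset D)) (powerset D)|).
  apply: subset_leq_card; apply/subsetP => -[[K A] B] /andP[/andP[_ /eqP dE] _].
  have H t : (t \in D) = [|| t \in K, t \in A | t \in B].
    rewrite inE -dE ffunE /delta1 /=.
    by case: (t \in K); case: (t \in A); case: (t \in B).
  rewrite !inE /=; apply/andP; split; first (apply/andP; split);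
    by apply/subsetP => t tX; rewrite H tX ?orbT.
rewrite !cardsX !card_powerset -!expnD (_ : 8 = 2 ^ 3)%N// -expnM leq_exp2l//.
lia.
Qed.

(** Cauchy-Schwarz over the triples with a given d and over l, together with [2 ^+ p] for the power
    of two in [weight_delta]. The flag b drops the constant coefficient: [delta kap] vanishes for
    the empty triple only, so this removes the total contraction p = q = r = l. *)
Lemma product_coef_sqr_le (b : bool) (W : R) : (forall l, (l <= p)%N -> `|om l| <= W) ->
  \sum_(d | b ==> (d != multi0)) weight lam d * product_coef d ^+ 2 <=
  (8 ^ (p + q) * p.+1 * 2 ^ p)%:R * W ^+ 2 *
  \sum_(r < (minn p q).+1)
    \sum_(l < r.+1 | (om l != 0) && ~~ [&& b, p == q, q == r & r == l :> nat])
      setstar p q r l alpha beta.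
Proof.
move=> oW; pose y kap := \sum_(l < p.+1) om l * sstar alpha beta l kap.
have step1 d : product_coef d ^+ 2 <= (8 ^ (p + q))%:R *
    \sum_(kap | admissible kap && (delta kap == d)) y kap ^+ 2.
  rewrite product_coefE -/y (bigID (fun kap => y kap == 0)) /= big1 ?add0r; last first.
    by move=> kap /andP[_ /eqP].
  apply: le_trans (sqr_sum_le _ _) _; rewrite ler_pM ?ler_nat ?card_fiber//.
    by apply: sumr_ge0 => kap _; exact: sqr_ge0.
  rewrite [leRHS](bigID (fun kap => y kap == 0)) /= lerDr sumr_ge0// => kap _.
  exact: sqr_ge0.
have step2 kap : y kap ^+ 2 <= p.+1%:R * (W ^+ 2 *
    \sum_(l < p.+1 | om l != 0) sstar alpha beta l kap ^+ 2).
  rewrite /y (bigID (fun l : 'I_p.+1 => om l == 0)) /= big1 ?add0r; last first.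
    by move=> l /eqP ->; rewrite mul0r.
  apply: le_trans (sqr_sum_le _ _) _.
  rewrite ler_pM//; first by apply: sumr_ge0 => l _; exact: sqr_ge0.
    by rewrite ler_nat (leq_trans (max_card _))// card_ord.
  rewrite mulr_sumr; apply: ler_sum => l _; rewrite exprMn ler_wpM2r ?sqr_ge0//.
  rewrite -[om l ^+ 2]real_normK ?num_real// lerXn2r ?nnegrE//; last by apply: oW; rewrite -ltnS.
  by rewrite (le_trans _ (oW 0%N _)).
have step3 kap : admissible kap -> (b ==> (delta kap != multi0)) ->
    weight lam (delta kap) * y kap ^+ 2 <= (p.+1 * 2 ^ p)%:R * W ^+ 2 *
    (\sum_(r < (minn p q).+1)
      \sum_(l < r.+1 | (om l != 0) && ~~ [&& b, p == q, q == r & r == l :> nat])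
       if sizes p q r l kap then lam3 kap * sstar alpha beta l kap ^+ 2 else 0).
  move=> ok bd; set Z := \sum_(r < _) _.
  have Z0 : 0 <= Z.
    apply: sumr_ge0 => r _; apply: sumr_ge0 => l _; case: ifP => // _.
    by rewrite mulr_ge0 ?lam3_ge0 ?sqr_ge0.
  have [->|ny] := eqVneq (y kap) 0.
    by rewrite expr0n mulr0 mulr_ge0 // mulr_ge0 // sqr_ge0.
  have cA : (#|kap.1.2| <= p)%N.
    have [l nl] : exists l : 'I_p.+1, sstar alpha beta l kap != 0.
      apply/existsP; apply: contraNT ny => /existsPn H.
      rewrite /y big1// => l _; have := H l; rewrite negbK => /eqP ->; exact: mulr0.
    have [_ /and3P[_ /eqP -> _]] := sstar_sizes ha hb ok nl; exact: leq_subr.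
  have -> : (p.+1 * 2 ^ p)%:R * W ^+ 2 * Z = 2 ^+ p * (p.+1%:R * (W ^+ 2 * Z)).
    by rewrite natrM natrX; ring.
  rewrite weight_delta// -[leLHS](mulrA (2 ^+ _) (lam3 kap)).
  apply: ler_pM; [by rewrite exprn_ge0|exact: mulr_ge0 (lam3_ge0 _) (sqr_ge0 _)| |].
    by rewrite ler_weXn2l ?ler1n// (leq_trans (subset_leq_card (subsetIl _ _))).
  apply: le_trans (ler_wpM2l (lam3_ge0 kap) (step2 kap)) _.
  rewrite mulrCA ler_wpM2l// mulrCA ler_wpM2l ?sqr_ge0// mulr_sumr.
  pose G (r l : nat) := if sizes p q r l kap then lam3 kap * sstar alpha beta l kap ^+ 2 else 0.
  have G0 r l : 0 <= G r l.
    by rewrite /G; case: ifP => // _; rewrite mulr_ge0 ?lam3_ge0 ?sqr_ge0.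
  pose Q (r l : nat) := (om l != 0) && ~~ [&& b, p == q, q == r & r == l].
  (* The triple and l determine r as [l + #|K|], so a single term of the inner sum carries the whole
     contribution. *)
  apply: (@le_trans _ _ (\sum_(l < p.+1 | om l != 0)
     \sum_(r < (minn p q).+1 | (l <= r)%N && Q r l) G r l)).
    apply: ler_sum => l nl; have [->|ns] := eqVneq (sstar alpha beta l kap) 0.
      by rewrite expr0n mulr0 sumr_ge0.
    have [rm sz] := sstar_sizes ha hb ok ns.
    have rlt : (l + #|kap.1.1| < (minn p q).+1)%N by [].
    rewrite (bigD1 (Ordinal rlt)) /=; last first.
      rewrite leq_addr /Q nl /=; apply/negP => /and4P[bt /eqP pq /eqP qr /eqP rl].
      move: bd; rewrite bt delta_eq0 => /negP; apply.
      have /and3P[/eqP + /eqP + /eqP] := sz; rewrite /= in rl.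
      case: (kap) rl qr => [[K A] B] /= rl qr cK cA' cB.
      have [K0 [A0 B0]] : #|K| = 0%N /\ #|A| = 0%N /\ #|B| = 0%N by lia.
      by rewrite (cards0_eq K0) (cards0_eq A0) (cards0_eq B0).
    by rewrite {1}/G sz lerDl sumr_ge0.
  rewrite [leRHS](_ : _ = \sum_(r < (minn p q).+1) \sum_(l < p.+1 | (l <= r)%N && Q r l) G r l).
    rewrite (exchange_big_dep predT) //=; apply: ler_sum => r _.
    rewrite [leRHS](bigID (fun l : 'I_p.+1 => om l != 0)) /=.
    rewrite [leLHS](eq_bigl (fun l : 'I_p.+1 => ((l <= r)%N && Q r l) && (om l != 0))) => [|l];
      last by rewrite andbC.
    by rewrite lerDl sumr_ge0.
  apply: eq_bigr => r _; rewrite (big_ord_widen_cond p.+1 (Q r) (G r)); last first.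
    by rewrite (leq_trans (ltn_ord r))// ltnS geq_minl.
  by apply: eq_bigl => l; rewrite andbC ltnS.
set SS := (X in _ <= _ * X).
have -> : (8 ^ (p + q) * p.+1 * 2 ^ p)%:R * W ^+ 2 * SS =
    (8 ^ (p + q))%:R * ((p.+1 * 2 ^ p)%:R * W ^+ 2 * SS) by rewrite !natrM; ring.
apply: (@le_trans _ _ ((8 ^ (p + q))%:R *
   \sum_(d | b ==> (d != multi0)) \sum_(kap | admissible kap && (delta kap == d))
      weight lam (delta kap) * y kap ^+ 2)).
  rewrite mulr_sumr; apply: ler_sum => d _; rewrite mulrC.
  apply: le_trans (ler_wpM2r (weight_ge0 d) (step1 d)) _.
  rewrite -mulrA ler_wpM2l// mulr_suml; apply: ler_sum => kap /andP[_ /eqP ->].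
  by rewrite mulrC.
rewrite ler_wpM2l//.
rewrite (exchange_big_dep (fun kap => admissible kap && (b ==> (delta kap != multi0)))) /=;
  last by move=> d kap bd /andP[-> /eqP ->].
rewrite [leRHS](_ : _ = \sum_(kap | admissible kap) ((p.+1 * 2 ^ p)%:R * W ^+ 2 *
    (\sum_(r < (minn p q).+1)
      \sum_(l < r.+1 | (om l != 0) && ~~ [&& b, p == q, q == r & r == l :> nat])
       if sizes p q r l kap then lam3 kap * sstar alpha beta l kap ^+ 2 else 0))).
  rewrite [leRHS](bigID (fun kap => b ==> (delta kap != multi0))) /=.
  rewrite -[leLHS]addr0 lerD ?sumr_ge0//.
    apply: ler_sum => kap /andP[ok bd]; rewrite (big_pred1 (delta kap)).
      exact: step3.
    move=> d /=; rewrite ok /= [delta kap == d]eq_sym.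
    by case: (d =P delta kap) => [->|_]; rewrite ?bd ?andbF.
  move=> kap _; rewrite mulr_ge0//; first by rewrite mulr_ge0 ?sqr_ge0.
  rewrite sumr_ge0// => r _; rewrite sumr_ge0// => l _.
  by case: ifP => // _; rewrite mulr_ge0 ?lam3_ge0 ?sqr_ge0.
rewrite -mulr_sumr; congr (_ * _).
rewrite exchange_big /=; apply: eq_bigr => r _; rewrite exchange_big /=; apply: eq_bigr => l _.
by rewrite /setstar -big_mkcondr.
Qed.

End set_contractions.

(** * Chaos polynomials: differences, carre du champ, integration by parts *)

Section chaos.
Variables (R : realFieldType) (T : finType) (lam : T -> R).
Hypothesis lam_ge0 : forall t, 0 <= lam t.
Notation config := (config T).
Notation multi := {ffun T -> 'I_3}.
Implicit Types (kap : triple T) (alpha beta : {set T} -> R) (S : {set T}).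

Definition chaos alpha (n : config) : R := \sum_(S : {set T}) alpha S * walsh lam S n.

Lemma tame_chaos alpha : tame (chaos alpha).
Proof. by apply: tame_sum => S _; apply: tame_scale; exact: tame_walsh. Qed.

Lemma chaosM alpha beta n : chaos alpha n * chaos beta n =
  \sum_d product_coef lam alpha beta (fun=> 1) d * basis lam d n.
Proof.
rewrite /chaos big_distrlr /=.
under eq_bigr do under eq_bigr do rewrite mulrACA walshM mulr_sumr.
under eq_bigr do rewrite exchange_big /=.
rewrite exchange_big; apply: eq_bigr => d _ /=.
rewrite /product_coef -Theta_reindex mulr_suml; apply: eq_bigr => S _.
by rewrite mulr_suml; apply: eq_bigr => S' _; rewrite mul1r mulrA.
Qed.

Lemma multi_coef0 (c : {set T} -> {set T} -> R) :
  multi_coef lam (multi0 T) c = \sum_S lamS lam S * c S S.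
Proof.
rewrite /multi_coef (big_pred1 (set0, set0, set0)) => [|kap] /=; last first.
  rewrite delta_eq0; case: eqP => [->|]; rewrite ?andbF// andbT.
  by apply/forallP => t; rewrite /= inE.
apply: eq_big => [L|L _] /=; first by apply/forallP => t /=; rewrite !inE andbF.
by rewrite !setU0.
Qed.

(** The kernel of the difference operator at i ([chaos_diff]). Kernels on sets being unordered, the
    usual factor equal to the order is absent; it comes back on tuples, in [remove_set_kernel]. *)
Definition remove_kernel (i : T) alpha (S : {set T}) : R :=
  if i \in S then 0 else alpha (i |: S).

Lemma sum_remove (i : T) (f : {set T} -> {set T} -> R) :
  \sum_(S : {set T} | i \notin S) f S (i |: S) = \sum_(S : {set T} | i \in S) f (S :\ i) S.
Proof.
rewrite (reindex_onto (fun S => S :\ i) (fun S => i |: S)) /= => [|S iS]; last exact: setU1K.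
apply: eq_big => [S|S /andP[_ /eqP ->]//].
rewrite !inE eqxx /=; apply/eqP/idP => [<-|iS]; first by rewrite setU11.
exact: setD1K.
Qed.

Lemma chaos_remove i alpha n : chaos (remove_kernel i alpha) n =
  \sum_(S : {set T} | i \in S) alpha S * walsh lam (S :\ i) n.
Proof.
rewrite -(sum_remove i (fun S S' => alpha S' * walsh lam S n)) /chaos.
rewrite (bigID (fun S : {set T} => i \in S)) /= big1 ?add0r => [|S iS].
  by apply: eq_bigr => S iS; rewrite /remove_kernel (negPf iS).
by rewrite /remove_kernel iS mul0r.
Qed.

Lemma walsh_add_point S i n : i \notin S -> walsh lam S (add_point i n) = walsh lam S n.
Proof.
move=> iS; apply: eq_bigr => t tS; rewrite ffunE.
by have [ti|_] := eqVneq t i; [rewrite -ti tS in iS|rewrite addn0].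
Qed.

Lemma walshD1 S i n : i \in S ->
  walsh lam S n = ((n i)%:R - lam i) * walsh lam (S :\ i) n.
Proof. by move=> iS; rewrite /walsh (big_setD1 i). Qed.

Lemma chaos_diff i alpha n :
  chaos alpha (add_point i n) - chaos alpha n = chaos (remove_kernel i alpha) n.
Proof.
rewrite chaos_remove /chaos -sumrB (bigID (fun S : {set T} => i \in S)) /= addrC big1.
  rewrite add0r; apply: eq_bigr => S iS; rewrite !(walshD1 _ iS) walsh_add_point ?setD11//.
  by rewrite ffunE eqxx natrD /=; ring.
by move=> S iS; rewrite walsh_add_point// subrr.
Qed.

(** A common point of degree 0 contributes [lam i] before its removal from both sets and 1
    afterwards; at positive degree the reduced pair is incompatible with d. *)
Lemma Theta_remove i S S' d : i \in S -> i \in S' ->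
  lam i * Theta lam (S :\ i) (S' :\ i) d = (d i == 0 :> nat)%:R * Theta lam S S' d.
Proof.
move=> iS iS'; rewrite /Theta !(bigD1 i (P := predT))//= !mulrA; congr (_ * _).
  rewrite !inE eqxx iS iS' /theta /compatible /=.
  by case: (d i) => -[|[|[|]]]//= _; rewrite ?mulr1 ?mulr0 ?mul0r ?mul1r.
by apply: eq_bigr => t ti; rewrite !inE ti.
Qed.

Definition carre alpha beta (n : config) : R :=
  \sum_i lam i * (chaos (remove_kernel i alpha) n * chaos (remove_kernel i beta) n).

(** By [Theta_remove] a pair (S, S') is counted once for each common point at which d vanishes,
    whence the weight l. *)
Lemma carreE alpha beta n : carre alpha beta n =
  \sum_d product_coef lam alpha beta (fun l => l%:R) d * basis lam d n.
Proof.
under [RHS]eq_bigr do rewrite /product_coef -Theta_reindex mulr_suml.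
rewrite exchange_big /=; under [RHS]eq_bigr do under eq_bigr do rewrite mulr_suml.
under [RHS]eq_bigr do rewrite exchange_big /=.
rewrite /carre; under [LHS]eq_bigr do rewrite !chaos_remove big_distrlr mulr_sumr /= big_mkcond.
rewrite exchange_big /=; apply: eq_bigr => S _.
under eq_bigr => i _.
  rewrite (_ : (if _ then _ else _) = \sum_(S' : {set T}) if (i \in S) && (i \in S')
     then lam i * (alpha S * walsh lam (S :\ i) n * (beta S' * walsh lam (S' :\ i) n)) else 0).
    over.
  case: (i \in S) => /=; last by rewrite big1.
  by rewrite mulr_sumr big_mkcond.
rewrite exchange_big /=; apply: eq_bigr => S' _.
transitivity (\sum_(d : multi) (alpha S * beta S') *
    (\sum_i if (i \in S) && (i \in S') && (d i == 0 :> nat) then 1 else 0) *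
    Theta lam S S' d * basis lam d n); last first.
  apply: eq_bigr => d _; rewrite -big_mkcond sumr_const /=.
  rewrite (_ : #|_| = #|S :&: S' :&: [set t | d t == 0 :> nat]|); last first.
    by apply: eq_card => t; rewrite !inE.
  by ring.
under [RHS]eq_bigr do rewrite mulr_sumr !mulr_suml.
rewrite [RHS]exchange_big; apply: eq_bigr => i _ /=.
case: ifPn => [/andP[iS iS']|_] /=; last first.
  by rewrite big1// => d _; rewrite mulr0 !mul0r.
rewrite mulrACA walshM mulrCA !mulr_sumr; apply: eq_bigr => d _.
transitivity ((alpha S * beta S') * (lam i * Theta lam (S :\ i) (S' :\ i) d) * basis lam d n).
  by ring.
by rewrite Theta_remove//; case: (d i == 0 :> nat) => /=; ring.
Qed.

Section functional.
Variable E : (config -> R) -> R.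
Hypothesis pfE : poisson_functional lam E.

Lemma pf_basis0 d : E (basis lam d) = (d == multi0 T)%:R.
Proof.
have b0 n : basis lam (multi0 T) n = 1 by rewrite /basis big1// => t _; rewrite ffunE.
rewrite (pf_ext pfE (h := fun n => basis lam d n * basis lam (multi0 T) n)) => [||n].
- rewrite (pf_basis pfE); case: eqP => [->|]; rewrite ?mul0r// mul1r.
  by rewrite /weight big1// => t _; rewrite ffunE /= fact0 mul1r expr0.
- exact: tame_basis.
- by rewrite b0 mulr1.
Qed.

Lemma pf_expansion (c : multi -> R) : E (fun n => \sum_d c d * basis lam d n) = c (multi0 T).
Proof.
have tb d : tame (fun n => c d * basis lam d n) by apply: tame_scale; exact: tame_basis.
rewrite (pf_sum pfE)//; transitivity (\sum_d c d * (d == multi0 T)%:R).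
  by apply: eq_bigr => d _; rewrite (pf_scale pfE) ?pf_basis0//; exact: tame_basis.
by rewrite (bigD1 (multi0 T))//= eqxx mulr1 big1 ?addr0// => d /negPf ->; rewrite mulr0.
Qed.

Lemma pf_chaosM alpha beta :
  E (fun n => chaos alpha n * chaos beta n) = \sum_S lamS lam S * (alpha S * beta S).
Proof.
rewrite (pf_ext pfE (h := fun n => \sum_d product_coef lam alpha beta (fun=> 1) d * basis lam d n)).
- rewrite pf_expansion /product_coef multi_coef0.
  by apply: eq_bigr => S _; rewrite mul1r.
- by apply: tame_mul; exact: tame_chaos.
- by move=> n; rewrite chaosM.
Qed.

(** Parseval applied to the square of the chaos: a fourth moment becomes a sum of squares of
    Charlier coefficients, which serves both the upper and the lower bounds. *)
Lemma pf_chaos4 alpha : E (fun n => chaos alpha n ^+ 4) =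
  \sum_d weight lam d * product_coef lam alpha alpha (fun=> 1) d ^+ 2.
Proof.
under eq_bigr do rewrite expr2; rewrite -(pf_parseval pfE).
apply: (pf_ext pfE) => [|n]; first by apply: tame_exp; exact: tame_chaos.
by rewrite -chaosM; ring.
Qed.

Lemma pf_walsh_ibp S i H : tame H -> i \in S ->
  E (fun n => walsh lam S n * H n) =
  lam i * E (fun n => walsh lam (S :\ i) n * (H (add_point i n) - H n)).
Proof.
move=> tH iS; have tW := tame_walsh lam (S :\ i).
have tWH := tame_mul tW tH; have tH' := tame_add_point i tH.
have tWH' := tame_mul tW tH'.
rewrite (pf_ext pfE (h := fun n => (n i)%:R * (walsh lam (S :\ i) n * H n)
    - lam i * (walsh lam (S :\ i) n * H n))) => [||n].
- rewrite (pf_sub pfE) ?(pf_scale pfE)//; [|exact: tame_mul (tame_coord _ _) _|exact: tame_scale].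
  rewrite (pf_mecke pfE)// -mulrBr -(pf_sub pfE)//; last exact: (tame_add_point i tWH).
  congr (_ * _); apply: (pf_ext pfE) => [|n].
    by apply: tame_sub => //; exact: (tame_add_point i tWH).
  by rewrite walsh_add_point ?setD11//; ring.
- by apply: tame_mul => //; exact: tame_walsh.
- by rewrite (walshD1 _ iS); ring.
Qed.

(** The kernel of minus the inverse of the Ornstein-Uhlenbeck generator; on the empty set the value
    is 0, by division by 0. *)
Definition inverse_L alpha (S : {set T}) : R := alpha S / #|S|%:R.

(** The Mecke identity at a point i of S turns the mean of [walsh lam S n * H n] into one that
    involves the difference of H at i. Averaging over all points of S, rather than choosing one,
    introduces [inverse_L]; the constant term has no point to use and must vanish. *)
Lemma pf_chaos_ibp alpha H : alpha set0 = 0 -> tame H ->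
  E (fun n => chaos alpha n * H n) = \sum_i lam i *
    E (fun n => chaos (remove_kernel i (inverse_L alpha)) n * (H (add_point i n) - H n)).
Proof.
move=> a0 tH; have tD i : tame (fun n => H (add_point i n) - H n).
  by apply: tame_sub => //; exact: tame_add_point.
have tW S i : tame (fun n => walsh lam S n * (H (add_point i n) - H n)).
  by apply: tame_mul => //; exact: tame_walsh.
have tw S : tame (fun n => walsh lam S n * H n) by apply: tame_mul => //; exact: tame_walsh.
transitivity (\sum_S alpha S * E (fun n => walsh lam S n * H n)).
  rewrite (pf_ext pfE (h := fun n => \sum_S alpha S * (walsh lam S n * H n))) => [||n].
  - rewrite (pf_sum pfE) => [|S _]; last exact: tame_scale.
    by apply: eq_bigr => S _; rewrite (pf_scale pfE).
  - by apply: tame_mul => //; exact: tame_chaos.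
  - by rewrite mulr_suml; apply: eq_bigr => S _; rewrite mulrA.
transitivity (\sum_i lam i * \sum_(S : {set T} | i \in S) inverse_L alpha S *
   E (fun n => walsh lam (S :\ i) n * (H (add_point i n) - H n))); last first.
  apply: eq_bigr => i _; congr (_ * _); rewrite [RHS](pf_ext pfE (h := fun n =>
    \sum_(S : {set T} | i \in S) inverse_L alpha S *
      (walsh lam (S :\ i) n * (H (add_point i n) - H n)))) => [||n].
  - rewrite (pf_sum pfE) => [|S _]; last exact: tame_scale.
    by apply: eq_bigr => S _; rewrite (pf_scale pfE).
  - by apply: tame_mul => //; exact: tame_chaos.
  - by rewrite chaos_remove mulr_suml; apply: eq_bigr => S _; rewrite mulrA.
under [RHS]eq_bigr do rewrite mulr_sumr big_mkcond.
rewrite exchange_big; apply: eq_bigr => S _; rewrite -big_mkcond /=.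
have [->|S0] := eqVneq S set0; first by rewrite a0 mul0r big_pred0// => i; rewrite inE.
transitivity (\sum_(i in S) (alpha S / #|S|%:R) * E (fun n => walsh lam S n * H n)).
  by rewrite sumr_const -[RHS]mulr_natl mulrA [_%:R * _]mulrC divfK// pnatr_eq0 cards_eq0.
by apply: eq_bigr => i iS; rewrite (pf_walsh_ibp tH iS) mulrCA.
Qed.

Lemma chaos_fourth p alpha : homogeneous p alpha ->
  E (fun n => chaos alpha n ^+ 4) <= (8 ^ (p + p) * p.+1 * 2 ^ p)%:R *
  \sum_(r < p.+1) \sum_(l < r.+1) setstar lam p p r l alpha alpha.
Proof.
move=> ha; rewrite pf_chaos4.
have := product_coef_sqr_le lam_ge0 ha ha (om := fun=> 1) false (W := 1).
rewrite expr1n mulr1 minnn => /(_ (fun _ _ => _)); rewrite normr1 => /(_ (lexx _)) H.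
apply: le_trans H _; rewrite ler_wpM2l//; apply: ler_sum => r _.
by under eq_bigl do rewrite oner_neq0 /=.
Qed.

(** The weight l kills the contractions without integration, and centring removes the total one,
    which is the mean. What remains is the range of (r, l) in the first two maxima of [B3]. *)
Lemma carre_variance p q alpha beta : homogeneous p alpha -> homogeneous q beta ->
  E (fun n => (carre alpha beta n - E (carre alpha beta)) ^+ 2) <=
  (8 ^ (p + q) * p.+1 * 2 ^ p)%:R * p%:R ^+ 2 *
  \sum_(r < (minn p q).+1)
    \sum_(l < r.+1 | (0 < l)%N && ~~ [&& p == q, q == r & r == l :> nat])
      setstar lam p q r l alpha beta.
Proof.
move=> ha hb; set c := product_coef lam alpha beta (fun l => l%:R).
have tc : tame (carre alpha beta).
  by apply: tame_sum => i _; apply: tame_scale; apply: tame_mul; exact: tame_chaos.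
have Ec : E (carre alpha beta) = c (multi0 T).
  by rewrite (pf_ext pfE tc (carreE alpha beta)) pf_expansion.
pose c' d := if d == multi0 T then 0 else c d.
have -> : E (fun n => (carre alpha beta n - E (carre alpha beta)) ^+ 2) =
   E (fun n => (\sum_d c' d * basis lam d n) * (\sum_d c' d * basis lam d n)).
  apply: (pf_ext pfE) => [|n].
    by apply/tame_exp/tame_sub => //; exact: tame_cst.
  rewrite Ec carreE -expr2; congr (_ ^+ 2); rewrite -/c.
  rewrite (bigD1 (multi0 T))//= [in RHS](bigD1 (multi0 T))//= /c' eqxx mul0r add0r.
  rewrite {1}/basis big1 => [|t _]; last by rewrite ffunE.
  by rewrite mulr1 addrAC subrr add0r; apply: eq_bigr => d /negPf ->.
rewrite (pf_parseval pfE).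
have := product_coef_sqr_le lam_ge0 ha hb (om := fun l => l%:R) true (W := p%:R).
move=> /(_ _); rewrite -/c => H.
apply: le_trans (le_trans _ (H _)) _.
- rewrite (bigD1 (multi0 T))//= /c' eqxx !mulr0 add0r; apply: ler_sum => d /negPf ->.
  by rewrite -expr2.
- by move=> l lp; rewrite normr_nat ler_nat.
- rewrite ler_wpM2l ?mulr_ge0 ?sqr_ge0//; apply: ler_sum => r _.
  by under eq_bigl do rewrite pnatr_eq0 -lt0n /=.
Qed.

End functional.
End chaos.

(** * A lower bound for the fourth cumulant of a nonnegative kernel *)

Section fourth_cumulant.
Variables (R : realFieldType) (T : finType) (lam : T -> R).
Hypothesis lam_ge0 : forall t, 0 <= lam t.
Notation config := (config T).
Notation multi := {ffun T -> 'I_3}.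
Variable alpha : {set T} -> R.
Hypotheses (alpha_ge0 : forall S, 0 <= alpha S) (alpha0 : alpha set0 = 0).

Let y (x : {set T} * {set T}) := alpha x.1 * alpha x.2.
Let del (x : {set T} * {set T}) := delta (set0, x.1, x.2).

Let y_ge0 x : 0 <= y x. Proof. exact: mulr_ge0. Qed.

Lemma admissible0 (A B : {set T}) : admissible (set0, A, B).
Proof. by apply/forallP => t; rewrite /= inE. Qed.

(* The pairs (S, S') with the same d are exchanged by the swap, which has no
   fixed point unless S and S' meet; and if they meet, the norm of the Charlier
   polynomial of degree two brings the factor 2. *)
Lemma product_part_ge (d : multi) : d != multi0 T ->
  2 * (\sum_(x | del x == d) lamS lam x.1 * lamS lam x.2 * y x ^+ 2) <=
  weight lam d * (\sum_(x | del x == d) y x) ^+ 2.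
Proof.
move=> d0.
have wE x : del x == d -> weight lam d = 2 ^+ #|x.1 :&: x.2| * (lamS lam x.1 * lamS lam x.2).
  move=> /eqP <-; rewrite weight_delta//; last exact: admissible0.
  by rewrite /lam3 /= /lamS big_set0 mul1r.
have w0 := weight_ge0 lam_ge0 d.
case: (boolP [exists t, d t == 2 :> nat]) => [/existsP[t0 dt0]|/existsPn nd].
  apply: le_trans (ler_wpM2l w0 (sqr_sum_ge (fun x _ => y_ge0 x))).
  rewrite !mulr_sumr; apply: ler_sum => x dx; rewrite (wE _ dx).
  rewrite mulrA ler_wpM2r ?sqr_ge0// ler_wpM2r ?mulr_ge0 ?lamS_ge0//.
  have : (0 < #|x.1 :&: x.2|)%N.
    apply/card_gt0P; exists t0; move/eqP/ffunP/(_ t0): dx; rewrite ffunE /delta1 !inE /=.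
    by move=> e; move: dt0; rewrite -e; case: (t0 \in x.1); case: (t0 \in x.2).
  by case: #|_| => // m _; rewrite exprS ler_peMr// exprn_ege1// ler1n.
have AB x : del x == d -> x.1 :&: x.2 = set0.
  move=> /eqP/ffunP dx; apply/setP => t; have := nd t; rewrite -dx ffunE /delta1 !inE /=.
  by case: (t \in x.1); case: (t \in x.2).
apply: (@le_trans _ _ (weight lam d * (2 * \sum_(x | del x == d) y x ^+ 2))).
  rewrite mulrCA ler_wpM2l// mulr_sumr; apply: ler_sum => x dx.
  by rewrite (wE _ dx) AB// cards0 expr0 mul1r.
rewrite ler_wpM2l// [leRHS]expr2 big_distrlr mulr_sumr /=; apply: ler_sum => x dx.
have sx : del (x.2, x.1) == d.
  rewrite -(eqP dx); apply/eqP/ffunP => t; rewrite !ffunE /delta1 /= !inE.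
  by case: (t \in x.1); case: (t \in x.2).
have nx : (x.2, x.1) != x.
  apply: contraNneq d0 => e; have e12 : x.1 = x.2 by rewrite -[in LHS]e.
  have x20 : x.2 = set0 by have := AB _ dx; rewrite e12 setIid.
  rewrite -(eqP dx) /del e12 x20; apply/eqP/ffunP => t.
  by rewrite !ffunE /delta1 !inE /=; apply/val_inj.
rewrite (bigD1 x)//= (bigD1 (x.2, x.1)) ?sx//=.
have -> : y (x.2, x.1) = y x by rewrite /y /= mulrC.
rewrite addrA [leLHS](_ : _ = y x * y x + y x * y x) ?lerDl ?sumr_ge0//; last by ring.
by move=> z _; rewrite mulr_ge0.
Qed.

Variables (p q r l : nat) (a b : {set T} -> R).
Hypotheses (a_ge0 : forall S, 0 <= a S) (b_ge0 : forall S, 0 <= b S).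
Hypotheses (a_le : forall S, a S <= alpha S) (b_le : forall S, b S <= alpha S).
Hypotheses (r_gt0 : (0 < r)%N) (rp : (r <= p)%N) (rq : (r <= q)%N) (lr : (l <= r)%N).
Hypothesis not_total : ~~ [&& p == q, q == r & r == l].

Lemma sstar_ge0 kap : 0 <= sstar lam a b l kap.
Proof. by apply: sumr_ge0 => L _; rewrite !mulr_ge0 ?lamS_ge0. Qed.

(** All terms of the coefficient are nonnegative, so two disjoint groups of them bound it from
    below: those with K and L empty, and those of shape (r, l). They are disjoint because r > 0
    forces K or L to be nonempty. The kernels a and b, below alpha, serve to single out two orders
    of a sum. *)
Lemma product_coef_ge (d : multi) :
  \sum_(x | del x == d) y x +
  \sum_(kap | admissible kap && (delta kap == d) && sizes p q r l kap) sstar lam a b l kap <=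
  product_coef lam alpha alpha (fun=> 1) d.
Proof.
rewrite /product_coef /multi_coef.
have -> : \sum_(x | del x == d) y x = \sum_(kap : triple T | admissible kap && (delta kap == d))
    (if kap.1.1 == set0 then alpha kap.1.2 * alpha kap.2 else 0).
  rewrite -big_mkcondr /=.
  rewrite (reindex_onto (fun x : {set T} * {set T} => (set0, x.1, x.2) : triple T)
    (fun kap => (kap.1.2, kap.2))) /=; last by move=> [[K A] B] /= /andP[_ /eqP ->].
  by apply: eq_bigl => -[A B]; rewrite /= !eqxx !andbT admissible0.
rewrite [X in _ + X]big_mkcondr -big_split /=; apply: ler_sum => -[[K A] B] /andP[ok /eqP dE] /=.
pose G (L : {set T}) := lamS lam L * (1 * (alpha (L :|: K :|: A) * alpha (L :|: K :|: B))).
have G0 L : 0 <= G L by rewrite !mulr_ge0 ?lamS_ge0.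
rewrite -[leRHS]/(\sum_(L | apart L (K, A, B)) G L); have sle : sstar lam a b l (K, A, B) <=
    \sum_(L : {set T} | apart L (K, A, B) && (#|L| == l)) G L.
  apply: ler_sum => L _; rewrite /G mul1r ler_wpM2l ?lamS_ge0//.
  by rewrite ler_pM.
have [K0|K0] := eqVneq K set0; last first.
  rewrite add0r; case: ifP => _; last by apply: sumr_ge0 => L _; apply: G0.
  apply: le_trans sle _; rewrite [leRHS](bigID (fun L : {set T} => #|L| == l)) /=.
  by rewrite lerDl sumr_ge0.
have ap0 : apart set0 (K, A, B) by apply/forallP => t /=; rewrite inE.
rewrite [leRHS](bigD1 set0)//= lerD//.
  by rewrite /G K0 !setU0 !set0U /lamS big_set0 !mul1r.
case: ifP => [/and3P[/= /eqP cK _ _]|_]; last by apply: sumr_ge0 => L _; apply: G0.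
apply: le_trans sle _; rewrite [leRHS](bigID (fun L : {set T} => #|L| == l)) /=.
rewrite -[leLHS]addr0 lerD ?sumr_ge0//.
rewrite [leRHS](eq_bigl (fun L : {set T} => apart L (K, A, B) && (#|L| == l))) => // L.
case: (apart L _) => //=; case: (#|L| =P l) => [Ll|]; rewrite ?andbF// andbT.
move: cK; rewrite K0 cards0 => /esym/eqP; rewrite subn_eq0 => rl.
by apply/eqP => L0; move: Ll; rewrite L0 cards0 => l0; move: rl r_gt0; rewrite -l0; case: (r).
Qed.

Variable E : (config -> R) -> R.
Hypothesis pfE : poisson_functional lam E.

(** Parseval makes the fourth moment a sum over d. The term d = 0 is the square of the second
    moment, and [product_part_ge] extracts twice that square from the others: together 3, what the
    cumulant subtracts. The contraction is left over because (u + v)^2 >= u^2 + v^2 for u, v >=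
    0. *)
Lemma fourth_cumulant_ge :
  setstar lam p q r l a b <=
  E (fun n => chaos lam alpha n ^+ 4) - 3 * (E (fun n => chaos lam alpha n ^+ 2)) ^+ 2.
Proof.
have -> : E (fun n => chaos lam alpha n ^+ 2) = \sum_S lamS lam S * (alpha S * alpha S).
  rewrite -(pf_chaosM pfE); apply: (pf_ext pfE) => [|n]; last by rewrite expr2.
  by apply: tame_exp; exact: tame_chaos.
set s2 := \sum_S _.
rewrite (pf_chaos4 pfE) (bigD1 (multi0 T))//=.
have -> : product_coef lam alpha alpha (fun=> 1) (multi0 T) = s2.
  by rewrite /product_coef multi_coef0; apply: eq_bigr => S _; rewrite mul1r.
have -> : weight lam (multi0 T) = 1.
  by rewrite /weight big1// => t _; rewrite ffunE /= fact0 mul1r expr0.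
set rest := \sum_(i | _) _.
suff : 2 * s2 ^+ 2 + setstar lam p q r l a b <= rest by lra.
pose P d := \sum_(x | del x == d) y x.
pose Q d := \sum_(kap | admissible kap && (delta kap == d) && sizes p q r l kap) sstar lam a b l kap.
have P0 d : 0 <= P d by apply: sumr_ge0.
have Q0 d : 0 <= Q d by apply: sumr_ge0 => kap _; exact: sstar_ge0.
apply: (@le_trans _ _ (\sum_(d | d != multi0 T) (weight lam d * P d ^+ 2 + weight lam d * Q d ^+ 2))).
  rewrite big_split lerD //=.
    apply: le_trans (ler_sum _ (fun d d0 => product_part_ge d0)).
    rewrite -mulr_sumr ler_wpM2l//.
    rewrite (exchange_big_dep (fun x => del x != multi0 T)) /=; last by move=> d x d0 /eqP ->.
    rewrite expr2 /s2 big_distrlr /= pair_big /=.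
    rewrite [leLHS](bigID (fun x => del x != multi0 T)) /= [X in _ + X]big1 ?addr0.
      apply: ler_sum => x dx; rewrite (big_pred1 (del x)) => [|d] /=.
        by rewrite (_ : _ * _ = lamS lam x.1 * lamS lam x.2 * y x ^+ 2)// /y; ring.
      by rewrite [del x == d]eq_sym; case: (d =P del x) => [->|_]; rewrite ?dx ?andbF.
    move=> [A B]; rewrite negbK /del delta_eq0 /= => /eqP[-> ->].
    by rewrite alpha0 !(mul0r, mulr0).
  apply: (@le_trans _ _ (\sum_(d | d != multi0 T)
     \sum_(kap | admissible kap && (delta kap == d) && sizes p q r l kap)
       weight lam d * sstar lam a b l kap ^+ 2)); last first.
    apply: ler_sum => d _; rewrite -mulr_sumr ler_wpM2l ?weight_ge0//.
    by apply: sqr_sum_ge => kap _; exact: sstar_ge0.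
  rewrite (exchange_big_dep (fun kap => admissible kap && sizes p q r l kap)) /=; last first.
    by move=> d kap _ /andP[/andP[-> _] ->].
  apply: ler_sum => kap /andP[ok sz].
  have dn : delta kap != multi0 T.
    rewrite delta_eq0; apply: contraNneq not_total => e; move: sz.
    by rewrite e /sizes /= cards0 => /and3P[/eqP ? /eqP ? /eqP ?]; apply/and3P; split; apply/eqP; lia.
  rewrite (big_pred1 (delta kap)) => [|d] /=.
    rewrite weight_delta// ler_wpM2r ?sqr_ge0// ler_peMl ?lam3_ge0//.
    by rewrite exprn_ege1// ler1n.
  rewrite ok sz andbT [delta kap == d]eq_sym.
  by case: (d =P delta kap) => [->|_]; rewrite ?dn ?andbF.
apply: ler_sum => d _; rewrite -mulrDr ler_wpM2l ?weight_ge0//.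
have /(lerXn2r 2) := product_coef_ge d; rewrite -/(P d) -/(Q d).
rewrite !nnegrE addr_ge0// => /(_ isT) H; apply: le_trans (H _); last first.
  exact: le_trans (addr_ge0 (P0 d) (Q0 d)) (product_coef_ge d).
have := mulr_ge0 (P0 d) (Q0 d); move: (P d) (Q d) => u v; nra.
Qed.

End fourth_cumulant.

(** * From kernels on sets to kernels on tuples *)

Section tuple_kernels.
Variables (R : realFieldType) (T : finType) (lam : T -> R).
Hypothesis lam_ge0 : forall t, 0 <= lam t.
Implicit Types (G H : seq T -> R) (x y : seq T).

Definition dsum n H : R := \sum_(x : n.-tuple T) (\prod_(t <- x) lam t) * H x.

Lemma dsum0 H : dsum 0 H = H [::].
Proof.
rewrite /dsum (big_pred1 [tuple]) /= => [|x]; last by apply/esym/eqP; exact: tuple0.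
by rewrite big_nil mul1r.
Qed.

Lemma dsumS n H : dsum n.+1 H = \sum_t lam t * dsum n (fun x => H (t :: x)).
Proof.
rewrite /dsum; under [RHS]eq_bigr do rewrite mulr_sumr.
rewrite pair_big /= (reindex (fun x : T * n.-tuple T => [tuple of x.1 :: x.2])) /=.
  by apply: eq_bigr => -[t x] _ /=; rewrite big_cons mulrA.
exists (fun x : n.+1.-tuple T => (thead x, [tuple of behead x])) => [[t x] _|x _] /=.
  by rewrite theadE; congr pair; apply/val_inj.
by rewrite [RHS]tuple_eta.
Qed.

Lemma eq_dsum n H H' : (forall x, size x = n -> H x = H' x) -> dsum n H = dsum n H'.
Proof. by move=> HH; apply: eq_bigr => x _; rewrite HH// size_tuple. Qed.

Lemma dsum_scale n c H : dsum n (fun x => c * H x) = c * dsum n H.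
Proof. by rewrite mulr_sumr; apply: eq_bigr => x _; rewrite mulrCA. Qed.

Lemma dsum_ge0 n H : (forall x, size x = n -> 0 <= H x) -> 0 <= dsum n H.
Proof.
move=> H0; apply: sumr_ge0 => x _; rewrite mulr_ge0 ?H0 ?size_tuple//.
by rewrite big_seq prodr_ge0.
Qed.

Lemma card_enumerations n (S : {set T}) : #|S| = n ->
  #|[pred x : n.-tuple T | uniq x && ([set t in x] == S)]| = n`!.
Proof.
move=> Sn; transitivity #|[set x : n.-tuple T | all (mem S) x & uniq x]|; last first.
  by rewrite card_uniq_tuples Sn ffactnn.
apply: eq_card => x; rewrite !inE; apply/andP/andP => [[ux /eqP <-]|[/allP aS ux]]; split => //.
  by apply/allP => t; rewrite /= inE.
rewrite eqEcard Sn cardsE (card_uniqP ux) size_tuple leqnn andbT.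
by apply/subsetP => t; rewrite inE => /aS.
Qed.

(** Each set of n points is listed by n! injective tuples. *)
Lemma dsum_uniq n H (h : {set T} -> R) :
  (forall x, size x = n -> H x = if uniq x then h [set t in x] else 0) ->
  dsum n H = n`!%:R * \sum_(S : {set T} | #|S| == n) lamS lam S * h S.
Proof.
move=> Hh; transitivity (\sum_(x : n.-tuple T | uniq x) lamS lam [set t in x] * h [set t in x]).
  rewrite [RHS]big_mkcond; apply: eq_bigr => x _; rewrite Hh ?size_tuple//.
  case: ifPn => [ux|_]; last exact: mulr0.
  rewrite /lamS big_uniq//=; congr (_ * _).
  by apply: eq_bigl => t; rewrite inE.
rewrite (partition_big (fun x : n.-tuple T => [set t in x]) (fun S => #|S| == n)) /=.
  rewrite mulr_sumr; apply: eq_bigr => S /eqP Sn.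
  rewrite (eq_bigr (fun=> lamS lam S * h S)) => [|x /andP[_ /eqP ->]//].
  rewrite sumr_const mulr_natl; congr (_ *+ _).
  exact: card_enumerations.
by move=> x ux; rewrite cardsE (card_uniqP ux) size_tuple eqxx.
Qed.

(** Elementary kernels vanish as soon as two arguments lie in the same cell; this makes the passage
    from tuples to sets lossless. *)
Record symmetric_kernel p G : Prop := SymmetricKernel {
  sk_perm : forall x y, size x = p -> perm_eq x y -> G x = G y ;
  sk_uniq : forall x, size x = p -> ~~ uniq x -> G x = 0 }.

(** The factor p! turns the sum over sets into the sum over all ordered tuples
    ([chaos_set_kernel]). *)
Definition set_kernel p G (S : {set T}) : R :=
  if #|S| == p then p`!%:R * G (enum S) else 0.

Lemma set_kernel_homogeneous p G : homogeneous p (set_kernel p G).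
Proof. by move=> S /negPf nS; rewrite /set_kernel nS. Qed.

Lemma natfact_neq0 n : n`!%:R != 0 :> R.
Proof. by rewrite pnatr_eq0 -lt0n fact_gt0. Qed.
Hint Resolve natfact_neq0 : core.

Lemma set_kernelE p G x : symmetric_kernel p G -> size x = p ->
  G x = if uniq x then set_kernel p G [set t in x] / p`!%:R else 0.
Proof.
move=> sG xp; case: ifPn => ux; last exact: (sk_uniq sG).
rewrite /set_kernel cardsE (card_uniqP ux) xp eqxx mulrC mulKf//.
apply: (sk_perm sG) => //; apply: uniq_perm => //; first exact: enum_uniq.
by move=> t; rewrite mem_enum inE.
Qed.

Definition compensated_product (n : config T) x : R := \prod_(t <- x) ((n t)%:R - lam t).

Lemma chaos_set_kernel p G n : symmetric_kernel p G ->
  chaos lam (set_kernel p G) n = \sum_(x : p.-tuple T) G x * compensated_product n x.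
Proof.
move=> sG.
transitivity (\sum_(S : {set T} | #|S| == p) set_kernel p G S * walsh lam S n).
  rewrite /chaos [RHS]big_mkcond; apply: eq_bigr => S _.
  by case: ifPn => // /set_kernel_homogeneous ->; rewrite mul0r.
transitivity (\sum_(x : p.-tuple T | uniq x) G x * compensated_product n x); last first.
  rewrite [LHS]big_mkcond; apply: eq_bigr => x _; case: ifPn => // ux.
  by rewrite (sk_uniq sG) ?size_tuple// mul0r.
rewrite [RHS](partition_big (fun x : p.-tuple T => [set t in x]) (fun S => #|S| == p)) /=.
  apply: eq_bigr => S /eqP Sp.
  rewrite (eq_bigr (fun=> set_kernel p G S * walsh lam S n / p`!%:R)).
    rewrite sumr_const (_ : #|_| = p`!); last exact: card_enumerations.
    by rewrite -[RHS]mulr_natr divfK.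
  move=> x /andP[ux /eqP <-]; rewrite (set_kernelE sG) ?size_tuple// ux mulrAC.
  rewrite /compensated_product big_uniq//; congr (_ * _ * _).
  by apply: eq_bigl => t; rewrite inE.
by move=> x ux; rewrite cardsE (card_uniqP ux) size_tuple eqxx.
Qed.

(** The squared norm of a contraction for the weights [lam], with the blocks in the order of [star]:
    c stands for gamma. *)
Definition dstar p q G H r l : R :=
  dsum (r - l) (fun c => dsum (p - r) (fun t => dsum (q - r) (fun s =>
    dsum l (fun z => G (z ++ c ++ t) * H (z ++ c ++ s)) ^+ 2))).

Lemma dstar_ge0 p q G H r l : 0 <= dstar p q G H r l.
Proof.
by do 3 (apply: dsum_ge0 => ? _); exact: sqr_ge0.
Qed.

(** Kernels vanish on repetitions, so the left side is zero unless c, t and s are injective and c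
    avoids both t and s. The sequences t and s may share points, in accordance with [admissible]. *)
Lemma inner_star p q G H r l c t s : symmetric_kernel p G -> symmetric_kernel q H ->
  (l <= r)%N -> (r <= p)%N -> (r <= q)%N ->
  size c = (r - l)%N -> size t = (p - r)%N -> size s = (q - r)%N ->
  let kap := ([set i in c], [set i in t], [set i in s]) in
  dsum l (fun z => G (z ++ c ++ t) * H (z ++ c ++ s)) =
  if [&& uniq c, uniq t, uniq s & admissible kap] then
    l`!%:R / (p`!%:R * q`!%:R) * sstar lam (set_kernel p G) (set_kernel q H) l kap
  else 0.
Proof.
move=> sG sH lr rp rq cl tl sl kap.
have sz1 z : size z = l -> size (z ++ c ++ t) = p by rewrite !size_cat cl tl => ->; lia.
have sz2 z : size z = l -> size (z ++ c ++ s) = q by rewrite !size_cat cl sl => ->; lia.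
case: ifPn => [/and4P[uc ut us ok]|nu]; last first.
  rewrite -[RHS](mul0r (dsum l (fun=> 1))) -dsum_scale; apply: eq_dsum => z zl; rewrite mul0r.
  case: (boolP (uniq (c ++ t) && uniq (c ++ s))) => [/andP[]|]; last first.
    rewrite negb_and => /orP[n1|n1].
      by rewrite (sk_uniq sG) ?mul0r ?sz1// cat_uniq !negb_and n1 !orbT.
    by rewrite (sk_uniq sH) ?mulr0 ?sz2// cat_uniq !negb_and n1 !orbT.
  rewrite !cat_uniq => /and3P[uc hct ut] /and3P[_ hcs us].
  case/negP: nu; rewrite uc ut us; apply/forallP => i /=; rewrite !inE.
  apply/negP => /andP[ic /orP[it|is_]]; [case/hasP: hct|case/hasP: hcs]; by exists i.
pose h (L : {set T}) := if apart L kap then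
  (p`!%:R * q`!%:R)^-1 * (set_kernel p G (L :|: kap.1.1 :|: kap.1.2) *
     set_kernel q H (L :|: kap.1.1 :|: kap.2)) else 0.
have setE (z u v : seq T) : [set i in z ++ u ++ v] = [set i in z] :|: [set i in u] :|: [set i in v].
  by apply/setP => i; rewrite !inE !mem_cat orbA.
have uE (z u v : seq T) : uniq u -> uniq v -> ~~ has (mem u) v ->
    uniq (z ++ u ++ v) = uniq z && [forall i, ~~ ((i \in z) && ((i \in u) || (i \in v)))].
  move=> uu uv nuv; rewrite !cat_uniq uu uv nuv !andbT; congr (_ && _).
  apply/hasPn/forallP => /= [H0 i|H0 i].
    by apply/negP => /andP[iz iuv]; have := H0 i; rewrite mem_cat iuv iz => /(_ isT).
  by rewrite mem_cat => iuv; have := H0 i; rewrite iuv andbT.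
have nct : ~~ has (mem c) t.
  by apply/hasPn => i it /=; apply/negP => ic; have := forallP ok i; rewrite !inE /= ic it.
have ncs : ~~ has (mem c) s.
  by apply/hasPn => i it /=; apply/negP => ic; have := forallP ok i; rewrite !inE /= ic it orbT.
rewrite (@dsum_uniq l _ h) => [|z zl].
  rewrite /sstar -mulrA; congr (_ * _); rewrite mulr_sumr.
  rewrite [RHS](eq_bigl (fun L : {set T} => (#|L| == l) && apart L kap)) => [|L]; last by rewrite andbC.
  rewrite [RHS]big_mkcondr; apply: eq_bigr => L _; rewrite /h; case: ifP => _; last exact: mulr0.
  by rewrite mulrCA.
rewrite (set_kernelE sG) ?sz1// (set_kernelE sH) ?sz2// !uE//.
case: (uniq z) => //=; last by rewrite mul0r.
rewrite /h; have -> : apart [set i in z] kap = [forall i, ~~ ((i \in z) && ((i \in c) || (i \in t)))] &&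
    [forall i, ~~ ((i \in z) && ((i \in c) || (i \in s)))].
  apply/forallP/andP => [H0|[/forallP H1 /forallP H2] i] /=.
    split; apply/forallP => i; have := H0 i; rewrite !inE /=;
    by case: (i \in z); case: (i \in c); case: (i \in t); case: (i \in s).
  have := H1 i; have := H2 i; rewrite !inE;
  by case: (i \in z); case: (i \in c); case: (i \in t); case: (i \in s).
rewrite !setE; case: [forall i, _] => /=; last by rewrite mul0r.
case: [forall i, _] => /=; last by rewrite mulr0.
by rewrite invfM mulrACA mulrC.
Qed.

Lemma dstarE p q G H r l : symmetric_kernel p G -> symmetric_kernel q H ->
  (l <= r)%N -> (r <= p)%N -> (r <= q)%N ->
  dstar p q G H r l = (r - l)`!%:R * (p - r)`!%:R * (q - r)`!%:R *
    (l`!%:R / (p`!%:R * q`!%:R)) ^+ 2 * setstar lam p q r l (set_kernel p G) (set_kernel q H).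
Proof.
move=> sG sH lr rp rq; set w := _ / _.
pose y (kap : triple T) := if admissible kap then
  w ^+ 2 * sstar lam (set_kernel p G) (set_kernel q H) l kap ^+ 2 else 0.
transitivity (dsum (r - l) (fun c => if uniq c then (p - r)`!%:R * (\sum_(A : {set T} | #|A| == (p - r)%N)
    lamS lam A * ((q - r)`!%:R * (\sum_(B : {set T} | #|B| == (q - r)%N)
       lamS lam B * y ([set i in c], A, B)))) else 0)).
  apply: eq_dsum => c cl; rewrite (@dsum_uniq _ _ (fun A => if uniq c then (q - r)`!%:R *
     (\sum_(B : {set T} | #|B| == (q - r)%N) lamS lam B * y ([set i in c], A, B)) else 0)).
    by case: ifP => // _; rewrite big1 ?mulr0// => ? _; rewrite mulr0.
  move=> t tl; rewrite (@dsum_uniq _ _ (fun B => if uniq c && uniq t then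
      y ([set i in c], [set i in t], B) else 0)).
    case: (uniq c) => /=; case: (uniq t) => //=; by rewrite big1 ?mulr0// => ? _; rewrite mulr0.
  move=> s sl; rewrite (inner_star sG sH lr rp rq cl tl sl) /y.
  case: (uniq c) => /=; case: (uniq t); case: (uniq s) => //=; rewrite ?expr0n//.
  by case: ifP => _; rewrite ?expr0n// exprMn.
rewrite (@dsum_uniq _ _ (fun K => (p - r)`!%:R * (\sum_(A : {set T} | #|A| == (p - r)%N)
    lamS lam A * ((q - r)`!%:R * (\sum_(B : {set T} | #|B| == (q - r)%N)
       lamS lam B * y (K, A, B)))))) //.
have -> : setstar lam p q r l (set_kernel p G) (set_kernel q H) =
   \sum_(K : {set T} | #|K| == (r - l)%N) \sum_(A : {set T} | #|A| == (p - r)%N)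
     \sum_(B : {set T} | #|B| == (q - r)%N) (if admissible (K, A, B) then
      lam3 lam (K, A, B) * sstar lam (set_kernel p G) (set_kernel q H) l (K, A, B) ^+ 2 else 0).
  rewrite pair_big_dep /= pair_big_dep /= -big_mkcondr /=; apply: eq_big => [[[K A] B]|[[K A] B] _] //=.
  by rewrite /sizes /= andbC !andbA.
rewrite !mulr_sumr; apply: eq_bigr => K _; rewrite !mulr_sumr; apply: eq_bigr => A _.
rewrite !mulr_sumr; apply: eq_bigr => B _; rewrite /y; case: ifP => _; last by rewrite !mulr0.
by rewrite /lam3 /=; ring.
Qed.

End tuple_kernels.

Lemma pow4_sum_le (R : realFieldType) (I : finType) (y : I -> R) :
  (\sum_i y i) ^+ 4 <= #|I|%:R ^+ 3 * \sum_i y i ^+ 4.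
Proof.
have H := sqr_sum_le predT y; have H2 := sqr_sum_le predT (fun i => y i ^+ 2).
rewrite -[4%N]/(2 * 2)%N exprM; set c : R := #|I|%:R in H H2 *.
have c0 : 0 <= c by rewrite /c.
apply: (@le_trans _ _ ((c * \sum_i y i ^+ 2) ^+ 2)).
  by rewrite lerXn2r ?nnegrE ?sqr_ge0 ?mulr_ge0// sumr_ge0// => i _; exact: sqr_ge0.
rewrite exprMn (_ : c ^+ 3 = c ^+ 2 * c); last by ring.
rewrite -mulrA ler_wpM2l ?sqr_ge0//; apply: le_trans H2 _.
by rewrite ler_wpM2l//; apply: ler_sum => i _; rewrite -exprM.
Qed.

Section symmetric_kernels.
Variables (R : realFieldType) (T : finType) (lam : T -> R).
Hypothesis lam_ge0 : forall t, 0 <= lam t.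
Implicit Types (G H : seq T -> R).

(** A crude constant that absorbs the ratios of factorials of [dstarE] in both directions. *)
Definition fact_bound p q : R := (p`! * q`!)%:R ^+ 4.

Lemma fact_bound_gt0 p q : 0 < fact_bound p q.
Proof. by rewrite exprn_gt0// ltr0n !muln_gt0 !fact_gt0. Qed.

Lemma natfact_ge1 n : 1 <= n`!%:R :> R.
Proof. by rewrite ler1n fact_gt0. Qed.

Lemma setstar_le_dstar p q G H r l : symmetric_kernel p G -> symmetric_kernel q H ->
  (l <= r)%N -> (r <= p)%N -> (r <= q)%N ->
  setstar lam p q r l (set_kernel p G) (set_kernel q H) <=
  fact_bound p q * dstar lam p q G H r l.
Proof.
move=> sG sH lr rp rq; rewrite (dstarE lam sG sH)//.
set S := setstar _ _ _ _ _ _ _; have S0 : 0 <= S by exact: setstar_ge0.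
rewrite mulrA ler_peMl// /fact_bound -[p`!%:R * q`!%:R]natrM.
set P : R := (p`! * q`!)%:R; have P1 : 1 <= P by rewrite ler1n muln_gt0 !fact_gt0.
have P0 : P != 0 by rewrite gt_eqF// (lt_le_trans ltr01).
set a : R := _`!%:R * _ * _; have a1 : 1 <= a.
  by apply: mulr_ege1; [apply: mulr_ege1|]; exact: natfact_ge1.
rewrite (_ : P ^+ 4 * (a * (l`!%:R / P) ^+ 2) = P ^+ 2 * a * l`!%:R ^+ 2);
  last by field; rewrite !pnatr_eq0 -!lt0n !fact_gt0.
by apply: mulr_ege1; [apply: mulr_ege1 => //|]; rewrite exprn_ege1// natfact_ge1.
Qed.

Lemma dstar_le_setstar p q G H r l : symmetric_kernel p G -> symmetric_kernel q H ->
  (l <= r)%N -> (r <= p)%N -> (r <= q)%N ->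
  dstar lam p q G H r l <=
  fact_bound p q * setstar lam p q r l (set_kernel p G) (set_kernel q H).
Proof.
move=> sG sH lr rp rq; rewrite (dstarE lam sG sH)//.
set S := setstar _ _ _ _ _ _ _; have S0 : 0 <= S by exact: setstar_ge0.
rewrite ler_wpM2r// /fact_bound -[p`!%:R * q`!%:R]natrM.
set P : R := (p`! * q`!)%:R; have P1 : 1 <= P by rewrite ler1n muln_gt0 !fact_gt0.
have P0 : 0 < P by rewrite (lt_le_trans ltr01).
have lf (a b : nat) : (a <= b)%N -> a`!%:R <= b`!%:R :> R by move=> ab; rewrite ler_nat leq_fact.
have H1 : (r - l)`!%:R <= p`!%:R :> R by apply: lf; lia.
have H2 : (p - r)`!%:R <= p`!%:R :> R by apply: lf; lia.
have H3 : (q - r)`!%:R <= q`!%:R :> R by apply: lf; lia.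
have H4 : l`!%:R <= q`!%:R :> R by apply: lf; lia.
have p1 := natfact_ge1 p; have q1 := natfact_ge1 q.
have PE : P = p`!%:R * q`!%:R by rewrite /P natrM.
apply: (@le_trans _ _ (p`!%:R * p`!%:R * q`!%:R * 1)).
  apply: ler_pM; [by rewrite !mulr_ge0|exact: sqr_ge0| |].
    by apply: ler_pM => //; [rewrite mulr_ge0|apply: ler_pM].
  rewrite exprn_ile1 ?divr_ge0// ?(ltW P0)// ler_pdivrMr// mul1r (le_trans H4)// PE.
  by rewrite ler_peMl.
rewrite mulr1; apply: (@le_trans _ _ (P ^+ 2)); last by rewrite ler_weXn2l.
rewrite (_ : P ^+ 2 = p`!%:R * p`!%:R * q`!%:R * q`!%:R); last by rewrite PE; ring.
by rewrite ler_peMr// !mulr_ge0.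
Qed.

Lemma cons_symmetric_kernel p G i c : symmetric_kernel p.+1 G ->
  symmetric_kernel p (fun x => c * G (i :: x)).
Proof.
move=> [sp su]; split=> [x y xp xy|x xp nx].
  by congr (_ * _); apply: sp; rewrite /= ?xp// perm_cons.
by rewrite su ?mulr0//= ?xp// (negPf nx) andbF.
Qed.

Lemma remove_set_kernel p G i S : symmetric_kernel p.+1 G ->
  remove_kernel i (set_kernel p.+1 G) S = set_kernel p (fun x => p.+1%:R * G (i :: x)) S.
Proof.
move=> sG; rewrite /remove_kernel /set_kernel.
have sE : #|S| = p -> size (enum S) = p by move=> <-; rewrite cardE.
case: ifPn => iS.
  case: eqP => // /sE Sp; rewrite (sk_uniq sG) ?mulr0//= ?Sp//.
  by rewrite mem_enum iS.
rewrite cardsU1 iS add1n eqSS; case: eqP => // /sE Sp.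
rewrite factS natrM [_%:R * _%:R]mulrC mulrA; congr (_ * _).
apply: (sk_perm sG); first by rewrite -cardE cardsU1 iS cardE Sp.
apply: uniq_perm; rewrite /= ?enum_uniq ?mem_enum ?iS// => t.
by rewrite mem_enum !inE mem_enum.
Qed.

(** Summed over i, the fixed argument is shared by the two factors but stays outside the inner
    square: it becomes one more gamma variable, so r grows by one and l does not change. *)
Lemma dstar_cons p G r l : symmetric_kernel p.+1 G -> (l <= r)%N -> (r <= p)%N ->
  \sum_i lam i * dstar lam p p (fun x => p.+1%:R * G (i :: x)) (fun x => p.+1%:R * G (i :: x)) r l
  = p.+1%:R ^+ 4 * dstar lam p.+1 p.+1 G G r.+1 l.
Proof.
move=> sG lr rp; rewrite /dstar subSS subSn// dsumS mulr_sumr; apply: eq_bigr => i _.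
rewrite mulrCA; congr (_ * _); rewrite -dsum_scale; apply: eq_dsum => c cl.
rewrite -dsum_scale; apply: eq_dsum => t tl; rewrite -dsum_scale; apply: eq_dsum => s sl.
rewrite (_ : _%:R ^+ 4 = (p.+1%:R ^+ 2) ^+ 2); last by rewrite -exprM.
rewrite -exprMn; congr (_ ^+ 2); rewrite -dsum_scale.
apply: eq_dsum => z zl.
rewrite (sk_perm sG (y := z ++ (i :: c) ++ t)); last first.
- exact: (permEl (perm_catCA [:: i] z (c ++ t))).
- by rewrite /= !size_cat cl tl zl; lia.
rewrite (sk_perm sG (x := i :: z ++ c ++ s) (y := z ++ (i :: c) ++ s)); last first.
- exact: (permEl (perm_catCA [:: i] z (c ++ s))).
- by rewrite /= !size_cat cl sl zl; lia.
by ring.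
Qed.

(** Both sides are the integral over r variables of the square of the partial L^2 mass of G: without
    inner integration the squared term is a product, which Fubini factors. *)
Lemma dstar_no_integration p G r : symmetric_kernel p G -> (r <= p)%N ->
  dstar lam p p G G r 0 = dstar lam p p G G p (p - r).
Proof.
move=> sG rp; rewrite /dstar subn0 subnn subKn//; apply: eq_dsum => c cl.
rewrite !dsum0; transitivity ((dsum lam (p - r) (fun t => G (c ++ t) ^+ 2)) ^+ 2).
  rewrite expr2 -dsum_scale; apply: eq_dsum => t tl.
  rewrite mulrC -dsum_scale; apply: eq_dsum => s sl.
  by rewrite dsum0 /= -exprMn.
congr (_ ^+ 2); apply: eq_dsum => z zl; rewrite !cats0 -expr2; congr (_ ^+ 2).
by apply: (sk_perm sG); rewrite ?size_cat ?cl ?zl ?subnKC// perm_catC.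
Qed.

Lemma dstar_full p G : dstar lam p p G G p 0 = dsum lam p (fun x => G x ^+ 4).
Proof.
rewrite /dstar subn0 subnn; apply: eq_dsum => c _; rewrite !dsum0 /= cats0.
by rewrite -expr2 -exprM.
Qed.

End symmetric_kernels.

Lemma ler_sum_term (R : realFieldType) (I : finType) (A : pred I) (w : I -> R) i :
  A i -> (forall j, A j -> 0 <= w j) -> w i <= \sum_(j | A j) w j.
Proof. by move=> Ai w0; rewrite (bigD1 i)//= lerDl sumr_ge0// => j /andP[/w0]. Qed.

Definition total_sum (R : realFieldType) (T : finType) (lam : T -> R) (k : nat)
    (q : 'I_k -> nat) (G : 'I_k -> seq T -> R) (n : config T) : R :=
  \sum_i \sum_(x : (q i).-tuple T) G i x * compensated_product lam n x.

(** The finite counterpart, up to constants, of the square of [s * B3], with sums of squared norms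
    in place of maxima of norms. *)
Definition energy (R : realFieldType) (T : finType) (lam : T -> R) (k : nat)
    (q : 'I_k -> nat) (G : 'I_k -> seq T -> R) : R :=
  \sum_i \sum_(r < (q i).+1) \sum_(l < r.+1 | (0 < l)%N && ~~ [&& q i == r & r == l :> nat])
    dstar lam (q i) (q i) (G i) (G i) r l +
  \sum_(i < k) \sum_(j < k | (i < j)%N) \sum_(r < (q i).+1) \sum_(l < r.+1 | (0 < l)%N)
    dstar lam (q i) (q j) (G i) (G j) r l +
  \sum_i dsum lam (q i) (fun x => G i x ^+ 4).

(** * Sums of chaoses of increasing orders *)

Section kernel_family.
Variables (R : realFieldType) (k : nat) (q : 'I_k -> nat).
Hypothesis q_gt0 : forall i, (0 < q i)%N.
Hypothesis q_incr : forall i j : 'I_k, (i < j)%N -> (q i < q j)%N.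

Lemma q_inj : injective q.
Proof.
move=> i j qij; apply/val_inj; case: (ltngtP i j) => // /q_incr; rewrite qij ltnn //.
Qed.

Variables (T : finType) (lam : T -> R) (G : 'I_k -> seq T -> R).
Hypothesis lam_ge0 : forall t, 0 <= lam t.
Hypothesis sG : forall i, symmetric_kernel (q i) (G i).
Variable E : (config T -> R) -> R.
Hypothesis pfE : poisson_functional lam E.

Let a i := set_kernel (q i) (G i).
Let ha i : homogeneous (q i) (a i) := @set_kernel_homogeneous R T (q i) (G i).
Let alpha S := \sum_i a i S.
Let F := total_sum lam q G.
Let V := energy lam q G.

Lemma chaos_sum (b : 'I_k -> {set T} -> R) n :
  chaos lam (fun S => \sum_i b i S) n = \sum_i chaos lam (b i) n.
Proof. by rewrite exchange_big; apply: eq_bigr => S _; rewrite mulr_suml. Qed.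

Lemma total_sumE n : F n = chaos lam alpha n.
Proof. by rewrite chaos_sum; apply: eq_bigr => i _; rewrite chaos_set_kernel. Qed.

Lemma eq_chaos b b' n : b =1 b' -> chaos lam b n = chaos lam b' n.
Proof. by move=> bb'; apply: eq_bigr => S _; rewrite bb'. Qed.

Lemma alpha0 : alpha set0 = 0.
Proof. by apply: big1 => i _; rewrite ha// cards0 eq_sym -lt0n. Qed.

Lemma tame_total : tame F.
Proof. exact: tame_ext (tame_chaos lam alpha) (fun n => esym (total_sumE n)). Qed.

Lemma sum_set_kernel_sqr i :
  \sum_S lamS lam S * (a i S * a i S) = (q i)`!%:R * dsum lam (q i) (fun x => G i x ^+ 2).
Proof.
rewrite (@dsum_uniq _ _ _ _ _ (fun S => (a i S / (q i)`!%:R) ^+ 2)) => [|x xq].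
  rewrite (bigID (fun S : {set T} => #|S| == q i)) /= [X in _ + X]big1 ?addr0; last first.
    by move=> S nS; rewrite (ha nS) mul0r mulr0.
  rewrite !mulr_sumr; apply: eq_bigr => S _; field.
  by rewrite pnatr_eq0 -lt0n fact_gt0.
by rewrite (set_kernelE (sG i) xq); case: (uniq x) => //; rewrite expr0n.
Qed.

(** Set kernels of different orders have disjoint supports, so no cross term survives; this is where
    distinct indices must have distinct orders. *)
Lemma total_second_moment :
  E (fun n => F n ^+ 2) = \sum_i (q i)`!%:R * dsum lam (q i) (fun x => G i x ^+ 2).
Proof.
rewrite (pf_ext pfE (h := fun n => chaos lam alpha n * chaos lam alpha n)); last first.
- by move=> n; rewrite total_sumE expr2.
- exact/tame_exp/tame_total.
rewrite (pf_chaosM pfE); under [RHS]eq_bigr do rewrite -sum_set_kernel_sqr.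
rewrite [RHS]exchange_big; apply: eq_bigr => S _ /=; rewrite -mulr_sumr; congr (_ * _).
rewrite /alpha big_distrlr; apply: eq_bigr => i _ /=; rewrite (bigD1 i)//= big1 ?addr0// => j ji.
have [Si|/ha ->] := eqVneq #|S| (q i); last by rewrite mul0r.
by rewrite (ha (i := j)) ?mulr0// Si; apply: contra_neq ji => /q_inj ->.
Qed.

Let d0 j j' r l : 0 <= dstar lam (q j) (q j') (G j) (G j') r l.
Proof. exact: dstar_ge0. Qed.

Let s0 i : 0 <= dsum lam (q i) (fun x => G i x ^+ 4).
Proof. by apply: dsum_ge0 => // x _; rewrite exprn_even_ge0. Qed.

Let V1_ge0 i : 0 <= \sum_(r < (q i).+1) \sum_(l < r.+1 | (0 < l)%N && ~~ [&& q i == r & r == l :> nat])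
    dstar lam (q i) (q i) (G i) (G i) r l.
Proof. by do 2 (apply: sumr_ge0 => ? _). Qed.

Let V2_ge0 i j : 0 <= \sum_(r < (q i).+1) \sum_(l < r.+1 | (0 < l)%N)
    dstar lam (q i) (q j) (G i) (G j) r l.
Proof. by do 2 (apply: sumr_ge0 => ? _). Qed.

Lemma energy_ge0 : 0 <= V.
Proof.
rewrite /V /energy !addr_ge0//; apply: sumr_ge0 => i _; last exact: s0.
  exact: V1_ge0.
by apply: sumr_ge0 => j _; exact: V2_ge0.
Qed.

Lemma energy_self i (r l : nat) : (r <= q i)%N -> (l <= r)%N -> (0 < l)%N ->
  ~~ [&& q i == r & r == l] -> dstar lam (q i) (q i) (G i) (G i) r l <= V.
Proof.
move=> rq lr l0 nt; rewrite -ltnS in rq; rewrite -ltnS in lr.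
rewrite /V /energy -addrA; apply: ler_wpDr.
  rewrite addr_ge0//; apply: sumr_ge0 => ? _; last exact: s0.
  by apply: sumr_ge0 => ? _; exact: V2_ge0.
apply: le_trans (ler_sum_term (i := i) _ (fun j _ => V1_ge0 j)) => //.
apply: le_trans (ler_sum_term (i := Ordinal rq) _ _) => //=; last first.
  by move=> ? _; apply: sumr_ge0 => ? _; exact: d0.
by apply: le_trans (ler_sum_term (i := Ordinal lr) _ _) => //=; rewrite l0 nt.
Qed.

Lemma energy_cross (i j : 'I_k) (r l : nat) : (i < j)%N -> (r <= q i)%N -> (l <= r)%N -> (0 < l)%N ->
  dstar lam (q i) (q j) (G i) (G j) r l <= V.
Proof.
move=> ij rq lr l0; rewrite -ltnS in rq; rewrite -ltnS in lr.
rewrite /V /energy -addrA; apply: ler_wpDl; first by apply: sumr_ge0 => ? _; exact: V1_ge0.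
apply: ler_wpDr; first by apply: sumr_ge0 => ? _; exact: s0.
apply: le_trans (ler_sum_term (i := i) _ _) => //=; last first.
  by move=> ? _; apply: sumr_ge0 => ? _; exact: V2_ge0.
apply: le_trans (ler_sum_term (i := j) _ (fun j _ => V2_ge0 i j)) => //.
apply: le_trans (ler_sum_term (i := Ordinal rq) _ _) => //=; last first.
  by move=> ? _; apply: sumr_ge0 => ? _; exact: d0.
by apply: le_trans (ler_sum_term (i := Ordinal lr) _ _).
Qed.

Lemma energy_fourth i : dsum lam (q i) (fun x => G i x ^+ 4) <= V.
Proof.
rewrite /V /energy; apply: ler_wpDl; last exact: ler_sum_term.
rewrite addr_ge0//; apply: sumr_ge0 => ? _; first exact: V1_ge0.
by apply: sumr_ge0 => ? _; exact: V2_ge0.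
Qed.

(** The first two sums of [energy] have l > 0. For r = [q i] the norm is the L^4 one; otherwise
    [dstar_no_integration] exchanges it for a contraction with [q i - r] > 0 integrations. *)
Lemma energy_no_integration i (r : nat) : (r <= q i)%N -> (0 < r)%N ->
  dstar lam (q i) (q i) (G i) (G i) r 0 <= V.
Proof.
move=> rq r0; have [rE|rE] := eqVneq r (q i).
  by rewrite rE dstar_full energy_fourth.
rewrite dstar_no_integration// energy_self ?leq_subr ?subn_gt0 ?ltn_neqAle ?rE//.
by rewrite eqxx /= eq_sym; lia.
Qed.

(** In the variance of [gamma], the first factor comes from [product_coef_sqr_le], [p.+1%:R ^+ 2]
    covers the squared weight l, [(p + q').+1%:R ^+ 2] the number of pairs (r, l), and [fact_bound]
    the passage from sets to tuples. *)
Definition chaos_bound (p q' : nat) : R :=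
  (8 ^ (p + q') * p.+1 * 2 ^ p)%:R * p.+1%:R ^+ 2 * (p + q').+1%:R ^+ 2 * fact_bound R p q'.

Lemma chaos_bound_ge0 p q' : 0 <= chaos_bound p q'.
Proof. by rewrite !mulr_ge0 ?(ltW (fact_bound_gt0 _ _ _)). Qed.

Lemma double_sum_le m (P : nat -> nat -> bool) (w : nat -> nat -> R) (b : R) (c : nat) :
  (m < c)%N -> 0 <= b ->
  (forall r l, (r <= m)%N -> (l <= r)%N -> P r l -> w r l <= b) ->
  \sum_(r < m.+1) \sum_(l < r.+1 | P r l) w r l <= c%:R ^+ 2 * b.
Proof.
move=> mc b0 H; apply: (@le_trans _ _ (\sum_(r < m.+1) (c%:R * b))).
  apply: ler_sum => r _; apply: (@le_trans _ _ (\sum_(l < r.+1) b)).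
    rewrite big_mkcond; apply: ler_sum => l _; case: ifPn => // Prl.
    by apply: H => //; rewrite -ltnS.
  rewrite sumr_const card_ord -[leLHS]mulr_natl ler_wpM2r// ler_nat.
  by have := ltn_ord r; lia.
rewrite sumr_const card_ord -[leLHS]mulr_natl expr2 -mulrA ler_wpM2r ?mulr_ge0//.
by rewrite ler_nat.
Qed.

Lemma carre_le (i j : 'I_k) : (i <= j)%N ->
  E (fun n => (carre lam (a i) (a j) n - E (carre lam (a i) (a j))) ^+ 2) <=
  chaos_bound (q i) (q j) * V.
Proof.
move=> ij; have qij : (q i <= q j)%N.
  by case: ltngtP ij => [/q_incr/ltnW||/val_inj ->].
apply: le_trans (carre_variance lam_ge0 pfE (@ha i) (@ha j)) _.
rewrite /chaos_bound; set A : R := _%:R; set fb := fact_bound _ _ _.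
have -> : A * (q i).+1%:R ^+ 2 * (q i + q j).+1%:R ^+ 2 * fb * V =
  A * ((q i).+1%:R ^+ 2 * ((q i + q j).+1%:R ^+ 2 * (fb * V))) by ring.
rewrite -[leLHS]mulrA ler_wpM2l//; apply: ler_pM; first exact: sqr_ge0.
- by do 2 (apply: sumr_ge0 => ? _); exact: setstar_ge0.
- by rewrite lerXn2r ?nnegrE// ler_nat.
have f0 := ltW (fact_bound_gt0 R (q i) (q j)).
rewrite (minn_idPl qij); apply: (double_sum_le
  (P := fun r l => (0 < l)%N && ~~ [&& q i == q j, q j == r & r == l])
  (w := fun r l => setstar lam (q i) (q j) r l (a i) (a j))); first by lia.
  by rewrite mulr_ge0// energy_ge0.
move=> r l rq lr /andP[l0 nt].
apply: le_trans (setstar_le_dstar lam_ge0 (sG i) (sG j) lr rq (leq_trans rq qij)) _.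
rewrite ler_wpM2l//; case: (ltngtP i j) ij => // [ij _|/val_inj eij _].
  exact: energy_cross.
by move: nt; rewrite -eij eqxx /=; exact: energy_self.
Qed.

Lemma carreC b b' n : carre lam b b' n = carre lam b' b n.
Proof. by apply: eq_bigr => i _; rewrite [X in _ * X]mulrC. Qed.

(** The scalar product of the gradient of F with that of minus the inverse generator applied to F.
    Its mean is the second moment ([pf_gamma]), and its fluctuations measure the distance to
    normality. *)
Definition gamma n : R :=
  \sum_i lam i * (chaos lam (remove_kernel i (inverse_L alpha)) n * chaos lam (remove_kernel i alpha) n).

Lemma tame_carre b b' : tame (carre lam b b').
Proof. by apply: tame_sum => i _; apply: tame_scale; apply: tame_mul; exact: tame_chaos. Qed.

Lemma gammaE n : gamma n = \sum_i \sum_j (q i)%:R^-1 * carre lam (a i) (a j) n.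
Proof.
transitivity (\sum_t lam t * ((\sum_i (q i)%:R^-1 * chaos lam (remove_kernel t (a i)) n) *
    (\sum_j chaos lam (remove_kernel t (a j)) n))).
  apply: eq_bigr => t _; congr (_ * (_ * _)).
    under [RHS]eq_bigr do rewrite mulr_sumr.
    rewrite /chaos exchange_big; apply: eq_bigr => S _ /=.
    under eq_bigr do rewrite mulrA; rewrite -mulr_suml; congr (_ * _).
    rewrite /remove_kernel; case: ifPn => tS; first by rewrite big1// => i _; rewrite mulr0.
    rewrite /inverse_L mulr_suml; apply: eq_bigr => i _.
    by have [->|/ha ->] := eqVneq #|t |: S| (q i); rewrite ?mul0r ?mulr0// mulrC.
  rewrite -chaos_sum; apply: eq_chaos => S; rewrite /remove_kernel.
  by case: ifP => // _; rewrite big1.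
rewrite /carre; under [RHS]eq_bigr do under eq_bigr do rewrite mulr_sumr.
under [RHS]eq_bigr do rewrite exchange_big /=.
rewrite [RHS]exchange_big; apply: eq_bigr => t _ /=.
rewrite big_distrlr mulr_sumr; apply: eq_bigr => i _; rewrite mulr_sumr.
by apply: eq_bigr => j _ /=; ring.
Qed.

Lemma tame_gamma : tame gamma.
Proof.
apply: tame_ext (fun n => esym (gammaE n)); apply: tame_sum => i _; apply: tame_sum => j _.
by apply: tame_scale; exact: tame_carre.
Qed.

Lemma pf_gamma : E gamma = E (fun n => F n ^+ 2).
Proof.
rewrite [RHS](pf_ext pfE (h := fun n => chaos lam alpha n * chaos lam alpha n)); last first.
- by move=> n; rewrite total_sumE expr2.
- exact/tame_exp/tame_total.
rewrite (pf_chaos_ibp pfE alpha0) ?(pf_sum pfE) => [|i _|]; last exact: tame_chaos.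
  apply: eq_bigr => i _; rewrite (pf_scale pfE); last by apply: tame_mul; exact: tame_chaos.
  congr (_ * _); apply: (pf_ext pfE) => [|n]; first by apply: tame_mul; exact: tame_chaos.
  by rewrite chaos_diff.
by apply: tame_scale; apply: tame_mul; exact: tame_chaos.
Qed.

Definition gamma_bound : R := k%:R ^+ 2 *
  \sum_i \sum_j (chaos_bound (q i) (q j) + chaos_bound (q j) (q i)).

Lemma gamma_variance :
  E (fun n => (E (fun n => F n ^+ 2) - gamma n) ^+ 2) <= gamma_bound * V.
Proof.
rewrite -pf_gamma; pose W i j n := carre lam (a i) (a j) n - E (carre lam (a i) (a j)).
have tW i j : tame (W i j) by apply: tame_sub (tame_carre _ _) (tame_cst _ _).
have qi1 i : (q i)%:R^-1 <= 1 :> R by rewrite invf_le1 ?ltr0n// ler1n.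
have qi0 i : 0 <= (q i)%:R^-1 :> R by rewrite invr_ge0.
have tW2 i j : tame (fun n => W i j n ^+ 2) by exact: tame_exp.
apply: (@le_trans _ _ (E (fun n => k%:R ^+ 2 * \sum_i \sum_j W i j n ^+ 2))).
  apply: (pf_mono pfE).
  - by apply: tame_exp; apply: tame_sub (tame_cst _ _) tame_gamma.
  - by apply: tame_scale; do 2 (apply: tame_sum => ? _).
  move=> n; rewrite -sqrrN opprB.
  have -> : gamma n - E gamma = \sum_(x : 'I_k * 'I_k) (q x.1)%:R^-1 * W x.1 x.2 n.
    rewrite gammaE (pf_ext pfE tame_gamma gammaE) (pf_sum pfE) => [|i _]; last first.
      by apply: tame_sum => j _; apply: tame_scale; exact: tame_carre.
    rewrite -sumrB.
    rewrite -(pair_bigA _ (fun i j => (q i)%:R^-1 * W i j n)) /=; apply: eq_bigr => i _.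
    rewrite (pf_sum pfE) => [|j _]; last by apply: tame_scale; exact: tame_carre.
    by rewrite -sumrB; apply: eq_bigr => j _; rewrite (pf_scale pfE) ?mulrBr//; exact: tame_carre.
  apply: le_trans (sqr_sum_le _ _) _.
  rewrite card_prod card_ord natrM -expr2 ler_wpM2l ?sqr_ge0// pair_bigA /=.
  apply: ler_sum => x _; rewrite exprMn ler_piMl ?sqr_ge0//.
  by rewrite exprn_ile1.
rewrite (pf_scale pfE); last by do 2 (apply: tame_sum => ? _).
rewrite /gamma_bound -mulrA ler_wpM2l ?sqr_ge0// (pf_sum pfE) => [|i _]; last first.
  by apply: tame_sum.
rewrite mulr_suml; apply: ler_sum => i _; rewrite (pf_sum pfE)// mulr_suml.
apply: ler_sum => j _; rewrite mulrDl; have V0 := energy_ge0.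
have cb0 p q' := mulr_ge0 (chaos_bound_ge0 p q') V0.
case: (leqP i j) => [/carre_le H|/ltnW/carre_le H]; first by rewrite (le_trans H)// lerDl.
apply: (@le_trans _ _ (chaos_bound (q j) (q i) * V)); last by rewrite lerDr.
apply: le_trans H; rewrite le_eqVlt; apply/orP; left; apply/eqP.
apply: (pf_ext pfE) => [|n]; first exact: tW2.
by rewrite /W carreC (pf_ext pfE (tame_carre _ _) (carreC (a i) (a j))).
Qed.

Lemma chaos_fourth_dstar p H : symmetric_kernel p H ->
  E (fun n => chaos lam (set_kernel p H) n ^+ 4) <= (8 ^ (p + p) * p.+1 * 2 ^ p)%:R *
  fact_bound R p p * \sum_(r < p.+1) \sum_(l < r.+1) dstar lam p p H H r l.
Proof.
move=> sH; apply: le_trans (chaos_fourth lam_ge0 pfE (@set_kernel_homogeneous _ _ p H)) _.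
rewrite -mulrA ler_wpM2l// mulr_sumr; apply: ler_sum => r _; rewrite mulr_sumr.
apply: ler_sum => l _; apply: setstar_le_dstar => //; rewrite -ltnS; exact: ltn_ord.
Qed.

Lemma total_fourth : E (fun n => F n ^+ 4) <= k%:R ^+ 3 *
  \sum_i ((8 ^ (q i + q i) * (q i).+1 * 2 ^ (q i))%:R * fact_bound R (q i) (q i) *
    \sum_(r < (q i).+1) \sum_(l < r.+1) dstar lam (q i) (q i) (G i) (G i) r l).
Proof.
have tc i : tame (fun n => chaos lam (a i) n ^+ 4) by apply: tame_exp; exact: tame_chaos.
apply: (@le_trans _ _ (E (fun n => k%:R ^+ 3 * \sum_i chaos lam (a i) n ^+ 4))).
  apply: (pf_mono pfE); first exact/tame_exp/tame_total.
    by apply: tame_scale; exact: tame_sum.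
  move=> n; rewrite total_sumE chaos_sum; have := pow4_sum_le (fun i => chaos lam (a i) n).
  by rewrite card_ord.
rewrite (pf_scale pfE); last exact: tame_sum.
rewrite ler_wpM2l ?exprn_ge0// (pf_sum pfE)//; apply: ler_sum => i _.
exact: chaos_fourth_dstar.
Qed.

Definition difference_bound : R := k%:R ^+ 3 * \sum_i chaos_bound (q i) (q i) * (q i)%:R ^+ 4.

(** The difference at t of the chaos of order p + 1 is a chaos of order p with kernel
    [p.+1%:R * G i (t :: x)]. Its fourth moment is bounded by its contractions, and [dstar_cons]
    sums these over t into contractions of [G i] with indices r + 1 and l <= r, never total;
    [energy_no_integration] takes care of l = 0. *)
Lemma difference_fourth :
  \sum_t lam t * E (fun n => chaos lam (remove_kernel t alpha) n ^+ 4) <= difference_bound * V.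
Proof.
have tc t i : tame (fun n => chaos lam (remove_kernel t (a i)) n ^+ 4).
  by apply: tame_exp; exact: tame_chaos.
have V0 := energy_ge0.
apply: (@le_trans _ _ (\sum_t lam t * (k%:R ^+ 3 * \sum_i E (fun n => chaos lam (remove_kernel t (a i)) n ^+ 4)))).
  apply: ler_sum => t _; rewrite ler_wpM2l// -(pf_sum pfE)// -(pf_scale pfE); last exact: tame_sum.
  apply: (pf_mono pfE); first by apply: tame_exp; exact: tame_chaos.
    by apply: tame_scale; exact: tame_sum.
  move=> n; rewrite (@eq_chaos _ (fun S => \sum_i remove_kernel t (a i) S)); last first.
    by move=> S; rewrite /remove_kernel; case: ifP => // _; rewrite big1.
  rewrite chaos_sum; have := pow4_sum_le (fun i => chaos lam (remove_kernel t (a i)) n).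
  by rewrite card_ord.
under eq_bigr do rewrite mulrCA; rewrite -mulr_sumr /difference_bound -mulrA.
rewrite ler_wpM2l ?exprn_ge0// mulr_suml; under eq_bigr do rewrite mulr_sumr.
rewrite exchange_big; apply: ler_sum => i _ /=.
case qi: (q i) (q_gt0 i) (sG i) => [//|p] _ sGi.
have f0 := ltW (fact_bound_gt0 R p p).
apply: (@le_trans _ _ (\sum_t lam t * ((8 ^ (p + p) * p.+1 * 2 ^ p)%:R * fact_bound R p p *
   \sum_(r < p.+1) \sum_(l < r.+1) dstar lam p p (fun x => p.+1%:R * G i (t :: x))
     (fun x => p.+1%:R * G i (t :: x)) r l))).
  apply: ler_sum => t _; rewrite ler_wpM2l//.
  apply: le_trans (chaos_fourth_dstar (cons_symmetric_kernel t _ sGi)).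
  rewrite le_eqVlt; apply/orP; left; apply/eqP; apply: (pf_ext pfE) => // n.
  by congr (_ ^+ 4); apply: eq_chaos => S; rewrite /a qi remove_set_kernel.
under eq_bigr do rewrite mulrCA; rewrite -mulr_sumr /chaos_bound.
have step : \sum_t lam t * (\sum_(r < p.+1) \sum_(l < r.+1)
     dstar lam p p (fun x => p.+1%:R * G i (t :: x)) (fun x => p.+1%:R * G i (t :: x)) r l) <=
     p.+1%:R ^+ 2 * (p.+1%:R ^+ 4 * V).
  under eq_bigr do rewrite mulr_sumr; rewrite exchange_big /=.
  under eq_bigr do under eq_bigr do rewrite mulr_sumr.
  under eq_bigr do rewrite exchange_big /=.
  apply: (@double_sum_le p (fun _ _ => true) (fun r l => \sum_t lam t * dstar lam p p
    (fun x => p.+1%:R * G i (t :: x)) (fun x => p.+1%:R * G i (t :: x)) r l) _ p.+1) => //.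
    by rewrite mulr_ge0 ?exprn_ge0.
  move=> r l rp lr _; rewrite dstar_cons// ler_wpM2l ?exprn_ge0//.
  case: (posnP l) => [->|l0]; first by have := @energy_no_integration i r.+1; rewrite qi; exact.
  by have := @energy_self i r.+1 l; rewrite qi; apply => //; [exact: leqW|lia].
apply: (@le_trans _ _ ((8 ^ (p + p) * p.+1 * 2 ^ p)%:R * fact_bound R p p *
  (p.+1%:R ^+ 2 * (p.+1%:R ^+ 4 * V)))).
  by rewrite ler_wpM2l// mulr_ge0.
set A : R := _%:R; set fb := fact_bound _ _ _.
rewrite (_ : A * fb * (p.+1%:R ^+ 2 * (p.+1%:R ^+ 4 * V)) =
  A * p.+1%:R ^+ 2 * 1 * fb * (p.+1%:R ^+ 4 * V)); last by ring.
rewrite -[leRHS]mulrA ler_wpM2r ?mulr_ge0 ?exprn_ge0//.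
have fm : fb <= fact_bound R p.+1 p.+1.
  by rewrite lerXn2r ?nnegrE// ler_nat leq_mul// leq_fact.
have A0 : 0 <= A by rewrite /A.
have p0 : 0 <= p.+1%:R ^+ 2 :> R by exact: sqr_ge0.
apply: ler_pM => //; first by rewrite !mulr_ge0.
apply: ler_pM => //; [by rewrite mulr_ge0| |by rewrite exprn_ege1// ler1n].
apply: ler_pM => //; last by rewrite lerXn2r ?nnegrE// ler_nat.
by rewrite ler_nat !leq_mul// leq_exp2l//; lia.
Qed.

(* Kernels with all star contractions nonnegative: no cancellation can occur in
   the Charlier coefficients of the square. *)
Lemma energy_le_cumulant (i j : 'I_k) (r l : nat) :
  (forall i x, 0 <= G i x) ->
  (0 < r)%N -> (r <= q i)%N -> (r <= q j)%N -> (l <= r)%N ->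
  ~~ [&& q i == q j, q j == r & r == l] ->
  dstar lam (q i) (q j) (G i) (G j) r l <= fact_bound R (q i) (q j) *
    (E (fun n => F n ^+ 4) - 3 * (E (fun n => F n ^+ 2)) ^+ 2).
Proof.
move=> G0 r0 ri rj lr nt.
have a0 i' S : 0 <= a i' S by rewrite /a /set_kernel; case: ifP => // _; rewrite mulr_ge0.
apply: le_trans (dstar_le_setstar lam_ge0 (sG i) (sG j) lr ri rj) _.
rewrite ler_wpM2l ?(ltW (fact_bound_gt0 _ _ _))//.
have ale i' S : a i' S <= alpha S by rewrite /alpha (bigD1 i')//= lerDl sumr_ge0.
have al0 S : 0 <= alpha S by exact: sumr_ge0.
have := fourth_cumulant_ge lam_ge0 al0 alpha0 (a0 i) (a0 j) (ale i) (ale j) r0 ri rj lr nt pfE.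
suff EE m : E (fun n => F n ^+ m) = E (fun n => chaos lam alpha n ^+ m) by rewrite !EE.
by apply: (pf_ext pfE) => [|n]; [exact/tame_exp/tame_total|rewrite total_sumE].
Qed.

End kernel_family.

(** * Stein's method for a polynomial in Poisson counts *)

Section stein_bound.
Variables (R : rcfType) (k : nat) (q : 'I_k -> nat).
Hypothesis q_gt0 : forall i, (0 < q i)%N.
Hypothesis q_incr : forall i j : 'I_k, (i < j)%N -> (q i < q j)%N.
Variables (T : finType) (lam : T -> R) (G : 'I_k -> seq T -> R).
Hypothesis lam_ge0 : forall t, 0 <= lam t.
Hypothesis sG : forall i, symmetric_kernel (q i) (G i).
Variable E : (config T -> R) -> R.
Hypothesis pfE : poisson_functional lam E.
Let F := total_sum lam q G.
Let s2 := E (fun n => F n ^+ 2).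
Let alpha S := \sum_i set_kernel (q i) (G i) S.

(** Integration by parts turns the mean of [F n * psi (F n)] into that of [gamma] times
    [psi' (F n)], plus a second order Taylor remainder, the chain rule being only approximate for
    differences. The first part is bounded by the standard deviation of [gamma], the second by
    Cauchy-Schwarz between the square of one gradient and the fourth power of the other. *)
Lemma total_stein (psi psi' : R -> R) (c1 c2 : R) :
  (forall x, `|psi' x| <= c1) -> (forall x y, `|psi x - psi y| <= c1 * `|x - y|) ->
  (forall x y, `|psi y - psi x - psi' x * (y - x)| <= c2 * (y - x) ^+ 2) ->
  `|E (fun n => s2 * psi' (F n) - F n * psi (F n))| <=
  c1 * Num.sqrt (gamma_bound R q * energy lam q G) +
  c2 * (Num.sqrt s2 * Num.sqrt (difference_bound R q * energy lam q G)).
Proof.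
move=> psi'1 psi1 psi2.
have c10 : 0 <= c1 by apply: le_trans (psi'1 0).
have c20 : 0 <= c2 by have := le_trans (normr_ge0 _) (psi2 0 1); rewrite subr0 expr1n mulr1.
have FE n : F n = chaos lam alpha n by exact: total_sumE.
have tF : tame F by exact: tame_total.
have tps : tame (fun n => psi (F n)).
  apply: (@tame_le _ _ _ (fun n => `|psi 0| + c1 * `|F n|)).
    by apply: tame_add (tame_cst _ _) _; apply: tame_scale; exact: tame_norm.
  move=> n; rewrite [leRHS]ger0_norm ?addr_ge0 ?mulr_ge0//.
  rewrite -[psi (F n)](subrK (psi 0)) addrC; apply: le_trans (ler_normD _ _) _.
  by rewrite lerD2l (le_trans (psi1 _ _))// subr0.
have tps' : tame (fun n => psi' (F n)).
  by apply: (@tame_le _ _ _ (fun=> c1)) (tame_cst _ _) _ => n; rewrite [leRHS]ger0_norm.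
pose g := gamma q lam G; have tg : tame g by exact: tame_gamma.
pose dG t n := chaos lam (remove_kernel t (inverse_L alpha)) n.
pose dF t n := chaos lam (remove_kernel t alpha) n.
pose rem t n := psi (F (add_point t n)) - psi (F n) - psi' (F n) * dF t n.
have tdG t : tame (dG t) by exact: tame_chaos.
have tdF t : tame (dF t) by exact: tame_chaos.
have tD t : tame (fun n => psi (F (add_point t n)) - psi (F n)).
  by apply: tame_sub => //; exact: (tame_add_point t tps).
have trem t : tame (rem t) by apply: tame_sub (tD t) _; exact: tame_mul.
have remE t n : `|rem t n| <= c2 * dF t n ^+ 2.
  rewrite /rem (_ : dF t n = F (add_point t n) - F n); last by rewrite !FE chaos_diff.
  exact: psi2.
have ibp : E (fun n => F n * psi (F n)) =
    E (fun n => g n * psi' (F n)) + \sum_t lam t * E (fun n => dG t n * rem t n).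
  rewrite (pf_ext pfE (h := fun n => chaos lam alpha n * psi (F n))); last 2 first.
  - exact: tame_mul.
  - by move=> n; rewrite FE.
  rewrite (pf_chaos_ibp pfE _ tps); last exact: alpha0.
  have tt t : tame (fun n => dG t n * dF t n * psi' (F n)).
    by apply: tame_mul => //; exact: tame_mul.
  rewrite [X in X + _](pf_ext pfE (h := fun n => \sum_t lam t * (dG t n * dF t n * psi' (F n)))); last 2 first.
  - exact: tame_mul.
  - by move=> n; rewrite /g /gamma mulr_suml; apply: eq_bigr => t _; rewrite -mulrA.
  rewrite (pf_sum pfE) => [|t _]; last exact: tame_scale.
  rewrite -big_split; apply: eq_bigr => t _ /=; rewrite (pf_scale pfE)// -mulrDr.
  congr (_ * _); rewrite -(pf_add pfE)//; last exact: tame_mul.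
  apply: (pf_ext pfE); first exact: tame_mul (tdG t) (tD t).
  by move=> n; rewrite /rem /dG; ring.
have tsp : tame (fun n => s2 * psi' (F n)) by exact: tame_scale.
have tgp : tame (fun n => g n * psi' (F n)) by exact: tame_mul.
have -> : E (fun n => s2 * psi' (F n) - F n * psi (F n)) =
    E (fun n => (s2 - g n) * psi' (F n)) - \sum_t lam t * E (fun n => dG t n * rem t n).
  rewrite (pf_sub pfE)// ?ibp; last exact: tame_mul.
  rewrite opprD addrA; congr (_ - _); rewrite -(pf_sub pfE)//; apply: (pf_ext pfE).
    exact: tame_sub.
  by move=> n; ring.
have tsg : tame (fun n => s2 - g n) by apply: tame_sub (tame_cst _ _) tg.
apply: le_trans (ler_normB _ _) _; rewrite lerD//.
  apply: le_trans (pf_norm pfE _) _; first exact: tame_mul.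
  apply: (@le_trans _ _ (c1 * E (fun n => `|s2 - g n|))).
    rewrite -(pf_scale pfE); last exact: tame_norm.
    apply: (pf_mono pfE); first by apply: tame_norm; exact: tame_mul.
      by apply: tame_scale; exact: tame_norm.
    by move=> n; rewrite normrM mulrC ler_wpM2r.
  rewrite ler_wpM2l// -[leLHS]ger0_norm; last first.
    by apply: (pf_ge0 pfE); first exact: tame_norm.
  rewrite -sqrtr_sqr ler_wsqrtr//; apply: le_trans (gamma_variance q_gt0 q_incr lam_ge0 sG pfE).
  have := pf_cauchy_schwarz pfE (I := unit) (w := fun=> 1) (g := fun _ n => `|s2 - g n|)
    (h := fun _ _ => 1) (fun _ => ler01) (fun _ => tame_norm tsg) (fun _ => tame_cst _ _).
  rewrite !big_const !card_unit /= !addr0 !mul1r.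
  rewrite (pf_ext pfE (g := fun n => 1 ^+ 2) (h := fun=> 1)) ?(pf_one pfE) ?mulr1 => [H||n]; last 2 first.
  - exact: tame_exp (tame_cst _ _).
  - by rewrite expr1n.
  apply: le_trans (le_trans _ H) _.
    rewrite (pf_ext pfE (g := fun n => `|s2 - g n| * 1) (h := fun n => `|s2 - g n|))// => [|n].
      by apply: tame_mul (tame_norm _) (tame_cst _ _).
    by rewrite mulr1.
  rewrite le_eqVlt; apply/orP; left; apply/eqP; apply: (pf_ext pfE) => [|n].
    by apply: tame_exp; exact: tame_norm.
  by rewrite real_normK ?num_real.
have tdF2 t : tame (fun n => dF t n ^+ 2) by exact: tame_exp.
apply: (@le_trans _ _ (c2 * \sum_t lam t * E (fun n => `|dG t n| * dF t n ^+ 2))).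
  apply: le_trans (ler_norm_sum _ _ _) _; rewrite mulr_sumr; apply: ler_sum => t _.
  rewrite normrM ger0_norm// mulrCA ler_wpM2l//.
  apply: le_trans (pf_norm pfE _) _; first exact: tame_mul.
  rewrite -(pf_scale pfE); last by apply: tame_mul => //; exact: tame_norm.
  apply: (pf_mono pfE); first by apply: tame_norm; exact: tame_mul.
    by apply: tame_scale; apply: tame_mul => //; exact: tame_norm.
  by move=> n; rewrite normrM mulrCA ler_wpM2l.
rewrite ler_wpM2l// -sqrtrM; last by apply: (pf_ge0 pfE) => [|n]; [exact: tame_exp|exact: sqr_ge0].
set X := (X in X <= _); have X0 : 0 <= X.
  apply: sumr_ge0 => t _; rewrite mulr_ge0//; apply: (pf_ge0 pfE) => [|n].
    by apply: tame_mul => //; exact: tame_norm.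
  by rewrite mulr_ge0 ?sqr_ge0.
rewrite -[X]ger0_norm// -sqrtr_sqr ler_wsqrtr//.
apply: le_trans (pf_cauchy_schwarz pfE lam_ge0 (fun t => tame_norm (tdG t)) tdF2) _.
have E0 t (h : config T -> R) : tame h -> 0 <= lam t * E (fun n => h n ^+ 2).
  by move=> th; rewrite mulr_ge0//; apply: (pf_ge0 pfE) => [|n]; [exact: tame_exp|exact: sqr_ge0].
apply: ler_pM.
- by apply: sumr_ge0 => t _; apply: E0; exact: tame_norm.
- by apply: sumr_ge0 => t _; apply: (E0 _ (fun n => dF t n ^+ 2)).
(* Integration by parts backwards: the squared norm of the gradient of [inverse_L alpha] is the mean
   of the product of both chaoses, at most the second moment because every degree that occurs is at
   least 1. *)
- apply: (@le_trans _ _ (E (fun n => chaos lam alpha n * chaos lam (inverse_L alpha) n))).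
    rewrite (pf_chaos_ibp pfE) ?le_eqVlt; [|exact: alpha0|exact: tame_chaos].
    apply/orP; left; apply/eqP; apply: eq_bigr => t _; congr (_ * _).
    apply: (pf_ext pfE) => [|n]; first by apply: tame_exp; exact: tame_norm.
    by rewrite chaos_diff real_normK ?num_real// expr2.
  rewrite (pf_chaosM pfE) /s2 (pf_ext pfE (h := fun n => chaos lam alpha n * chaos lam alpha n)).
  + rewrite (pf_chaosM pfE); apply: ler_sum => S _; rewrite ler_wpM2l ?lamS_ge0//.
    rewrite /inverse_L mulrA ler_piMr -?expr2 ?sqr_ge0//.
    case: #|S| => [|m]; first by rewrite invr0.
    by rewrite invf_le1 ?ltr0n// ler1n.
  + exact: tame_exp.
  + by move=> n; rewrite FE expr2.
- apply: le_trans (_ : _ <= _) (difference_fourth q_gt0 lam_ge0 sG pfE).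
  apply: ler_sum => t _; rewrite ler_wpM2l// le_eqVlt; apply/orP; left; apply/eqP.
  apply: (pf_ext pfE) => [|n]; first exact: (tame_exp 2 (tdF2 t)).
  by rewrite -exprM.
Qed.

End stein_bound.


From mathcomp Require Import perm.
From mathcomp Require Import all_classical all_reals all_analysis measurable_realfun.
Import numFieldNormedType.Exports.
Local Open Scope classical_set_scope.
Local Open Scope ring_scope.
Local Open Scope ereal_scope.

(** * Gaussian means and the Stein equation *)

Section density.
Context {d} {T : measurableType d} {R : realType}.
Variables (mu nu : {measure set T -> \bar R}) (g : T -> R).
Hypotheses (g0 : forall x, (0 <= g x)%R) (mg : measurable_fun setT g).
Hypothesis nuE : forall A, measurable A -> nu A = \int[mu]_(x in A) (g x)%:E.

Import HBNNSimple.

Lemma integral_density_nnsfun (f : {nnsfun T >-> R}) :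
  \int[nu]_x (f x)%:E = \int[mu]_x ((f x)%:E * (g x)%:E).
Proof.
under [LHS]eq_integral do rewrite fimfunE -fsumEFin//.
rewrite [LHS]ge0_integral_fsum//; last 2 first.
  - by move=> r; exact/measurable_EFinP/measurableT_comp.
  - by move=> n x _; rewrite EFinM nnfun_muleindic_ge0.
under [RHS]eq_integral.
  move=> x xD; rewrite fimfunE -fsumEFin// muleC ge0_mule_fsumr; last first.
    by move=> r; rewrite EFinM nnfun_muleindic_ge0.
  over.
rewrite [RHS]ge0_integral_fsum//; last 2 first.
  - move=> r; apply: emeasurable_funM; first exact/measurable_EFinP.
    exact/measurable_EFinP/measurableT_comp.
  - move=> n x _; apply: mule_ge0; [by rewrite lee_fin|by rewrite EFinM nnfun_muleindic_ge0].
apply: eq_fsbigr => r _.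
under [RHS]eq_integral do rewrite EFinM muleCA.
rewrite integralZl_indic_nnsfun// integral_indic// setIT nuE//.
have [r0|r0] := ltP r 0%R.
  rewrite (_ : f @^-1` [set r] = set0); last first.
    apply/seteqP; split => // x /= fxr; suff : (0 <= f x)%R by rewrite fxr leNgt r0.
    exact: fun_ge0.
  by rewrite integral_set0 mule0 integral0_eq// => x _; rewrite indicE in_set0 mule0 mule0.
rewrite ge0_integralZl//; last 2 first.
  - by apply: emeasurable_funM; apply/measurable_EFinP.
  - by move=> x _; rewrite mule_ge0 ?lee_fin.
rewrite [in LHS]integral_mkcond; congr (_ * _); apply: eq_integral => x _.
by rewrite patchE indicE; case: ifP => _; rewrite ?mule1 ?mule0.
Qed.

Lemma ge0_integral_density (f : T -> R) :
  measurable_fun setT f -> (forall x, (0 <= f x)%R) ->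
  \int[nu]_x (f x)%:E = \int[mu]_x (f x * g x)%:E.
Proof.
move=> mf f0; have mF : measurable_fun setT (EFin \o f) by exact/measurable_EFinP.
pose f_ := nnsfun_approx measurableT mF.
transitivity (lim (\int[nu]_x (f_ n x)%:E @[n --> \oo])).
  rewrite -monotone_convergence//=.
  - by apply: eq_integral => ? _; apply/esym/cvg_lim => //=; apply: cvg_nnsfun_approx => // y _; rewrite /= lee_fin.
  - by move=> n; exact/measurable_EFinP/measurable_funTS.
  - by move=> n ? _; rewrite lee_fin.
  - by move=> ? _ ? ? mn; rewrite lee_fin; exact/lefP/nd_nnsfun_approx.
under eq_fun do rewrite integral_density_nnsfun.
rewrite -monotone_convergence//=.
- apply: eq_integral => x _; rewrite EFinM; apply/cvg_lim => //.
  apply: cvgeZr => //; apply: cvg_nnsfun_approx => // y _; by rewrite /= lee_fin.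
- by move=> n; apply: emeasurable_funM; exact/measurable_EFinP.
- by move=> n x _; rewrite mule_ge0 ?lee_fin.
- by move=> x _ m n mn; rewrite lee_wpmul2r ?lee_fin//; exact/lefP/nd_nnsfun_approx.
Qed.

End density.

Section standard_gaussian.
Context {R : realType}.
Notation mu := (@lebesgue_measure R).
Local Open Scope ring_scope.

Definition gpdf (x : R) : R := normal_pdf 0 1 x.

Lemma gpdfE x : gpdf x = normal_peak 1 * expR (- x ^+ 2 / 2).
Proof. by rewrite /gpdf normal_pdfE ?oner_neq0// /normal_fun subr0 expr1n. Qed.

Lemma gpdf_gt0 x : 0 < gpdf x.
Proof. by rewrite gpdfE mulr_gt0 ?expR_gt0// normal_peak_gt0 ?oner_neq0. Qed.

Lemma gpdf_ge0 x : 0 <= gpdf x. Proof. exact/ltW/gpdf_gt0. Qed.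

Lemma measurable_gpdf : measurable_fun setT gpdf.
Proof. exact: measurable_normal_pdf. Qed.

Lemma continuous_gpdf : continuous gpdf.
Proof. by apply: continuous_normal_pdf; rewrite oner_neq0. Qed.

Lemma gpdfN x : gpdf (- x) = gpdf x. Proof. by rewrite !gpdfE sqrrN. Qed.

Lemma is_derive_gpdf (x : R) : is_derive x 1 gpdf (- x * gpdf x).
Proof.
rewrite gpdfE (_ : gpdf = (normal_peak 1 *: (fun x : R => expR (- x ^+ 2 / 2)))); last first.
  by apply/funext => y; rewrite gpdfE.
rewrite [X in is_derive _ _ _ X](_ : _ = normal_peak 1 *: ((- x) *: expR (- x ^+ 2 / 2))); last first.
  by rewrite /GRing.scale /=; ring.
apply: is_deriveZ; have H : is_derive x 1 (fun x : R => - x ^+ 2 / 2) (- x).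
  rewrite (_ : (fun _ => _) = (- 2^-1) *: (@id R ^+ 2)); last first.
    by apply/funext => y; rewrite -[RHS]/(- 2^-1 * y ^+ 2); field.
  by apply: is_derive_eq; rewrite /GRing.scale /=; field.
by have := is_derive1_comp (is_derive_expR _) H; rewrite mulrC.
Qed.

Lemma scaled_integral (s : R) (f : R -> R) : 0 < s -> continuous f -> (forall x, 0 <= f x) ->
  (\int[mu]_x (f x * normal_pdf 0 s x)%:E = \int[mu]_x (f (s * x) * gpdf x)%:E)%E.
Proof.
move=> s0 cf f0; have sn0 : s != 0 by rewrite gt_eqF.
have ds (x : R) : is_derive x 1 (fun x : R => s * x) s.
  by apply: is_derive_eq; rewrite /GRing.scale /= mulr1.
have d1 : derive1 (fun x : R => s * x) = cst s.
  by apply/funext => x; rewrite derive1E derive_val.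
rewrite (@increasing_ge0_integration_by_substitutionT _ (fun x => s * x)).
- apply: eq_integral => x _; rewrite /gpdf !normal_pdfE ?oner_neq0// d1.
  have pk : normal_peak s * s = normal_peak 1.
    rewrite /normal_peak expr1n mul1r -mulrnAr sqrtrM ?sqr_ge0// sqrtr_sqr gtr0_norm//.
    by rewrite invfM mulrAC mulVf// mul1r.
  have ex : normal_fun 0 s (s * x) = normal_fun 0 1 x.
    by rewrite /normal_fun !subr0 expr1n; congr expR; field.
  congr EFin; transitivity (f (s * x) * (normal_peak s * normal_fun 0 s (s * x)) * s) => //.
  by rewrite ex -pk; ring.
- by move=> x y xy; rewrite ltr_pM2l.
- by rewrite d1; exact: cst_continuous.
- by rewrite d1; exact: is_cvg_cst.
- by rewrite d1; exact: is_cvg_cst.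
- by move=> x; have [] := ds x.
- exact: gt0_cvgMrNy.
- exact: gt0_cvgMry.
- by move=> x; apply: cvgM; [exact: cf|exact: continuous_normal_pdf].
- by move=> x; rewrite mulr_ge0 ?normal_pdf_ge0.
Qed.

Lemma ge0_expectation_normal d (Omega : measurableType d) (P : probability Omega R)
    (N : {RV P >-> R}) (s : R) (f : R -> R) : 0 < s ->
  (forall A, measurable A -> distribution P N A = normal_prob 0 s A) ->
  continuous f -> (forall x, 0 <= f x) ->
  (\int[P]_w (f (N w))%:E = \int[mu]_x (f (s * x) * gpdf x)%:E)%E.
Proof.
move=> s0 NE cf f0; have mf : measurable_fun setT f by exact: continuous_measurable_fun.
have mN : measurable_fun setT (N : Omega -> measurableTypeR R) by exact: (@measurable_funPT _ _ _ _ N).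
(* The codomain is declared again as [measurableTypeR R], the type on which Lebesgue measure
   lives. *)
pose N' : {mfun Omega >-> measurableTypeR R} :=
  HB.pack (N : Omega -> measurableTypeR R) (isMeasurableFun.Build _ _ _ _ _ mN).
transitivity (\int[distribution P N']_y (f y)%:E)%E.
  rewrite (@ge0_integral_distribution _ _ _ _ _ P N' (EFin \o f))//.
  exact/measurable_EFinP.
transitivity (\int[mu]_x (f x * normal_pdf 0 s x)%:E)%E; last exact: scaled_integral.
apply: (@ge0_integral_density _ _ R mu (distribution P N') (normal_pdf 0 s)) => //.
- by move=> x; exact: normal_pdf_ge0.
- exact: measurable_normal_pdf.
Qed.

End standard_gaussian.

(** * Gaussian tails and moments *)

Section gaussian_tails.
Context {R : realType}.
Notation mu := (@lebesgue_measure R).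
Notation g := (@gpdf R).
Local Open Scope ring_scope.

Lemma cvg_pow_gpdf n : x ^+ n * g x @[x --> +oo] --> (0 : R).
Proof.
pose C : R := normal_peak 1 * (n.+1`!%:R * 2 ^+ n.+1).
have C0 : 0 <= C by rewrite mulr_ge0 ?normal_peak_ge0// mulr_ge0 ?exprn_ge0.
apply/cvgrPdist_le => e e0; near=> x.
have x1 : 1 <= x by near: x; exact: nbhs_pinfty_ge.
have x0 : 0 < x by rewrite (lt_le_trans _ x1).
have xC : C / e <= x by near: x; apply: nbhs_pinfty_ge; rewrite num_real.
rewrite sub0r normrN ger0_norm ?mulr_ge0 ?gpdf_ge0 ?exprn_ge0 ?(ltW x0)//.
have H : expR (- x ^+ 2 / 2) <= (n.+1`!%:R * 2 ^+ n.+1) / (x ^+ 2) ^+ n.+1.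
  rewrite mulNr expRN; have y0 : 0 <= x ^+ 2 / 2 by rewrite divr_ge0 ?sqr_ge0.
  have := expR_ge1Dxn n y0; rewrite expr_div_n => H.
  rewrite -[leRHS]invrK lef_pV2 ?posrE ?expR_gt0 ?invr_gt0 ?divr_gt0 ?mulr_gt0 ?exprn_gt0 ?ltr0n ?fact_gt0//.
  by apply: le_trans H; rewrite invf_div invfM mulrA mulrAC lerDr.
apply: (@le_trans _ _ (C / x)); last by rewrite ler_pdivrMr// mulrC -ler_pdivrMr.
rewrite gpdfE mulrCA /C -mulrA ler_wpM2l ?normal_peak_ge0//.
apply: le_trans (ler_wpM2l _ H) _; first by rewrite exprn_ge0// ltW.
rewrite mulrCA ler_wpM2l ?mulr_ge0 ?exprn_ge0//.
rewrite ler_pdivrMr ?exprn_gt0// -exprM (_ : (2 * n.+1 = (2 * n + 1).+1)%N); last by lia.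
by rewrite exprS mulKf ?gt_eqF// ler_weXn2l//; lia.
Unshelve. all: by end_near. Qed.

Lemma cvg_gpdf : g x @[x --> +oo] --> (0 : R).
Proof.
rewrite (_ : (fun x => g x) = (fun x => x ^+ 0 * g x)); first exact: cvg_pow_gpdf.
by apply/funext => x; rewrite expr0 mul1r.
Qed.

Lemma is_derive_continuous (f : R -> R) (x l : R) : is_derive x 1 f l -> {for x, continuous f}.
Proof. by move=> [df _]; apply/differentiable_continuous/derivable1_diffP. Qed.

Lemma FTC_tail (f F : R -> R) (a l : R) : (forall x, a <= x -> 0 <= f x) -> continuous f ->
  (forall x : R, is_derive x 1 F (f x)) -> F x @[x --> +oo] --> l ->
  (\int[mu]_(x in `[a, +oo[) (f x)%:E = (l - F a)%:E)%E.
Proof.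
move=> f0 cf dF Fl; rewrite (@ge0_continuous_FTC2y _ f F a l)//.
- exact: continuous_subspaceT.
- by apply: cvg_at_right_filter; apply: is_derive_continuous (dF a).
- by move=> x _; rewrite derive1E; have [_ ->] := dF x.
Qed.

Lemma continuousXgpdf n : continuous (fun x : R => x ^+ n * g x).
Proof. by move=> x; apply: cvgM; [exact: exprn_continuous|exact: continuous_gpdf]. Qed.

Lemma integral_tail_id (a : R) : 0 <= a -> (\int[mu]_(x in `[a, +oo[) (x * g x)%:E = (g a)%:E)%E.
Proof.
move=> a0; have dF (x : R) : is_derive x 1 (- g) (x * g x).
  by have dg := is_derive_gpdf x; apply: is_derive_eq; rewrite mulNr opprK.
have f0 x : a <= x -> 0 <= x * g x.
  by move=> ax; rewrite mulr_ge0 ?gpdf_ge0// (le_trans a0).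
have Fl : (- g) x @[x --> +oo] --> (0 : R) by rewrite -oppr0; apply: cvgN; exact: cvg_gpdf.
by have := FTC_tail f0 (@continuousXgpdf 1) dF Fl; rewrite sub0r opprK.
Qed.

Lemma cvg_mills : x / (1 + x ^+ 2) * g x @[x --> +oo] --> (0 : R).
Proof.
apply/cvgrPdist_le => e e0; near=> x.
have x1 : 1 <= x by near: x; exact: nbhs_pinfty_ge.
have gx : `|0 - g x| <= e by near: x; move: e e0; apply/cvgrPdist_le; exact: cvg_gpdf.
have p0 : 0 < 1 + x ^+ 2 :> R by rewrite ltr_pwDl// sqr_ge0.
have r1 : x / (1 + x ^+ 2) <= 1 by rewrite ler_pdivrMr// mul1r; nra.
have r0 : 0 <= x / (1 + x ^+ 2) by apply: divr_ge0; [lra|exact: ltW].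
move: gx; rewrite !sub0r !normrN ger0_norm ?gpdf_ge0 // ger0_norm; last exact: mulr_ge0 r0 (gpdf_ge0 x).
by move=> gx; apply: le_trans gx; rewrite ler_piMl ?gpdf_ge0.
Unshelve. all: by end_near. Qed.

(** The lower Mills bound: [- (x / (1 + x ^+ 2) * g x)] is a primitive of
    [(1 - 2 / (1 + x ^+ 2) ^+ 2) * g x], which is at most [g x]. From 1 on this integrand is
    nonnegative, as [FTC_tail] requires. *)
Lemma mills_ge (a : R) : 1 <= a ->
  ((a / (1 + a ^+ 2) * g a)%:E <= \int[mu]_(x in `[a, +oo[) (g x)%:E)%E.
Proof.
move=> a1; pose f x := (1 - 2 / (1 + x ^+ 2) ^+ 2) * g x.
have p0 x : 0 < 1 + x ^+ 2 :> R by rewrite ltr_pwDl// sqr_ge0.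
pose F x := - (x / (1 + x ^+ 2) * g x).
have dF (x : R) : is_derive x 1 F (f x).
  rewrite /F (_ : (fun _ => _) = - ((@id R * (fun y => (1 + y ^+ 2)^-1)) * g)) //.
  have d1 : is_derive x 1 (fun y : R => (1 + y ^+ 2)^-1) (- (1 + x ^+ 2) ^- 2 * (2 * x)).
    have d2 : is_derive x 1 (fun y : R => 1 + y ^+ 2) (2 * x).
      rewrite (_ : (fun _ => _) = cst 1 + (@id R ^+ 2)) //.
      by apply: is_derive_eq; rewrite /GRing.scale /=; ring.
    have n0 : 1 + x ^+ 2 != 0 by rewrite gt_eqF.
    split; first by apply: derivableV => //; case: d2.
    by case: d2 => dd <-; rewrite deriveV.
  have dg := is_derive_gpdf x.
  apply: is_derive_eq; rewrite /f /GRing.scale /= !fctE /=.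
  by have := gt_eqF (p0 x); move=> /negbT ?; field.
have cf : continuous f.
  move=> x; apply: cvgM; last exact: continuous_gpdf.
  apply: cvgB; first exact: cvg_cst.
  apply: cvgM; first exact: cvg_cst.
  apply: cvgV; first by rewrite expf_neq0// gt_eqF.
  apply: (cvg_comp _ (fun y : R => y ^+ 2)); last exact: exprn_continuous.
  by apply: cvgD; [exact: cvg_cst|exact: exprn_continuous].
have f0 x : a <= x -> 0 <= f x.
  move=> ax; rewrite mulr_ge0 ?gpdf_ge0// subr_ge0 ler_pdivrMr ?exprn_gt0// mul1r.
  by have := le_trans a1 ax => x1; nra.
have Fl : F x @[x --> +oo] --> (0 : R) by rewrite -oppr0; apply: cvgN; exact: cvg_mills.
have := FTC_tail f0 cf dF Fl; rewrite /F sub0r opprK => <-.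
apply: ge0_le_integral => //.
- by move=> x /= /[!in_itv]/= /andP[ax _]; rewrite lee_fin f0.
- by apply/measurable_EFinP/measurable_funTS; exact: continuous_measurable_fun.
- by apply/measurable_EFinP/measurable_funTS; exact: measurable_gpdf.
- move=> x _; rewrite lee_fin ler_piMl ?gpdf_ge0// gerBl divr_ge0//.
  by rewrite exprn_ge0// ltW.
Qed.

Lemma integral_gpdf : (\int[mu]_x (g x)%:E = 1)%E.
Proof. exact: integral_normal_pdf. Qed.

Lemma integral_even_gauss (f : R -> R) : continuous f -> (forall x, 0 <= f x) -> f =1 f \o -%R ->
  (\int[mu]_x (f x * g x)%:E = 2%:E * \int[mu]_(x in `[0%R, +oo[) (f x * g x)%:E)%E.
Proof.
move=> cf f0 fe; rewrite ge0_symfun_integralT.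
- by congr (_ * integral _ _ _)%E; apply/seteqP; split => x /=; rewrite in_itv/= andbT.
- by move=> x; rewrite mulr_ge0 ?gpdf_ge0.
- by move=> x; apply: cvgM; [exact: cf|exact: continuous_gpdf].
- by move=> x /=; rewrite gpdfN -[f (- x)]/((f \o -%R) x) -fe.
Qed.

Lemma integral_abs_gauss : (\int[mu]_x (`|x| * g x)%:E = (Num.sqrt (2 / pi))%:E)%E.
Proof.
have cn : continuous (fun x : R => `|x|) by exact: norm_continuous.
have H0 := integral_even_gauss cn (fun x => normr_ge0 x) (fun x => esym (normrN x)).
transitivity (2%:E * \int[mu]_(x in `[0%R, +oo[) (`|x| * g x)%:E)%E; first exact: H0.
transitivity (2%:E * \int[mu]_(x in `[0%R, +oo[) (x * g x)%:E)%E.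
  congr (_ * _)%E; apply: eq_integral => x; rewrite inE /= in_itv/= andbT => x0.
  by rewrite ger0_norm.
rewrite integral_tail_id// -EFinM; congr EFin.
rewrite gpdfE expr0n oppr0 mul0r expR0 mulr1 /normal_peak expr1n mul1r.
have p0 := @pi_gt0 R; rewrite -[pi *+ 2]mulr_natr.
have s0 : Num.sqrt (pi * 2) != 0 :> R by rewrite gt_eqF// sqrtr_gt0 mulr_gt0.
apply: (mulIf s0); rewrite divfK// -sqrtrM ?divr_ge0 ?(ltW p0)//.
rewrite (_ : 2 / pi * (pi * 2) = 2 ^+ 2); last by rewrite mulrA divfK ?expr2 ?(gt_eqF p0).
by rewrite sqrtr_sqr ger0_norm.
Qed.

Lemma integral_pow4_gauss : (\int[mu]_x (x ^+ 4 * g x)%:E = 3%:E)%E.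
Proof.
have m4 : continuous (fun x : R => x ^+ 4) by exact: exprn_continuous.
have p4 (x : R) : 0 <= x ^+ 4 by rewrite exprn_even_ge0.
have e4 : (fun x : R => x ^+ 4) =1 (fun x : R => x ^+ 4) \o -%R by move=> x /=; ring.
have H0 := integral_even_gauss m4 p4 e4.
transitivity (2%:E * \int[mu]_(x in `[0%R, +oo[) (x ^+ 4 * g x)%:E)%E; first exact: H0.
have half : (\int[mu]_(x in `[0%R, +oo[) (g x)%:E = (2^-1)%:E)%E.
  have c1 : continuous (fun _ : R => 1 : R) by exact: cst_continuous.
  have := integral_even_gauss c1 (fun=> ler01) (fun=> erefl).
  under eq_integral do rewrite mul1r; rewrite integral_gpdf.
  under eq_integral do rewrite mul1r.
  case: (\int[mu]_(x in _) _)%E => [r||]; last 2 first.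
  - by rewrite gt0_muley ?lte_fin// => /(congr1 (@fine R)) /= /eqP; rewrite oner_eq0.
  - by rewrite gt0_muleNy ?lte_fin// => /(congr1 (@fine R)) /= /eqP; rewrite oner_eq0.
  by rewrite -EFinM => -[] r2; congr EFin; lra.
(* [(x ^+ 4 - 3) * g x] has an explicit primitive but changes sign, while [FTC_tail] asks for a
   nonnegative integrand. Adding [K * expR (- x)], of integral K, repairs this:
   [3 * g x <= K * expR (- x)] amounts to (x - 1)^2 >= 0. *)
pose K : R := 3 * normal_peak 1 * expR 2^-1.
have K0 : 0 <= K by rewrite !mulr_ge0 ?normal_peak_ge0 ?expR_ge0.
pose f x := (x ^+ 4 - 3) * g x + K * expR (- x).
have ce : continuous (fun x : R => K * expR (- x)).
  move=> x; apply: cvgM; first exact: cvg_cst.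
  by apply: (cvg_comp (fun y : R => - y)); [apply: cvgN|exact: continuous_expR].
have cf : continuous f.
  move=> x; apply: cvgD; last exact: ce.
  by apply: cvgM; [apply: cvgB; [exact: exprn_continuous|exact: cvg_cst]|exact: continuous_gpdf].
have gK x : 3 * g x <= K * expR (- x).
  rewrite gpdfE mulrA /K -[leRHS]mulrA ler_wpM2l ?mulr_ge0 ?normal_peak_ge0//.
  by rewrite -expRD ler_expR; have := sqr_ge0 (x - 1); nra.
have f0 x : 0 <= f x.
  have := mulr_ge0 (p4 x) (gpdf_ge0 x); have := gK x; rewrite /f mulrBl; lra.
have de (x : R) : is_derive x 1 (fun y : R => - (K * expR (- y))) (K * expR (- x)).
  rewrite (_ : (fun _ => _) = (- K) *: (expR \o -%R)); last first.
    by apply/funext => y; rewrite -[RHS]/(- K * expR (- y)) mulNr.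
  have d1 : is_derive x 1 (expR \o -%R) (expR (- x) * - 1).
    by apply: is_derive1_comp.
  by apply: is_derive_eq; rewrite /GRing.scale /=; ring.
have el : - (K * expR (- x)) @[x --> +oo] --> (0 : R).
  rewrite -oppr0; apply: cvgN; rewrite -[X in _ --> X](mulr0 K).
  by apply: cvgM; [exact: cvg_cst|exact: cvgr_expR].
have I1 : (\int[mu]_(x in `[0%R, +oo[) (K * expR (- x))%:E = K%:E)%E.
  have e0 x : 0 <= x -> 0 <= K * expR (- x) by move=> _; rewrite mulr_ge0 ?expR_ge0.
  by have := FTC_tail e0 ce de el => ->; rewrite sub0r opprK oppr0 expR0 mulr1.
have I2 : (\int[mu]_(x in `[0%R, +oo[) (f x)%:E = K%:E)%E.
  pose F (x : R) := - (x ^+ 3 * g x + 3 * (x ^+ 1 * g x)) + - (K * expR (- x)).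
  have dF (x : R) : is_derive x 1 F (f x).
    apply: is_deriveD; rewrite (_ : (fun _ => _) = - ((@id R ^+ 3 + 3 *: @id R) * g)); last first.
      by apply/funext => y; rewrite -[RHS]/(- ((y ^+ 3 + 3 * y) * g y)); ring.
    have dg := is_derive_gpdf x.
    by apply: is_derive_eq; rewrite /GRing.scale /= !fctE /= -[3 *: x]/(3 * x); ring.
  have Fl : F x @[x --> +oo] --> (0 : R).
    rewrite -[X in _ --> X](addr0 0); apply: cvgD; last exact: el.
    rewrite -[X in _ --> X]oppr0 -[X in - X](addr0 0); apply: cvgN; apply: cvgD.
      exact: cvg_pow_gpdf.
    rewrite -[X in _ --> X](mulr0 3); apply: cvgM; [exact: cvg_cst|exact: cvg_pow_gpdf].
  have f0' x : 0 <= x -> 0 <= f x by [].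
  have := FTC_tail f0' cf dF Fl => ->; congr EFin.
  by rewrite /F sub0r oppr0 expR0 !expr0n !mul0r mulr0 addr0 oppr0 add0r opprK mulr1.
have mce (h : R -> R) : continuous h ->
    measurable_fun (`[0%R, +oo[%classic : set (measurableTypeR R)) (fun x : R => (h x)%:E).
  by move=> ch; apply/measurable_EFinP/measurable_funTS; exact: continuous_measurable_fun.
set J := (\int[mu]_(x in _) (_ ^+ 4 * _)%:E)%E.
have E1 : (J + K%:E = K%:E + (3 * 2^-1)%:E)%E.
  rewrite -{1}I1 -I2 EFinM -half -ge0_integralZl//; last 2 first.
  - by apply: mce; exact: continuous_gpdf.
  - by move=> x _; rewrite lee_fin gpdf_ge0.
  rewrite /J -ge0_integralD//; last 4 first.
  - by move=> x _; rewrite lee_fin mulr_ge0 ?gpdf_ge0 ?exprn_even_ge0.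
  - by apply: (mce (fun x => x ^+ 4 * g x)); exact: continuousXgpdf.
  - by move=> x _; rewrite lee_fin mulr_ge0 ?expR_ge0.
  - by apply: (mce (fun x => K * expR (- x))).
  rewrite -ge0_integralD//; last 4 first.
  - by move=> x _; rewrite lee_fin.
  - by apply: mce.
  - by move=> x _; rewrite -EFinM lee_fin mulr_ge0 ?gpdf_ge0.
  - apply: (mce (fun x => 3 * g x)) => x; apply: cvgM; [exact: cvg_cst|exact: continuous_gpdf].
  by apply: eq_integral => x _; rewrite -EFinM -!EFinD /f; congr EFin; ring.
have -> : J = (3 * 2^-1)%:E.
  by move: E1; rewrite addeC; case: J => [r||] //=; rewrite -!EFinD => -[] /addrI ->.
by rewrite -EFinM; congr EFin; field.
Qed.

End gaussian_tails.

(** * Stein's equation for Lipschitz functions *)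

Section stein_equation.
Context {R : realType}.
Notation mu := (@lebesgue_measure R).
Notation g := (@gpdf R).
Local Open Scope ring_scope.

Definition lip1 (h : R -> R) := forall x y, `|h x - h y| <= `|x - y|.

Lemma lip1_continuous h : lip1 h -> continuous h.
Proof.
move=> hl x; apply/cvgrPdist_lt => e e0; near=> y.
apply: le_lt_trans (hl x y) _; near: y.
by move: e e0; apply/cvgrPdist_lt; exact: cvg_id.
Unshelve. all: by end_near. Qed.

Lemma integrable_id_gauss : mu.-integrable setT (fun x => (x * g x)%:E).
Proof.
apply/integrableP; split.
  by apply/measurable_EFinP; apply: continuous_measurable_fun; exact: (@continuousXgpdf R 1).
under eq_integral do rewrite /= normrM (ger0_norm (gpdf_ge0 _)).
by rewrite integral_abs_gauss ltry.
Qed.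

Lemma integrable_gauss : mu.-integrable setT (fun x => (g x)%:E).
Proof. exact: integrable_normal_pdf. Qed.

Lemma integrable_affine_gauss (h : R -> R) (a b : R) : continuous h ->
  (forall x, `|h x| <= a + b * `|x|) -> mu.-integrable setT (fun x => (h x * g x)%:E).
Proof.
move=> ch hb; apply: (@le_integrable _ _ _ mu _ measurableT _ (fun x => (a * g x)%:E + (b * (`|x| * g x))%:E)%E).
- by apply/measurable_EFinP; apply: continuous_measurable_fun => x; apply: cvgM; [exact: ch|exact: continuous_gpdf].
- move=> x _; rewrite -EFinD lee_fin normrM (ger0_norm (gpdf_ge0 _)).
  apply: le_trans (ler_norm _); rewrite mulrA -mulrDl.
  by rewrite ler_wpM2r ?gpdf_ge0.
- apply: integrableD => //.
    by under eq_fun do rewrite EFinM; apply: integrableZl => //; exact: integrable_gauss.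
  under eq_fun do rewrite EFinM; apply: integrableZl => //.
  rewrite (_ : (fun _ => _) = (abse \o (fun x => (x * g x)%:E))).
    by apply: integrable_abse; exact: integrable_id_gauss.
  by apply/funext => x /=; rewrite normrM (ger0_norm (gpdf_ge0 _)).
Qed.

Definition gauss_mean (h : R -> R) : R := \int[mu]_x (h x * g x).

Lemma integrable_lip1_gauss h s : lip1 h -> mu.-integrable setT (fun x => (h (s * x) * g x)%:E).
Proof.
move=> hl; apply: (@integrable_affine_gauss (fun x => h (s * x)) `|h 0| `|s|).
  move=> x; apply: (cvg_comp (fun y => s * y)); last exact: lip1_continuous.
  by apply: cvgM; [exact: cvg_cst|exact: cvg_id].
move=> x; have := hl (s * x) 0; rewrite subr0 normrM => H.
by rewrite -[h (s * x)](subrK (h 0)) addrC (le_trans (ler_normD _ _))// lerD2l.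
Qed.

Section solution.
Variable h : R -> R.
Hypothesis hl : lip1 h.
Let c0 : R := Num.sqrt (2 / pi).
Let H x := h x - gauss_mean h.
Let L x := \int[mu]_(t in `]-oo, x]) (H t * g t).
(** The bounded solution of psi'(x) - x psi(x) = H(x), where H is h centred under the standard
    normal law. *)
Definition stein_solution x := L x / g x.
Let psi := stein_solution.
Let psi' x := x * psi x + H x.

Let c0_ge0 : 0 <= c0. Proof. exact: sqrtr_ge0. Qed.

Let intH : mu.-integrable setT (fun x => (H x * g x)%:E).
Proof.
apply: (@integrable_affine_gauss H (`|h 0 - gauss_mean h|) 1).
  by move=> x; apply: cvgB; [exact: lip1_continuous|exact: cvg_cst].
move=> x; rewrite mul1r /H; have := hl x 0; rewrite subr0 => hx.
have -> : h x - gauss_mean h = (h 0 - gauss_mean h) + (h x - h 0) by ring.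
by rewrite (le_trans (ler_normD _ _))// lerD2l.
Qed.

Let inth : mu.-integrable setT (fun x => (h x * g x)%:E).
Proof. by have := integrable_lip1_gauss 1 hl; under eq_fun do rewrite mul1r. Qed.

Let H0 : \int[mu]_x (H x * g x) = 0.
Proof.
transitivity (\int[mu]_x (h x * g x - gauss_mean h * g x)).
  by apply: eq_Rintegral => x _; rewrite /H mulrBl.
have ig := integrable_gauss.
have iZ b : mu.-integrable setT (fun x => (b * g x)%:E) by exact: (integrableZl measurableT b ig).
rewrite RintegralB//; last exact: iZ.
have ig1 : \int[mu]_x g x = 1 by rewrite /Rintegral integral_gpdf.
by rewrite RintegralZl// -/(gauss_mean h) ig1 mulr1 subrr.
Qed.

Let H_le x : `|H x| <= `|x| + c0.
Proof.
have ig := integrable_gauss.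
have iZ b : mu.-integrable setT (fun x => (b * g x)%:E) by exact: (integrableZl measurableT b ig).
have E : H x = \int[mu]_t ((h x - h t) * g t).
  transitivity (\int[mu]_t (h x * g t - h t * g t)).
    rewrite RintegralB//; last exact: iZ.
    by rewrite RintegralZl// {1}/Rintegral integral_gpdf /= mulr1.
  by apply: eq_Rintegral => t _; rewrite mulrBl.
have i1 : mu.-integrable setT (fun t => ((h x - h t) * g t)%:E).
  apply: (@integrable_affine_gauss _ `|x| 1).
    by move=> t; apply: cvgB; [exact: cvg_cst|exact: lip1_continuous].
  by move=> t; rewrite mul1r (le_trans (hl _ _))// ler_normB.
have i2 : mu.-integrable setT (fun t => (`|t| * g t)%:E).
  apply: (@integrable_affine_gauss _ 0 1); first exact: norm_continuous.
  by move=> t; rewrite normr_id add0r mul1r.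
have i3 : mu.-integrable setT (fun t => (`|x| * g t)%:E).
  by under eq_fun do rewrite EFinM; exact: integrableZl.
rewrite E; apply: le_trans (le_normr_Rintegral _ i1) _ => //.
apply: (@le_trans _ _ (\int[mu]_t (`|x| * g t + `|t| * g t))).
  apply: le_Rintegral => //.
  - by apply: integrable_norm.
  - by exact: (integrableD measurableT i3 i2).
  move=> t _; rewrite normrM (ger0_norm (gpdf_ge0 _)) -mulrDl ler_wpM2r ?gpdf_ge0//.
  by rewrite (le_trans (hl _ _))// ler_normB.
rewrite RintegralD// RintegralZl// {1}/Rintegral integral_gpdf /= mulr1 lerD2l.
by rewrite /Rintegral integral_abs_gauss.
Qed.

Let cH : continuous H.
Proof. by move=> x; apply: cvgB; [exact: lip1_continuous|exact: cvg_cst]. Qed.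

Let cHg : continuous (fun x => H x * g x).
Proof. by move=> x; apply: cvgM; [exact: cH|exact: continuous_gpdf]. Qed.

Lemma is_derive_L (x : R) : is_derive x 1 L (H x * g x).
Proof.
have FT := @continuous_FTC1 R (fun t => H t * g t) (BInfty R true) x (x + 1).
case: FT => //.
- by rewrite ltrDl.
- exact: (integrableS measurableT _ (@subsetT _ _) intH).
- by rewrite ltNyr.
- exact: cHg.
by move=> d1 d2; split; [exact: d1|rewrite -derive1E d2].
Qed.

Lemma is_derive_psi (x : R) : is_derive x 1 psi (psi' x).
Proof.
have dL := is_derive_L x; have gn : g x != 0 by rewrite gt_eqF// gpdf_gt0.
have dg := is_derive_gpdf x.
have dV : is_derive x 1 (fun y => (g y)^-1) (- g x ^- 2 * (- x * g x)).
  by split; [apply: derivableV => //; case: dg|case: dg => ? <-; rewrite deriveV].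
rewrite (_ : psi = L * (fun y => (g y)^-1))//.
apply: is_derive_eq; rewrite /psi' /psi /stein_solution /GRing.scale /=; field.
exact: gn.
Qed.

Let M y : R := fine (\int[mu]_(t in `[y, +oo[) (g t)%:E).

Let M_fin y : (\int[mu]_(t in `[y, +oo[) (g t)%:E = (M y)%:E)%E.
Proof.
rewrite /M fineK// ge0_fin_numE; last by apply: integral_ge0 => x _; rewrite lee_fin gpdf_ge0.
apply: (@le_lt_trans _ _ (\int[mu]_t (g t)%:E)%E); last by rewrite integral_gpdf ltry.
apply: ge0_subset_integral => //; first by apply/measurable_EFinP; exact: measurable_gpdf.
by move=> x _; rewrite lee_fin gpdf_ge0.
Qed.

Let M_ge0 y : 0 <= M y.
Proof. by rewrite -lee_fin -M_fin; apply: integral_ge0 => x _; rewrite lee_fin gpdf_ge0. Qed.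

Let M_le1 y : M y <= 1.
Proof.
rewrite -lee_fin -M_fin -(@integral_gpdf R); apply: ge0_subset_integral => //.
  by apply/measurable_EFinP; exact: measurable_gpdf.
by move=> x _; rewrite lee_fin gpdf_ge0.
Qed.

(** The right side is the integral of [(t - y) * g t] over the tail, since [t * g t] integrates to
    [g y]. It is used with c equal to [f y], so that a Lipschitz f is compared with a constant. *)
Lemma tail_bound (f : R -> R) (c y : R) : 0 <= y ->
  mu.-integrable setT (fun x => (f x * g x)%:E) -> continuous f ->
  (forall t, y <= t -> `|f t - c| <= t - y) ->
  `|\int[mu]_(t in `[y, +oo[) (f t * g t) - c * M y| <= g y - y * M y.
Proof.
move=> y0 intf cf fc; have ig := integrable_gauss; have ii := integrable_id_gauss.
have sub F : mu.-integrable setT F -> mu.-integrable `[y, +oo[%classic F.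
  by move=> iF; apply: (integrableS measurableT _ (subsetT _) iF).
have icg (b : R) : mu.-integrable `[y, +oo[%classic (fun t => (b * g t)%:E).
  by exact: (integrableZl _ b (sub _ ig)).
have ME : M y = \int[mu]_(t in `[y, +oo[) g t by [].
have cM b : b * M y = \int[mu]_(t in `[y, +oo[) (b * g t) by rewrite RintegralZl//; exact: sub.
rewrite !cM -RintegralB//; [|exact: sub|exact: icg].
have -> : g y = \int[mu]_(t in `[y, +oo[) (t * g t) by rewrite /Rintegral integral_tail_id.
rewrite -RintegralB//; [|exact: sub|exact: icg].
have i1 : mu.-integrable `[y, +oo[%classic (fun t => (f t * g t - c * g t)%:E).
  by exact: (integrableB _ (sub _ intf) (icg c)).
apply: le_trans (le_normr_Rintegral _ i1) _ => //.
apply: le_Rintegral => //.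
- exact: integrable_norm.
- by exact: (integrableB _ (sub _ ii) (icg y)).
move=> t /=; rewrite in_itv/= andbT => yt.
by rewrite -!mulrBl normrM (ger0_norm (gpdf_ge0 _)) ler_wpM2r ?gpdf_ge0// fc.
Qed.

Lemma integral_reflect (f : R -> R) (x : R) : continuous f ->
  mu.-integrable setT (EFin \o f) ->
  \int[mu]_(t in `]-oo, x]) f t = \int[mu]_(t in `[(- x), +oo[) f (- t).
Proof.
move=> cf intf; have cfN : continuous (fun t => f (- t)).
  by move=> t; apply: (cvg_comp (fun t => - t)); [apply: cvgN|exact: cf].
have mfp (F : R -> R) : continuous F -> measurable_fun setT (F : measurableTypeR R -> R).
  exact: continuous_measurable_fun.
have cmax (F : R -> R) : continuous F -> continuous (fun t => Num.max (F t) 0).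
  by move=> cF t; apply: continuous_max; [exact: cF|exact: cvg_cst].
have E (F : R -> R) : continuous F -> (forall t, 0 <= F t) ->
   (\int[mu]_(t in `]-oo, x]) (F t)%:E = \int[mu]_(t in `[(- x)%R, +oo[) (F (- t))%:E)%E.
  move=> cF F0; rewrite -[x in `]-oo, x]]opprK.
  rewrite (@ge0_integration_by_substitutionNy _ F (- x)) //.
  exact: continuous_subspaceT.
rewrite /Rintegral; congr fine; rewrite integralE [RHS]integralE; congr (_ - _)%E.
  have m0 t : 0 <= Num.max (f t) 0 by rewrite le_max lexx orbT.
  have := E _ (cmax _ cf) m0.
  by congr (_ = _); apply: eq_integral => t _; rewrite funeposE EFin_max.
have cn : continuous (fun t => - f t) by move=> t; apply: cvgN; exact: cf.
have m0 t : 0 <= Num.max (- f t) 0 by rewrite le_max lexx orbT.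
have := E _ (cmax _ cn) m0.
by congr (_ = _); apply: eq_integral => t _; rewrite funenegE EFin_max.
Qed.

Lemma solution_bound_pos x : 0 <= x -> `|- L x - H x * M x| <= g x - x * M x.
Proof.
move=> x0; have -> : - L x = \int[mu]_(t in `[x, +oo[) (H t * g t).
  rewrite -Rintegral_itv_obnd_cbnd; last exact: (integrableS measurableT _ (@subsetT _ _) intH).
  rewrite -(@Rintegral_itvB _ _ -oo%O +oo%O)//.
    by rewrite set_itvE H0 sub0r.
  by rewrite set_itvE; exact: intH.
apply: tail_bound => // t xt; rewrite /H opprD addrACA subrr addr0.
by rewrite (le_trans (hl _ _))// ger0_norm// subr_ge0.
Qed.

Lemma solution_bound_neg x : x <= 0 -> `|L x - H x * M (- x)| <= g (- x) - (- x) * M (- x).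
Proof.
move=> x0; have -> : L x = \int[mu]_(t in `[(- x), +oo[) (H (- t) * g t).
  rewrite /L integral_reflect//; apply: eq_Rintegral => t _.
  by rewrite gpdfN.
apply: (@tail_bound (fun t => H (- t)) (H x) (- x)).
- by rewrite oppr_ge0.
- apply: (@integrable_affine_gauss (fun t => H (- t)) c0 1).
    by move=> t; apply: (cvg_comp (fun t => - t)); [apply: cvgN|exact: cH].
  by move=> t; rewrite mul1r addrC (le_trans (H_le _))// normrN.
- by move=> t; apply: (cvg_comp (fun t => - t)); [apply: cvgN|exact: cH].
move=> t xt; rewrite /H opprD addrACA subrr addr0 (le_trans (hl _ _))//.
by rewrite ler_norml; apply/andP; split; lra.
Qed.

(** A bound of [M y / g y] for y >= 0: at most 1 beyond 1, where [y * M y <= g y], and at most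
    [(g 1)^-1] before, where [M y <= 1] and [g 1 <= g y]. *)
Definition mills_bound : R := 1 + (g 1)^-1.

Let M_le y : 0 <= y -> y * M y <= g y -> M y <= mills_bound * g y.
Proof.
move=> y0 yM; have g1 := @gpdf_gt0 R 1; have gy := @gpdf_gt0 R y.
have k0 : 0 <= (g 1)^-1 by rewrite invr_ge0 gpdf_ge0.
rewrite /mills_bound mulrDl mul1r; have [y1|y1] := leP 1 y.
  have : M y <= g y by apply: le_trans yM; rewrite ler_peMl.
  by have := mulr_ge0 k0 (ltW gy); lra.
have : 1 <= (g 1)^-1 * g y.
  rewrite mulrC ler_pdivlMr// mul1r !gpdfE ler_wpM2l ?normal_peak_ge0// ler_expR.
  by rewrite !mulNr lerN2 ler_pM2r// expr1n exprn_ile1// ltW.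
by have := M_le1 y; lra.
Qed.

Definition sup_bound : R := c0 * mills_bound + 1.

(** Let y be the modulus of x. Up to sign psi is P, and [P * g y] lies within [g y - y * M y] of
    [H x * M y]; hence psi' times [g y] is at most [(2 * y + c0) * (g y - y * M y)]. Beyond 1 the
    Mills bound makes the last factor at most [g y / (1 + y ^+ 2)], which absorbs even one more
    factor y: this is the third bound, on which the Lipschitz property of psi' rests. *)
Lemma solution_bounds x :
  [/\ `|psi x| <= sup_bound, `|psi' x| <= c0 + 2 & `|x * psi' x| <= c0 + 2].
Proof.
pose y := `|x|; have y0 : 0 <= y by exact: normr_ge0.
pose P := if 0 <= x then - psi x else psi x.
have gy : 0 < g y by exact: gpdf_gt0.
have gx : g x = g y by rewrite /y; case: (ger0P x) => // _; rewrite gpdfN.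
have Pb : `|P * g y - H x * M y| <= g y - y * M y.
  rewrite /P /y; case: (ger0P x) => x0.
    by rewrite mulNr /psi /stein_solution divfK ?gt_eqF ?gpdf_gt0// solution_bound_pos.
  rewrite gpdfN /psi /stein_solution divfK ?gt_eqF ?gpdf_gt0//.
  by have := solution_bound_neg (ltW x0); rewrite gpdfN.
have pE : psi' x = H x - y * P.
  by rewrite /psi' /P /y; case: (ger0P x) => x0; ring.
have aP : `|psi x| = `|P| by rewrite /P; case: ifP => _; rewrite ?normrN.
have ay : `|x * psi' x| = y * `|psi' x| by rewrite normrM.
rewrite aP ay pE; have := H_le x; rewrite -/y; move: Pb; set h0 := H x => Pb hb.
have M0 := M_ge0 y.
have yM : y * M y <= g y by rewrite -subr_ge0 (le_trans _ Pb).
have Mk := M_le y0 yM.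
have D0 : 0 <= g y - y * M y by rewrite subr_ge0.
have key : `|h0 - y * P| * g y <= (2 * y + c0) * (g y - y * M y).
  rewrite -[g y in X in X <= _]gtr0_norm// -normrM.
  have -> : (h0 - y * P) * g y = h0 * (g y - y * M y) - y * (P * g y - h0 * M y) by ring.
  apply: le_trans (ler_normB _ _) _; rewrite !normrM (ger0_norm D0) (ger0_norm y0).
  apply: (@le_trans _ _ ((y + c0) * (g y - y * M y) + y * (g y - y * M y))).
    by rewrite lerD// ?ler_wpM2r// ler_wpM2l.
  by rewrite -mulrDl; apply: ler_wpM2r => //; lra.
split.
- rewrite -(ler_pM2r gy) -{1}[g y]gtr0_norm// -normrM.
  have -> : P * g y = (P * g y - h0 * M y) + h0 * M y by ring.
  apply: le_trans (ler_normD _ _) _; rewrite normrM (ger0_norm M0).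
  have : `|h0| * M y <= (y + c0) * M y by rewrite ler_wpM2r.
  have : c0 * M y <= c0 * (mills_bound * g y) by rewrite ler_wpM2l.
  by rewrite /sup_bound; lra.
- rewrite -(ler_pM2r gy); apply: le_trans key _; have [y1|y1] := ltP y 1.
    apply: ler_pM => //; first by rewrite addr_ge0// mulr_ge0.
      by lra.
    by rewrite gerBl mulr_ge0.
  have mg : y / (1 + y ^+ 2) * g y <= M y by rewrite -lee_fin -M_fin mills_ge.
  have p0 : 0 < 1 + y ^+ 2 by rewrite ltr_pwDl// sqr_ge0.
  have Dg : g y - y * M y <= g y / (1 + y ^+ 2).
    rewrite lerBlDr -lerBlDl; apply: le_trans (ler_wpM2l y0 mg).
    by rewrite le_eqVlt; apply/orP; left; apply/eqP; field; rewrite gt_eqF.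
  have c20 : 0 <= 2 * y + c0 by rewrite addr_ge0// mulr_ge0.
  apply: le_trans (ler_wpM2l c20 Dg) _.
  rewrite mulrCA mulrC ler_wpM2r ?(ltW gy)// ler_pdivrMr//.
  have := mulr_ge0 c0_ge0 (sqr_ge0 y); have := sqr_ge0 (y - 1).
  by rewrite sqrrB expr1n mulr1; lra.
- rewrite -(ler_pM2r gy) -mulrA; apply: le_trans (ler_wpM2l y0 key) _; have [y1|y1] := ltP y 1.
    apply: (@le_trans _ _ (1 * ((c0 + 2) * g y))); last by rewrite mul1r.
    apply: ler_pM => //; first by rewrite mulr_ge0// addr_ge0// mulr_ge0.
      by exact: ltW.
    apply: ler_pM => //; first by rewrite addr_ge0// mulr_ge0.
      by lra.
    by rewrite gerBl mulr_ge0.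
  have mg : y / (1 + y ^+ 2) * g y <= M y by rewrite -lee_fin -M_fin mills_ge.
  have p0 : 0 < 1 + y ^+ 2 by rewrite ltr_pwDl// sqr_ge0.
  have Dg : g y - y * M y <= g y / (1 + y ^+ 2).
    rewrite lerBlDr -lerBlDl; apply: le_trans (ler_wpM2l y0 mg).
    by rewrite le_eqVlt; apply/orP; left; apply/eqP; field; rewrite gt_eqF.
  have c20 : 0 <= 2 * y + c0 by rewrite addr_ge0// mulr_ge0.
  apply: le_trans (ler_wpM2l y0 (ler_wpM2l c20 Dg)) _.
  rewrite mulrA mulrCA mulrC ler_wpM2r ?(ltW gy)// ler_pdivrMr//.
  have := mulr_ge0 c0_ge0 (sqr_ge0 (y - 1)); have := mulr_ge0 c0_ge0 y0.
  rewrite sqrrB expr1n mulr1; lra.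
Qed.

Lemma mvt_lipschitz (f df : R -> R) (c : R) : (forall x : R, is_derive x 1 f (df x)) ->
  (forall x, `|df x| <= c) -> forall x y, `|f x - f y| <= c * `|x - y|.
Proof.
move=> dff dfc; suff W x y : x <= y -> `|f y - f x| <= c * `|y - x|.
  by move=> x y; case/orP: (le_total x y) => /W; rewrite // distrC [in X in _ <= X]distrC.
move=> xy; have [z _ ->] := MVT_segment xy (fun z _ => dff z)
  (@continuous_subspaceT _ _ _ _ (fun z => is_derive_continuous (dff z))).
by rewrite normrM ler_wpM2r.
Qed.

Definition stein_constant : R := sup_bound + c0 + 3.

Lemma stein_solution_spec :
  [/\ forall x, psi' x - x * psi x = h x - gauss_mean h,
      forall x, `|psi' x| <= stein_constant,
      forall x y, `|psi x - psi y| <= stein_constant * `|x - y|,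
      forall x y, `|psi' x - psi' y| <= stein_constant * `|x - y| &
      forall x y, `|psi y - psi x - psi' x * (y - x)| <= stein_constant * (y - x) ^+ 2].
Proof.
have sb0 : 0 <= sup_bound.
  by rewrite addr_ge0// mulr_ge0// addr_ge0// invr_ge0 gpdf_ge0.
have le1 : c0 + 2 <= stein_constant by rewrite /stein_constant; lra.
(* As h is only Lipschitz, psi' need not be differentiable. But psi' is the sum of x psi, whose
   derivative psi + x psi' is bounded, and of H, which is 1-Lipschitz. *)
have pl x y : `|psi' x - psi' y| <= stein_constant * `|x - y|.
  have dx (z : R) : is_derive z 1 (fun z => z * psi z) (psi z + z * psi' z).
    have dp := is_derive_psi z.
    rewrite (_ : (fun _ => _) = (@id R) * psi)//.
    by apply: is_derive_eq; rewrite /GRing.scale /= mulr1 addrC.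
  have db z : `|psi z + z * psi' z| <= sup_bound + (c0 + 2).
    by have [p1 _ p2] := solution_bounds z; rewrite (le_trans (ler_normD _ _))// lerD.
  have -> : psi' x - psi' y = (x * psi x - y * psi y) + (h x - h y) by rewrite /psi' /H; ring.
  apply: le_trans (ler_normD _ _) _.
  apply: le_trans (lerD (mvt_lipschitz dx db x y) (hl x y)) _.
  by rewrite -{2}[`|x - y|]mul1r -mulrDl ler_wpM2r// /stein_constant; lra.
split => //.
- by move=> x; rewrite /psi' addrAC subrr add0r.
- by move=> x; have [_ p _] := solution_bounds x; apply: le_trans le1.
- by apply: mvt_lipschitz is_derive_psi _ => x; have [_ p _] := solution_bounds x; apply: le_trans le1.
- have cp : continuous psi by move=> z; exact: is_derive_continuous (is_derive_psi z).
  have sc0 : 0 <= stein_constant by apply: le_trans le1; rewrite addr_ge0.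
  have key x y z : z \in `[Num.min x y, Num.max x y] -> psi y - psi x = psi' z * (y - x) ->
      `|psi y - psi x - psi' x * (y - x)| <= stein_constant * (y - x) ^+ 2.
    move=> zxy ->; rewrite -mulrBl normrM -[(y - x) ^+ 2]real_normK ?num_real// expr2 mulrA.
    rewrite ler_wpM2r//; apply: le_trans (pl _ _) _; rewrite ler_wpM2l//.
    move: zxy; rewrite in_itv/= => /andP[]; rewrite /Num.min /Num.max; case: ltP => xy z1 z2.
      by rewrite !ger0_norm; lra.
    by rewrite !ler0_norm; lra.
  move=> x y; case/orP: (le_total x y) => xy.
    have [z zxy ez] := MVT_segment xy (fun z _ => is_derive_psi z) (@continuous_subspaceT _ _ _ _ cp).
    by apply: (key _ _ z) => //; rewrite (min_idPl xy) (max_idPr xy).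
  have [z zxy ez] := MVT_segment xy (fun z _ => is_derive_psi z) (@continuous_subspaceT _ _ _ _ cp).
  apply: (key _ _ z); first by rewrite (min_idPr xy) (max_idPl xy).
  by rewrite -opprB ez -mulrN opprB.
Qed.

End solution.

(** Reduction to variance 1: the function [h (s * x) / s] of x is again 1-Lipschitz, and its
    solution phi yields [s * phi (x / s)]. The bound on psi' is then free of s, and its Lipschitz
    constant acquires one factor [s^-1]. *)
Lemma stein_scaled (h : R -> R) (s : R) : lip1 h -> 0 < s ->
  exists psi psi' : R -> R,
  [/\ forall x, s * (h x - gauss_mean (fun x => h (s * x))) = s ^+ 2 * psi' x - x * psi x,
      forall x, `|psi' x| <= stein_constant,
      forall x y, `|psi x - psi y| <= stein_constant * `|x - y|,
      forall x y, `|psi' x - psi' y| <= stein_constant / s * `|x - y| &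
      forall x y, `|psi y - psi x - psi' x * (y - x)| <= stein_constant / s * (y - x) ^+ 2].
Proof.
move=> hl s0; have sn : s != 0 by rewrite gt_eqF.
pose hs x := h (s * x) / s.
have hsl : lip1 hs.
  move=> x y; rewrite /hs -mulrBl normrM normfV (gtr0_norm s0) ler_pdivrMr//.
  by apply: le_trans (hl _ _) _; rewrite -mulrBr normrM (gtr0_norm s0) mulrC.
have [E1 E2 E3 E4 E5] := stein_solution_spec hsl.
have gm : gauss_mean hs = gauss_mean (fun x => h (s * x)) / s.
  rewrite mulrC /gauss_mean -RintegralZl//; last exact: integrable_lip1_gauss.
  by apply: eq_Rintegral => x _; rewrite /hs; ring.
pose phi := stein_solution hs; pose phi' x := x * phi x + (hs x - gauss_mean hs).
exists (fun x => s * phi (x / s)), (fun x => phi' (x / s)); split.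
- move=> x; have := E1 (x / s); rewrite -/phi -/(phi' _) gm /hs [s * (x / s)]mulrC divfK// => e.
  have -> : h x - gauss_mean (fun x => h (s * x)) = s * (phi' (x / s) - x / s * phi (x / s)).
    by rewrite e -mulrBl mulrC divfK.
  by field.
- by move=> x; exact: E2.
- move=> x y; rewrite -mulrBr normrM (gtr0_norm s0).
  have -> : stein_constant * `|x - y| = s * (stein_constant * `|x / s - y / s|).
    by rewrite -mulrBl normrM normfV (gtr0_norm s0); field.
  by rewrite ler_pM2l//; exact: E3.
- move=> x y; apply: le_trans (E4 _ _) _.
  rewrite -mulrBl normrM normfV (gtr0_norm s0) le_eqVlt; apply/orP; left; apply/eqP; ring.
- move=> x y.
  have -> : s * phi (y / s) - s * phi (x / s) - phi' (x / s) * (y - x) =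
     s * (phi (y / s) - phi (x / s) - phi' (x / s) * (y / s - x / s)) by field.
  have -> : stein_constant / s * (y - x) ^+ 2 = s * (stein_constant * (y / s - x / s) ^+ 2).
    by field.
  by rewrite normrM (gtr0_norm s0) ler_pM2l//; exact: E5.
Qed.

End stein_equation.

(** * The joint law of the counts *)

Section probability_reals.
Context {d} {Omega : measurableType d} {R : realType} (P : probability Omega R).
Local Open Scope ring_scope.

Definition pr (A : set Omega) : R := fine (P A).

Lemma prE A : measurable A -> P A = (pr A)%:E.
Proof. by move=> mA; rewrite /pr fineK// fin_num_measure. Qed.

Lemma pr_ge0 A : 0 <= pr A.
Proof. by rewrite /pr fine_ge0. Qed.

Lemma pr_le1 A : measurable A -> pr A <= 1.
Proof. by move=> mA; rewrite -lee_fin -prE// probability_le1. Qed.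

Lemma prT : pr setT = 1.
Proof. by rewrite /pr probability_setT. Qed.

Lemma pr_le A B : measurable A -> measurable B -> A `<=` B -> pr A <= pr B.
Proof. by move=> mA mB AB; rewrite -lee_fin -!prE// le_measure ?inE. Qed.

Lemma prU A B : measurable A -> measurable B -> A `&` B = set0 ->
  pr (A `|` B) = pr A + pr B.
Proof. by move=> mA mB AB; apply: EFin_inj; rewrite EFinD -!prE ?measureU//; exact: measurableU. Qed.

Lemma prU_le A B : measurable A -> measurable B -> pr (A `|` B) <= pr A + pr B.
Proof.
by move=> mA mB; rewrite -lee_fin EFinD -!prE ?measureU2//; exact: measurableU.
Qed.

Lemma prDI A B : measurable A -> measurable B -> pr A = pr (A `&` B) + pr (A `\` B).
Proof.
move=> mA mB; rewrite -prU; [by rewrite setUIDK|exact: measurableI|exact: measurableD|].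
by apply/seteqP; split => w // [[_ ?] []].
Qed.

Lemma pr_fin_le (I : finType) (A : pred I) (V : I -> set Omega) :
  (forall i, measurable (V i)) ->
  pr [set w | exists2 i, A i & V i w] <= \sum_(i | A i) pr (V i).
Proof.
move=> mV.
have W (s : seq I) : measurable [set w | exists2 i, i \in s & V i w] /\
    pr [set w | exists2 i, i \in s & V i w] <= \sum_(i <- s) pr (V i).
  elim: s => [|i s [m1 IH]].
    rewrite big_nil (_ : [set w | _] = set0); first by rewrite /pr measure0.
    by apply/seteqP; split => // w [].
  rewrite (_ : [set w | _] = V i `|` [set w | exists2 i, i \in s & V i w]); last first.
    apply/seteqP; split => w /=.
      by move=> [j]; rewrite inE => /predU1P[->|js] Vj; [left|right; exists j].
    by move=> [Vi|[j js Vj]]; [exists i; rewrite ?mem_head|exists j; rewrite ?inE ?js ?orbT].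
  split; first exact: measurableU.
  rewrite big_cons; apply: le_trans (prU_le _ _) _ => //.
  by rewrite lerD2l.
have [_] := W (enum A); rewrite big_enum_cond /= => H.
rewrite (eq_bigl (fun i => i \in A)) in H; last by move=> i; rewrite andbT.
by apply: le_trans H; rewrite le_eqVlt; apply/orP; left; apply/eqP; congr pr;
  apply/seteqP; split => w [i Ai Vi]; exists i => //; move: Ai; rewrite mem_enum.
Qed.

Lemma pr_partition (F : finType) (xi : Omega -> F) (Q : pred F) :
  (forall x, measurable (xi @^-1` [set x])) ->
  measurable [set w | Q (xi w)] /\
  pr [set w | Q (xi w)] = \sum_(x | Q x) pr (xi @^-1` [set x]).
Proof.
move=> mF.
have W (s : seq F) : uniq s -> measurable [set w | xi w \in s] /\
    pr [set w | xi w \in s] = \sum_(x <- s) pr (xi @^-1` [set x]).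
  elim: s => [_|x s IH /= /andP[xs us]].
    rewrite big_nil (_ : [set w | _] = set0); first by rewrite /pr measure0.
    by apply/seteqP; split.
  have [m1 e1] := IH us.
  rewrite (_ : [set w | _] = (xi @^-1` [set x]) `|` [set w | xi w \in s]); last first.
    apply/seteqP; split => w /=; rewrite inE; first by move/predU1P.
    by move=> [->|->]; rewrite ?eqxx ?orbT.
  split; first exact: measurableU.
  rewrite big_cons -e1 prU//; apply/seteqP; split => w //= [-> xw].
  by rewrite xw in xs.
have [m e] := W (enum Q) (enum_uniq _).
have -> : [set w | Q (xi w)] = [set w | xi w \in enum Q].
  by apply/seteqP; split => w /=; rewrite mem_enum.
by split => //; rewrite e big_enum_cond; apply: eq_bigl => x; rewrite andbT.
Qed.

Section product_law.
Variables (I : finType) (V : I -> set Omega) (p : I -> R).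
Hypothesis mV : forall i, measurable (V i).
Hypothesis pV : forall J : {set I}, pr [set w | forall i, i \in J -> V i w] = \prod_(i in J) p i.

Lemma measurable_forall (J : {set I}) (W : I -> set Omega) : (forall i, measurable (W i)) ->
  measurable [set w | forall i, i \in J -> W i w].
Proof.
move=> mW; rewrite (_ : [set w | _] = \bigcap_(i in [set` J]) W i); last first.
  by apply/seteqP; split => w /= H i; [apply: H|move=> iJ; apply: H].
by apply: fin_bigcap_measurable.
Qed.

(** Induction on the avoided indices: avoiding one more index is the difference of two events
    covered by the induction hypothesis, one of them with that index moved to J. *)
Lemma pr_void_nonvoid (s : seq I) (J : {set I}) : uniq s -> {in s, forall i, i \notin J} ->
  pr [set w | (forall i, i \in J -> V i w) /\ (forall i, i \in s -> ~ V i w)] =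
  \prod_(i in J) p i * \prod_(i <- s) (1 - p i).
Proof.
have meas (J' : {set I}) (s' : seq I) : measurable
   [set w | (forall i, i \in J' -> V i w) /\ (forall i, i \in s' -> ~ V i w)].
  rewrite (_ : [set w | _] = [set w | forall i, i \in J' -> V i w] `&`
     [set w | forall i, i \in [set i in s']%SET -> (~` V i) w]).
    by apply: measurableI; apply: measurable_forall => // i; exact: measurableC.
  apply/seteqP; split => w /= [H1 H2]; split => // i is_; apply: H2; move: is_; by rewrite inE.
elim: s J => [J _ _|i s IH J /= /andP[is_ us] nJ].
  rewrite big_nil mulr1 -pV; congr pr; apply/seteqP; split => w /=; first by case.
  by move=> H; split.
have iJ : i \notin J by apply: nJ; rewrite mem_head.
have nJ' : {in s, forall j, j \notin J} by move=> j js; apply: nJ; rewrite inE js orbT.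
have := prDI (meas J s) (mV i); rewrite IH//.
have -> : [set w | (forall i, i \in J -> V i w) /\ (forall i, i \in s -> ~ V i w)] `&` V i =
   [set w | (forall j, j \in i |: J -> V j w) /\ (forall i, i \in s -> ~ V i w)].
  apply/seteqP; split => w /=.
    by move=> [[H1 H2] Vi]; split => // j; rewrite !inE => /predU1P[->|/H1].
  move=> [H1 H2]; split; last by apply: H1; rewrite !inE eqxx.
  by split => // j jJ; apply: H1; rewrite !inE jJ orbT.
rewrite IH//; last first.
  by move=> j js; rewrite !inE negb_or nJ' ?andbT//; apply: contraNneq is_ => <-.
have -> : [set w | (forall i, i \in J -> V i w) /\ (forall i, i \in s -> ~ V i w)] `\` V i =
   [set w | (forall j, j \in J -> V j w) /\ (forall j, j \in i :: s -> ~ V j w)].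
  apply/seteqP; split => w /=.
    by move=> [[H1 H2] Vi]; split => // j; rewrite inE => /predU1P[->|/H2].
  move=> [H1 H2]; split; last by apply: H2; rewrite mem_head.
  by split => // j js; apply: H2; rewrite inE js orbT.
rewrite big_setU1//= => e; rewrite big_cons.
by apply: (addrI (p i * \prod_(i in J) p i * \prod_(i <- s) (1 - p i))); rewrite -e; ring.
Qed.

Definition pattern (w : Omega) : {ffun I -> bool} := [ffun i => `[< V i w >]].

Definition pattern_weight (x : {ffun I -> bool}) : R :=
  \prod_i (if x i then p i else 1 - p i).

Lemma pr_pattern x : measurable (pattern @^-1` [set x]) /\
  pr (pattern @^-1` [set x]) = pattern_weight x.
Proof.
pose J := [set i | x i]%SET; pose s := enum (~: J).
have E : pattern @^-1` [set x] =
    [set w | (forall i, i \in J -> V i w) /\ (forall i, i \in [set i in s]%SET -> (~` V i) w)].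
  apply/seteqP; split => w /=.
    move=> xE; split => i; rewrite !inE ?mem_enum ?inE -xE ffunE; first by move/asboolP.
    by move/asboolPn.
  move=> [H1 H2]; apply/ffunP => i; rewrite ffunE; case xi: (x i).
    by apply/asboolP; apply: H1; rewrite inE.
  by apply/asboolPn; apply: H2; rewrite !inE mem_enum !inE xi.
split.
  rewrite E (_ : [set w | _] = [set w | forall i, i \in J -> V i w] `&`
     [set w | forall i, i \in [set i in s]%SET -> (~` V i) w]).
    by apply: measurableI; apply: measurable_forall => // i; exact: measurableC.
  by apply/seteqP; split => w /= [].
rewrite E (_ : [set w | _] =
  [set w | (forall i, i \in J -> V i w) /\ (forall i, i \in s -> ~ V i w)]); last first.
  by apply/seteqP; split => w /= [H1 H2]; split => // i; [have := H2 i; rewrite inE|rewrite inE; exact: H2].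
rewrite pr_void_nonvoid ?enum_uniq//; last by move=> i; rewrite mem_enum inE.
rewrite /s big_enum_cond /pattern_weight [RHS](bigID (fun i => x i)) /=; congr (_ * _).
  by apply: eq_big => [i|i]; rewrite inE // => ->.
by apply: eq_big => [i|i]; rewrite !inE andbT // => /negPf ->.
Qed.

Lemma pr_pattern_in (Q : pred {ffun I -> bool}) : measurable [set w | Q (pattern w)] /\
  pr [set w | Q (pattern w)] = \sum_(x | Q x) pattern_weight x.
Proof.
have [m e] := pr_partition Q (fun x => (pr_pattern x).1); split => //.
by rewrite e; apply: eq_bigr => x _; exact: (pr_pattern x).2.
Qed.

End product_law.
End probability_reals.

Lemma measure_bigsetU_seq d (T : measurableType d) (R : realType)
    (nu : {measure set T -> \bar R}) (I : finType) (s : seq I) (D : I -> set T) :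
  uniq s -> (forall i, measurable (D i)) -> (forall i j, i != j -> D i `&` D j = set0) ->
  nu (\big[setU/set0]_(i <- s) D i) = (\sum_(i <- s) nu (D i))%E.
Proof.
move=> + mD dD; elim: s => [_|i s IH /= /andP[is_ us]]; first by rewrite !big_nil measure0.
rewrite [in LHS]big_cons [in RHS]big_cons measureU.
- by congr (_ + _)%E; exact: IH.
- exact: mD.
- by apply: bigsetU_measurable.
rewrite -bigcup_seq; apply/seteqP; split => // z [Di [j /= js Dj]].
have ij : i != j by apply: contraNneq is_ => ->.
by have /seteqP[+ _] := dD _ _ ij; move=> /(_ z); apply.
Qed.

Section block_independence.
Context {d} {Omega : measurableType d} {R : realType} (P : probability Omega R).
Variables (T K : finType) (V : T * K -> set Omega) (p : T * K -> R).
Local Open Scope ring_scope.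
Hypothesis mV : forall i, measurable (V i).
Hypothesis pV : forall J : {set T * K}, pr P [set w | forall i, i \in J -> V i w] = \prod_(i in J) p i.

(** When [V] records the void pieces of a subdivision, this is the number of occupied pieces of the
    cell t; it is the count of t as soon as no piece holds two points. *)
Definition nonvoid_count (t : T) (w : Omega) : nat := \sum_(k : K) ~~ `[< V (t, k) w >].

Lemma measurable_nonvoid (n : T -> nat) : measurable [set w | forall t, nonvoid_count t w = n t].
Proof.
have [m _] := pr_pattern_in mV pV (fun x => [forall t, \sum_(k : K) ~~ x (t, k) == n t]%N).
rewrite (_ : [set w | _] = [set w | [forall t, \sum_(k : K) ~~ pattern V w (t, k) == n t]%N])//.
apply/seteqP; split => w /=.
  move=> H; apply/forallP => t; rewrite -(H t); apply/eqP; apply: eq_bigr => k _.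
  by rewrite ffunE.
move/forallP => H t; rewrite -(eqP (H t)); apply: eq_bigr => k _; by rewrite ffunE.
Qed.

Lemma measurable_nonvoid1 t (m : nat) : measurable [set w | nonvoid_count t w = m].
Proof.
have [mQ _] := pr_pattern_in mV pV (fun x => \sum_(k : K) ~~ x (t, k) == m)%N.
rewrite (_ : [set w | _] = [set w | (\sum_(k : K) ~~ pattern V w (t, k) == m)%N])//.
have E w : nonvoid_count t w = (\sum_(k : K) ~~ pattern V w (t, k))%N.
  by apply: eq_bigr => k _; rewrite ffunE.
by apply/seteqP; split => w /=; rewrite E => /eqP.
Qed.

(** The probability of a pattern of void and occupied pieces is a product over [T * K]; summing over
    the patterns with prescribed numbers, the product over T distributes over the sums. *)
Lemma pr_blocks (n : T -> nat) :
  pr P [set w | forall t, nonvoid_count t w = n t] =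
  \prod_t pr P [set w | nonvoid_count t w = n t].
Proof.
pose f t (y : {ffun K -> bool}) := \prod_k (if y k then p (t, k) else 1 - p (t, k)).
pose q t (y : {ffun K -> bool}) := (\sum_(k : K) ~~ y k == n t)%N.
have one t : pr P [set w | nonvoid_count t w = n t] = \sum_(y | q t y) f t y.
  have mVt k : measurable (V (t, k)) by [].
  have pVt (J : {set K}) : pr P [set w | forall k, k \in J -> V (t, k) w] = \prod_(k in J) p (t, k).
    transitivity (pr P [set w | forall i, i \in [set (t, k) | k in J]%SET -> V i w]).
      congr pr; apply/seteqP; split => w /= H; first by move=> i /imsetP[k kJ ->]; exact: H.
      by move=> k kJ; apply: H; apply: imset_f.
    rewrite pV big_imset//= => k k' _ _ [] //.
  have [_ <-] := pr_pattern_in mVt pVt (q t).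
  congr pr; apply/seteqP; split => w /=; rewrite /q /nonvoid_count.
    by move=> <-; apply/eqP; apply: eq_bigr => k _; rewrite ffunE.
  by move/eqP => <-; apply: eq_bigr => k _; rewrite ffunE.
under [RHS]eq_bigr do rewrite one big_mkcond.
rewrite bigA_distr_bigA /=.
have [_ e] := pr_pattern_in mV pV (fun x => [forall t, \sum_(k : K) ~~ x (t, k) == n t]%N).
transitivity (pr P [set w | [forall t, \sum_(k : K) ~~ pattern V w (t, k) == n t]%N]).
  congr pr; apply/seteqP; split => w /=.
    move=> H; apply/forallP => t; rewrite -(H t); apply/eqP; apply: eq_bigr => k _.
    by rewrite ffunE.
  move/forallP => H t; rewrite -(eqP (H t)); apply: eq_bigr => k _; by rewrite ffunE.
rewrite e big_mkcond /=.
rewrite (reindex (fun y : {ffun T -> {ffun K -> bool}} => [ffun i : T * K => y i.1 i.2])) /=; last first.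
  exists (fun x : {ffun T * K -> bool} => [ffun t => [ffun k => x (t, k)]]) => [y _|x _].
    by apply/ffunP => t; apply/ffunP => k; rewrite !ffunE.
  by apply/ffunP => -[t k]; rewrite !ffunE.
apply: eq_bigr => y _.
have -> : [forall t, \sum_(k : K) ~~ [ffun i : T * K => y i.1 i.2] (t, k) == n t]%N =
    [forall t, q t (y t)].
  by apply: eq_forallb => t; rewrite /q; congr (_ == _); apply: eq_bigr => k _; rewrite ffunE.
have -> : pattern_weight p [ffun i : T * K => y i.1 i.2] = \prod_t f t (y t).
  rewrite /pattern_weight /f pair_big; apply: eq_bigr => -[t k] _ /=; by rewrite ffunE.
case: ifPn => [/forallP H|/forallPn[t nt]].
  by apply: eq_bigr => t _; rewrite H.
by rewrite (bigD1 t)//= (negPf nt) mul0r.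
Qed.

End block_independence.

(** * Meshes shrinking to points *)

Section mesh.
Context {d} {Z : measurableType d} {R : realType} (mu : {measure set Z -> \bar R}).
Variable g : Z -> R.
Hypotheses (mg : measurable_fun setT g) (gi : injective g).
Hypothesis mu_atom : no_atoms mu.
Local Open Scope ring_scope.

(** Two points share a code when no rational of index less than m in the enumeration by [pickle]
    separates their images under g. Since g is injective, fine enough codes separate any two
    points. *)
Definition mesh_code (m : nat) (z : Z) : {ffun 'I_m -> bool} :=
  [ffun i : 'I_m => if unpickle i is Some r then g z < ratr r else false].

Lemma measurable_mesh_code m x : measurable (mesh_code m @^-1` [set x]).
Proof.
rewrite (_ : _ @^-1` _ = \bigcap_(i in [set: 'I_m])
    ((fun z => if unpickle i is Some r then g z < ratr r else false) @^-1` [set x i])); last first.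
  apply/seteqP; split => z /=; first by move=> <- i _ /=; rewrite ffunE.
  by move=> H; apply/ffunP => i; rewrite ffunE; exact: H.
apply: fin_bigcap_measurable => // i _; rewrite -[X in measurable X]setTI.
case: (unpickle i) => [r|].
  have : measurable_fun setT (fun z => g z < ratr r) by apply: measurable_fun_ltr.
  by apply.
by have : measurable_fun setT (fun _ : Z => false) by []; apply.
Qed.

Lemma mesh_code_pickle (r : rat) y z :
  mesh_code (pickle r).+1 y = mesh_code (pickle r).+1 z -> (g y < ratr r) = (g z < ratr r).
Proof.
move=> /ffunP/(_ ord_max); rewrite !ffunE.
by have -> : unpickle (@ord_max (pickle r) : nat) = Some r := pickleK r.
Qed.

Variable C : set Z.
Hypotheses (mC : measurable C) (muC : (mu C < +oo)%E).

Definition mesh_cell m x : set Z := C `&` mesh_code m @^-1` [set x].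
Arguments mesh_cell : clear implicits.

Lemma measurable_mesh_cell m x : measurable (mesh_cell m x).
Proof. by apply: measurableI => //; exact: measurable_mesh_code. Qed.

Lemma mesh_cell_fin m x : (mu (mesh_cell m x) < +oo)%E.
Proof.
apply: le_lt_trans muC; rewrite le_measure ?inE//; last exact: subIsetl.
exact: measurable_mesh_cell.
Qed.

Lemma mesh_cell_disjoint m x y : x != y -> mesh_cell m x `&` mesh_cell m y = set0.
Proof. by move=> xy; apply/seteqP; split => // z [[_ /= ex] [_ /= ey]]; move: xy; rewrite -ex -ey eqxx. Qed.

Lemma mesh_cell_cover m : C = \big[setU/set0]_(x : {ffun 'I_m -> bool}) mesh_cell m x.
Proof.
rewrite -bigcup_seq; apply/seteqP; split => [z Cz|z [x _ []]//].
by exists (mesh_code m z) => //=; rewrite mem_index_enum.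
Qed.

(** The cells of z decrease to [[set z]], a null set in the absence of atoms. *)
Lemma mesh_cell_cvg z : C z -> (mu (mesh_cell m (mesh_code m z))) @[m --> \oo] --> (0 : \bar R).
Proof.
move=> Cz; pose D m := mesh_cell m (mesh_code m z).
have -> : 0%E = mu (\bigcap_m D m).
  rewrite (_ : \bigcap_m _ = [set z]) ?mu_atom//.
  apply/seteqP; split => [y /= H|y -> m _] //.
  apply: gi; apply/eqP; apply: contrapT => /negP; rewrite neq_lt => /orP[] yz;
    have [r] := rat_in_itvoo yz; rewrite in_itv/= => /andP[r1 r2];
    have [_ /mesh_code_pickle] := H (pickle r).+1 I.
  - by rewrite r1 => /esym; rewrite ltNge (ltW r2).
  - by rewrite r1 ltNge (ltW r2).
apply: nonincreasing_cvg_mu.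
- exact: mesh_cell_fin.
- by move=> m; exact: measurable_mesh_cell.
- by apply: bigcap_measurable => // m _; exact: measurable_mesh_cell.
- apply/nonincreasing_seqP => m; apply/subsetPset => y [Cy /= /ffunP e]; split => //=.
  apply/ffunP => i; have := e (widen_ord (leqnSn m) i); by rewrite !ffunE.
Qed.

Lemma mesh_sum_sqr m :
  (\int[mu]_(z in C) mu (mesh_cell m (mesh_code m z)) =
   \sum_(x : {ffun 'I_m -> bool}) mu (mesh_cell m x) * mu (mesh_cell m x))%E.
Proof.
transitivity (\int[mu]_(z in C) \sum_(x : {ffun 'I_m -> bool})
   (mu (mesh_cell m x) * (\1_(mesh_cell m x) z)%:E))%E.
  apply: eq_integral => z; rewrite inE => Cz; rewrite (bigD1 (mesh_code m z))//= big1.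
    by rewrite adde0 indicE mem_set ?mule1.
  move=> x xz; rewrite indicE memNset ?mule0// => -[_ /= e].
  by rewrite -e eqxx in xz.
rewrite ge0_integral_sum//.
- apply: eq_bigr => x _; rewrite ge0_integralZl//.
    rewrite integral_indic//; last exact: measurable_mesh_cell.
    by rewrite setIidl//; exact: subIsetl.
  by apply/measurable_EFinP; apply: measurable_indic; exact: measurable_mesh_cell.
- move=> x; apply: measurable_funeM; apply/measurable_EFinP; apply: measurable_indic.
  exact: measurable_mesh_cell.
Qed.

(** By [mesh_sum_sqr] the sum is the integral over C of the mass of the cell of z; this mass tends
    to 0 at each z and is dominated by [mu C]. *)
Lemma mesh_cvg :
  (\sum_(x : {ffun 'I_m -> bool}) mu (mesh_cell m x) * mu (mesh_cell m x))%E @[m --> \oo]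
  --> (0 : \bar R).
Proof.
under eq_fun do rewrite -mesh_sum_sqr.
have -> : 0%E = (\int[mu]_(z in C) (cst 0 z))%E by rewrite integral0.
have mf m : measurable_fun C (fun z => mu (mesh_cell m (mesh_code m z))).
  apply: measurable_funTS.
  rewrite (_ : (fun z => _) = (fun z => \sum_(x : {ffun 'I_m -> bool})
     (mu (mesh_cell m x) * (\1_(mesh_code m @^-1` [set x]) z)%:E)%E)).
    apply: emeasurable_sum => x; apply: measurable_funeM; apply/measurable_EFinP.
    by apply: measurable_indic; exact: measurable_mesh_code.
  apply/funext => z; rewrite (bigD1 (mesh_code m z))//= big1.
    by rewrite adde0 indicE mem_set ?mule1.
  move=> x xz; rewrite indicE memNset ?mule0// => /= e.
  by rewrite -e eqxx in xz.
apply: (@dominated_cvg _ _ _ mu _ mC _ _ (cst (mu C))) => //.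
- by move=> z Cz; exact: mesh_cell_cvg.
- by move=> z Cz /=; rewrite ge0_fin_numE.
- apply/integrableP; split => //; under eq_integral do rewrite /= gee0_abs//.
  by rewrite integral_cst// lte_mul_pinfty// ge0_fin_numE.
- move=> m z Cz /=; rewrite gee0_abs//; apply: le_measure; rewrite ?inE//.
    exact: measurable_mesh_cell.
  exact: subIsetl.
Qed.

End mesh.
Arguments mesh_cell {d Z R} g C {m} x.

(** * The joint law of the counts of disjoint sets *)

Section poisson_joint_law.
Context {d d'} {Z : measurableType d} {Omega : measurableType d'} {R : realType}.
Variables (P : probability Omega R) (mu : {measure set Z -> \bar R}) (eta : R.-ker Omega ~> Z).
Hypotheses (hZ : borel_space Z R) (hA : no_atoms mu) (hP : poisson_measure P mu eta).
Local Open Scope ring_scope.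

Definition pmass (l : R) (n : nat) : R := l ^+ n / n`!%:R * expR (- l).

Lemma poisson_prob1 l n : 0 <= l -> poisson_prob l 0 [set n] = (pmass l n)%:E.
Proof.
rewrite le_eqVlt => /predU1P[<-|l0].
  rewrite /poisson_prob ltxx /pmass oppr0 expR0 mulr1 /dirac indicE expr0n.
  case: n => [|n] /=; first by rewrite mem_set// divr1.
  by rewrite memNset//= mul0r.
rewrite /poisson_prob l0 esum_set1; last by rewrite lee_fin poisson_pmf_ge0.
by rewrite /poisson_pmf l0.
Qed.

Definition eta_eq (B : set Z) (n : nat) : set Omega := [set w | eta w B = n%:R%:E].

Lemma measurable_eta_eq B n : measurable B -> measurable (eta_eq B n).
Proof.
move=> mB; rewrite /eta_eq -[X in measurable X]setTI.
exact: (measurable_kernel eta B mB measurableT [set n%:R%:E] (emeasurable_set1 _)).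
Qed.

Lemma pr_eta_eq B n : measurable B -> (mu B < +oo)%E ->
  pr P (eta_eq B n) = pmass (fine (mu B)) n.
Proof.
move=> mB Boo; apply: EFin_inj; rewrite -prE; last exact: measurable_eta_eq.
by rewrite hP.1// poisson_prob1// fine_ge0.
Qed.

Lemma eta_nat B : measurable B -> (mu B < +oo)%E ->
  pr P [set w | exists n, eta w B = n%:R%:E] = 1.
Proof.
move=> mB Boo; rewrite /pr; apply: EFin_inj.
have -> : [set w | exists n, eta w B = n%:R%:E] = \bigcup_n eta_eq B n.
  by apply/seteqP; split => w /= [n]; [exists n|exists n].
have mb : measurable (\bigcup_n eta_eq B n).
  by apply: bigcup_measurable => n _; exact: measurable_eta_eq.
rewrite fineK ?fin_num_measure//.
rewrite measure_bigcup//=; last 2 first.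
- by move=> n _; exact: measurable_eta_eq.
- apply/trivIsetP => i j _ _ ij; apply/seteqP; split => // w.
  by rewrite /eta_eq /= => -[->] [] /eqP; rewrite eqr_nat (negPf ij).
have E : (poisson_prob (fine (mu B)) 0 [set: nat] = 1)%E by exact: probability_setT.
rewrite -E [X in poisson_prob _ _ X](_ : _ = \bigcup_n [set n]); last first.
  by apply/seteqP; split => // n _; exists n.
rewrite measure_bigcup//=; last by apply/trivIsetP => i j _ _ ij; apply/seteqP; split => // n [/= -> e]; rewrite e eqxx in ij.
by apply: eq_eseriesr => n _; rewrite hP.1.
Qed.

(** With l the mass of B, at most one point has probability (1 + l) exp(- l) >= (1 + l) (1 - l). *)
Lemma pr_many B : measurable B -> (mu B < +oo)%E ->
  pr P (~` (eta_eq B 0 `|` eta_eq B 1)) <= fine (mu B) ^+ 2.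
Proof.
move=> mB Boo; set l := fine (mu B); have l0 : 0 <= l by exact: fine_ge0.
have m0 := measurable_eta_eq 0 mB; have m1 := measurable_eta_eq 1 mB.
have mU := measurableU _ _ m0 m1.
have := prDI P measurableT mU; rewrite prT setTI setTD prU//; last first.
  by apply/seteqP; split => // w; rewrite /eta_eq /= => -[->] [] /eqP; rewrite eqr_nat.
rewrite !pr_eta_eq// -/l /pmass expr0 expr1 !divr1 mul1r => e.
have el : 1 - l <= expR (- l) by have := expR_ge1Dx (- l).
have : (1 + l) * (1 - l) <= (1 + l) * expR (- l) by rewrite ler_wpM2l// addr_ge0.
lra.
Qed.

Section cells.
Variables (T : finType) (C : T -> set Z).
Hypotheses (mC : forall t, measurable (C t)) (Coo : forall t, (mu (C t) < +oo)%E).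
Hypothesis disjC : forall s t, s != t -> C s `&` C t = set0.

Section refinement.
Variables (K : finType) (D : T * K -> set Z).
Hypotheses (mD : forall i, measurable (D i)) (Doo : forall i, (mu (D i) < +oo)%E).
Hypothesis disjD : forall t k k', k != k' -> D (t, k) `&` D (t, k') = set0.
Hypothesis CD : forall t, C t = \big[setU/set0]_k D (t, k).

Let V i := eta_eq (D i) 0.
Let p i := expR (- fine (mu (D i))).

Let disjT i j : i != j -> D i `&` D j = set0.
Proof.
case: i j => [s k] [t k'] /= ne; have [e|st] := eqVneq s t.
  by subst t; apply: disjD; apply: contraNneq ne => ->.
have sub (u : T) (l : K) : D (u, l) `<=` C u.
  by move=> z Dz; rewrite CD -bigcup_seq; exists l => //=; rewrite mem_index_enum.
have := disjC st; rewrite -!subset0 => H z [Dz Dz']; apply: (H z); split; [exact: sub Dz|exact: sub Dz'].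
Qed.

Let trivD (A : set (T * K)) : trivIset A D.
Proof. by apply/trivIsetP => i j _ _; exact: disjT. Qed.

(** The pieces of a family are all void exactly when their union is, and the count of the union has
    a given Poisson law; additivity of mu makes its void probability a product. *)
Let pV (J : {set T * K}) : pr P [set w | forall i, i \in J -> V i w] = \prod_(i in J) p i.
Proof.
pose B := \big[setU/set0]_(i in J) D i.
have mB : measurable B by apply: bigsetU_measurable.
have muB (nu : {measure set Z -> \bar R}) : nu B = (\sum_(i in J) nu (D i))%E.
  rewrite /B -[in RHS]big_enum -big_enum; apply: measure_bigsetU_seq => //.
  exact: enum_uniq.
have Boo : (mu B < +oo)%E by rewrite muB; apply/lte_sum_pinfty.
have -> : [set w | forall i, i \in J -> V i w] = eta_eq B 0.
  apply/seteqP; split => w /=; rewrite /V /eta_eq /= muB.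
    by move=> H; rewrite big1// => i iJ; rewrite (H i iJ).
  move=> e i iJ; apply/eqP; rewrite eq_le measure_ge0 andbT -[leRHS]e (bigD1 i)//=.
  by rewrite leeDl// sume_ge0.
rewrite pr_eta_eq// /pmass expr0 divr1 mul1r muB.
have -> : fine (\sum_(i in J) mu (D i))%E = \sum_(i in J) fine (mu (D i)).
  by rewrite sum_fine// => i _; rewrite ge0_fin_numE.
by rewrite -sumrN expR_sum.
Qed.

Let mV i : measurable (V i). Proof. exact: measurable_eta_eq. Qed.

Definition bad : set Omega := [set w | exists2 i, predT i & (~` (eta_eq (D i) 0 `|` eta_eq (D i) 1)) w].

Let mbad : measurable bad.
Proof.
rewrite /bad (_ : [set w | _] = \bigcup_(i in [set: T * K]) (~` (eta_eq (D i) 0 `|` eta_eq (D i) 1))).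
  by apply: fin_bigcup_measurable => // i _; apply: measurableC; apply: measurableU; exact: measurable_eta_eq.
by apply/seteqP; split => w /= [i]; exists i.
Qed.

Let pbad : pr P bad <= \sum_i fine (mu (D i)) ^+ 2.
Proof.
apply: le_trans (pr_fin_le P _ _) _.
  by move=> i; apply: measurableC; apply: measurableU; exact: measurable_eta_eq.
by apply: ler_sum => i _; exact: pr_many.
Qed.

Let good w t : ~ bad w -> eta w (C t) = (nonvoid_count V t w)%:R%:E.
Proof.
move=> nb; rewrite CD.
have -> : eta w (\big[setU/set0]_k D (t, k)) = (\sum_k eta w (D (t, k)))%E.
  apply: measure_bigsetU_seq => //; first exact: index_enum_uniq.
  exact: disjD.
rewrite /nonvoid_count natr_sum -sumEFin; apply: eq_bigr => k _.
have : (eta_eq (D (t, k)) 0 `|` eta_eq (D (t, k)) 1) w.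
  by apply: contrapT => H; apply: nb; exists (t, k).
case => e; rewrite e.
  by rewrite (_ : `[< V (t, k) w >] = true)//; apply/asboolP.
rewrite (_ : `[< V (t, k) w >] = false)//; apply/asboolPn; rewrite /V /eta_eq /= => e'.
by move: e; rewrite /eta_eq /= e' => -[] /eqP; rewrite eqr_nat.
Qed.

(** Outside [bad] the counts are the numbers of occupied pieces, which are exactly independent. One
    [pr P bad] is lost in replacing the joint event and one for each marginal law, whence the factor
    [1 + #|T|%:R]. *)
Lemma joint_law_approx (n : T -> nat) :
  `|pr P [set w | forall t, eta w (C t) = (n t)%:R%:E] - \prod_t pmass (fine (mu (C t))) (n t)| <=
  (1 + #|T|%:R) * \sum_i fine (mu (D i)) ^+ 2.
Proof.
have close (A B : set Omega) : measurable A -> measurable B ->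
    (forall w, ~ bad w -> A w <-> B w) -> `|pr P A - pr P B| <= pr P bad.
  move=> mA mB AB; wlog le : A B mA mB AB / pr P B <= pr P A.
    move=> W; case/orP: (le_total (pr P B) (pr P A)) => H; first exact: W.
    by rewrite distrC; apply: W => // w /AB[]; split.
  rewrite ger0_norm ?subr_ge0// lerBlDr.
  apply: le_trans (prU_le P mbad mB); apply: pr_le => //; first exact: measurableU.
  move=> w Aw; have [bw|nb] := pselect (bad w); [by left|right].
  by apply/(AB w nb).
have mN (S : {set T}) (m : T -> nat) : measurable [set w | forall t, t \in S -> eta w (C t) = (m t)%:R%:E].
  by apply: (measurable_forall S (W := fun t => eta_eq (C t) (m t))) => t; exact: measurable_eta_eq.
have natE (a b : nat) : a%:R%:E = b%:R%:E :> \bar R <-> a = b.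
  by split => [[] /eqP|->//]; rewrite eqr_nat => /eqP.
have B0 := pr_ge0 P bad.
have s1 : `|pr P [set w | forall t, eta w (C t) = (n t)%:R%:E] -
     pr P [set w | forall t, nonvoid_count V t w = n t]| <= pr P bad.
  apply: close.
  - by rewrite (_ : [set w | _] = [set w | forall t, t \in [set: T]%SET -> eta w (C t) = (n t)%:R%:E])//;
      apply/seteqP; split => w /= H t => [_|]; apply: H; rewrite ?inE.
  - exact: (measurable_nonvoid mV pV).
  - by move=> w nb; split => H t; [apply/natE; rewrite -good|rewrite good// H].
have s2 t : `|pr P [set w | nonvoid_count V t w = n t] - pmass (fine (mu (C t))) (n t)| <= pr P bad.
  rewrite -pr_eta_eq//; apply: close.
  - exact: (measurable_nonvoid1 mV pV).
  - exact: measurable_eta_eq.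
  - by move=> w nb; rewrite /eta_eq /= good//; split => [->|/natE].
rewrite (pr_blocks mV pV) in s1.
have s3 : `|\prod_t pr P [set w | nonvoid_count V t w = n t] - \prod_t pmass (fine (mu (C t))) (n t)| <=
    #|T|%:R * pr P bad.
  have pm1 t : 0 <= pmass (fine (mu (C t))) (n t) <= 1.
    rewrite -pr_eta_eq// pr_ge0 pr_le1//; exact: measurable_eta_eq.
  have mnv t : measurable [set w | nonvoid_count V t w = n t] by exact: (measurable_nonvoid1 mV pV).
  have gen (s : seq T) (u v : T -> R) : (forall t, 0 <= u t <= 1) -> (forall t, 0 <= v t <= 1) ->
      (forall t, `|u t - v t| <= pr P bad) ->
      `|\prod_(t <- s) u t - \prod_(t <- s) v t| <= (size s)%:R * pr P bad.
    move=> u1 v1 uv; elim: s => [|t s IH]; first by rewrite !big_nil subrr normr0 mul0r.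
    rewrite !big_cons [X in `|X|](_ : _ = (u t - v t) * \prod_(t <- s) u t +
      v t * (\prod_(t <- s) u t - \prod_(t <- s) v t)); last by ring.
    rewrite /= -[in leRHS]natr1 [leRHS]mulrDl mul1r [leRHS]addrC (le_trans (ler_normD _ _))// lerD//.
      rewrite normrM -[leRHS]mulr1 ler_pM//.
      rewrite ger0_norm; first by apply: prodr_ile1 => i _; exact: u1.
      by apply: prodr_ge0 => i _; have /andP[] := u1 i.
    rewrite normrM ger0_norm; last by have /andP[] := v1 t.
    by apply: le_trans IH; rewrite ler_piMl//; have /andP[] := v1 t.
  rewrite cardE; have := gen (enum T) _ _ _ _ s2; rewrite !big_enum; apply => //.
  by move=> t; rewrite pr_ge0 pr_le1.
apply: (@le_trans _ _ ((1 + #|T|%:R) * pr P bad)); last first.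
  by rewrite ler_wpM2l// addr_ge0.
rewrite mulrDl mul1r; apply: le_trans (lerD s1 s3).
by rewrite -[X in `|X|](subrKA (\prod_t pr P [set w | nonvoid_count V t w = n t])) ler_normD.
Qed.

End refinement.

Lemma joint_law (n : T -> nat) :
  pr P [set w | forall t, eta w (C t) = (n t)%:R%:E] = \prod_t pmass (fine (mu (C t))) (n t).
Proof.
have [g [mg gi _]] := hZ.
pose D m (i : T * {ffun 'I_m -> bool}) := mesh_cell g (C i.1) i.2.
have H m : `|pr P [set w | forall t, eta w (C t) = (n t)%:R%:E] - \prod_t pmass (fine (mu (C t))) (n t)| <=
    (1 + #|T|%:R) * \sum_i fine (mu (D m i)) ^+ 2.
  apply: joint_law_approx => [i|i|t k k' kk'|t].
  - exact: measurable_mesh_cell.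
  - exact: mesh_cell_fin.
  - exact: mesh_cell_disjoint.
  - exact: mesh_cell_cover.
apply/eqP; rewrite -subr_eq0 -normr_eq0; apply/eqP/le_anti; rewrite normr_ge0 andbT.
have E m : \sum_i fine (mu (D m i)) ^+ 2 =
    \sum_t fine (\sum_(x : {ffun 'I_m -> bool}) mu (mesh_cell g (C t) x) * mu (mesh_cell g (C t) x))%E.
  rewrite -(pair_bigA _ (fun t x => fine (mu (mesh_cell g (C t) x)) ^+ 2)) /=.
  have mf t x : mu (@mesh_cell _ _ _ g (C t) m x) \is a fin_num.
    by rewrite ge0_fin_numE//; exact: mesh_cell_fin.
  apply: eq_bigr => t _; rewrite -sum_fine; last by move=> x _; rewrite fin_numM.
  by apply: eq_bigr => x _; rewrite fineM// expr2.
have S0 (ts : seq T) : \sum_(t <- ts) fine (\sum_(x : {ffun 'I_m -> bool})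
    mu (mesh_cell g (C t) x) * mu (mesh_cell g (C t) x))%E @[m --> \oo] --> (0 : R).
  elim: ts => [|t ts IH].
    rewrite (_ : (fun m => _) = cst 0); first exact: cvg_cst.
    by apply/funext => m; rewrite big_nil.
  pose a m := fine (\sum_(x : {ffun 'I_m -> bool})
    mu (mesh_cell g (C t) x) * mu (mesh_cell g (C t) x))%E.
  have ca : a m @[m --> \oo] --> (0 : R) by exact: (fine_cvg (mesh_cvg mg gi hA (mC t) (Coo t))).
  pose b m := \sum_(t <- ts) fine (\sum_(x : {ffun 'I_m -> bool})
    mu (mesh_cell g (C t) x) * mu (mesh_cell g (C t) x))%E.
  rewrite (_ : (fun m => _) = (fun m => a m + b m)); last by apply/funext => m; rewrite big_cons.
  by rewrite -(addr0 (0 : R)); exact: (cvgD ca IH).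
have lim : (1 + #|T|%:R) * \sum_i fine (mu (D m i)) ^+ 2 @[m --> \oo] --> (0 : R).
  rewrite -[X in _ --> X](mulr0 (1 + #|T|%:R)); apply: cvgM; first exact: cvg_cst.
  under eq_fun do rewrite E.
  exact: S0.
apply: (ler_cvg_to (cvg_cst _) lim); by near=> m; exact: H.
Unshelve. all: by end_near. Qed.

End cells.
End poisson_joint_law.

(** * Counts of finitely many cells and the Mecke identity *)

Section poisson_counts.
Context {d d'} {Z : measurableType d} {Omega : measurableType d'} {R : realType}.
Variables (P : probability Omega R) (mu : {measure set Z -> \bar R}) (eta : R.-ker Omega ~> Z).
Hypotheses (hZ : borel_space Z R) (hA : no_atoms mu) (hP : poisson_measure P mu eta).
Variables (T : finType) (C : T -> set Z).
Hypotheses (mC : forall t, measurable (C t)) (Coo : forall t, mu (C t) < +oo).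
Hypothesis disjC : forall s t, s != t -> C s `&` C t = set0.
Local Open Scope ring_scope.

Definition cell_mass (t : T) : R := fine (mu (C t)).
Notation lam := cell_mass.

Lemma cell_mass_ge0 t : 0 <= lam t. Proof. exact: fine_ge0. Qed.

(** Truncation makes the counts integers at every outcome; almost surely they are the values of eta
    ([counts_ae]), the Poisson law being carried by the integers. *)
Definition counts (w : Omega) : config T := [ffun t => Num.truncn (fine (eta w (C t)))].

Lemma fine_eta_ge0 w t : 0 <= fine (eta w (C t)).
Proof. exact: fine_ge0. Qed.

Lemma measurable_count t n : measurable [set w | counts w t = n].
Proof.
have mf : measurable_fun setT (fun w => fine (eta w (C t))).
  by apply: measurableT_comp => //; exact: (measurable_kernel eta _ (mC t)).
rewrite (_ : [set w | _] = (fun w => fine (eta w (C t))) @^-1` `[n%:R, n.+1%:R[%classic).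
  by rewrite -[X in measurable X]setTI; apply: mf.
apply/funext => w; apply/propext; rewrite /= ffunE in_itv /= -(truncn_eq _ (fine_eta_ge0 w t)).
by split => /eqP.
Qed.

Lemma measurable_counts (n : config T) : measurable [set w | counts w = n].
Proof.
rewrite (_ : [set w | _] = \bigcap_(t in [set: T]) [set w | counts w t = n t]).
  by apply: fin_bigcap_measurable => // t _; exact: measurable_count.
apply/seteqP; split => w /= H; last by apply/ffunP => t; exact: H.
by move=> t _ /=; rewrite H.
Qed.

Lemma measurable_counts_comp (g : config T -> R) : measurable_fun setT (fun w => g (counts w)).
Proof.
move=> _ Y mY; rewrite setTI.
rewrite (_ : _ @^-1` _ = \bigcup_(k in [set k | exists2 n, pickle n = k & Y (g n)])
   [set w | pickle (counts w) = k]).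
  apply: bigcup_measurable => k [n <- _].
  rewrite (_ : [set w | _] = [set w | counts w = n]); first exact: measurable_counts.
  apply/seteqP; split => w /=; last by move->.
  exact: (pcan_inj pickleK).
apply/seteqP; split => w /=; first by exists (pickle (counts w)) => //; exists (counts w).
by move=> [k [n nk Yn] /= e]; rewrite (pcan_inj pickleK (etrans e (esym nk))).
Qed.

Lemma counts_ae : {ae P, forall w, forall t, eta w (C t) = (counts w t)%:R%:E}.
Proof.
pose N t := ~` [set w | exists n, eta w (C t) = n%:R%:E].
have mE t : measurable [set w | exists n, eta w (C t) = n%:R%:E].
  rewrite (_ : [set w | _] = \bigcup_n eta_eq eta (C t) n).
    by apply: bigcup_measurable => n _; exact: measurable_eta_eq.
  by apply/seteqP; split => w /= [n]; [exists n|exists n].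
have N0 t : pr P (N t) = 0.
  have := prDI P measurableT (mE t); rewrite prT setTI setTD (eta_nat hP)//.
  by move/eqP; rewrite -subr_eq0 opprD addrA subrr add0r oppr_eq0 => /eqP.
have mN : measurable [set w | exists2 t, predT t & N t w].
  rewrite (_ : [set w | _] = \bigcup_(t in [set: T]) N t); last first.
    by apply/seteqP; split => w /= [t]; exists t.
  by apply: fin_bigcup_measurable => // t _; exact: measurableC.
exists [set w | exists2 t, predT t & N t w]; split => //.
  rewrite prE//; congr EFin; apply/le_anti; rewrite pr_ge0 andbT.
  by apply: le_trans (pr_fin_le P _ _) _ => [t|]; [exact: measurableC|rewrite big1].
move=> w /= nH; apply: contrapT => H; apply: nH => t; rewrite ffunE.
have [n ->] : [set w | exists n, eta w (C t) = n%:R%:E] w.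
  by apply: contrapT => Nw; apply: H; exists t.
by rewrite /= natrK.
Qed.

Lemma pr_counts (n : config T) : pr P [set w | counts w = n] = \prod_t pmass (lam t) (n t).
Proof.
rewrite -(joint_law hZ hA hP mC Coo disjC).
have mJ : measurable [set w | forall t, eta w (C t) = (n t)%:R%:E].
  rewrite (_ : [set w | _] = \bigcap_(t in [set: T]) eta_eq eta (C t) (n t)).
    by apply: fin_bigcap_measurable => // t _; exact: measurable_eta_eq.
  by apply/seteqP; split => w /= H t; [move=> _|]; exact: H.
have [N [mN N0 sN]] := counts_ae.
have prN : pr P N = 0 by rewrite /pr N0.
have key A B : measurable A -> measurable B ->
    (forall w, (forall t, eta w (C t) = (counts w t)%:R%:E) -> A w -> B w) -> pr P A <= pr P B.
  move=> mA mB AB; rewrite -[X in _ <= X]addr0 -prN; apply: le_trans (prU_le _ _ _) => //.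
  apply: pr_le => // [|w Aw]; first exact: measurableU.
  have [Nw|Nw] := pselect (N w); [by right|left].
  by apply: AB => //; apply: contrapT => H; apply: Nw; exact: sN.
apply/le_anti/andP; split; apply: key => //; [exact: measurable_counts| |exact: measurable_counts|].
  by move=> w H /= <-.
move=> w H /= e.
by apply/ffunP => t; have := e t; rewrite H => -[] /eqP; rewrite eqr_nat => /eqP.
Qed.

Lemma pmass_succ (l : R) m : m.+1%:R * pmass l m.+1 = l * pmass l m.
Proof.
rewrite /pmass factS natrM exprS; field; rewrite pnatr_eq0 -lt0n fact_gt0 /=.
by rewrite addrC natr1 pnatr_eq0.
Qed.

(** The recursion [pmass_succ] of the Poisson weights, at the coordinate t: this is the Mecke
    identity before summation over configurations. *)
Lemma pmass_add_point t n : (add_point t n t)%:R * \prod_s pmass (lam s) (add_point t n s) =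
  lam t * \prod_s pmass (lam s) (n s).
Proof.
have -> : add_point t n t = (n t).+1 by rewrite ffunE eqxx addn1.
rewrite (bigD1 t)// [in RHS](bigD1 t)// [LHS]mulrA [RHS]mulrA.
have -> : add_point t n t = (n t).+1 by rewrite ffunE eqxx addn1.
rewrite pmass_succ; congr (_ * _).
by apply: eq_bigr => s /negPf st; rewrite ffunE st addn0.
Qed.

Lemma ge0_integral_counts (g : config T -> R) : (forall n, 0 <= g n) ->
  (\int[P]_w (g (counts w))%:E =
  \esum_(n in [set: config T]) (g n * \prod_t pmass (lam t) (n t))%:E)%E.
Proof.
move=> g0.
pose F k := [set w | pickle (counts w) = k].
have FE n : F (pickle n) = [set w | counts w = n].
  apply/seteqP; split => w; first exact: (pcan_inj pickleK).
  by rewrite /F /= => e; rewrite e.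
have mF k : measurable (F k).
  have [[n <-]|nk] := pselect (exists n : config T, pickle n = k).
    by rewrite FE; exact: measurable_counts.
  rewrite (_ : F k = set0)//; apply/seteqP; split => // w /= e; apply: nk.
  by exists (counts w).
have mg := measurable_counts_comp g.
have UF : \bigcup_k F k = setT by apply/seteqP; split => // w _; exists (pickle (counts w)).
have tF : trivIset setT F by move=> i j _ _ [w [/= <- <-]].
rewrite -[X in (\int[P]_(_ in X) _)%E]UF ge0_integral_bigcup//; last 2 first.
- by rewrite UF; exact/measurable_EFinP.
- by move=> w _; rewrite lee_fin.
rewrite nneseries_esumT => [|k]; last by apply: integral_ge0 => w _; rewrite lee_fin.
transitivity (\esum_(k in range (@pickle (config T))) (\int[P]_(w in F k) (g (counts w))%:E)%E)%E.
  rewrite [RHS]esum_mkcond; apply: eq_esum => k _; case: ifPn => //.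
  rewrite notin_setE => nk; rewrite (_ : F k = set0) ?integral_set0//.
  by apply/seteqP; split => // w /= e; apply: nk; exists (counts w).
rewrite (reindex_esum setT _ (@pickle (config T))); last first.
  split; [by move=> n _; exists n| |by move=> n].
  by move=> n n' _ _; exact: (pcan_inj pickleK).
apply: eq_esum => n _; rewrite FE.
rewrite (eq_integral (fun=> (g n)%:E)); last by move=> w; rewrite inE /= => ->.
rewrite integral_cst; last exact: measurable_counts.
by rewrite EFinM -pr_counts; congr (_ * _)%E; exact: prE (measurable_counts n).
Qed.

Lemma ge0_mecke t (g : config T -> R) : (forall n, 0 <= g n) ->
  (\int[P]_w ((counts w t)%:R * g (counts w))%:E =
  (lam t)%:E * \int[P]_w (g (add_point t (counts w)))%:E)%E.
Proof.
move=> g0; have l0 := cell_mass_ge0 t.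
rewrite -ge0_integralZl_EFin//; last first.
- exact/measurable_EFinP/(measurable_counts_comp (fun n => g (add_point t n))).
- by move=> w _; rewrite lee_fin.
rewrite (@ge0_integral_counts (fun n => (n t)%:R * g n)) => [|n]; last by rewrite mulr_ge0.
under [RHS]eq_integral do rewrite -EFinM.
rewrite (@ge0_integral_counts (fun n => lam t * g (add_point t n))) => [|n]; last by rewrite mulr_ge0.
(* Configurations without a point in t contribute 0, and every other one is [add_point t] of a
   unique configuration. *)
transitivity (\esum_(n in range (@add_point T t)) ((n t)%:R * g n * \prod_t pmass (lam t) (n t))%:E)%E.
  rewrite [RHS]esum_mkcond; apply: eq_esum => n _; case: ifPn => //.
  rewrite notin_setE => nk; case nt: (n t) => [|m]; first by rewrite !mul0r.
  exfalso; apply: nk; exists [ffun s => (n s - (s == t))%N] => //.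
  apply/ffunP => s; rewrite !ffunE; case: eqP => [->|_]; last by rewrite subn0 addn0.
  by rewrite nt subn1 addn1.
rewrite (reindex_esum setT _ (@add_point T t)); last first.
  split; [by move=> n _; exists n| |by move=> n].
  by move=> n n' _ _ /ffunP e; apply/ffunP => s; have := e s; rewrite !ffunE => /addIn.
apply: eq_esum => n _; congr EFin.
by rewrite mulrAC pmass_add_point mulrAC.
Qed.

Let total (n : config T) : R := 1 + (\sum_t n t)%:R.

Let total_ge1 n : 1 <= total n. Proof. by rewrite lerDl. Qed.
Let total_ge0' n : 0 <= total n. Proof. exact: le_trans (total_ge1 n). Qed.

(** One power of the total is written as a sum of counts, and the Mecke identity removes each count
    at the price of an added point, which at most doubles the total. *)
Lemma total_moment m : (\int[P]_w (total (counts w) ^+ m)%:E < +oo)%E.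
Proof.
elim: m => [|m IH].
  under eq_integral do rewrite expr0.
  by rewrite integral_cst//= probability_setT mule1 ltry.
pose W n := total n ^+ m.
have W0 n : 0 <= W n by rewrite exprn_ge0.
have -> : (\int[P]_w (total (counts w) ^+ m.+1)%:E =
    \int[P]_w (W (counts w))%:E + \sum_t (\int[P]_w ((counts w t)%:R * W (counts w))%:E))%E.
  rewrite -(@ge0_integral_sum _ _ _ P _ measurableT _ (fun t w => ((counts w t)%:R * W (counts w))%:E)); first last.
  - by move=> t w _; rewrite lee_fin mulr_ge0.
  - by move=> t; exact/measurable_EFinP/(measurable_counts_comp (fun n => (n t)%:R * W n)).
  rewrite -ge0_integralD//; first last.
  - apply: emeasurable_sum => t; exact/measurable_EFinP/(measurable_counts_comp (fun n => (n t)%:R * W n)).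
  - by move=> w _; apply: sume_ge0 => t _; rewrite lee_fin mulr_ge0.
  - exact/measurable_EFinP/(measurable_counts_comp W).
  - by move=> w _; rewrite lee_fin.
  apply: eq_integral => w _; rewrite sumEFin -EFinD; congr EFin.
  by rewrite -mulr_suml -natr_sum exprS /W {1}/total mulrDl mul1r.
rewrite lte_add_pinfty//; apply/lte_sum_pinfty => t _.
rewrite ge0_mecke//; apply: lte_mul_pinfty; rewrite ?lee_fin ?cell_mass_ge0//.
apply: (@le_lt_trans _ _ (\int[P]_w ((2 ^+ m)%:E * (W (counts w))%:E))%E).
  apply: ge0_le_integral => //.
  - by move=> w _; rewrite lee_fin.
  - exact/measurable_EFinP/(measurable_counts_comp (fun n => W (add_point t n))).
  - under eq_fun do rewrite -EFinM.
    exact/measurable_EFinP/(measurable_counts_comp (fun n => 2 ^+ m * W n)).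
  move=> w _; rewrite -EFinM lee_fin /W -exprMn lerXn2r// ?nnegrE ?mulr_ge0//.
  have -> : total (add_point t (counts w)) = total (counts w) + 1.
    rewrite /total -addrA -[X in _ + (_ + X)]/(1%:R) -natrD; congr (_ + _%:R).
    under eq_bigr do rewrite ffunE.
    by rewrite big_split/=; congr addn; rewrite (bigD1 t)//= eqxx big1// => s /negPf ->.
  by rewrite mulr_natl mulr2n lerD2l.
rewrite ge0_integralZl_EFin//; first by apply: lte_mul_pinfty => //; rewrite lee_fin.
- by move=> w _; rewrite lee_fin.
- exact/measurable_EFinP/(measurable_counts_comp W).
Qed.

Lemma integrable_tame (g : config T -> R) : tame g -> P.-integrable setT (EFin \o (fun w => g (counts w))).
Proof.
move=> /tameP[K K0 [m H]]; apply/integrableP; split.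
  exact/measurable_EFinP/measurable_counts_comp.
apply: (@le_lt_trans _ _ (\int[P]_w (K%:E * (total (counts w) ^+ m)%:E))%E).
  apply: ge0_le_integral => //.
  - apply: measurableT_comp => //; exact/measurable_EFinP/measurable_counts_comp.
  - under eq_fun do rewrite -EFinM.
    exact/measurable_EFinP/(measurable_counts_comp (fun n => K * total n ^+ m)).
  by move=> w _; rewrite -EFinM /= lee_fin H.
rewrite ge0_integralZl_EFin//; first by apply: lte_mul_pinfty; rewrite ?lee_fin//; exact: total_moment.
- by move=> w _; rewrite lee_fin exprn_ge0.
- exact/measurable_EFinP/(measurable_counts_comp (fun n => total n ^+ m)).
Qed.

Definition mean_counts (g : config T -> R) : R := \int[P]_w g (counts w).

Lemma mean_countsE (g : config T -> R) : tame g ->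
  (mean_counts g)%:E = (\int[P]_w (g (counts w))%:E)%E.
Proof. by move=> tg; rewrite /mean_counts /Rintegral fineK//; exact: integrable_fin_num (integrable_tame tg). Qed.

Lemma mean_counts_linear a g h : tame g -> tame h ->
  mean_counts (fun n => a * g n + h n) = a * mean_counts g + mean_counts h.
Proof.
move=> tg th; apply: EFin_inj; rewrite EFinD EFinM !mean_countsE//; last first.
  by apply: tame_add => //; exact: tame_scale.
under eq_integral do rewrite EFinD EFinM.
rewrite integralD//=; [|exact: integrableZl (integrable_tame tg)|exact: integrable_tame].
by rewrite integralZl//; exact: integrable_tame.
Qed.

Lemma counts_poisson : poisson_functional lam mean_counts.
Proof.
split; first exact: mean_counts_linear.
- move=> g h tg th gh; rewrite -lee_fin !mean_countsE//.
  by apply: le_integral => //; [exact: integrable_tame tg|exact: integrable_tame th|move=> w _; rewrite lee_fin].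
- apply: EFin_inj; rewrite mean_countsE; last exact: (tame_cst _ 1).
  by rewrite integral_cst//= probability_setT mule1.
- have ge0 t g : tame g -> (forall n, 0 <= g n) ->
      mean_counts (fun n => (n t)%:R * g n) = lam t * mean_counts (fun n => g (add_point t n)).
    move=> tg g0; apply: EFin_inj; rewrite EFinM !mean_countsE ?ge0_mecke//.
      exact: tame_add_point.
    by apply: tame_mul => //; exact: tame_coord.
  (* The signed case follows by subtraction from the functions g + |g| and |g|, both nonnegative and
     tame. *)
  move=> t g tg; have tn := tame_norm tg.
  have tgn : tame (fun n => g n + `|g n|) by exact: tame_add.
  have := ge0 t _ tgn (fun n => _); have := ge0 t _ tn (fun n => normr_ge0 _).
  move=> e1 e2.
  have {e2} : mean_counts (fun n => (n t)%:R * (g n + `|g n|)) =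
      lam t * mean_counts (fun n => (g (add_point t n) + `|g (add_point t n)|)).
    by apply: e2 => n; rewrite -lerBlDr sub0r lerNnormlW.
  have tc := tame_mul (tame_coord R t).
  have -> : mean_counts (fun n => (n t)%:R * (g n + `|g n|)) =
      1 * mean_counts (fun n => (n t)%:R * g n) + mean_counts (fun n => (n t)%:R * `|g n|).
    by rewrite -mean_counts_linear; [congr mean_counts; apply/funext => n; rewrite mul1r mulrDr|exact: tc..].
  have ta := tame_add_point t tg; have tna := tame_add_point t tn.
  have -> : mean_counts (fun n => (g (add_point t n) + `|g (add_point t n)|)) =
      1 * mean_counts (fun n => g (add_point t n)) + mean_counts (fun n => `|g (add_point t n)|).
    by rewrite -mean_counts_linear//; congr mean_counts; apply/funext => n; rewrite mul1r.
  by rewrite e1 !mul1r mulrDr => /addIr.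
Qed.

End poisson_counts.

(** * Contractions and mixed norms of kernels *)

Section seq_kernels.
Context {d} {Z : measurableType d} {R : realType}.

(** Kernels are functions of sequences, of which only the restriction to length n is measured:
    concatenating blocks of variables then needs no cast between tuple types. *)
Definition mker {dY} {Y : measurableType dY} n (G : seq Z -> Y) :=
  measurable_fun setT (fun x : n.-tuple Z => G x).

Definition mseq {dW} {W : measurableType dW} n (phi : W -> seq Z) :=
  (forall w, size (phi w) = n) /\
  forall i, measurable_fun setT (fun w => nth point (phi w) i).

Lemma mker_comp {dY} {Y : measurableType dY} {dW} {W : measurableType dW} n (G : seq Z -> Y)
    (phi : W -> seq Z) : mker n G -> mseq n phi -> measurable_fun setT (fun w => G (phi w)).
Proof.
move=> mG [sz mphi].
pose psi w : n.-tuple Z := [tuple nth point (phi w) i | i < n].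
have mpsi : measurable_fun setT psi.
  apply/measurable_fun_tnthP => i; rewrite (_ : _ \o _ = fun w => nth point (phi w) i)//.
  by apply/funext => w /=; rewrite tnth_mktuple.
rewrite (_ : (fun w => _) = (fun x : n.-tuple Z => G x) \o psi); first exact: measurableT_comp.
apply/funext => w /=; congr G; apply: (@eq_from_nth _ point) => [|i].
  by rewrite size_map size_enum_ord.
rewrite sz => ilt; rewrite (nth_map (Ordinal ilt)) ?size_enum_ord//=.
by rewrite -[i in RHS]/(val (Ordinal ilt)) nth_enum_ord.
Qed.

Lemma mseq_tuple {dW} {W : measurableType dW} n (pi : W -> n.-tuple Z) :
  measurable_fun setT pi -> mseq n (fun w => tval (pi w)).
Proof.
move=> /measurable_fun_tnthP m; split => [w|i]; first by rewrite size_tuple.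
have [ilt|ige] := ltnP i n.
  by apply: eq_measurable_fun (m (Ordinal ilt)) => w _ /=; rewrite (tnth_nth point).
apply: eq_measurable_fun (measurable_cst point) => w _.
by rewrite nth_default// size_tuple.
Qed.

Lemma mseq_cons {dW} {W : measurableType dW} n (z : W -> Z) (phi : W -> seq Z) :
  measurable_fun setT z -> mseq n phi -> mseq n.+1 (fun w => z w :: phi w).
Proof.
move=> mz [sz m]; split => [w|i]; first by rewrite /= sz.
by case: i => [|i]; [exact: mz|exact: m].
Qed.

Lemma mseq_cat {dW} {W : measurableType dW} m n (phi psi : W -> seq Z) :
  mseq m phi -> mseq n psi -> mseq (m + n) (fun w => phi w ++ psi w).
Proof.
move=> [s1 m1] [s2 m2]; split => [w|i]; first by rewrite size_cat s1 s2.
have [il|il] := ltnP i m.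
  by apply: eq_measurable_fun (m1 i) => w _; rewrite nth_cat s1 il.
by apply: eq_measurable_fun (m2 (i - m)%N) => w _; rewrite nth_cat s1 ltnNge il.
Qed.

Lemma mseq_take {dW} {W : measurableType dW} k n (phi : W -> seq Z) :
  (k <= n)%N -> mseq n phi -> mseq k (fun w => take k (phi w)).
Proof.
move=> kn [s m]; split => [w|i]; first by rewrite size_take_min s; apply/minn_idPl.
have [il|il] := ltnP i k.
  by apply: eq_measurable_fun (m i) => w _; rewrite nth_take.
apply: eq_measurable_fun (measurable_cst point) => w _.
by rewrite nth_default// size_take_min s geq_min il.
Qed.

Lemma mseq_drop {dW} {W : measurableType dW} k n (phi : W -> seq Z) :
  mseq n phi -> mseq (n - k) (fun w => drop k (phi w)).
Proof.
move=> [s m]; split => [w|i]; first by rewrite size_drop s.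
by apply: eq_measurable_fun (m (k + i)%N) => w _; rewrite nth_drop.
Qed.

Lemma mseq_map_nth {dW} {W : measurableType dW} n (p : seq nat) (phi : W -> seq Z) :
  mseq n phi -> mseq (size p) (fun w => map (nth point (phi w)) p).
Proof.
move=> [s m]; split => [w|i]; first by rewrite size_map.
have [il|il] := ltnP i (size p).
  by apply: eq_measurable_fun (m (nth 0%N p i)) => w _; rewrite (nth_map 0%N).
apply: eq_measurable_fun (measurable_cst point) => w _.
by rewrite nth_default// size_map.
Qed.

Lemma mseq_id n : mseq n (fun x : n.-tuple Z => tval x).
Proof. exact: mseq_tuple. Qed.

Lemma measurable_sqe {dW} {W : measurableType dW} (f : W -> \bar R) :
  measurable_fun setT f -> measurable_fun setT (fun w => f w ^+ 2).
Proof.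
move=> mf; rewrite (_ : (fun w => _) = f \* f); first exact: emeasurable_funM.
by apply/funext => w; rewrite expe2.
Qed.

Lemma sqe_ge0 (x : \bar R) : 0 <= x ^+ 2.
Proof.
by rewrite expe2; case: (leP 0 x) => [|/ltW] x0; [exact: mule_ge0|exact: mule_le0].
Qed.

Variable mu : {sigma_finite_measure set Z -> \bar R}.
Notation pm := (power_measure mu).

Lemma measurable_integral {dW} {W : measurableType dW} {dV} {V : measurableType dV}
    (nu : {sigma_finite_measure set V -> \bar R}) (K : W -> V -> \bar R) :
  measurable_fun setT (fun p : W * V => K p.1 p.2) ->
  measurable_fun setT (fun w => \int[nu]_v K w v).
Proof.
move=> mK.
rewrite (_ : (fun w => _) = (fun w => \int[nu]_v (fun p : W * V => K p.1 p.2)^\+ (w, v) -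
   \int[nu]_v (fun p : W * V => K p.1 p.2)^\- (w, v))).
  apply: emeasurable_funB; apply: (measurable_fun_fubini_tonelli_F (m2 := nu)) => //.
  - exact: measurable_funepos.
  - exact: measurable_funeneg.
apply/funext => w; rewrite [LHS]integralE; congr (_ - _).
  by apply: eq_integral => v _; rewrite !funeposE.
by apply: eq_integral => v _; rewrite !funenegE.
Qed.

Lemma int_pm0 (G : seq Z -> \bar R) : mker 0 G -> \int[pm 0]_x G x = G [::].
Proof. by move=> mG; rewrite integral_dirac// diracT mul1e. Qed.

Lemma int_cons n (G : seq Z -> \bar R) : (forall x, 0 <= G x) -> mker n.+1 G ->
  \int[pm n.+1]_x G x = \int[mu]_z \int[pm n]_x G (z :: x).
Proof.
move=> G0 mG; rewrite /= ge0_integral_pushforward//; last exact: measurable_tuple_cons.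
rewrite preimage_setT fubini_tonelli1//.
  exact: (measurableT_comp mG (@measurable_tuple_cons _ _ n)).
by move=> [z x]; exact: G0.
Qed.

Lemma int_swap {dV dW} {V : measurableType dV} {W : measurableType dW}
    (nu : {sigma_finite_measure set V -> \bar R}) (nu' : {sigma_finite_measure set W -> \bar R})
    (K : V -> W -> \bar R) : measurable_fun setT (fun p : V * W => K p.1 p.2) ->
  (forall v w, 0 <= K v w) ->
  \int[nu]_v \int[nu']_w K v w = \int[nu']_w \int[nu]_v K v w.
Proof. by move=> mK K0; apply: (fubini_tonelli (fun p => K p.1 p.2)) => //= -[]. Qed.

Lemma int_cat m n (G : seq Z -> \bar R) : (forall x, 0 <= G x) -> mker (m + n) G ->
  \int[pm (m + n)]_x G x = \int[pm m]_x \int[pm n]_y G (x ++ y).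
Proof.
elim: m G => [|m IH] G G0 mG.
  rewrite (@int_pm0 (fun x => \int[pm n]_y G (x ++ y)))//.
  apply: (@measurable_integral _ _ _ _ (pm n) (fun (x : 0.-tuple Z) (y : n.-tuple Z) => G (x ++ y))).
  apply: mker_comp mG _; apply: mseq_cat; exact: mseq_tuple.
have mcons z : mker (m + n) (fun x => G (z :: x)).
  apply: mker_comp mG _; apply: mseq_cons => //; exact: mseq_id.
rewrite addSn int_cons//.
under eq_integral do rewrite (IH (fun x => G (_ :: x)))//.
rewrite (@int_cons m (fun x => \int[pm n]_y G (x ++ y)))// => [x|]; first exact: integral_ge0.
apply: (@measurable_integral _ _ _ _ (pm n) (fun (x : m.+1.-tuple Z) (y : n.-tuple Z) => G (x ++ y))).
apply: mker_comp mG _; apply: mseq_cat; exact: mseq_tuple.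
Qed.

Lemma int_cat_eq N m n (G : seq Z -> \bar R) : N = (m + n)%N -> (forall x, 0 <= G x) ->
  mker N G -> \int[pm N]_x G x = \int[pm m]_x \int[pm n]_y G (x ++ y).
Proof. by move=> -> *; exact: int_cat. Qed.

(* Permutation invariance, by removing the first variable z from its position
   in the permuted sequence and moving it back to the front by Tonelli. *)
Lemma int_perm n (p : seq nat) (G : seq Z -> \bar R) : perm_eq p (iota 0 n) ->
  (forall x, 0 <= G x) -> mker n G ->
  \int[pm n]_x G (map (nth point x) p) = \int[pm n]_x G x.
Proof.
elim: n p G => [|n IH] p G pp G0 mG.
  apply: eq_integral => x _; rewrite (tuple0 x).
  by have := perm_size pp; case: p {pp}.
have up : uniq p by rewrite (perm_uniq pp) iota_uniq.
have : 0%N \in p by rewrite (perm_mem pp) mem_iota.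
have sp := perm_size pp; rewrite size_iota in sp.
move=> /path.splitPr pE; case: pE pp up sp => a b pp up sp.
have ab0 i : i \in a ++ b -> i != 0%N.
  move: up; rewrite cat_uniq /= negb_or => /and3P[_ /andP[na _] /andP[nb _]].
  by apply: contraTneq => ->; rewrite mem_cat negb_or na nb.
pose q := map predn (a ++ b).
have sab : (size a + size b = n)%N by move: sp; rewrite size_cat /= addnS => -[].
have qq : perm_eq q (iota 0 n).
  have : perm_eq (0%N :: (a ++ b)) (iota 0 n.+1).
    by apply: perm_trans pp; rewrite -(cat1s _ b) perm_sym perm_catCA.
  rewrite [iota 0 n.+1]/= perm_cons => /(perm_map predn).
  by rewrite -/q (iotaDl 1 0) -map_comp map_id.
pose H z (u : seq Z) := G (take (size a) u ++ z :: drop (size a) u).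
have sr : size (a ++ 0%N :: b) = n.+1 by [].
have mHp : mker n.+1 (fun x => G (map (nth point x) (a ++ 0%N :: b))).
  apply: mker_comp mG _; rewrite -[X in mseq X]sr; apply: mseq_map_nth; exact: mseq_id.
have mseqH dW (W : measurableType dW) (z : W -> Z) phi psi : measurable_fun setT z ->
    mseq (size a) phi -> mseq (size b) psi -> mseq n.+1 (fun w => phi w ++ z w :: psi w).
  move=> mz m1 m2; rewrite -sab -addnS; apply: mseq_cat => //; exact: mseq_cons.
have mH z : mker n (H z).
  apply: mker_comp mG _; apply: mseqH => //.
    by apply: mseq_take (mseq_id n); rewrite -sab leq_addr.
  by have := mseq_drop (size a) (mseq_id n); rewrite -[X in (X - _)%N]sab addKn.
rewrite (@int_cons n (fun x => G (map (nth point x) (a ++ 0%N :: b))))//.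
transitivity (\int[mu]_z \int[pm n]_x H z x).
  apply: eq_integral => z _; rewrite -[RHS](IH q _ qq (fun=> G0 _) (mH z)).
  apply: eq_integral => x _.
  rewrite /H /q -map_comp !map_cat take_size_cat ?size_map// drop_size_cat ?size_map//.
  rewrite /=; congr (G (_ ++ _ :: _)); apply/eq_in_map => i ia /=.
    by have := ab0 i; rewrite mem_cat ia => /(_ isT); case: i {ia}.
  by have := ab0 i; rewrite mem_cat ia orbT => /(_ isT); case: i {ia}.
transitivity (\int[mu]_z \int[pm (size a)]_x \int[pm (size b)]_y G (x ++ z :: y)).
  apply: eq_integral => z _; rewrite (int_cat_eq (G := H z) (esym sab))//; last by move=> x; exact: G0.
  apply: eq_integral => x _; apply: eq_integral => y _.
  by rewrite /H take_size_cat ?size_tuple// drop_size_cat ?size_tuple.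
rewrite (@int_swap _ _ _ _ mu (pm (size a))
    (fun z (x : (size a).-tuple Z) => \int[pm (size b)]_y G (x ++ z :: y))); last first.
- by move=> z x; apply: integral_ge0 => y _; exact: G0.
- apply: (@measurable_integral _ _ _ _ (pm (size b))
    (fun (p : Z * (size a).-tuple Z) (y : (size b).-tuple Z) => G (p.2 ++ p.1 :: y))).
  apply: mker_comp mG _; apply: mseqH.
  + exact: (measurableT_comp measurable_fst measurable_fst).
  + apply: mseq_tuple; exact: (measurableT_comp measurable_snd measurable_fst).
  + apply: mseq_tuple; exact: measurable_snd.
have mG' : mker (size a + (size b).+1) G by rewrite addnS sab.
have e : n.+1 = (size a + (size b).+1)%N by rewrite addnS sab.
rewrite [RHS](int_cat_eq e)//; apply: eq_integral => x _.
rewrite (@int_cons _ (fun y => G (x ++ y)))//.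
apply: mker_comp mG' _; apply: mseq_cat; last exact: mseq_id.
by split => [w|i]; [rewrite size_tuple|exact: measurable_cst].
Qed.

End seq_kernels.

Section extended_reals.
Context {R : realType}.
Implicit Types x y z : \bar R.

Lemma sqe_le x y : 0 <= x -> x <= y -> x ^+ 2 <= y ^+ 2.
Proof. by move=> x0 xy; rewrite !expe2 lee_pmul. Qed.

Lemma sqe_abs x : `|x| ^+ 2 = x ^+ 2.
Proof.
rewrite !expe2; case: x => [r| |] //.
by rewrite abse_EFin -!EFinM -normrM ger0_norm// -expr2 sqr_ge0.
Qed.

Lemma poweR2 x : 0 <= x -> x `^ 2 = x ^+ 2.
Proof.
case: x => [r| |]// r0; rewrite expe2.
  by rewrite poweR_EFin -EFinM powR_mulrn// expr2.
by rewrite poweRyr// mulyy.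
Qed.

Lemma sqe_add3_le x y z : 0 <= x -> 0 <= y -> 0 <= z ->
  (x + y + z) ^+ 2 <= 3%:E * (x ^+ 2 + y ^+ 2 + z ^+ 2).
Proof.
move=> x0 y0 z0; have [/eqP|xyz] := eqVneq (x ^+ 2 + y ^+ 2 + z ^+ 2) +oo.
  by move/eqP ->; rewrite gt0_muley ?lte_fin// leey.
have nny w : 0 <= w :> \bar R -> w != -oo by case: w.
have q := @sqe_ge0 R.
case: x x0 xyz => [x| |]// x0; last by rewrite expe2 mulyy -addeA addye ?nny ?adde_ge0.
case: y y0 => [y| |]// y0; last by rewrite [+oo ^+ 2]expe2 mulyy addey ?addye ?nny.
case: z z0 => [z| |]// z0 _.
rewrite !expe2 lee_fin.
have := sqr_ge0 (x - y)%R; have := sqr_ge0 (x - z)%R; have := sqr_ge0 (y - z)%R.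
rewrite !expr2; nra.
Qed.

Lemma sqe_add2_le x y : 0 <= x -> 0 <= y ->
  (2%:E * x + 2%:E * y) ^+ 2 <= 8%:E * (x ^+ 2 + y ^+ 2).
Proof.
case: x => [x| |]//; case: y => [y| |]// => x0 y0;
  rewrite ?expe2 ?(gt0_muley, gt0_mulye) ?lte_fin//= ?(mulyy, addye, addey)//= ?(gt0_muley, gt0_mulye) ?lte_fin ?leey//.
rewrite -?(EFinM, EFinD) -?(EFinM, EFinD) -?(EFinM, EFinD) -?(EFinM, EFinD) lee_fin.
have := sqr_ge0 (x - y); rewrite !expr2; nra.
Qed.

Lemma mule_amgm x y (a : R) : 0 <= x -> 0 <= y -> (0 < a)%R ->
  x * y <= a%:E * x ^+ 2 + a^-1%:E * y ^+ 2.
Proof.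
have inf (r : R) : (0 < r)%R -> r%:E * (+oo ^+ 2) = +oo :> \bar R.
  by move=> r0; rewrite expe2 mulyy gt0_muley ?lte_fin.
case: x => [x| |]//; case: y => [y| |]// => x0 y0 a0; have ia0 : (0 < a^-1)%R by rewrite invr_gt0.
- rewrite !expe2 -!EFinM -EFinD lee_fin.
  have ->: (a * (x * x) + a^-1 * (y * y) = a * (x - a^-1 * y) ^+ 2 + 2 * (x * y))%R.
    by rewrite !expr2; field; rewrite gt_eqF.
  apply: (@ler_wpDl _ _ (a * _ ^+ 2)%R); first by rewrite mulr_ge0 ?sqr_ge0// ltW.
  by rewrite lee_fin in x0 y0; have := mulr_ge0 x0 y0; lra.
- by rewrite [X in _ + X]inf// addey ?leey// expe2 -!EFinM.
- by rewrite [X in X + _]inf// addye ?leey// expe2 -!EFinM.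
- by rewrite !inf// addye ?leey.
Qed.

End extended_reals.

Section integral_inequalities.
Context {d} {V : measurableType d} {R : realType} (nu : {measure set V -> \bar R}).
Variables a b : V -> R.
Hypotheses (ma : measurable_fun setT a) (mb : measurable_fun setT b).

Lemma integral_cauchy_schwarz :
  (\int[nu]_v `|a v * b v|%:E) ^+ 2 <= \int[nu]_v ((a v) ^+ 2)%:E * \int[nu]_v ((b v) ^+ 2)%:E.
Proof.
have h : (2^-1 + 2^-1 = 1 :> R)%R by lra.
have := @hoelder _ _ _ nu a b 2 2 ma mb (ltr0n _ _) (ltr0n _ _) h.
have e (c : V -> R) : ('N[nu]_2%:E[EFin \o c]) ^+ 2 = \int[nu]_v ((c v) ^+ 2)%:E.
  rewrite -poweR2 ?Lnorm_ge0// poweR_Lnorm//; apply: eq_integral => v _.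
  by rewrite poweR2 ?abse_ge0// sqe_abs expe2 /= -EFinM expr2.
rewrite -!e Lnorm1 => H; rewrite [X in _ <= X](_ : _ = ('N[nu]_2[EFin \o a] * 'N[nu]_2[EFin \o b]) ^+ 2); last by rewrite !expe2 muleACA.
by apply: sqe_le; [exact: integral_ge0|exact: H].
Qed.

(** No integrability is assumed: if a - b or b is not integrable, the right side is [+oo]. For b
    this uses the convention that a difference of two infinite parts is [-oo], of modulus [+oo]. *)
Lemma abse_integral_le :
  `|\int[nu]_v (a v)%:E| <= `|\int[nu]_v (b v)%:E| + \int[nu]_v `|a v - b v|%:E.
Proof.
have mab : measurable_fun setT (fun v => (a v - b v)%R) by exact: measurable_funB.
case: (ltP (\int[nu]_v `|a v - b v|%:E) +oo) => [foo|]; last first.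
  by rewrite leye_eq => /eqP ->; rewrite addey ?leey// gt_eqF// (lt_le_trans _ (abse_ge0 _)).
have iab : nu.-integrable setT (EFin \o (fun v => (a v - b v)%R)).
  by apply/integrableP; split => //; exact/measurable_EFinP.
have [ib|nib] := pselect (nu.-integrable setT (EFin \o b)).
  have -> : \int[nu]_v (a v)%:E = \int[nu]_v (b v)%:E + \int[nu]_v (a v - b v)%:E.
    rewrite -[RHS]integralD//; apply: eq_integral => v _.
    by rewrite -EFinD addrC subrK.
  apply: le_trans (lee_abs_add _ _) _; rewrite leeD2l//.
  exact: le_abse_integral (measurable_int _ iab).
suff -> : `|\int[nu]_v (b v)%:E| = +oo.
  by rewrite addye ?leey// gt_eqF// (lt_le_trans _ (integral_ge0 _ _)).
have mB : measurable_fun setT (EFin \o b) by exact/measurable_EFinP.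
have : \int[nu]_v `|(EFin \o b) v| = +oo.
  apply/eqP; rewrite -leye_eq leNgt; apply/negP => h; apply: nib.
  by apply/integrableP.
have -> : \int[nu]_v `|(EFin \o b) v| = \int[nu]_v (EFin \o b)^\+ v + \int[nu]_v (EFin \o b)^\- v.
  rewrite -ge0_integralD//; [|exact: measurable_funepos|exact: measurable_funeneg].
  by apply: eq_integral => v _; rewrite -/((abse \o (EFin \o b)) v) fune_abse.
rewrite [in X in _ -> X]integralE.
have := integral_ge0 (D := setT) nu (fun x _ => funepos_ge0 (EFin \o b) x).
have := integral_ge0 (D := setT) nu (fun x _ => funeneg_ge0 (EFin \o b) x).
by do 2 case: integral => [?| |]//.
Qed.

End integral_inequalities.

Section triple_integral.
Context {d1 d2 d3} {X : measurableType d1} {T : measurableType d2}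
  {S : measurableType d3} {R : realType} (m1 : {sigma_finite_measure set X -> \bar R})
  (m2 : {sigma_finite_measure set T -> \bar R}) (m3 : {sigma_finite_measure set S -> \bar R}).
Implicit Types K H : X * T * S -> \bar R.

Definition triple_integral K := \int[m1]_x \int[m2]_t \int[m3]_s K ((x, t), s).

Let mK3 K : measurable_fun setT K -> measurable_fun setT (fun p : X * T => \int[m3]_s K (p, s)).
Proof.
move=> mK; apply: (@measurable_integral _ _ _ _ _ m3 (fun p s => K (p, s))).
by apply: eq_measurable_fun mK => -[].
Qed.

Let mK2 K : measurable_fun setT K -> measurable_fun setT (fun x => \int[m2]_t \int[m3]_s K ((x, t), s)).
Proof.
move=> mK; apply: (@measurable_integral _ _ _ _ _ m2 (fun x t => \int[m3]_s K ((x, t), s))).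
by apply: eq_measurable_fun (mK3 mK) => -[].
Qed.

Let mKx K x : measurable_fun setT K -> measurable_fun setT (fun t => \int[m3]_s K ((x, t), s)).
Proof. by move=> /mK3; exact: measurable_fun_pair2. Qed.

Let mKxt K x t : measurable_fun setT K -> measurable_fun setT (fun s => K ((x, t), s)).
Proof. by move=> mK; exact: (measurable_fun_pair2 (x, t) mK). Qed.

Let K0s K x t : (forall w, 0 <= K w) -> 0 <= \int[m3]_s K ((x, t), s).
Proof. by move=> K0; exact: integral_ge0. Qed.

Let K0ts K x : (forall w, 0 <= K w) -> 0 <= \int[m2]_t \int[m3]_s K ((x, t), s).
Proof. by move=> K0; apply: integral_ge0 => t _; exact: K0s. Qed.

Lemma le_triple_integral K H : measurable_fun setT K -> measurable_fun setT H ->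
  (forall w, 0 <= K w) -> (forall w, K w <= H w) -> triple_integral K <= triple_integral H.
Proof.
move=> mK mH K0 KH; apply: ge0_le_integral => //; [by move=> x _; exact: K0ts|exact: mK2|exact: mK2|].
move=> x _; apply: ge0_le_integral => //; [by move=> t _; exact: K0s|exact: mKx|exact: mKx|].
by move=> t _; apply: ge0_le_integral => //; exact: mKxt.
Qed.

Lemma triple_integralD K H : measurable_fun setT K -> measurable_fun setT H ->
  (forall w, 0 <= K w) -> (forall w, 0 <= H w) ->
  triple_integral (fun w => K w + H w) = triple_integral K + triple_integral H.
Proof.
move=> mK mH K0 H0; rewrite /triple_integral -ge0_integralD//; first last.
- exact: mK2.
- by move=> x _; exact: K0ts.
- exact: mK2.
- by move=> x _; exact: K0ts.
apply: eq_integral => x _; rewrite -ge0_integralD//; first last.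
- exact: mKx.
- by move=> t _; exact: K0s.
- exact: mKx.
- by move=> t _; exact: K0s.
by apply: eq_integral => t _; rewrite ge0_integralD//; exact: mKxt.
Qed.

Lemma triple_integralZl (r : R) K : (0 <= r)%R -> measurable_fun setT K -> (forall w, 0 <= K w) ->
  triple_integral (fun w => r%:E * K w) = r%:E * triple_integral K.
Proof.
move=> r0 mK K0; rewrite /triple_integral -ge0_integralZl_EFin//; first last.
- exact: mK2.
- by move=> x _; exact: K0ts.
apply: eq_integral => x _; rewrite -ge0_integralZl_EFin//; first last.
- exact: mKx.
- by move=> t _; exact: K0s.
by apply: eq_integral => t _; rewrite ge0_integralZl_EFin//; exact: mKxt.
Qed.

End triple_integral.

(** * Contractions dominated by mixed norms *)

Section contractions.
Context {d} {Z : measurableType d} {R : realType}.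
Variable mu : {sigma_finite_measure set Z -> \bar R}.
Notation pm := (power_measure mu).
Implicit Types (f g u v : seq Z -> R) (l m b c : nat).

Definition inner f g l (x t s : seq Z) : \bar R :=
  \int[pm l]_z (f (z ++ x ++ t) * g (z ++ x ++ s))%:E.

Definition contraction_sqr f g l m b c : \bar R :=
  triple_integral (pm m) (pm b) (pm c) (fun w => (inner f g l w.1.1 w.1.2 w.2) ^+ 2).

Definition section_mass u l b (x : seq Z) : \bar R := \int[pm b]_t inner u u l x t t.

(** The fourth power of the norm of u in L^4 of the middle m variables with values in L^2 of the l +
    b others. *)
Definition mixed_norm u l m b : \bar R := \int[pm m]_x (section_mass u l b x) ^+ 2.

Lemma measurable_inner {dW} {W : measurableType dW} f g l m b c (x t s : W -> seq Z) :
  mker (l + (m + b)) f -> mker (l + (m + c)) g -> mseq m x -> mseq b t -> mseq c s ->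
  measurable_fun setT (fun w => inner f g l (x w) (t w) (s w)).
Proof.
move=> mf mg mx mt ms.
apply: (@measurable_integral _ _ _ _ _ (pm l)
  (fun w (z : l.-tuple Z) => (f (z ++ x w ++ t w) * g (z ++ x w ++ s w))%:E)).
have lift n (y : W -> seq Z) : mseq n y -> mseq n (fun p : W * l.-tuple Z => y p.1).
  by move=> [sy my]; split => [p|i]; [exact: sy|exact: (measurableT_comp (my i) measurable_fst)].
have mz : mseq l (fun p : W * l.-tuple Z => tval p.2) by apply: mseq_tuple; exact: measurable_snd.
apply/measurable_EFinP/measurable_funM.
- by apply: (mker_comp mf); apply: mseq_cat => //; apply: mseq_cat; exact: lift.
- by apply: (mker_comp mg); apply: mseq_cat => //; apply: mseq_cat; exact: lift.
Qed.

Lemma measurable_kernel_section f l m b (x t : seq Z) : mker (l + (m + b)) f ->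
  size x = m -> size t = b -> measurable_fun setT (fun z : l.-tuple Z => f (z ++ x ++ t)).
Proof.
move=> mf sx st; apply: (mker_comp mf); apply: mseq_cat; first exact: mseq_id.
by split => [_|i]; [rewrite size_cat sx st|exact: measurable_cst].
Qed.

Lemma inner_self_ge0 u l x t : 0 <= inner u u l x t t.
Proof. by apply: integral_ge0 => z _; rewrite lee_fin -expr2 sqr_ge0. Qed.

Lemma section_mass_ge0 u l b x : 0 <= section_mass u l b x.
Proof. by apply: integral_ge0 => t _; exact: inner_self_ge0. Qed.

Lemma mixed_norm_ge0 u l m b : 0 <= mixed_norm u l m b.
Proof. by apply: integral_ge0 => x _; exact: sqe_ge0. Qed.

Lemma contraction_sqr_ge0 f g l m b c : 0 <= contraction_sqr f g l m b c.
Proof. by do 3 (apply: integral_ge0 => ? _); exact: sqe_ge0. Qed.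

Lemma measurable_section_mass u l m b : mker (l + (m + b)) u ->
  measurable_fun setT (fun x : m.-tuple Z => section_mass u l b x).
Proof.
move=> mu'; apply: (@measurable_integral _ _ _ _ _ (pm b)
  (fun (x : m.-tuple Z) (t : b.-tuple Z) => inner u u l x t t)).
by apply: (measurable_inner mu' mu'); apply: mseq_tuple;
  [exact: measurable_fst|exact: measurable_snd|exact: measurable_snd].
Qed.

Section fixed_orders.
Variables l m b c : nat.
Local Notation W := ((m.-tuple Z * b.-tuple Z) * c.-tuple Z)%type.

Let mx : mseq m (fun w : W => tval w.1.1).
Proof. by apply: mseq_tuple; exact: (measurableT_comp measurable_fst measurable_fst). Qed.
Let mt : mseq b (fun w : W => tval w.1.2).
Proof. by apply: mseq_tuple; exact: (measurableT_comp measurable_snd measurable_fst). Qed.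
Let ms : mseq c (fun w : W => tval w.2).
Proof. by apply: mseq_tuple; exact: measurable_snd. Qed.

Lemma measurable_inner_triple f g : mker (l + (m + b)) f -> mker (l + (m + c)) g ->
  measurable_fun setT (fun w : W => inner f g l w.1.1 w.1.2 w.2).
Proof. by move=> mf mg; exact: measurable_inner mf mg mx mt ms. Qed.

Lemma mker_norm n u : mker n u -> mker n (fun x => `|u x|%R).
Proof. by move=> h; apply: measurableT_comp h. Qed.

(** Cauchy-Schwarz in the l integrated variables separates t from s; the remaining integral over x
    of a product of section masses is split by [mule_amgm]. The weight a is free so as to be taken
    large when u is small and v merely bounded. *)
Lemma abs_contraction_le u v (a : R) : (0 < a)%R ->
  mker (l + (m + b)) u -> mker (l + (m + c)) v ->
  contraction_sqr (fun x => `|u x|%R) (fun x => `|v x|%R) l m b c <=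
  a%:E * mixed_norm u l m b + a^-1%:E * mixed_norm v l m c.
Proof.
move=> a0 mu1 mv.
pose K (w : W) := inner u u l w.1.1 w.1.2 w.1.2 * inner v v l w.1.1 w.2 w.2.
have mK : measurable_fun setT K.
  apply: emeasurable_funM; first exact: (measurable_inner mu1 mu1 mx mt mt).
  exact: (measurable_inner mv mv mx ms ms).
have K0 w : 0 <= K w by apply: mule_ge0; exact: inner_self_ge0.
apply: (@le_trans _ _ (triple_integral (pm m) (pm b) (pm c) K)).
  apply: le_triple_integral => //.
  - by apply: measurable_sqe; apply: measurable_inner_triple; exact: mker_norm.
  - by move=> w; exact: sqe_ge0.
  - move=> w; rewrite /K /inner.
    under eq_integral do rewrite -normrM.
    under [X in _ <= X * _]eq_integral do rewrite -expr2.
    under [X in _ <= _ * X]eq_integral do rewrite -expr2.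
    apply: integral_cauchy_schwarz.
      by apply: (@measurable_kernel_section u l m b); rewrite ?size_tuple.
    by apply: (@measurable_kernel_section v l m c); rewrite ?size_tuple.
have -> : triple_integral (pm m) (pm b) (pm c) K =
    \int[pm m]_x (section_mass u l b x * section_mass v l c x).
  apply: eq_integral => x _; rewrite /K /=.
  have mtt : measurable_fun setT (fun t : b.-tuple Z => inner u u l x t t).
    apply: (measurable_inner mu1 mu1 _ (mseq_id b) (mseq_id b)).
    by split => [_|i]; [rewrite size_tuple|exact: measurable_cst].
  have mss : measurable_fun setT (fun s : c.-tuple Z => inner v v l x s s).
    apply: (measurable_inner mv mv _ (mseq_id c) (mseq_id c)).
    by split => [_|i]; [rewrite size_tuple|exact: measurable_cst].
  have -> : \int[pm b]_t \int[pm c]_s (inner u u l x t t * inner v v l x s s) =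
      \int[pm b]_t (inner u u l x t t * section_mass v l c x).
    apply: eq_integral => t _; rewrite ge0_integralZl//; last exact: inner_self_ge0.
    by move=> s _; exact: inner_self_ge0.
  rewrite ge0_integralZr//; last exact: section_mass_ge0.
  by move=> t _; exact: inner_self_ge0.
apply: (@le_trans _ _ (\int[pm m]_x (a%:E * (section_mass u l b x) ^+ 2 + a^-1%:E * (section_mass v l c x) ^+ 2))).
  apply: ge0_le_integral => //.
  - by move=> x _; apply: mule_ge0; exact: section_mass_ge0.
  - by apply: emeasurable_funM; exact: measurable_section_mass.
  - by apply: emeasurable_funD; apply: emeasurable_funM => //; apply: measurable_sqe; exact: measurable_section_mass.
  - by move=> x _; apply: mule_amgm => //; exact: section_mass_ge0.
have ia0 : (0 <= a^-1)%R by rewrite invr_ge0 ltW.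
have mU := measurable_sqe (measurable_section_mass mu1).
have mV := measurable_sqe (measurable_section_mass mv).
rewrite ge0_integralD//.
- rewrite ge0_integralZl_EFin ?(ltW a0)//; last by move=> x _; exact: sqe_ge0.
  by rewrite ge0_integralZl_EFin//; move=> x _; exact: sqe_ge0.
- by move=> x _; apply: mule_ge0; rewrite ?lee_fin ?(ltW a0)//; exact: sqe_ge0.
- exact: emeasurable_funM.
- by move=> x _; apply: mule_ge0; rewrite ?lee_fin//; exact: sqe_ge0.
- exact: emeasurable_funM.
Qed.

(** From f' g' - f g = (f' - f) g + f' (g' - g), with absolute values inside the two error terms;
    the factor 3 is that of the square of a sum of three terms. *)
Lemma contraction_compare f g f' g' :
  mker (l + (m + b)) f -> mker (l + (m + c)) g -> mker (l + (m + b)) f' -> mker (l + (m + c)) g' ->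
  contraction_sqr f' g' l m b c <= 3%:E * (contraction_sqr f g l m b c +
    contraction_sqr (fun x => `|f' x - f x|%R) (fun x => `|g x|%R) l m b c +
    contraction_sqr (fun x => `|f' x|%R) (fun x => `|g' x - g x|%R) l m b c).
Proof.
move=> mf mg mf' mg'.
have mdf : mker (l + (m + b)) (fun x => f' x - f x)%R by exact: measurable_funB.
have mdg : mker (l + (m + c)) (fun x => g' x - g x)%R by exact: measurable_funB.
have M (h k : seq Z -> R) : mker (l + (m + b)) h -> mker (l + (m + c)) k ->
  measurable_fun setT (fun w : W => (inner h k l w.1.1 w.1.2 w.2) ^+ 2).
  by move=> *; apply: measurable_sqe; exact: measurable_inner_triple.
have M1 := M _ _ mf mg.
have M2 := M _ _ (mker_norm mdf) (mker_norm mg).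
have M3 := M _ _ (mker_norm mf') (mker_norm mdg).
have S0 (w : W) : 0 <= inner f g l w.1.1 w.1.2 w.2 ^+ 2 +
    inner (fun x => `|f' x - f x|%R) (fun x => `|g x|%R) l w.1.1 w.1.2 w.2 ^+ 2.
  by apply: adde_ge0; exact: sqe_ge0.
rewrite /contraction_sqr -triple_integralD//; [|by move=> w; exact: sqe_ge0|by move=> w; exact: sqe_ge0].
rewrite -triple_integralD//; [|exact: emeasurable_funD|by move=> w; exact: sqe_ge0].
pose K (w : W) := inner f g l w.1.1 w.1.2 w.2 ^+ 2 +
    inner (fun x => `|f' x - f x|%R) (fun x => `|g x|%R) l w.1.1 w.1.2 w.2 ^+ 2 +
    inner (fun x => `|f' x|%R) (fun x => `|g' x - g x|%R) l w.1.1 w.1.2 w.2 ^+ 2.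
rewrite -[X in _ <= _ * X]/(triple_integral (pm m) (pm b) (pm c) K).
have -> : 3%:E * triple_integral (pm m) (pm b) (pm c) K =
    triple_integral (pm m) (pm b) (pm c) (fun w => 3%:E * K w).
  rewrite triple_integralZl//; last by move=> w; apply: adde_ge0 => //; exact: sqe_ge0.
  by apply: emeasurable_funD => //; exact: emeasurable_funD.
rewrite /K.
apply: le_triple_integral.
- exact: M.
- by apply: emeasurable_funM => //; apply: emeasurable_funD => //; exact: emeasurable_funD.
- by move=> w; exact: sqe_ge0.
move=> w; rewrite -[X in X <= _]sqe_abs -[X in _ <= _ * (X + _ + _)]sqe_abs.
have nn (h k : seq Z -> R) : 0 <= inner (fun x => `|h x|%R) (fun x => `|k x|%R) l w.1.1 w.1.2 w.2.
  by apply: integral_ge0 => z _; rewrite lee_fin mulr_ge0.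
have H3 := sqe_add3_le (abse_ge0 (inner f g l w.1.1 w.1.2 w.2))
  (nn (fun x => f' x - f x)%R g) (nn f' (fun x => g' x - g x)%R).
apply: le_trans H3; apply: sqe_le => //.
have ms1 (h : seq Z -> R) : mker (l + (m + b)) h -> measurable_fun setT (fun z : l.-tuple Z => h (z ++ w.1.1 ++ w.1.2)).
  by move=> mh; apply: (@measurable_kernel_section h l m b); rewrite ?size_tuple.
have ms2 (h : seq Z -> R) : mker (l + (m + c)) h -> measurable_fun setT (fun z : l.-tuple Z => h (z ++ w.1.1 ++ w.2)).
  by move=> mh; apply: (@measurable_kernel_section h l m c); rewrite ?size_tuple.
have m1 := measurable_funM (ms1 _ mf') (ms2 _ mg'); have m2 := measurable_funM (ms1 _ mf) (ms2 _ mg).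
apply: le_trans (@abse_integral_le _ _ _ (pm l) _ _ m1 m2) _.
have mp (h k : seq Z -> R) : mker (l + (m + b)) h -> mker (l + (m + c)) k ->
  measurable_fun setT (fun z : l.-tuple Z => (`|h (z ++ w.1.1 ++ w.1.2)| * `|k (z ++ w.1.1 ++ w.2)|)%:E).
  move=> mh mk; apply/measurable_EFinP/measurable_funM.
    by apply: (ms1 (fun x => `|h x|%R)); exact: mker_norm.
  by apply: (ms2 (fun x => `|k x|%R)); exact: mker_norm.
have p1 := mp _ _ mdf mg; have p2 := mp _ _ mf' mdg.
rewrite -addeA leeD2l// -ge0_integralD//.
apply: ge0_le_integral => //.
- by apply/measurable_EFinP; apply: measurableT_comp => //; exact: measurable_funB.
- exact: emeasurable_funD.
move=> z _; rewrite -EFinD lee_fin -!normrM.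
apply: le_trans (ler_normD _ _); rewrite le_eqVlt; apply/orP; left; apply/eqP; congr `|_|%R => /=; ring.
Qed.

End fixed_orders.
End contractions.

Lemma dominated_cvg0 {d} {V : measurableType d} {R : realType} (nu : {measure set V -> \bar R})
    (g : (V -> \bar R)^nat) (G : V -> \bar R) :
  (forall n, measurable_fun setT (g n)) -> measurable_fun setT G ->
  (forall n x, 0 <= g n x) -> (forall n x, g n x <= G x) -> \int[nu]_x G x < +oo ->
  (forall x, G x < +oo -> g ^~ x @ \oo --> 0) ->
  (fun n => \int[nu]_x g n x) @ \oo --> 0.
Proof.
move=> mg mG g0 gG Goo cv.
have G0 x : 0 <= G x by exact: le_trans (g0 0%N x) (gG 0%N x).
have iG : nu.-integrable setT G.
  by apply/integrableP; split => //; under eq_integral do rewrite gee0_abs//.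
have cae : {ae nu, forall x, setT x -> g ^~ x @ \oo --> cst 0 x}.
  have := integrable_ae measurableT iG; apply: filterS => x /(_ Logic.I) fx _ /=.
  by apply: cv; rewrite -ge0_fin_numE.
have dae : {ae nu, forall x n, setT x -> `|g n x| <= G x}.
  by apply: aeW => x n _; rewrite gee0_abs.
have [_ _] := dominated_convergence measurableT mg (measurable_cst 0) cae iG dae.
by rewrite integral0.
Qed.

Section mixed_norms.
Context {d} {Z : measurableType d} {R : realType}.
Variable mu : {sigma_finite_measure set Z -> \bar R}.
Notation pm := (power_measure mu).
Notation mixed := (mixed_norm mu).
Implicit Types (f g u v : seq Z -> R) (l m b c n p q r : nat).

Definition sqr_mass n u : \bar R := \int[pm n]_x ((u x) ^+ 2)%:E.

Lemma sqr_mass_ge0 n u : 0 <= sqr_mass n u.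
Proof. by apply: integral_ge0 => x _; rewrite lee_fin sqr_ge0. Qed.

Lemma app_seqE n (f : n.-tuple Z -> R) (x : n.-tuple Z) : app_seq f x = f x.
Proof. by rewrite /app_seq valK. Qed.

Lemma mker_app_seq n (f : n.-tuple Z -> R) : measurable_fun setT f -> mker n (app_seq f).
Proof. by apply: eq_measurable_fun => x _; rewrite app_seqE. Qed.

Lemma mker_sqr n u : mker n u -> mker n (fun x => ((u x) ^+ 2)%:E).
Proof. by move=> mu1; apply/measurable_EFinP/measurable_funX. Qed.

Lemma int_cat3 n m b c (H : seq Z -> \bar R) : n = (m + (b + c))%N -> (forall x, 0 <= H x) ->
  mker n H ->
  \int[pm n]_x H x = \int[pm m]_x \int[pm b]_t \int[pm c]_s H (x ++ (t ++ s)).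
Proof.
move=> e H0 mH; rewrite (int_cat_eq mu e)//; apply: eq_integral => x _.
apply: (int_cat mu (G := fun y => H (x ++ y))) => //.
apply: (mker_comp mH); rewrite e; apply: mseq_cat (mseq_id _).
by split => [w|i]; [rewrite size_tuple|exact: measurable_cst].
Qed.

(** The integral over the concatenated argument of [star] is split into its three blocks, which
    replaces [take] and [drop] by nested integrals. *)
Lemma star_norm_sqr p q (f : p.-tuple Z -> R) (g : q.-tuple Z -> R) r l :
  measurable_fun setT f -> measurable_fun setT g -> (l <= r)%N -> (r <= p)%N -> (r <= q)%N ->
  (star_norm mu f g r l) ^+ 2 =
  contraction_sqr mu (app_seq f) (app_seq g) l (r - l) (p - r) (q - r).
Proof.
move=> /mker_app_seq mf /mker_app_seq mg lr rp rq.
have e : (p + q - r - l = (r - l) + ((p - r) + (q - r)))%N by lia.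
rewrite -poweR2 ?Lnorm_ge0// poweR_Lnorm//.
pose H (x : seq Z) : \bar R := (inner mu (app_seq f) (app_seq g) l (take (r - l) x)
  (take (p - r) (drop (r - l) x)) (drop (p - l) x)) ^+ 2.
have mH : mker (p + q - r - l) H.
  apply: measurable_sqe; apply: (@measurable_inner _ _ _ _ _ _ _ _ l (r - l) (p - r) (q - r)).
  - by rewrite (_ : (l + _ = p)%N)//; lia.
  - by rewrite (_ : (l + _ = q)%N)//; lia.
  - by apply: mseq_take (mseq_id _); lia.
  - by apply: mseq_take (mseq_drop _ (mseq_id _)); lia.
  - rewrite (_ : (q - r = p + q - r - l - (p - l))%N); last lia.
    exact: mseq_drop (mseq_id _).
transitivity (\int[pm (p + q - r - l)]_x H x).
  by apply: eq_integral => x _; rewrite poweR2 ?abse_ge0// sqe_abs.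
rewrite (int_cat3 e _ mH); last by move=> x; exact: sqe_ge0.
rewrite /contraction_sqr /triple_integral; apply: eq_integral => x _.
apply: eq_integral => t _; apply: eq_integral => s _; rewrite /H /=; congr (_ ^+ 2).
congr inner.
- by rewrite take_size_cat// size_tuple.
- by rewrite drop_size_cat ?size_tuple// take_size_cat// size_tuple.
- by rewrite catA drop_size_cat// size_cat !size_tuple; lia.
Qed.

Lemma int_block l m b (G : seq Z -> \bar R) : (forall x, 0 <= G x) -> mker (l + (m + b)) G ->
  \int[pm (l + (m + b))]_x G x = \int[pm m]_x \int[pm b]_t \int[pm l]_z G (z ++ x ++ t).
Proof.
move=> G0 mG; rewrite int_cat//.
have mGs dW (W : measurableType dW) (x y : W -> seq Z) : mseq l x -> mseq (m + b) y ->
    measurable_fun setT (fun w => G (x w ++ y w)).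
  by move=> mx my; apply: mker_comp mG _; exact: mseq_cat.
rewrite (@int_swap _ _ _ _ _ (pm l) (pm (m + b)) (fun z y => G (z ++ y)))//; last first.
  by apply: mGs; apply: mseq_tuple; [exact: measurable_fst|exact: measurable_snd].
rewrite (@int_cat _ _ _ mu m b (fun y => \int[pm l]_z G (z ++ y)))//.
  by move=> y; exact: integral_ge0.
apply: (@measurable_integral _ _ _ _ _ (pm l) (fun (y : (m + b).-tuple Z) (z : l.-tuple Z) => G (z ++ y))).
by apply: mGs; apply: mseq_tuple; [exact: measurable_snd|exact: measurable_fst].
Qed.

Lemma sqr_mass_block l m b u : mker (l + (m + b)) u ->
  sqr_mass (l + (m + b)) u = \int[pm m]_x section_mass mu u l b x.
Proof.
move=> mu1; rewrite /sqr_mass (@int_block l m b (fun x => ((u x) ^+ 2)%:E)); last 2 first.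
- by move=> x; rewrite lee_fin sqr_ge0.
- exact: mker_sqr.
by apply: eq_integral => x _; apply: eq_integral => t _; apply: eq_integral => z _; rewrite expr2.
Qed.

Lemma mixed_null l m b u : mker (l + (m + b)) u -> sqr_mass (l + (m + b)) u = 0 -> mixed u l m b = 0.
Proof.
move=> mu1; rewrite sqr_mass_block// => e0.
have mS := measurable_section_mass mu mu1.
have : \int[pm m]_x `|section_mass mu u l b x| = 0.
  by rewrite -e0; apply: eq_integral => x _; rewrite gee0_abs// section_mass_ge0.
move=> /(ae_eq_integral_abs _ measurableT mS) ae0.
rewrite /mixed_norm (ge0_ae_eq_integral (g := cst 0))//.
- by rewrite integral0.
- exact: measurable_sqe.
- by move=> x _; exact: sqe_ge0.
- by move: ae0; apply: filterS => x /(_ Logic.I) e _; rewrite [X in X ^+ 2]e /cst expe2 mule0.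
Qed.

Lemma mixed_bounded l m b u (C : R) : mker (l + (m + b)) u -> (0 <= C)%R ->
  (forall x : m.-tuple Z, section_mass mu u l b x <= C%:E) ->
  mixed u l m b <= C%:E * sqr_mass (l + (m + b)) u.
Proof.
move=> mu1 C0 H; rewrite sqr_mass_block// -ge0_integralZl_EFin//; first last.
- exact: measurable_section_mass.
- by move=> x _; exact: section_mass_ge0.
have mS := measurable_section_mass mu mu1.
apply: ge0_le_integral => //.
- by move=> x _; exact: sqe_ge0.
- exact: measurable_sqe.
- exact: emeasurable_funM.
- by move=> x _; rewrite expe2; apply: lee_wpmul2r => //; exact: section_mass_ge0.
Qed.

Lemma le_section_mass u v l m b (x : m.-tuple Z) : mker (l + (m + b)) u -> mker (l + (m + b)) v ->
  (forall y, `|u y| <= `|v y|)%R -> section_mass mu u l b x <= section_mass mu v l b x.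
Proof.
move=> mu1 mv uv.
have mx (w : seq Z -> R) : mker (l + (m + b)) w -> measurable_fun setT (fun t : b.-tuple Z => inner mu w w l x t t).
  move=> mw; apply: (measurable_inner mu mw mw _ (mseq_id b) (mseq_id b)).
  by split => [_|i]; [rewrite size_tuple|exact: measurable_cst].
apply: ge0_le_integral => //; [by move=> t _; exact: inner_self_ge0|exact: mx|exact: mx|].
move=> t _; have mz (w : seq Z -> R) : mker (l + (m + b)) w ->
    measurable_fun setT (fun z : l.-tuple Z => (w (z ++ x ++ t) * w (z ++ x ++ t))%:E).
  move=> mw; apply/measurable_EFinP.
  by apply: measurable_funM; apply: (@measurable_kernel_section _ _ _ w l m b); rewrite ?size_tuple.
apply: ge0_le_integral => //; [|exact: mz|exact: mz|].
  by move=> z _; rewrite lee_fin -expr2 sqr_ge0.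
move=> z _; rewrite lee_fin -!expr2 -[X in (X <= _)%R]real_normK ?num_real//.
by rewrite -[X in (_ <= X)%R]real_normK ?num_real// lerXn2r ?nnegrE.
Qed.

(** From (u + v)^2 <= 2 u^2 + 2 v^2 under the inner integrals, and [sqe_add2_le] for the outer
    square. *)
Lemma mixedD u v l m b : mker (l + (m + b)) u -> mker (l + (m + b)) v ->
  mixed (fun x => u x + v x)%R l m b <= 8%:E * (mixed u l m b + mixed v l m b).
Proof.
move=> mu1 mv; have muv : mker (l + (m + b)) (fun x => u x + v x)%R by exact: measurable_funD.
have mS w := @measurable_section_mass _ _ _ mu w l m b.
rewrite /mixed_norm -ge0_integralD//; [|by move=> x _; exact: sqe_ge0|by apply: measurable_sqe; apply: mS
  |by move=> x _; exact: sqe_ge0|by apply: measurable_sqe; apply: mS].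
rewrite -ge0_integralZl_EFin//; last 2 first.
- by move=> x _; apply: adde_ge0; exact: sqe_ge0.
- by apply: emeasurable_funD; apply: measurable_sqe; apply: mS.
apply: ge0_le_integral => //.
- by move=> x _; exact: sqe_ge0.
- by apply: measurable_sqe; apply: mS.
- by apply: emeasurable_funM => //; apply: emeasurable_funD; apply: measurable_sqe; apply: mS.
move=> x _.
apply: le_trans (sqe_add2_le (section_mass_ge0 _ _ _ _ _) (section_mass_ge0 _ _ _ _ _)).
apply: sqe_le; first exact: section_mass_ge0.
have mx (w : seq Z -> R) : mker (l + (m + b)) w -> measurable_fun setT (fun t : b.-tuple Z => inner mu w w l x t t).
  move=> mw; apply: (measurable_inner mu mw mw _ (mseq_id b) (mseq_id b)).
  by split => [_|i]; [rewrite size_tuple|exact: measurable_cst].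
have i0 (w : seq Z -> R) (t : b.-tuple Z) : 0 <= 2%:E * inner mu w w l x t t.
  by apply: mule_ge0 => //; exact: inner_self_ge0.
have m2 (w : seq Z -> R) : mker (l + (m + b)) w -> measurable_fun setT (fun t : b.-tuple Z => 2%:E * inner mu w w l x t t).
  by move=> mw; apply: emeasurable_funM => //; exact: mx.
rewrite /section_mass -ge0_integralZl_EFin//; [|by move=> t _; exact: inner_self_ge0|exact: mx].
rewrite -ge0_integralZl_EFin//; [|by move=> t _; exact: inner_self_ge0|exact: mx].
rewrite -ge0_integralD//; [|exact: m2|exact: m2].
apply: ge0_le_integral => //.
- by move=> t _; exact: inner_self_ge0.
- exact: mx.
- by apply: emeasurable_funD; exact: m2.
move=> t _; have mz (w : seq Z -> R) : mker (l + (m + b)) w ->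
    measurable_fun setT (fun z : l.-tuple Z => (w (z ++ x ++ t) * w (z ++ x ++ t))%:E).
  move=> mw; apply/measurable_EFinP.
  by apply: measurable_funM; apply: (@measurable_kernel_section _ _ _ w l m b); rewrite ?size_tuple.
have w0 (w : seq Z -> R) (z : l.-tuple Z) : 0 <= (w (z ++ x ++ t) * w (z ++ x ++ t))%:E.
  by rewrite lee_fin -expr2 sqr_ge0.
have w2 (w : seq Z -> R) (z : l.-tuple Z) : 0 <= 2%:E * (w (z ++ x ++ t) * w (z ++ x ++ t))%:E.
  by apply: mule_ge0.
have mz2 (w : seq Z -> R) : mker (l + (m + b)) w ->
    measurable_fun setT (fun z : l.-tuple Z => 2%:E * (w (z ++ x ++ t) * w (z ++ x ++ t))%:E).
  by move=> mw; apply: emeasurable_funM => //; exact: mz.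
rewrite /inner -ge0_integralZl_EFin//; last exact: mz.
rewrite -ge0_integralZl_EFin//; last exact: mz.
rewrite -ge0_integralD//; [|exact: mz2|exact: mz2].
apply: ge0_le_integral => //.
- by move=> z _; exact: (w0 (fun x => u x + v x)%R).
- exact: (mz (fun x => u x + v x)%R).
- by apply: emeasurable_funD; exact: mz2.
move=> z _; rewrite -!EFinM -EFinD lee_fin.
by have := sqr_ge0 (u (z ++ x ++ t) - v (z ++ x ++ t))%R; rewrite expr2; nra.
Qed.

Lemma section_mass0 u l (x : seq Z) :
  section_mass mu u l 0 x = \int[pm l]_z ((u (z ++ x)) ^+ 2)%:E.
Proof.
rewrite /section_mass (@int_pm0 _ _ _ mu (fun t => inner mu u u l x t t)).
  by apply: eq_integral => z _; rewrite cats0 expr2.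
apply: (@eq_measurable_fun _ _ _ _ _ (fun _ : 0.-tuple Z => inner mu u u l x [::] [::])).
  by move=> y _; rewrite (tuple0 y).
exact: measurable_cst.
Qed.

(** Dominated convergence twice: in the inner variables at each x where the section mass of f is
    finite, then in the outer ones. *)
Lemma mixed_dominated l m f (u : nat -> seq Z -> R) : mker (l + m) f ->
  (forall n, mker (l + m) (u n)) -> sqr_mass (l + m) f < +oo -> mixed f l m 0 < +oo ->
  (forall n x, `|u n x| <= `|f x|)%R -> (forall x, (fun n => u n x) @ \oo --> 0%R) ->
  (fun n => mixed (u n) l m 0) @ \oo --> 0.
Proof.
rewrite -{1 2 3}(addn0 m) => mf mun f2 fm uf u0.
have mS w := @measurable_section_mass _ _ _ mu w l m 0.
apply: (@dominated_cvg0 _ _ _ (pm m) (fun n x => section_mass mu (u n) l 0 x ^+ 2)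
   (fun x => section_mass mu f l 0 x ^+ 2)) => //.
- by move=> n; apply: measurable_sqe; apply: mS.
- by apply: measurable_sqe; apply: mS.
- by move=> n x; exact: sqe_ge0.
- by move=> n x; apply: sqe_le; [exact: section_mass_ge0|exact: le_section_mass].
move=> x Foo.
have {}Foo : section_mass mu f l 0 x < +oo.
  have := section_mass_ge0 mu f l 0 x; move: Foo; rewrite expe2.
  by case: (section_mass _ _ _ _ _) => [r| |] // _ _; rewrite ltry.
have -> : (0 : \bar R) = 0 ^+ 2 by rewrite expe2 mule0.
under eq_fun do rewrite expe2; rewrite expe2; suff cv : (fun n => section_mass mu (u n) l 0 x) @ \oo --> 0.
  by apply: cvgeM => //; rewrite mule_defE /= ?eqxx.
have mz (w : seq Z -> R) : mker (l + (m + 0)) w -> measurable_fun setT (fun z : l.-tuple Z => ((w (z ++ x)) ^+ 2)%:E).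
  move=> mw; apply/measurable_EFinP/measurable_funX.
  by have := @measurable_kernel_section _ _ _ w l m 0 x [::] mw (size_tuple _) erefl; rewrite cats0.
under eq_fun do rewrite section_mass0.
rewrite section_mass0 in Foo.
apply: (dominated_cvg0 _ _ _ _ Foo) => //.
- by move=> n; exact: mz.
- exact: mz.
- by move=> n z; rewrite lee_fin sqr_ge0.
- move=> n z; rewrite lee_fin -[X in (X <= _)%R]real_normK ?num_real//.
  by rewrite -[X in (_ <= X)%R]real_normK ?num_real// lerXn2r ?nnegrE.
- move=> z _; apply: cvg_EFin; first exact: nearW.
  rewrite [X in _ --> X](_ : _ = 0 * 0)%R; last by rewrite mulr0.
  rewrite [X in X @ _](_ : _ = fun n => u n (z ++ x) * u n (z ++ x))%R; last first.
    by apply/funext => n /=; rewrite expr2.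
  by apply: cvgM; exact: u0.
Qed.

End mixed_norms.

(** * Almost everywhere symmetric kernels *)

Section ae_symmetric.
Context {d} {Z : measurableType d} {R : realType}.
Variable mu : {sigma_finite_measure set Z -> \bar R}.
Notation pm := (power_measure mu).
Notation mixed := (mixed_norm mu).
Implicit Types (f g u v : seq Z -> R) (l m b c n p q r : nat) (s : seq nat).

Definition ae_symmetric n u := forall s, perm_eq s (iota 0 n) ->
  {ae pm n, forall x : n.-tuple Z, u (map (nth point x) s) = u x}.

Lemma ae_symmetricB n u v : ae_symmetric n u -> ae_symmetric n v ->
  ae_symmetric n (fun x => u x - v x)%R.
Proof.
move=> su sv s ps; have := su s ps; have := sv s ps.
by apply: filterS2 => x -> ->.
Qed.

Lemma ae_symmetric_perm n u :
  (forall x y, size x = n -> perm_eq x y -> u x = u y) -> ae_symmetric n u.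
Proof.
move=> H s ps; apply: aeW => x; apply: H.
  by rewrite size_map (perm_size ps) size_iota.
rewrite -[X in perm_eq _ X](mkseq_nth point) size_tuple.
exact: perm_map.
Qed.

Lemma L2s_ae_symmetric n (f : n.-tuple Z -> R) : L2s mu f -> ae_symmetric n (app_seq f).
Proof.
move=> [_ H] s ps.
have sz : size s == n by rewrite (perm_size ps) size_iota.
have : perm_eq (Tuple sz) (iota_tuple n 0) by [].
move=> /tuple_permP[pi es].
have := H pi; apply: filterS => x e.
rewrite [RHS]app_seqE -e -app_seqE; congr app_seq.
have {}es : s = [seq val (pi i) | i <- enum 'I_n].
  rewrite [LHS]es /=; apply: eq_map => i.
  by rewrite (tnth_nth 0%N) nth_iota.
rewrite {1}es -map_comp /=; apply: eq_map => i /=.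
by rewrite (tnth_nth point).
Qed.

Lemma sqr_mass_null n u : mker n u -> {ae pm n, forall x : n.-tuple Z, u x = 0%R} -> sqr_mass mu n u = 0.
Proof.
move=> mu1 H; rewrite /sqr_mass (ge0_ae_eq_integral (g := cst 0))//.
- by rewrite integral0.
- exact: mker_sqr.
- by move=> x _; rewrite lee_fin sqr_ge0.
- by move: H; apply: filterS => x e _; rewrite e expr0n.
Qed.

(** Symmetry moves the b variables next to the l ones, so that only the norms with b = 0 matter,
    those that assumption (i) bounds. As symmetry holds almost everywhere only, u differs from the
    permuted kernel by a null function, and the factor 8 is the price of [mixedD]. *)
Lemma mixed_rotate l m b u : mker (l + (m + b)) u -> ae_symmetric (l + (m + b)) u ->
  mixed u l m b <= 8%:E * mixed u (l + b) m 0.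
Proof.
move=> mu1 su.
pose s := iota 0 l ++ iota (l + m) b ++ iota l m.
have ps : perm_eq s (iota 0 (l + (m + b))).
  by rewrite !iotaD add0n /s perm_cat2l perm_catC.
pose v x := u (map (nth point x) s).
have ss : size s = (l + (m + b))%N by rewrite (perm_size ps) size_iota.
have mv : mker (l + (m + b)) v.
  have := mseq_map_nth s (mseq_id (l + (m + b))); rewrite ss => ms.
  by apply: (mker_comp mu1); exact: ms.
have md : mker (l + (m + b)) (fun x => u x - v x)%R by exact: measurable_funB.
have d0 : mixed (fun x => u x - v x)%R l m b = 0.
  apply: mixed_null => //; apply: sqr_mass_null => //.
  by have := su s ps; apply: filterS => x e; rewrite /v e subrr.
have -> : mixed u l m b = mixed (fun x => v x + (u x - v x))%R l m b.
  by apply: (congr1 (fun w => mixed w l m b)); apply/funext => x; rewrite addrC subrK.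
apply: le_trans (mixedD _ mv md) _; rewrite d0 adde0.
rewrite (_ : mixed v l m b = mixed u (l + b) m 0)//.
apply: eq_integral => x _; congr (_ ^+ 2); rewrite section_mass0.
pose G (y : seq Z) := ((u (y ++ x)) ^+ 2)%:E.
have mG dW (W : measurableType dW) (z t : W -> seq Z) : mseq l z -> mseq b t ->
    measurable_fun setT (fun w => G (z w ++ t w)).
  move=> mz mt; apply/measurable_EFinP/measurable_funX/(mker_comp mu1).
  rewrite (addnC m b) addnA; apply: mseq_cat; first exact: mseq_cat.
  by split => [w|i]; [rewrite size_tuple|exact: measurable_cst].
have mG' : mker (l + b) G.
  apply/measurable_EFinP/measurable_funX/(mker_comp mu1).
  rewrite (addnC m b) addnA; apply: mseq_cat (mseq_id _) _.
  by split => [w|i]; [rewrite size_tuple|exact: measurable_cst].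
rewrite -/(G _) (int_cat mu _ mG'); last by move=> y; rewrite lee_fin sqr_ge0.
rewrite (@int_swap _ _ _ _ _ (pm l) (pm b) (fun z t => G (z ++ t))); last 2 first.
- by apply: mG; apply: mseq_tuple; [exact: measurable_fst|exact: measurable_snd].
- by move=> z t; rewrite lee_fin sqr_ge0.
apply: eq_integral => t _; apply: eq_integral => z _; rewrite -expr2 /G /v.
congr ((u _ ^+ 2)%:E); rewrite /s !map_cat !map_nth_iota.
have sz : size (z ++ x ++ t) = (l + (m + b))%N by rewrite !size_cat !size_tuple.
rewrite drop0 take_size_cat ?size_tuple// -catA; congr cat.
rewrite drop_cat size_tuple ltnNge leq_addr /= addKn drop_size_cat ?size_tuple//.
rewrite take_oversize ?size_tuple//; congr cat.
  by rewrite drop_size_cat ?size_tuple// take_size_cat ?size_tuple.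
all: by rewrite !size_cat !size_tuple; lia.
Qed.

Lemma contraction_self0 l m f : mker (l + (m + 0)) f ->
  contraction_sqr mu f f l m 0 0 = mixed f l m 0.
Proof.
move=> mf; apply: eq_integral => x _.
have mt (K : 0.-tuple Z -> \bar R) : measurable_fun setT K.
  apply: (@eq_measurable_fun _ _ _ _ _ (cst (K [tuple]))); last exact: measurable_cst.
  by move=> y _ /=; rewrite (tuple0 y).
rewrite (@int_pm0 _ _ _ mu (fun t => \int[pm 0]_y inner mu f f l x t y ^+ 2)); last exact: mt.
rewrite /= (@int_pm0 _ _ _ mu (fun y => inner mu f f l x [::] y ^+ 2)); last exact: mt.
by congr (_ ^+ 2); rewrite section_mass0; apply: eq_integral => z _; rewrite cats0 expr2.
Qed.

Lemma mixed_q00 q u : mker q u -> mixed u q 0 0 = (sqr_mass mu q u) ^+ 2.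
Proof.
move=> mu1; rewrite /mixed_norm (@int_pm0 _ _ _ mu (fun x => section_mass mu u q 0 x ^+ 2)).
  by rewrite section_mass0; congr (_ ^+ 2); apply: eq_integral => z _; rewrite cats0.
apply: (@eq_measurable_fun _ _ _ _ _ (cst (section_mass mu u q 0 [::] ^+ 2))); last exact: measurable_cst.
by move=> y _ /=; rewrite (tuple0 y).
Qed.

Lemma mixed_0q0 q u : mker q u -> mixed u 0 q 0 = \int[pm q]_x ((u x) ^+ 4)%:E.
Proof.
move=> mu1; apply: eq_integral => x _; rewrite section_mass0.
rewrite (@int_pm0 _ _ _ mu (fun z => ((u (z ++ x)) ^+ 2)%:E)).
  by rewrite expe2 -EFinM -expr2 -exprM.
apply: (@eq_measurable_fun _ _ _ _ _ (cst ((u x) ^+ 2)%:E)); last exact: measurable_cst.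
by move=> y _ /=; rewrite (tuple0 y).
Qed.

End ae_symmetric.

(** * Kernels constant on the cells of a finite partition *)

Section grid.
Context {d} {Z : measurableType d} {R : realType}.
Variable mu : {sigma_finite_measure set Z -> \bar R}.
Notation pm := (power_measure mu).
Variables (T : finType) (kappa : Z -> T) (t0 : T).

(** The class of t0 may have infinite measure. Its cell is declared empty, so that every cell has
    finite measure, and kernels are asked to vanish there ([vanishing]). *)
Definition grid_cell t : set Z := if t == t0 then set0 else kappa @^-1` [set t].

Definition grid := (forall t, measurable (kappa @^-1` [set t])) /\
  (forall t, t != t0 -> mu (kappa @^-1` [set t]) < +oo).

Hypothesis gridP : grid.

Lemma measurable_grid_cell t : measurable (grid_cell t).
Proof. by rewrite /grid_cell; case: ifP => // _; exact: gridP.1. Qed.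

Lemma grid_cell_finite t : mu (grid_cell t) < +oo.
Proof.
by rewrite /grid_cell; case: ifPn => [_|]; [rewrite measure0|exact: gridP.2].
Qed.

Lemma grid_cell_disjoint s t : s != t -> grid_cell s `&` grid_cell t = set0.
Proof.
move=> st; rewrite /grid_cell; case: ifP => _; first by rewrite set0I.
case: ifP => _; first by rewrite setI0.
apply/seteqP; split => // z [e1 e2]; move: st.
by rewrite -[s](e1 : kappa z = s) -[t](e2 : kappa z = t) eqxx.
Qed.

Notation lam := (cell_mass mu grid_cell).

Definition vanishing (G : seq T -> R) := forall x, t0 \in x -> G x = 0%R.

Definition lift_kernel (G : seq T -> R) (x : seq Z) : R := G (map kappa x).

Lemma measurable_lift n (G : seq T -> R) : mker n (lift_kernel G).
Proof.
move=> _ Y mY; rewrite setTI.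
rewrite (_ : _ @^-1` _ = \bigcup_(y in [set y : n.-tuple T | Y (G y)])
   \bigcap_(i in [set: 'I_n]) [set x : n.-tuple Z | kappa (tnth x i) = tnth y i]).
  apply: fin_bigcup_measurable => // y _; apply: fin_bigcap_measurable => // i _.
  rewrite -[X in measurable X]setTI.
  exact: (measurable_tnth i measurableT (gridP.1 (tnth y i))).
apply/seteqP; split => x /=.
  by move=> Yx; exists (map_tuple kappa x) => // i _ /=; rewrite tnth_map.
move=> [y /= Yy H]; rewrite /lift_kernel (_ : map _ _ = y)//.
rewrite -[map kappa x]/(tval (map_tuple kappa x)); congr tval.
by apply: eq_from_tnth => i; rewrite tnth_map; exact: H.
Qed.

Lemma integral_kappa (nu : {measure set Z -> \bar R}) (phi : T -> R) :
  (forall t, nu (grid_cell t) < +oo) -> (forall t, 0 <= phi t)%R -> phi t0 = 0%R ->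
  \int[nu]_z (phi (kappa z))%:E = (\sum_t fine (nu (grid_cell t)) * phi t)%:E.
Proof.
move=> nuoo phi0 pt0.
have E z : (phi (kappa z))%:E = \sum_t (phi t * \1_(grid_cell t) z)%:E.
  rewrite sumEFin (bigD1 (kappa z))//= big1 => [|t tz].
    rewrite addr0 indicE /grid_cell; case: ifPn => [/eqP ->|_]; first by rewrite pt0 mul0r.
    by rewrite mem_set// mulr1.
  rewrite indicE /grid_cell memNset ?mulr0//; case: ifP => _; first by [].
  by move=> e; move: tz; rewrite -[t](e : kappa z = t) eqxx.
under eq_integral do rewrite E.
have m1 t : measurable_fun setT (fun z => (phi t * \1_(grid_cell t) z)%:E).
  apply/measurable_EFinP/measurable_funM => //; apply: measurable_indic; exact: measurable_grid_cell.
rewrite ge0_integral_sum//; last by move=> t z _; rewrite lee_fin mulr_ge0.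
rewrite -sumEFin; apply: eq_bigr => t _.
under eq_integral do rewrite EFinM.
rewrite ge0_integralZl_EFin//; last first.
- apply/measurable_EFinP/measurable_indic; exact: measurable_grid_cell.
rewrite integral_indic//; last exact: measurable_grid_cell.
rewrite setIT mulrC EFinM; congr (_ * _).
by rewrite fineK// ge0_fin_numE.
Qed.

Lemma ge0_integral_lift n (H : seq T -> R) : (forall x, 0 <= H x)%R -> vanishing H ->
  \int[pm n]_x (lift_kernel H x)%:E = (dsum lam n H)%:E.
Proof.
elim: n H => [|n IH] H H0 vH.
  by rewrite (@int_pm0 _ _ _ mu (fun x => (lift_kernel H x)%:E)) ?dsum0//; apply/measurable_EFinP; exact: measurable_lift.
rewrite (@int_cons _ _ _ mu n (fun x => (lift_kernel H x)%:E))//; last 2 first.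
- by move=> x; rewrite lee_fin H0.
- by apply/measurable_EFinP; exact: measurable_lift.
rewrite dsumS; under eq_integral.
  move=> z _; rewrite -[X in integral _ _ X]/(fun x : n.-tuple Z => (lift_kernel (fun y => H (kappa z :: y)) x)%:E).
  rewrite IH//; last by move=> x xt; apply: vH; rewrite inE xt orbT.
  over.
rewrite (@integral_kappa mu (fun t => dsum lam n (fun y => H (t :: y))))//; first exact: grid_cell_finite.
- by move=> t; apply: dsum_ge0 => // s; exact: cell_mass_ge0.
- apply: big1 => x _; rewrite vH ?mulr0//; exact: mem_head.
Qed.

Lemma integral_lift n (H : seq T -> R) : vanishing H ->
  \int[pm n]_x (lift_kernel H x)%:E = (dsum lam n H)%:E.
Proof.
move=> vH; rewrite integralE.
rewrite (eq_integral (fun x : n.-tuple Z => (lift_kernel (fun y => Num.max (H y) 0)%R x)%:E)); last first.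
  by move=> x _; rewrite funeposE /lift_kernel EFin_max.
rewrite [X in _ - X](eq_integral (fun x : n.-tuple Z => (lift_kernel (fun y => Num.max (- H y) 0)%R x)%:E)); last first.
  by move=> x _; rewrite funenegE /lift_kernel EFin_max.
rewrite !ge0_integral_lift; first last.
- by move=> x /vH ->; rewrite maxxx.
- by move=> x; rewrite le_max lexx orbT.
- by move=> x /vH ->; rewrite oppr0 maxxx.
- by move=> x; rewrite le_max lexx orbT.
rewrite -EFinB; congr EFin; rewrite /dsum -sumrB; apply: eq_bigr => x _.
rewrite -mulrBr; congr (_ * _)%R.
by case: (leP (H x) (0:R)%R) => h; case: (leP (- H x)%R (0:R)%R) => h'; lra.
Qed.

Lemma contraction_lift p q r l (F G : seq T -> R) : vanishing F -> vanishing G ->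
  contraction_sqr mu (lift_kernel F) (lift_kernel G) l (r - l) (p - r) (q - r) = (dstar lam p q F G r l)%:E.
Proof.
move=> vF vG.
have vm (x : seq T) (y y' : seq T) : t0 \in x -> (F (y ++ x ++ y') * G (y ++ x ++ y') = 0)%R.
  by move=> xt; rewrite vF ?mul0r// !mem_cat xt orbT.
pose I c t s := dsum lam l (fun z => F (z ++ c ++ t) * G (z ++ c ++ s))%R.
have I0 c t s : (t0 \in c) || (t0 \in t) || (t0 \in s) -> I c t s = 0%R.
  move=> h; apply: big1 => z _; case/orP: h => [/orP[]|] h.
  - by rewrite vF ?mul0r ?mulr0// !mem_cat h orbT.
  - by rewrite vF ?mul0r ?mulr0// !mem_cat h !orbT.
  - by rewrite vG ?mulr0// !mem_cat h !orbT.
have sI (x t s : seq Z) : inner mu (lift_kernel F) (lift_kernel G) l x t s = (I (map kappa x) (map kappa t) (map kappa s))%:E.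
  rewrite -integral_lift.
    by apply: eq_integral => z _; rewrite /lift_kernel !map_cat.
  by move=> y yt; rewrite vF ?mul0r// mem_cat yt.
rewrite /contraction_sqr /triple_integral.
under eq_integral => x _.
  under eq_integral => t _.
    under eq_integral => s _.
      rewrite expe2 !sI -EFinM -expr2 /=.
      rewrite -[X in X%:E]/(lift_kernel (fun y => I (map kappa x) (map kappa t) y ^+ 2)%R s).
      over.
    rewrite ge0_integral_lift => [|y|y yt]; [|exact: sqr_ge0|by rewrite I0 ?yt ?orbT// expr0n].
    rewrite -[X in X%:E]/(lift_kernel (fun y => dsum lam (q - r) (fun s => I (map kappa x) y s ^+ 2))%R t).
    over.
  rewrite ge0_integral_lift => [|y|y yt]; last 2 first.
  - by apply: dsum_ge0 => [s|s _]; [exact: cell_mass_ge0|exact: sqr_ge0].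
  - by apply: big1 => s _; rewrite I0 ?yt ?orbT// expr0n mulr0.
  rewrite -[X in X%:E]/(lift_kernel (fun y => dsum lam (p - r) (fun t => dsum lam (q - r) (fun s => I y t s ^+ 2)))%R x).
  over.
rewrite ge0_integral_lift// => [y|y yt].
- by do 2 (apply: dsum_ge0 => [?|? _]; first exact: cell_mass_ge0); exact: sqr_ge0.
- by apply: big1 => t _; rewrite [dsum _ _ _]big1 ?mulr0// => s _; rewrite I0 ?yt// expr0n mulr0.
Qed.

End grid.

Section symmetrization.
Context {R : realType} {T : finType}.
Variables (t0 : T) (q : nat).
Local Open Scope ring_scope.
Implicit Types G Phi : seq T -> R.

Definition permuted (s : 'S_q) (x : q.-tuple T) : q.-tuple T := [tuple tnth x (s i) | i < q].

Lemma permutedK s : cancel (permuted s) (permuted s^-1%g).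
Proof. by move=> x; apply: eq_from_tnth => i; rewrite !tnth_mktuple permKV. Qed.

Lemma permutedKV s : cancel (permuted s^-1%g) (permuted s).
Proof. by move=> x; apply: eq_from_tnth => i; rewrite !tnth_mktuple permK. Qed.

Lemma perm_eq_permuted s x : perm_eq (permuted s x) x.
Proof. by apply/tuple_permP; exists s. Qed.

Definition symmetrize G (x : seq T) : R :=
  (q`!%:R)^-1 * \sum_(s : 'S_q) G [seq nth t0 x (s i) | i <- enum 'I_q].

Lemma symmetrizeE G (x : q.-tuple T) :
  symmetrize G x = (q`!%:R)^-1 * \sum_(s : 'S_q) G (permuted s x).
Proof.
congr (_ * _); apply: eq_bigr => s _; congr G => /=.
by apply: eq_map => i; rewrite (tnth_nth t0).
Qed.

Lemma symmetrize_perm G (x y : seq T) : size x = q -> perm_eq x y -> symmetrize G x = symmetrize G y.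
Proof.
move=> sx pxy; have sy : size y == q by rewrite -(perm_size pxy) sx.
have {}sx : size x == q by rewrite sx.
have /tuple_permP[pi e] : perm_eq (Tuple sx) (Tuple sy) by [].
have -> : x = permuted pi (Tuple sy) by rewrite -e.
rewrite -[y in RHS]/(tval (Tuple sy)) !symmetrizeE; congr (_ * _).
rewrite [RHS](reindex_inj (mulIg pi)) /=; apply: eq_bigr => s _; congr G.
by apply: eq_map => i; rewrite tnth_mktuple permM.
Qed.

Lemma sum_permuted s (H : q.-tuple T -> R) : \sum_x H (permuted s x) = \sum_x H x.
Proof.
by rewrite [RHS](reindex (permuted s))//; exists (permuted s^-1%g) => x _; [exact: permutedK|exact: permutedKV].
Qed.

Lemma sum_symmetrize G Phi : (forall x y, size x = q -> perm_eq x y -> Phi x = Phi y) ->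
  \sum_(x : q.-tuple T) symmetrize G x * Phi x = \sum_(x : q.-tuple T) G x * Phi x.
Proof.
move=> sP; under eq_bigr do rewrite symmetrizeE -mulrA mulr_suml.
rewrite -mulr_sumr exchange_big /=.
under eq_bigr => s _.
  rewrite (eq_bigr (fun x => (fun y : q.-tuple T => G y * Phi y) (permuted s x))); last first.
    by move=> x _; rewrite (sP _ _ (size_tuple _) (perm_eq_permuted s x)).
  rewrite (sum_permuted s (fun y : q.-tuple T => G y * Phi y)); over.
rewrite sumr_const card_Sn -[X in _ * X]mulr_natl mulrA mulVf ?mul1r//.
Qed.

(** Jensen's inequality for the average over permutations, under weights that are themselves
    symmetric. *)
Lemma dsum_symmetrize_le (lam : T -> R) G : (forall t, 0 <= lam t) ->
  dsum lam q (fun x => symmetrize G x ^+ 2) <= dsum lam q (fun x => G x ^+ 2).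
Proof.
move=> lam0; have f0 : (q`!%:R : R) != 0 by rewrite pnatr_eq0 -lt0n fact_gt0.
have card : #|pred_of_simpl (@predT {perm 'I_q})| = q`! by rewrite -(card_Sn q); exact: eq_card.
have L0 (x : seq T) : 0 <= \prod_(t <- x) lam t by rewrite prodr_ge0.
apply: (@le_trans _ _ (\sum_(x : q.-tuple T) symmetrize (fun y => G y ^+ 2) x * \prod_(t <- x) lam t)).
  apply: ler_sum => x _; rewrite mulrC ler_wpM2r// !symmetrizeE exprMn [_^-1 ^+ 2]expr2 -mulrA.
  rewrite ler_wpM2l ?invr_ge0// ler_pdivrMl ?ltr0n ?fact_gt0//.
  by have := sqr_sum_le (pred_of_simpl predT) (fun s : 'S_q => G (permuted s x)); rewrite card.
rewrite (@sum_symmetrize _ (fun x => \prod_(t <- x) lam t)).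
  by rewrite le_eqVlt; apply/orP; left; apply/eqP; apply: eq_bigr => x _; rewrite mulrC.
by move=> x y _ pxy; exact: perm_big.
Qed.

End symmetrization.

(** * Elementary kernels as functions of the cells *)

Section elementary_on_grid.
Context {d d'} {Z : measurableType d} {Omega : measurableType d'} {R : realType}.
Variables (P : probability Omega R) (mu : {sigma_finite_measure set Z -> \bar R}) (eta : R.-ker Omega ~> Z).
Hypotheses (hZ : borel_space Z R) (hA : no_atoms mu) (hP : poisson_measure P mu eta).
Notation pm := (power_measure mu).
Variables (T : finType) (kappa : Z -> T) (t0 : T).
Hypothesis gridP : grid mu kappa t0.
Notation cell := (grid_cell kappa t0).
Notation lam := (cell_mass mu cell).

Definition representative (t : T) : Z := xget point [set z | kappa z = t].

(** A class may be empty; its representative is then the default [point], which lies in another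
    class, and the equation tells the two cases apart. *)
Definition proper t := (t != t0) && `[< kappa (representative t) = t >].

Lemma representativeK z : kappa (representative (kappa z)) = kappa z.
Proof. by rewrite /representative; case: xgetP => [y _ //|/(_ z) []]. Qed.

Lemma proper_kappa z : proper (kappa z) = (kappa z != t0).
Proof.
by rewrite /proper; case: eqP => //= _; apply/asboolP; exact: representativeK.
Qed.

(** The unions of classes of kappa that avoid the class of t0. *)
Definition saturated (A : set Z) :=
  (forall z z', kappa z = kappa z' -> A z -> A z') /\ (forall z, A z -> kappa z != t0).

Definition grid_kernel (u : seq Z -> R) (x : seq T) : R :=
  if all proper x then u (map representative x) else 0%R.

Lemma grid_kernel_vanishing u : vanishing t0 (grid_kernel u).
Proof.
move=> x xt; rewrite /grid_kernel; case: ifP => // /allP /(_ _ xt).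
by rewrite /proper eqxx.
Qed.

Lemma measure_saturated (nu : {measure set Z -> \bar R}) A : measurable A -> saturated A ->
  (forall t, nu (cell t) < +oo) ->
  fine (nu A) = (\sum_t fine (nu (cell t)) * (proper t && `[< A (representative t) >])%:R)%R.
Proof.
move=> mA [sA A0] nuoo; rewrite -[LHS]/(fine (nu A)) -[in LHS](setIT A) -integral_indic//.
rewrite -[RHS]/(fine (_)%:E) -(@integral_kappa _ _ _ _ _ _ _ gridP nu)//; last by rewrite /proper eqxx.
congr fine; apply: eq_integral => z _; congr EFin; rewrite indicE proper_kappa.
have -> : `[< A (representative (kappa z)) >] = (z \in A).
  by apply/asboolP/idP; rewrite inE => h; apply: sA h; rewrite representativeK.
case: (boolP (z \in A)) => h; last by rewrite andbF.
by rewrite andbT A0//; rewrite inE in h.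
Qed.

Variable q : nat.
Implicit Types e : elementary mu q.

Definition elem_saturated e := forall c j, saturated (@elem_set _ _ _ _ _ e c j).
Arguments elem_set {d Z R mu q} e c j.

Notation ekernel e := (app_seq (elem_kernel e)).
Notation egrid e := (grid_kernel (ekernel e)).

Lemma lift_elem e (y : q.-tuple Z) : elem_saturated e ->
  lift_kernel kappa (egrid e) y = elem_kernel e y.
Proof.
move=> se; rewrite /lift_kernel /grid_kernel all_map -map_comp.
have rep (c : 'I_(elem_size e)) j z : \1_(elem_set e c j) (representative (kappa z)) = \1_(elem_set e c j) z :> R.
  rewrite !indicE; congr ((_ : bool)%:R); have [sA _] := se c j.
  by apply/idP/idP; rewrite !inE => h; apply: sA h; rewrite representativeK.
case: ifPn => [_|/allPn[z zy]].
  rewrite -[map _ _]/(tval (map_tuple _ y)) app_seqE; apply: eq_bigr => c _; congr (_ * _)%R.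
  by apply: eq_bigr => j _; rewrite tnth_map /= rep.
rewrite /= proper_kappa negbK => /eqP zt; have /tnthP[j zj] := zy.
apply/esym; apply: big1 => c _; rewrite (bigD1 j)//= -zj indicE memNset ?mul0r ?mulr0//.
by move=> /(se c j).2; rewrite zt eqxx.
Qed.

(** In each term of the kernel the two arguments in question are tested against disjoint unions of
    classes; lying in one class, they cannot both pass. *)
Lemma elem_collision e (y : q.-tuple Z) : elem_saturated e ->
  ~~ uniq (map kappa y) -> elem_kernel e y = 0%R.
Proof.
move=> se nu; have [i [j [ij kij]]] : exists i j, i != j /\ kappa (tnth y i) = kappa (tnth y j).
  apply: contrapT => H; move/negP: nu; apply; rewrite -[map _ _]/(tval (map_tuple kappa y)).
  apply/tuple_uniqP => i j; rewrite !tnth_map => kij; apply/eqP; apply: contrapT => ij.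
  by apply: H; exists i, j; split => //; apply/negP.
apply: big1 => c _; rewrite (bigD1 i)//= (bigD1 j) 1?eq_sym//= !indicE.
case: (boolP (_ \in elem_set e c i)) => hi; last by rewrite mul0r mulr0.
case: (boolP (_ \in elem_set e c j)) => hj; last by rewrite mul0r !mulr0.
rewrite !inE in hi hj; exfalso; move/negP: ij; apply; apply/eqP.
have := @elem_disjoint _ _ _ _ _ e c i j Logic.I Logic.I; apply.
by exists (tnth y i); split => //; apply: (se c j).1 hj.
Qed.

Lemma egrid_uniq e x : elem_saturated e -> size x = q -> ~~ uniq x -> egrid e x = 0%R.
Proof.
move=> se sx ux; rewrite /grid_kernel.
case: ifP => // ax; have sx' : size (map representative x) == q by rewrite size_map sx.
rewrite -[map _ x]/(tval (Tuple sx')) !app_seqE elem_collision//= -map_comp.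
rewrite (_ : map _ x = x)//; rewrite -[RHS]map_id; apply/eq_in_map => t tx /=.
by move/allP: ax => /(_ _ tx) /andP[_ /asboolP].
Qed.

Lemma egrid_symmetric e : elem_saturated e ->
  (forall x y : q.-tuple Z, perm_eq x y -> elem_kernel e x = elem_kernel e y) ->
  symmetric_kernel q (egrid e).
Proof.
move=> se sym; split => [x y sx pxy|x]; last exact: egrid_uniq.
  rewrite /grid_kernel (perm_all _ pxy); case: ifP => // _.
  have sx' : size (map representative x) == q by rewrite size_map sx.
  have sy' : size (map representative y) == q by rewrite size_map -(perm_size pxy) sx.
  rewrite -[map _ x]/(tval (Tuple sx')) -[map _ y]/(tval (Tuple sy')) !app_seqE.
  by apply: sym; exact: perm_map.
Qed.

(** Almost surely eta is finite on every cell, so the compensated measure of a union of cells is the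
    sum of compensated counts. The product of these sums is expanded over tuples of cells. *)
Lemma elem_integral_grid e : elem_saturated e ->
  {ae P, forall w, elem_integral eta e w =
    (\sum_(x : q.-tuple T) egrid e x * compensated_product lam (counts eta cell w) x)%R}.
Proof.
move=> se; have := counts_ae hP (measurable_grid_cell gridP) (grid_cell_finite gridP).
apply: filterS => w cw.
pose X t := ((counts eta cell w t)%:R - lam t)%R.
have comp c j : compensated mu eta w (elem_set e c j) =
    (\sum_t (proper t && `[< elem_set e c j (representative t) >])%:R * X t)%R.
  have mA := @elem_measurable _ _ _ _ _ e c j.
  rewrite /compensated !measure_saturated//; last 2 first.
  - exact: grid_cell_finite.
  - by move=> t; rewrite cw ltry.
  by rewrite -sumrB; apply: eq_bigr => t _; rewrite cw /= -mulrBl mulrC.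
rewrite /elem_integral; under eq_bigr => c _.
  under eq_bigr => j _ do rewrite comp.
  rewrite bigA_distr_bigA mulr_sumr; over.
rewrite exchange_big /=.
rewrite (reindex (fun x : q.-tuple T => [ffun j => tnth x j])) /=; last first.
  exists (fun f : {ffun 'I_q -> T} => [tuple f j | j < q]) => [x _|f _].
    by apply: eq_from_tnth => j; rewrite tnth_mktuple ffunE.
  by apply/ffunP => j; rewrite ffunE tnth_mktuple.
apply: eq_bigr => x _; rewrite /compensated_product big_tuple.
transitivity (\sum_(c < elem_size e) (elem_coef c *
    \prod_(j < q) (proper (tnth x j) && `[< elem_set e c j (representative (tnth x j)) >])%:R) *
    \prod_(j < q) X (tnth x j))%R.
  apply: eq_bigr => c _; rewrite -mulrA -big_split; congr (_ * _)%R.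
  by apply: eq_bigr => j _; rewrite ffunE.
rewrite -mulr_suml; congr (_ * _)%R; rewrite /grid_kernel; case: ifPn => [/allP ax|/allPn[t tx nt]].
  rewrite -[map _ _]/(tval (map_tuple _ x)) app_seqE; apply: eq_bigr => c _; congr (_ * _)%R.
  apply: eq_bigr => j _; rewrite ax ?mem_tnth// tnth_map indicE /=.
  by congr ((_ : bool)%:R); rewrite in_setE; apply/asboolP/idP; rewrite inE.
apply: big1 => c _; have /tnthP[j tj] := tx.
by rewrite (bigD1 j)//= -tj (negPf nt) mul0r mulr0.
Qed.

Lemma measurable_elem_kernel e : measurable_fun setT (elem_kernel e).
Proof.
apply: measurable_sum => c; apply: measurable_funM => //.
apply: (@measurable_prod _ (q.-tuple Z) R setT 'I_q (index_enum 'I_q)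
  (fun j x => \1_(elem_set e c j) (tnth x j))) => j _.
have m1 : measurable_fun setT (\1_(elem_set e c j) : Z -> R).
  by apply: measurable_indic; exact: elem_measurable.
exact: (measurableT_comp m1 (measurable_tnth j)).
Qed.

Lemma measurable_elem_integral e : measurable_fun setT (elem_integral eta e).
Proof.
apply: measurable_sum => c; apply: measurable_funM => //.
apply: (@measurable_prod _ Omega R setT 'I_q (index_enum 'I_q)
  (fun j w => compensated mu eta w (elem_set e c j))) => j _.
apply: measurable_funB => //; apply: measurableT_comp => //.
by apply: measurable_kernel; exact: elem_measurable.
Qed.

End elementary_on_grid.

Section common_grid.
Context {d} {Z : measurableType d} {R : realType}.
Variable mu : {sigma_finite_measure set Z -> \bar R}.
Variables (I : finType) (A : I -> set Z).
Hypotheses (mA : forall i, measurable (A i)) (Aoo : forall i, mu (A i) < +oo).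

(** Its fibres are the atoms of the finite algebra generated by the sets [A i]; [no_atom] labels the
    complement of their union. *)
Definition atom_of (z : Z) : {ffun I -> bool} := [ffun i => `[< A i z >]].
Definition no_atom : {ffun I -> bool} := [ffun=> false].

Lemma grid_atoms : grid mu atom_of no_atom.
Proof.
have mt t : measurable (atom_of @^-1` [set t]).
  rewrite (_ : _ @^-1` _ = \bigcap_(i in [set: I]) (if t i then A i else ~` A i)).
    by apply: fin_bigcap_measurable => // i _; case: ifP => _ //; exact: measurableC.
  apply/seteqP; split => z /=.
    by move=> <- i _; rewrite ffunE; case: ifPn => /asboolP.
  move=> H; apply/ffunP => i; rewrite ffunE; have := H i Logic.I.
  by case: (t i) => h; [exact/asboolP|apply/asboolP].
split=> // t tn; have [i ti] : exists i, t i.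
  apply: contrapT => H; move/negP: tn; apply; apply/eqP/ffunP => i; rewrite ffunE.
  by apply/negP => ti; apply: H; exists i.
apply: le_lt_trans (Aoo i); apply: le_measure; rewrite ?inE//.
by move=> z /= e; move: ti; rewrite -e ffunE => /asboolP.
Qed.

Lemma saturated_atoms i : saturated atom_of no_atom (A i).
Proof.
split=> [z z' /ffunP/(_ i)|z Az]; rewrite ?ffunE.
  by move=> e Az; apply/asboolP; rewrite -e; exact/asboolP.
apply/eqP => /ffunP/(_ i); rewrite !ffunE => /asboolP; exact.
Qed.

End common_grid.

Section elementary_isometry.
Context {d d'} {Z : measurableType d} {Omega : measurableType d'} {R : realType}.
Variables (P : probability Omega R) (mu : {sigma_finite_measure set Z -> \bar R}) (eta : R.-ker Omega ~> Z).
Hypotheses (hZ : borel_space Z R) (hA : no_atoms mu) (hP : poisson_measure P mu eta).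
Notation pm := (power_measure mu).
Notation ekernel e := (app_seq (elem_kernel e)).

Arguments elem_set {d Z R mu q} e c j.

Section given_grid.
Variables (T : finType) (kappa : Z -> T) (t0 : T).
Hypothesis gridP : grid mu kappa t0.
Notation cell := (grid_cell kappa t0).
Notation lam := (cell_mass mu cell).
Variable q : nat.
Implicit Types e : elementary mu q.
Notation egrid e := (grid_kernel kappa t0 (ekernel e)).

Lemma counts_poisson_grid : poisson_functional lam (mean_counts P eta cell).
Proof.
exact: (counts_poisson hZ hA hP (measurable_grid_cell gridP) (grid_cell_finite gridP) (grid_cell_disjoint kappa t0)).
Qed.

(** The difference of the kernels is symmetrised on the grid, which leaves the integral unchanged
    and does not increase the L^2 norm: hence an inequality. The single order is treated as a family
    indexed by ['I_1]. *)
Lemma elem_isometry_grid e e' : elem_saturated kappa t0 e -> elem_saturated kappa t0 e' ->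
  \int[P]_w ((elem_integral eta e w - elem_integral eta e' w) ^+ 2)%:E <=
  (q`!%:R)%:E * sqr_mass mu q (fun x => ekernel e x - ekernel e' x)%R.
Proof.
move=> se se'.
pose D x := (egrid e x - egrid e' x)%R.
have vD : vanishing t0 D by move=> x xt; rewrite /D !grid_kernel_vanishing// subrr.
have uD x : size x = q -> ~~ uniq x -> D x = 0%R.
  by move=> sx ux; rewrite /D !egrid_uniq// subrr.
have symD : symmetric_kernel q (symmetrize t0 q D).
  split; first exact: symmetrize_perm.
  move=> x /eqP sx ux; rewrite -[x]/(tval (Tuple sx)) symmetrizeE big1 ?mulr0// => s _.
  by rewrite uD ?size_tuple// (perm_uniq (perm_eq_permuted s (Tuple sx))).
pose Gs (_ : 'I_1) := symmetrize t0 q D; pose qs (_ : 'I_1) := q.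
have qi (i j : 'I_1) : (i < j)%N -> (qs i < qs j)%N by rewrite !ord1.
have sG i : symmetric_kernel (qs i) (Gs i) by [].
have tF : tame (fun n => total_sum lam qs Gs n ^+ 2)%R by apply: tame_exp; exact: tame_total.
have := total_second_moment qi sG counts_poisson_grid.
rewrite big_ord1 /qs /Gs => E.
have -> : \int[P]_w ((elem_integral eta e w - elem_integral eta e' w) ^+ 2)%:E =
    (mean_counts P eta cell (fun n => total_sum lam qs Gs n ^+ 2)%R)%:E.
  rewrite (mean_countsE hZ hA hP (measurable_grid_cell gridP) (grid_cell_finite gridP) (grid_cell_disjoint kappa t0))//.
  apply: ge0_ae_eq_integral => //.
  - apply/measurable_EFinP/measurable_funX/measurable_funB; exact: measurable_elem_integral.
  - apply/measurable_EFinP.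
    exact: (measurable_counts_comp eta (measurable_grid_cell gridP) (fun n => total_sum lam qs Gs n ^+ 2)%R).
  - by move=> w _; rewrite lee_fin sqr_ge0.
  - by move=> w _; rewrite lee_fin sqr_ge0.
  have := elem_integral_grid hP gridP se; have := elem_integral_grid hP gridP se'.
  apply: filterS2 => w e1 e2 _; rewrite e1 e2 -sumrB; congr ((_ ^+ 2)%:E).
  rewrite /total_sum big_ord1 /qs /Gs.
  rewrite (@sum_symmetrize _ _ t0 q D (fun x => compensated_product lam (counts eta cell w) x)).
    by apply: eq_bigr => x _; rewrite -mulrBl.
  by move=> x y _ pxy; exact: perm_big.
rewrite [mean_counts _ _ _ _]E EFinM lee_pmul2l ?lte_fin ?ltr0n ?fact_gt0//.
have -> : sqr_mass mu q (fun x => ekernel e x - ekernel e' x)%R = (dsum lam q (fun x => D x ^+ 2)%R)%:E.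
  rewrite -(ge0_integral_lift gridP) => [|x|x xt]; [|exact: sqr_ge0|by rewrite vD// expr0n].
  apply: eq_integral => x _; rewrite !app_seqE /lift_kernel /D.
  have := lift_elem x se; have := lift_elem x se'; rewrite /lift_kernel => -> ->.
  by [].
by rewrite lee_fin; apply: dsum_symmetrize_le => t; exact: cell_mass_ge0.
Qed.

(** One term per tuple of cells. A tuple with repetitions is given empty sets, which keeps the sets
    of each term disjoint; G vanishes there anyway. *)
Lemma rebuild_elementary (G : seq T -> R) : (forall x, size x = q -> t0 \in x -> G x = 0%R) ->
  (forall x, size x = q -> ~~ uniq x -> G x = 0%R) ->
  exists e : elementary mu q, forall y : q.-tuple Z, elem_kernel e y = lift_kernel kappa G y.
Proof.
move=> vG uG; pose N := #|{: q.-tuple T}|.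
pose S (c : 'I_N) (j : 'I_q) := if uniq (enum_val c) then cell (tnth (enum_val c) j) else set0.
have mS c j : measurable (S c j) by rewrite /S; case: ifP => // _; exact: measurable_grid_cell gridP _.
have fS c j : mu (S c j) < +oo.
  by rewrite /S; case: ifP => _; [exact: grid_cell_finite|rewrite measure0].
have dS c : trivIset setT (S c).
  move=> i j _ _; rewrite /S; case: ifP => [/tuple_uniqP u|_]; last by rewrite setI0 => -[].
  move=> [z zz]; apply/eqP; apply: contraT => ij.
  have := @grid_cell_disjoint _ _ _ kappa t0 (tnth (enum_val c) i) (tnth (enum_val c) j).
  rewrite (inj_eq u) => /(_ ij) e0.
  by have : (set0 : set Z) z by rewrite -e0.
exists (Elementary (fun c : 'I_N => G (enum_val c)) mS fS dS) => y; rewrite /elem_kernel /=.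
rewrite /lift_kernel -[map _ _]/(tval (map_tuple kappa y)).
set k := map_tuple kappa y.
rewrite (bigD1 (enum_rank k))//= enum_rankK [X in (_ + X)%R]big1 ?addr0 => [|c ck].
  have [u|u] := boolP (uniq k); last by rewrite uG ?size_tuple// mul0r.
  have [t0k|t0k] := boolP (t0 \in k); first by rewrite vG ?size_tuple// mul0r.
  rewrite big1 ?mulr1// => j _; rewrite indicE /S enum_rankK u mem_set// /grid_cell.
  case: eqP => [e|_]; last by rewrite /k tnth_map.
  by move/negP: t0k; case; rewrite -e mem_tnth.
suff [j zj] : exists j, ~ S c j (tnth y j) by rewrite (bigD1 j)//= indicE memNset// mul0r mulr0.
apply: contrapT => H; move/negP: ck; apply; apply/eqP; apply: enum_val_inj.
rewrite enum_rankK; apply: eq_from_tnth => j; rewrite /k tnth_map.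
have : S c j (tnth y j) by apply: contrapT => h; apply: H; exists j.
by rewrite /S; case: ifP => // _; rewrite /grid_cell; case: ifP => // _ /= ->.
Qed.

End given_grid.

Variable q : nat.
Implicit Types e : elementary mu q.



Lemma elem_isometry e e' :
  \int[P]_w ((elem_integral eta e w - elem_integral eta e' w) ^+ 2)%:E <=
  (q`!%:R)%:E * sqr_mass mu q (fun x => ekernel e x - ekernel e' x)%R.
Proof.
pose A (i : ('I_(elem_size e) * 'I_q) + ('I_(elem_size e') * 'I_q)) :=
  match i with inl p => elem_set e p.1 p.2 | inr p => elem_set e' p.1 p.2 end.
have mA i : measurable (A i) by case: i => p; exact: elem_measurable.
have fA i : mu (A i) < +oo by case: i => p; exact: elem_finite.
apply: (elem_isometry_grid (grid_atoms mA fA)) => c j.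
- exact: (saturated_atoms A (inl (c, j))).
- exact: (saturated_atoms A (inr (c, j))).
Qed.

Definition clip (lo hi x : R) : R := Num.max lo (Num.min hi x).

Definition mean_permuted (u : seq Z -> R) (y : seq Z) : R :=
  ((q`!%:R)^-1 * \sum_(s : 'S_q) u [seq nth point y (s i) | i <- enum 'I_q])%R.

(** On a grid adapted to both e and B, averaging over permutations, clipping and restricting to B
    all yield functions of the cells. The value 0 is fixed by clipping because [lo <= 0 <= hi], so
    the result still vanishes on repeated cells and [rebuild_elementary] applies. *)
Lemma truncated_elementary e (B : set Z) (lo hi : R) : (lo <= 0)%R -> (0 <= hi)%R -> measurable B -> mu B < +oo ->
  exists e' : elementary mu q, (forall y : q.-tuple Z, elem_kernel e' y =
    clip lo hi (mean_permuted (ekernel e) y) * (all (fun z => `[< B z >]) y)%:R)%R /\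
    (forall x y : q.-tuple Z, perm_eq x y -> elem_kernel e' x = elem_kernel e' y).
Proof.
move=> lo0 hi0 mB Boo.
pose A (i : option ('I_(elem_size e) * 'I_q)) :=
  match i with Some p => elem_set e p.1 p.2 | None => B end.
have mA i : measurable (A i) by case: i => [p|//]; exact: elem_measurable.
have fA i : mu (A i) < +oo by case: i => [p|//]; exact: elem_finite.
have gP := grid_atoms mA fA; set kappa := atom_of A in gP; set t0 := no_atom _ in gP.
have se : elem_saturated kappa t0 e by move=> c j; exact: (saturated_atoms A (Some (c, j))).
have sB : saturated kappa t0 B by exact: (saturated_atoms A None).
pose g := grid_kernel kappa t0 (ekernel e).
pose G x := (clip lo hi (symmetrize t0 q g x) * (all (fun t => `[< B (representative kappa t) >]) x)%:R)%R.
have clip0 : clip lo hi 0 = 0%R by rewrite /clip (min_r hi0) (max_r lo0).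
have vsym (Q : pred (seq _)) : (forall x y, perm_eq x y -> Q x -> Q y) ->
    (forall x, size x = q -> Q x -> g x = 0%R) -> forall x, size x = q -> Q x -> G x = 0%R.
  move=> pQ gQ x /eqP sx Qx; rewrite /G -[x]/(tval (Tuple sx)) symmetrizeE big1 ?mulr0 ?clip0 ?mul0r// => s _.
  rewrite gQ ?size_tuple//; apply: pQ Qx; rewrite perm_sym; exact: perm_eq_permuted.
have [e' He'] : exists e' : elementary mu q, forall y : q.-tuple Z, elem_kernel e' y = lift_kernel kappa G y.
  apply: (rebuild_elementary gP).
    apply: vsym => [x y pxy|x _ xt]; first by rewrite (perm_mem pxy).
    by rewrite /g grid_kernel_vanishing.
  apply: vsym => [x y pxy|x sx ux]; first by rewrite (perm_uniq pxy).
  exact: egrid_uniq.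
exists e'; split=> [y|x y pxy].
  rewrite He' /lift_kernel /G -[map _ _]/(tval (map_tuple kappa y)) symmetrizeE.
  rewrite all_map; congr (clip lo hi (_ * _) * (_ : bool)%:R)%R.
    apply: eq_bigr => s _.
    have -> : tval (permuted s (map_tuple kappa y)) = map kappa [tuple tnth y (s i) | i < q].
      rewrite -[RHS]/(tval (map_tuple kappa [tuple tnth y (s i) | i < q])); congr tval.
      by apply: eq_from_tnth => i; rewrite [LHS]tnth_mktuple [RHS]tnth_map tnth_mktuple tnth_map.
    have := lift_elem [tuple tnth y (s i) | i < q] se; rewrite /lift_kernel /g => ->.
    rewrite -app_seqE; congr app_seq => /=.
    by apply: eq_map => i; rewrite (tnth_nth point).
  apply: eq_all => z /=; apply/asboolP/asboolP => h; apply: sB.1 h.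
    exact: representativeK.
  by rewrite representativeK.
rewrite !He' /lift_kernel /G; have pk := perm_map kappa pxy.
rewrite (symmetrize_perm t0 g _ pk) ?size_map ?size_tuple//.
by rewrite (perm_all _ pk).
Qed.

End elementary_isometry.

Lemma cvge0_near {R : realType} (u : (\bar R)^nat) (eps : R) : u @ \oo --> 0 -> (0 < eps)%R ->
  \forall n \near \oo, u n <= eps%:E.
Proof.
move=> cu e0; have : nbhs (0 : \bar R) [set x | x < eps%:E].
  by apply: open_nbhs_nbhs; split; [exact: open_ereal_lt_ereal|rewrite /= lte_fin].
move=> /cu H; apply: (@filterS _ \oo _ (fun n => u n < eps%:E)); last exact: H.
by move=> n /ltW.
Qed.

Lemma near_cvge0 {R : realType} (u : (\bar R)^nat) : (forall n, 0 <= u n) ->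
  (forall eps : R, (0 < eps)%R -> \forall n \near \oo, u n <= eps%:E) -> u @ \oo --> 0.
Proof.
move=> u0 H A [/= e e0 Ae].
have e2 : (0 < e / 2)%R by rewrite divr_gt0.
apply: (@filterS _ \oo _ (fun n => u n <= (e / 2)%:E)); last exact: H.
move=> n /=.
have := u0 n; case: (u n) => [r| |] //; rewrite !lee_fin => r0 re.
by apply: Ae => /=; rewrite sub0r normrN ger0_norm//; have : (0 < e)%R := e0; lra.
Qed.

Lemma sume_cst {R : realType} (I : finType) (S : \bar R) : 0 <= S ->
  \sum_(i : I) S = (#|I|%:R)%:E * S.
Proof.
move=> S0; rewrite big_const cardT; elim: (size _) => [|n IH]; first by rewrite mul0e.
by rewrite iterS IH -natr1 EFinD ge0_muleDl ?lee_fin// mul1e addeC.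
Qed.

Lemma integral_sqrD {d} {V : measurableType d} {R : realType} (nu : {measure set V -> \bar R}) (a b : V -> R) :
  measurable_fun setT a -> measurable_fun setT b ->
  \int[nu]_v ((a v + b v) ^+ 2)%:E <=
    2%:E * \int[nu]_v ((a v) ^+ 2)%:E + 2%:E * \int[nu]_v ((b v) ^+ 2)%:E.
Proof.
move=> ma mb.
have m2 (c : V -> R) : measurable_fun setT c -> measurable_fun setT (fun v => ((c v) ^+ 2)%:E).
  by move=> mc; apply/measurable_EFinP/measurable_funX.
have mm2 (c : V -> R) : measurable_fun setT c -> measurable_fun setT (fun v => 2%:E * ((c v) ^+ 2)%:E).
  by move=> mc; apply: emeasurable_funM => //; exact: m2.
rewrite -ge0_integralZl_EFin//; [|by move=> v _; rewrite lee_fin sqr_ge0|exact: m2].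
rewrite -ge0_integralZl_EFin//; [|by move=> v _; rewrite lee_fin sqr_ge0|exact: m2].
rewrite -ge0_integralD//; first last.
- exact: mm2.
- by move=> v _; rewrite -EFinM lee_fin mulr_ge0 ?sqr_ge0.
- exact: mm2.
- by move=> v _; rewrite -EFinM lee_fin mulr_ge0 ?sqr_ge0.
apply: ge0_le_integral => //.
- by move=> v _; rewrite lee_fin sqr_ge0.
- by apply: m2; exact: measurable_funD.
- by apply: emeasurable_funD; exact: mm2.
- by move=> v _; rewrite -!EFinM -EFinD lee_fin; have := sqr_ge0 (a v - b v)%R; nra.
Qed.

Lemma clip_lipschitz {R : realType} (lo hi x y : R) : (`|clip lo hi x - clip lo hi y| <= `|x - y|)%R.
Proof.
have lip (op : R -> R) : (forall a b, a <= b -> op a <= op b /\ op b - op a <= b - a)%R ->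
    forall a b, (`|op a - op b| <= `|a - b|)%R.
  move=> H a b; case: (leP a b) => [ab|/ltW ab]; have [h1 h2] := H _ _ ab.
    by rewrite (ler0_norm (_ : op a - op b <= 0)%R) ?(ler0_norm (_ : a - b <= 0)%R); lra.
  by rewrite (ger0_norm (_ : 0 <= op a - op b)%R) ?(ger0_norm (_ : 0 <= a - b)%R); lra.
apply: (le_trans (lip (Num.max lo) _ _ _)); last apply: lip => a b ab.
  by move=> a b ab; case: (leP lo a) => ?; case: (leP lo b) => ?; split; lra.
by case: (leP hi a) => ?; case: (leP hi b) => ?; split; lra.
Qed.

(** * Approximation in L^2 and in the mixed norms *)

Section approximation.
Context {d} {Z : measurableType d} {R : realType}.
Variable mu : {sigma_finite_measure set Z -> \bar R}.
Notation pm := (power_measure mu).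
Notation mixed := (mixed_norm mu).
Implicit Types (u v w : seq Z -> R).

Definition all_in (B : set Z) (x : seq Z) : R := (all (fun z => `[< B z >]) x)%:R.

Lemma all_in_cat B x y : all_in B (x ++ y) = (all_in B x * all_in B y)%R.
Proof. by rewrite /all_in all_cat; do 2 case: all => //=; rewrite ?mul0r ?mulr0 ?mulr1. Qed.

Lemma integral_all_in B n : measurable B -> mu B < +oo ->
  \int[pm n]_x (all_in B x)%:E = (fine (mu B) ^+ n)%:E.
Proof.
move=> mB Boo; have := @power_measure_box _ Z R mu n (fun=> B) (fun=> mB).
have -> : \prod_(i < n) mu B = (fine (mu B) ^+ n)%:E.
  elim: n => [|n IH]; first by rewrite big_ord0 expr0.
  by rewrite big_ord_recl IH exprS EFinM fineK// ge0_fin_numE.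
move=> <-.
have mE : measurable [set x : n.-tuple Z | forall i, B (tnth x i)].
  rewrite (_ : [set x | _] = \bigcap_(i in [set: 'I_n]) ((@tnth n Z ^~ i) @^-1` B)).
    apply: fin_bigcap_measurable => // i _.
    by rewrite -[X in measurable X]setTI; exact: measurable_tnth.
  by apply/seteqP; split => x /= H i; [move=> _|]; exact: H.
rewrite -[X in pm n X]setIT -integral_indic//.
apply: eq_integral => x _; congr EFin; rewrite indicE /all_in; congr ((_ : bool)%:R).
apply/all_tnthP/idP => [H|]; rewrite ?inE /=; first by move=> i; exact/asboolP/H.
by move=> H i; apply/asboolP; exact: H.
Qed.

Lemma mker_all_in B n : measurable B -> mker n (all_in B).
Proof.
move=> mB; rewrite /mker.
rewrite (_ : (fun x : n.-tuple Z => all_in B x) = fun x => (\prod_(i < n) \1_B (tnth x i))%R); last first.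
  apply/funext => x; rewrite /all_in; case: (boolP (all _ _)) => [/all_tnthP H|].
    by apply/esym; apply: big1 => i _; rewrite indicE mem_set//; exact/asboolP/H.
  by move=> /allPn[z /tnthP[i ->] nB]; rewrite (bigD1 i)//= indicE memNset ?mul0r//; move/asboolP: nB.
have m1 : measurable_fun setT (\1_B : Z -> R) by exact: measurable_indic.
apply: (@measurable_prod _ (n.-tuple Z) R setT 'I_n (index_enum 'I_n)
  (fun j x => \1_B (tnth x j))) => j _.
exact: (measurableT_comp m1 (measurable_tnth j)).
Qed.

(** For a bounded kernel supported in a set of finite measure the section masses are bounded, and
    the mixed norm is controlled by the L^2 mass. This fails in general and is the reason for
    truncating. *)
Lemma mixed_bounded_support l m w (K : R) B : mker (l + (m + 0)) w -> measurable B -> mu B < +oo ->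
  (forall y, `|w y| <= K * all_in B y)%R ->
  mixed w l m 0 <= (K ^+ 2 * fine (mu B) ^+ l)%:E * sqr_mass mu (l + (m + 0)) w.
Proof.
move=> mw mB Boo wK; apply: mixed_bounded => // [|x].
  by rewrite mulr_ge0 ?sqr_ge0// exprn_ge0// fine_ge0.
have -> : (K ^+ 2 * fine (mu B) ^+ l)%:E = (K ^+ 2)%:E * \int[pm l]_x (all_in B x)%:E.
  by rewrite integral_all_in// EFinM.
have K2 : (0 <= K ^+ 2)%R by exact: sqr_ge0.
rewrite -ge0_integralZl_EFin//; last by apply/measurable_EFinP; exact: mker_all_in.
rewrite section_mass0; apply: ge0_le_integral => //.
- by move=> z _; rewrite lee_fin sqr_ge0.
- apply/measurable_EFinP/measurable_funX.
  by have := @measurable_kernel_section _ _ _ w l m 0 x [::] mw (size_tuple _) erefl; rewrite cats0.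
- by apply: emeasurable_funM => //; apply/measurable_EFinP; exact: mker_all_in.
- move=> z _; rewrite -EFinM lee_fin -[X in (X <= _)%R]real_normK ?num_real//.
  apply: (@le_trans _ _ ((K * all_in B (z ++ x)) ^+ 2)%R).
    by rewrite lerXn2r ?nnegrE ?(le_trans _ (wK _)).
  rewrite exprMn ler_wpM2l// all_in_cat /all_in.
  by do 2 case: all => //=; rewrite ?(mulr0, mul0r, mulr1, expr1n, expr0n).
- by move=> z _; rewrite lee_fin.
Qed.

Lemma perm_eq_iota_perm q (s : 'S_q) : perm_eq [seq val (s i) | i <- enum 'I_q] (iota 0 q).
Proof.
rewrite -val_enum_ord (map_comp val s); apply: perm_map.
apply: uniq_perm; [rewrite map_inj_uniq ?enum_uniq//; exact: perm_inj|exact: enum_uniq|].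
by move=> i; rewrite mem_enum; apply/mapP; exists (s^-1%g i); rewrite ?mem_enum ?permKV.
Qed.

(** The average over permutations does not increase the L^2 distance to a symmetric function, by
    convexity and permutation invariance of the product measure. *)
Lemma mean_permuted_sqr_mass q (E F F' : seq Z -> R) : mker q E -> mker q F -> mker q F' ->
  ae_symmetric mu q F -> {ae pm q, forall x : q.-tuple Z, F' x = F x} ->
  sqr_mass mu q (fun y => mean_permuted q E y - F' y)%R <= sqr_mass mu q (fun y => E y - F y)%R.
Proof.
move=> mE mF mF' sF eF.
pose ps (s : 'S_q) := [seq val (s i) | i <- enum 'I_q].
have pE (s : 'S_q) (y : seq Z) : [seq nth point y (s i) | i <- enum 'I_q] = map (nth point y) (ps s).
  by rewrite /ps -map_comp.
have sps s : size (ps s) = q by rewrite (perm_size (perm_eq_iota_perm s)) size_iota.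
have mperm (u : seq Z -> R) s : mker q u -> mker q (fun y => u (map (nth point y) (ps s))).
  move=> mu1; apply: (mker_comp mu1); rewrite -[X in mseq X](sps s).
  exact: mseq_map_nth (mseq_id q).
have mD : mker q (fun y => E y - F y)%R by exact: measurable_funB.
have mM : mker q (mean_permuted q E).
  apply: measurable_funM => //; apply: measurable_sum => s.
  apply: (eq_measurable_fun (fun y : q.-tuple Z => E (map (nth point y) (ps s)))).
    by move=> y _; rewrite pE.
  exact: mperm.
pose c : R := (q`!%:R^-1)%R.
have c0 : (0 <= c)%R by rewrite invr_ge0.
have f0 : (q`!%:R : R) != 0%R by rewrite pnatr_eq0 -lt0n fact_gt0.
have mS s : measurable_fun setT (fun y : q.-tuple Z => (((E (map (nth point y) (ps s)) - F (map (nth point y) (ps s))) ^+ 2)%R)%:E).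
  by apply/measurable_EFinP/measurable_funX/measurable_funB; exact: mperm.
have mSum : measurable_fun setT (fun y : q.-tuple Z => \sum_(s : 'S_q) (((E (map (nth point y) (ps s)) - F (map (nth point y) (ps s))) ^+ 2)%R)%:E).
  by apply: emeasurable_sum => s; exact: mS.
have -> : sqr_mass mu q (fun y => E y - F y)%R =
    \int[pm q]_y (c%:E * \sum_(s : 'S_q) (((E (map (nth point y) (ps s)) - F (map (nth point y) (ps s))) ^+ 2)%R)%:E).
  rewrite ge0_integralZl_EFin//; last by move=> y _; apply: sume_ge0 => s _; rewrite lee_fin sqr_ge0.
  rewrite ge0_integral_sum//; last by move=> s y _; rewrite lee_fin sqr_ge0.
  rewrite (eq_bigr (fun=> sqr_mass mu q (fun y => E y - F y)%R)) => [|s _]; last first.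
    apply: (int_perm mu (G := fun y => ((E y - F y) ^+ 2)%:E) (perm_eq_iota_perm s)).
      by move=> x; rewrite lee_fin sqr_ge0.
    exact: mker_sqr mD.
  rewrite sume_cst ?sqr_mass_ge0// -cardsT (eq_card (B := 'S_q)) ?card_Sn; last by move=> s; rewrite inE.
  rewrite muleA [c%:E * _](_ : _ = 1) ?mul1e//.
  by rewrite -EFinM /c mulVf.
apply: ae_ge0_le_integral => //.
- by move=> y _; rewrite lee_fin sqr_ge0.
- by apply/measurable_EFinP/measurable_funX/measurable_funB.
- by move=> y _; apply: mule_ge0; [rewrite lee_fin|apply: sume_ge0 => s _; rewrite lee_fin sqr_ge0].
- exact: emeasurable_funM.
have : {ae pm q, forall y : q.-tuple Z, forall s, F (map (nth point y) (ps s)) = F y}.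
  by apply: filter_forall => s; exact: sF (perm_eq_iota_perm s).
move: eF; apply: filterS2 => y e1 e2 _.
rewrite sumEFin -EFinM lee_fin e1 /mean_permuted.
have -> : (q`!%:R^-1 * \sum_(s : 'S_q) E [seq nth point y (s i) | i <- enum 'I_q] - F y =
    c * \sum_(s : 'S_q) (E (map (nth point y) (ps s)) - F (map (nth point y) (ps s))))%R.
  rewrite sumrB mulrBr; congr (_ - _)%R; first by congr (_ * _)%R; apply: eq_bigr => s _; rewrite pE.
  rewrite (eq_bigr (fun=> F y)) => [|s _]; last by rewrite e2.
  by rewrite sumr_const card_Sn -[X in (_ * X)%R]mulr_natl mulrA mulVf ?mul1r.
rewrite exprMn [(c ^+ 2)%R]expr2 -mulrA ler_wpM2l// ler_pdivrMl ?ltr0n ?fact_gt0//.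
have card : #|pred_of_simpl (@predT {perm 'I_q})| = q`! by rewrite -(card_Sn q); exact: eq_card.
have := sqr_sum_le (pred_of_simpl predT) (fun s : 'S_q => E (map (nth point y) (ps s)) - F (map (nth point y) (ps s)))%R.
by rewrite card.
Qed.

Section multiple_integral.
Context {d'} {Omega : measurableType d'}.
Variables (P : probability Omega R) (eta : R.-ker Omega ~> Z).
Hypotheses (hZ : borel_space Z R) (hA : no_atoms mu) (hP : poisson_measure P mu eta).
Notation ekernel e := (app_seq (elem_kernel e)).

Lemma Lnorm2_sqr {d2} {V : measurableType d2} (nu : {measure set V -> \bar R}) (a : V -> R) :
  ('N[nu]_2%:E[EFin \o a]) ^+ 2 = \int[nu]_v ((a v) ^+ 2)%:E.
Proof.
rewrite -poweR2 ?Lnorm_ge0// poweR_Lnorm//; apply: eq_integral => v _.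
by rewrite poweR2 ?abse_ge0// sqe_abs expe2 /= -EFinM expr2.
Qed.

Lemma Lnorm2_near {d2} {V : measurableType d2} (nu : {measure set V -> \bar R}) (a : nat -> V -> R) (eps : R) :
  ('N[nu]_2%:E[EFin \o a n] @[n --> \oo] --> 0) -> (0 < eps)%R ->
  \forall n \near \oo, \int[nu]_v ((a n v) ^+ 2)%:E <= eps%:E.
Proof.
move=> cv e0; pose h := Num.min 1%R eps.
have h0 : (0 < h)%R by rewrite lt_min ltr01.
have := cvge0_near cv h0; apply: filterS => n le.
rewrite -Lnorm2_sqr; apply: le_trans (sqe_le (Lnorm_ge0 _ _ _) le) _.
rewrite expe2 -EFinM lee_fin /h; case: (leP 1%R eps) => h1; first by rewrite mulr1.
by rewrite ger_pMr// ltW.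
Qed.

(** The given elementary kernels converge to f in L^2 only. The truncations [fK k] converge to f in
    the mixed norms by domination; for a fixed k, averaging the given kernels over permutations,
    clipping them at level k and restricting them to [B k] produces elementary kernels close to
    [fK k] in L^2, hence in the mixed norms. Clipping below at 0 gives nonnegative kernels, and the
    isometry transfers the closeness to the integrals. *)
Lemma elementary_approximation q (f : q.-tuple Z -> R) (X : Omega -> R) (nn : bool) (eps : R) :
  measurable_fun setT f -> L2s mu f -> sqr_mass mu q (app_seq f) < +oo ->
  (forall l m, (l + m = q)%N -> mixed (app_seq f) l m 0 < +oo) ->
  (nn -> {ae pm q, forall x, 0 <= f x}%R) ->
  measurable_fun setT X -> is_multiple_integral P mu eta f X -> (0 < eps)%R ->
  exists e : elementary mu q,
  [/\ forall x y : q.-tuple Z, perm_eq x y -> elem_kernel e x = elem_kernel e y,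
      nn -> forall x, (0 <= elem_kernel e x)%R,
      forall l m, (l + m = q)%N -> mixed (fun x => ekernel e x - app_seq f x)%R l m 0 <= eps%:E &
      \int[P]_w ((elem_integral eta e w - X w) ^+ 2)%:E <= eps%:E].
Proof.
move=> mf L2f f2 fM fnn mX [es [cvk cvI]] eps0.
pose F := app_seq f; have mF : mker q F := mker_app_seq mf.
have sF : ae_symmetric mu q F := L2s_ae_symmetric L2f.
(* Nonnegativity of f holds almost everywhere; its positive part is a version that is nonnegative at
   every point. *)
pose F' x := if nn then Num.max (F x) 0%R else F x.
have mF' : mker q F'.
  rewrite /F'; case: (nn) => //; apply: measurable_maxr => //; exact: measurable_cst.
have eF : {ae pm q, forall x : q.-tuple Z, F' x = F x}.
  rewrite /F'; case: (nn) fnn => [/(_ isT)|_]; last by apply: aeW.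
  by apply: filterS => x x0; rewrite max_l// /F app_seqE.
have F'F x : (`|F' x| <= `|F x|)%R.
  by rewrite /F'; case: (nn) => //; case: (leP (F x) (0:R)%R) => // _; rewrite normr0.
pose lo (K : R) : R := if nn then 0%R else (- K)%R.
have lo0 K : (0 <= K)%R -> (lo K <= 0)%R by rewrite /lo; case: (nn) => //; rewrite oppr_le0.
have /sigma_finiteP[B [BT Bnd BP]] := sigma_finiteT mu.
pose fK (k : nat) x := (clip (lo k%:R) k%:R (F' x) * all_in (B k) x)%R.
have F'0 x : nn -> (0 <= F' x)%R by rewrite /F' => ->; rewrite le_max lexx orbT.
have clipF k x : (`|clip (lo k%:R) k%:R (F' x) - F' x| <= `|F' x|)%R /\
    ((`|F' x| <= k%:R)%R -> clip (lo k%:R) k%:R (F' x) = F' x).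
  have k0 : (0 <= k%:R :> R)%R by [].
  rewrite /clip /lo; have := F'0 x; case: (nn) => [/(_ isT) h|_].
    rewrite (ger0_norm h); case: (leP k%:R (F' x)) => h1.
      rewrite max_r//; split; first by rewrite ler0_norm; lra.
      by move=> h2; apply/le_anti; rewrite h1 h2.
    by rewrite max_r// subrr normr0.
  case: (leP k%:R (F' x)) => h1.
    rewrite max_r; last by lra.
    rewrite (ger0_norm (_ : 0 <= F' x)%R); last by lra.
    by split; [rewrite ler0_norm; lra|move=> h2; lra].
  case: (leP (- k%:R)%R (F' x)) => h2; first by rewrite subrr normr0.
  rewrite (ltr0_norm (_ : F' x < 0)%R); last by lra.
  by split; [rewrite ger0_norm; lra|move=> h3; lra].
have mfK k : mker q (fK k).
  apply: measurable_funM; last by apply: mker_all_in; exact: (BP k).1.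
  by apply: measurable_maxr => //; exact: measurable_minr.
pose u k x := (fK k x - F' x)%R.
have uF k x : (`|u k x| <= `|F x|)%R.
  apply: le_trans (F'F x); rewrite /u /fK /all_in; case: all; rewrite ?mulr1 ?mulr0.
    exact: (clipF k x).1.
  by rewrite sub0r normrN.
have mu1 k : mker q (u k) by exact: (measurable_funB (mfK k) mF').
have u0 x : (fun k => u k x) @ \oo --> 0%R.
  suff H : \forall k \near \oo, u k x = 0%R by apply/cvgrPdist_le => e e0; near=> k; rewrite (near H k)// subrr normr0 ltW.
  have Bx : \forall k \near \oo, all (fun z => `[< B k z >]) x.
    elim: x => [|z x IH]; first exact: nearW.
    have [k0 _ Bz] : (\bigcup_k B k) z by rewrite -BT.
    near=> k; rewrite /= (near IH k)// andbT; apply/asboolP.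
    have k0k : (k0 <= k)%N by near: k; exact: nbhs_infty_ge.
    by have := Bnd _ _ k0k => /subsetPset; apply.
  near=> k; rewrite /u /fK /all_in (near Bx k)// mulr1 (clipF k x).2 ?subrr//.
  by apply: ltW; near: k; exact: nbhs_infty_gtr.
(* The new kernel and the chosen [es n] will each be within rho of f in squared L^2 norm, hence
   within 4 rho of each other, and the integral of [es n] within rho of X. The total error on the
   integral is 2 q! 4 rho + 2 rho = eps. *)
pose rho : R := (eps / (8 * q`!%:R + 2))%R.
have den0 : (0 < 8 * q`!%:R + 2 :> R)%R by rewrite ltr_wpDl// mulr_ge0.
have rho0 : (0 < rho)%R by rewrite divr_gt0.
(* Here 72 = 8 (1 + 8): [mixedD] is used twice between the new kernel and f, through [fK k] and F'.
   The bound [rho ^+ 2] is there because the mixed norm with m = 0 is the square of the L^2 mass. *)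
pose del : R := (Num.min eps (rho ^+ 2) / 72)%R.
have del0 : (0 < del)%R by rewrite divr_gt0// lt_min eps0 exprn_gt0.
have [k Hk] : exists k, forall l : 'I_q.+1, mixed (u k) l (q - l) 0 <= del%:E.
  have : \forall k \near \oo, forall l : 'I_q.+1, mixed (u k) l (q - l) 0 <= del%:E.
    apply: filter_forall => l; have e : (l + (q - l) = q)%N by rewrite subnKC// -ltnS.
    apply: cvge0_near => //; apply: (@mixed_dominated _ _ _ mu l (q - l) F); rewrite ?e//.
    by apply: fM; rewrite e.
  by case=> k _ /(_ k (leqnn k)) H; exists k.
pose Cl l : R := ((2 * k%:R) ^+ 2 * fine (mu (B k)) ^+ l)%R.
have Cl0 l : (0 <= Cl l)%R by rewrite mulr_ge0 ?sqr_ge0// exprn_ge0// fine_ge0.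
pose Cm : R := (1 + \sum_(l < q.+1) Cl l)%R.
have Cm0 : (0 < Cm)%R by rewrite ltr_pwDl// sumr_ge0.
pose rho2 : R := Num.min rho (del / Cm)%R.
have rho20 : (0 < rho2)%R by rewrite lt_min rho0 divr_gt0.
have cvk' : ('N[pm q]_2%:E[EFin \o (fun x => elem_kernel (es n) x - f x)%R] @[n --> \oo] --> 0) by exact: cvk.
have [n [Hn1 Hn2]] : exists n, sqr_mass mu q (fun x => ekernel (es n) x - F x)%R <= rho2%:E /\
    \int[P]_w ((elem_integral eta (es n) w - X w) ^+ 2)%:E <= rho%:E.
  have [N1 _ H1] := Lnorm2_near cvk' rho20; have [N2 _ H2] := Lnorm2_near (a := fun n => (elem_integral eta (es n) \- X)%R) cvI rho0.
  exists (maxn N1 N2); split; last by apply: H2; rewrite /= leq_maxr.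
  have := H1 (maxn N1 N2) (leq_maxl _ _).
  by rewrite /sqr_mass; under [X in _ -> X <= _]eq_integral do rewrite /F !app_seqE.
have [mB Boo] := BP k; have k0 : (0 <= k%:R :> R)%R by [].
have [e [eE esym]] := truncated_elementary (es n) (lo0 _ k0) k0 mB Boo.
exists e.
have mE (e1 : elementary mu q) : mker q (ekernel e1) by apply: mker_app_seq; exact: measurable_elem_kernel.
pose w x := (ekernel e x - fK k x)%R.
pose w' := (fun x => clip (lo k%:R) k%:R (mean_permuted q (ekernel (es n)) x) * all_in (B k) x - fK k x)%R.
have ww' (x : q.-tuple Z) : w x = w' x by rewrite /w /w' app_seqE eE.
have mw : mker q w by exact: (measurable_funB (mE e) (mfK k)).
have mw' : mker q w' by apply: eq_measurable_fun mw => x _; rewrite ww'.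
have mixE l m : (l + m = q)%N -> mixed w l m 0 = mixed w' l m 0.
  move=> lm; apply: eq_integral => x _; congr (_ ^+ 2); rewrite !section_mass0.
  apply: eq_integral => z _; congr ((_ ^+ 2)%:E).
  have s : size (z ++ x) == q by rewrite size_cat !size_tuple lm.
  exact: (ww' (Tuple s)).
have w'K y : (`|w' y| <= 2 * k%:R * all_in (B k) y)%R.
  rewrite /w' /fK -mulrBl normrM (ger0_norm (_ : 0 <= all_in _ _)%R) ?ler_wpM2r//.
  have cb (v : R) : ((- (k%:R : R) <= clip (lo k%:R) k%:R v)%R && (clip (lo k%:R) k%:R v <= k%:R)%R).
    rewrite /clip /lo; case: (nn); case: (leP k%:R v) => h1.
    - by rewrite max_r//; apply/andP; split; lra.
    - by case: (leP (0:R)%R v) => h2; apply/andP; split; lra.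
    - by rewrite max_r; [apply/andP; split; lra|lra].
    - by case: (leP (- k%:R)%R v) => h2; apply/andP; split; lra.
  have := cb (mean_permuted q (ekernel (es n)) y); have := cb (F' y).
  by move=> /andP[a1 a2] /andP[a3 a4]; rewrite ler_norml; apply/andP; split; lra.
have wS : sqr_mass mu q w' <= rho2%:E.
  apply: le_trans Hn1; apply: le_trans (mean_permuted_sqr_mass (mE (es n)) mF mF' sF eF).
  have mM : mker q (mean_permuted q (ekernel (es n))).
    apply: measurable_funM => //; apply: measurable_sum => s.
    have := mseq_map_nth [seq val (s i) | i <- enum 'I_q] (mseq_id (Z := Z) q).
    rewrite (perm_size (perm_eq_iota_perm s)) size_iota => ms.
    have := mker_comp (mE (es n)) ms; apply: eq_measurable_fun => y _; congr app_seq.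
    by rewrite -map_comp.
  apply: ge0_le_integral => //.
  - by move=> x _; rewrite lee_fin sqr_ge0.
  - exact: mker_sqr mw'.
  - by apply: (@mker_sqr _ _ _ q (fun y => mean_permuted q (ekernel (es n)) y - F' y)%R); exact: measurable_funB.
  - move=> x _; rewrite lee_fin -[X in (X <= _)%R]real_normK ?num_real//.
    rewrite -[X in (_ <= X)%R]real_normK ?num_real// lerXn2r ?nnegrE//.
    rewrite /w' /fK -mulrBl normrM; apply: le_trans (clip_lipschitz (lo k%:R) k%:R _ _).
    by rewrite /all_in; case: all; rewrite ?normr1 ?normr0 ?mulr1 ?mulr0.
have mixW l m : (l + m = q)%N -> mixed w l m 0 <= del%:E.
  move=> lm; rewrite mixE//.
  have mw0 : mker (l + (m + 0)) w' by rewrite addn0 lm.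
  apply: le_trans (mixed_bounded_support mw0 mB Boo w'K) _; rewrite addn0 lm -/(Cl l).
  apply: (@le_trans _ _ (Cm%:E * (del / Cm)%:E)); last by rewrite -EFinM mulrC divfK// gt_eqF.
  apply: lee_pmul; [by rewrite lee_fin|exact: sqr_mass_ge0| |].
    have lq : (l < q.+1)%N by rewrite ltnS -lm leq_addr.
    rewrite lee_fin /Cm (bigD1 (Ordinal lq))//=; have : (0 <= \sum_(i < q.+1 | i != Ordinal lq) Cl i)%R by apply: sumr_ge0.
    by lra.
  by apply: le_trans wS _; rewrite lee_fin /rho2 ge_min lexx orbT.
have mixF l m : (l + m = q)%N -> mixed (fun x => ekernel e x - F x)%R l m 0 <= (72 * del)%:E.
  move=> lm.
  have M (v : seq Z -> R) : mker q v -> mker (l + (m + 0)) v by rewrite addn0 lm.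
  have mFF : mker q (fun x => F' x - F x)%R by exact: measurable_funB.
  have muF : mker q (fun x => u k x + (F' x - F x))%R by exact: (measurable_funD (mu1 k) mFF).
  have -> : mixed (fun x => ekernel e x - F x)%R l m 0 = mixed (fun x => w x + (u k x + (F' x - F x)))%R l m 0.
    by apply: (congr1 (fun v => mixed v l m 0)); apply/funext => x; rewrite /w /u; ring.
  apply: le_trans (mixedD mu (M _ mw) (M _ muF)) _.
  rewrite (_ : (72 * del)%:E = 8%:E * (del%:E + (8 * del)%:E)); last by rewrite -EFinD -EFinM; congr EFin; ring.
  apply: lee_wpmul2l => //; apply: leeD; first exact: mixW.
  apply: le_trans (mixedD mu (M _ (mu1 k)) (M _ mFF)) _.
  rewrite [X in _ + X]mixed_null ?adde0; last 2 first.
  - exact: M.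
  - rewrite addn0 lm; apply: sqr_mass_null => //.
    by move: eF; apply: filterS => x ->; rewrite subrr.
  rewrite EFinM; apply: lee_wpmul2l => //.
  have lq : (l < q.+1)%N by rewrite ltnS -lm leq_addr.
  by have := Hk (Ordinal lq); rewrite /= -[X in (X - l)%N]lm addKn.
have del72 : (72 * del = Num.min eps (rho ^+ 2))%R by rewrite /del mulrC divfK.
split=> //.
- by move=> n1 x; rewrite eE /clip /lo n1 mulr_ge0// le_max lexx.
- by move=> l m lm; apply: le_trans (mixF l m lm) _; rewrite del72 lee_fin ge_min lexx.
have sm : sqr_mass mu q (fun x => ekernel e x - F x)%R <= rho%:E.
  have mD : mker q (fun x => ekernel e x - F x)%R by exact: (measurable_funB (mE e) mF).
  have := mixF q 0%N (addn0 q); rewrite (mixed_q00 mu mD) del72 => H.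
  have {}H := le_trans H (_ : _ <= (rho ^+ 2)%:E); move: H.
  rewrite lee_fin ge_min lexx orbT => /(_ isT).
  have := sqr_mass_ge0 mu q (fun x => ekernel e x - F x)%R.
  case: (sqr_mass _ _ _) => [r| |] //; rewrite expe2 ?mulyy// -EFinM !lee_fin -expr2 => r0.
  by rewrite ler_pXn2r ?nnegrE// ltW.
have iso := elem_isometry hZ hA hP e (es n).
have mI (e1 : elementary mu q) : measurable_fun setT (elem_integral eta e1) by exact: measurable_elem_integral.
have := @integral_sqrD _ _ _ P (fun o => elem_integral eta e o - elem_integral eta (es n) o)%R
  (fun o => elem_integral eta (es n) o - X o)%R (measurable_funB (mI _) (mI _)) (measurable_funB (mI _) mX).
under eq_integral do rewrite addrA subrK.
move=> H; apply: (le_trans H).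
have S2 := @integral_sqrD _ _ _ (pm q) (fun x => ekernel e x - F x)%R (fun x => F x - ekernel (es n) x)%R
  (measurable_funB (mE _) mF) (measurable_funB mF (mE _)).
have S3 : sqr_mass mu q (fun x => ekernel e x - ekernel (es n) x)%R <= (4 * rho)%:E.
  have -> : sqr_mass mu q (fun x => ekernel e x - ekernel (es n) x)%R =
      \int[pm q]_x (((ekernel e x - F x + (F x - ekernel (es n) x)) ^+ 2)%R)%:E.
    by apply: eq_integral => x _; rewrite addrA subrK.
  apply: (le_trans S2).
  have -> : \int[pm q]_x (((F x - ekernel (es n) x) ^+ 2)%R)%:E = sqr_mass mu q (fun x => ekernel (es n) x - F x)%R.
    by apply: eq_integral => x _; rewrite -sqrrN opprB.
  rewrite (_ : (4 * rho)%:E = 2%:E * rho%:E + 2%:E * rho%:E); last by rewrite -!EFinM -EFinD; congr EFin; ring.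
  apply: leeD; apply: lee_wpmul2l => //.
  by apply: le_trans Hn1 _; rewrite lee_fin /rho2 ge_min lexx.
rewrite [leRHS](_ : _ = 2%:E * ((q`!%:R)%:E * (4 * rho)%:E) + 2%:E * rho%:E); last first.
  by rewrite -!EFinM -EFinD; congr EFin; rewrite /rho; field; rewrite gt_eqF.
apply: leeD; apply: lee_wpmul2l => //; apply: (le_trans iso).
by apply: lee_wpmul2l => //; rewrite lee_fin.
Unshelve. all: by end_near.
Qed.

End multiple_integral.
End approximation.

(** * Total integrals of elementary kernels *)

Section contraction_closeness.
Context {d} {Z : measurableType d} {R : realType}.
Variable mu : {sigma_finite_measure set Z -> \bar R}.
Notation pm := (power_measure mu).
Notation mixed := (mixed_norm mu).
Implicit Types f g : seq Z -> R.

Lemma contraction_ext l m b c f g f' g' :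
  (forall x, size x = (l + (m + b))%N -> f x = f' x) ->
  (forall x, size x = (l + (m + c))%N -> g x = g' x) ->
  contraction_sqr mu f g l m b c = contraction_sqr mu f' g' l m b c.
Proof.
move=> ff gg; apply: eq_integral => x _; apply: eq_integral => t _; apply: eq_integral => s _.
congr (_ ^+ 2); apply: eq_integral => z _ /=.
by rewrite ff ?gg// !size_cat !size_tuple.
Qed.

Lemma mixed_norm_abs l m b f : mixed (fun x => `|f x|%R) l m b = mixed f l m b.
Proof.
apply: eq_integral => x _; congr (_ ^+ 2); apply: eq_integral => t _; apply: eq_integral => z _ /=.
by rewrite -normrM ger0_norm// -expr2 sqr_ge0.
Qed.

(** In [abs_contraction_le] a weight a of order M / del makes the bounded kernel cost at most del /
    12, and then eps of order del / a does the same for the small one. The four contributions,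
    multiplied by 3, make del; 96 is 12 times the factor 8 of [mixed_rotate]. *)
Lemma contraction_close (M del : R) : (0 <= M)%R -> (0 < del)%R -> exists2 eps : R, (0 < eps)%R &
  forall l m b c f g f' g',
  mker (l + (m + b)) f -> mker (l + (m + c)) g -> mker (l + (m + b)) f' -> mker (l + (m + c)) g' ->
  ae_symmetric mu (l + (m + b)) f -> ae_symmetric mu (l + (m + c)) g ->
  ae_symmetric mu (l + (m + b)) f' -> ae_symmetric mu (l + (m + c)) g' ->
  mixed g (l + c) m 0 <= M%:E -> mixed f' (l + b) m 0 <= M%:E ->
  mixed (fun x => f' x - f x)%R (l + b) m 0 <= eps%:E -> mixed (fun x => g' x - g x)%R (l + c) m 0 <= eps%:E ->
  contraction_sqr mu f' g' l m b c <= 3%:E * contraction_sqr mu f g l m b c + del%:E.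
Proof.
move=> M0 d0; pose a := (96 * (M + 1) / del)%R.
have a0 : (0 < a)%R by rewrite divr_gt0// mulr_gt0// ltr_wpDl.
exists (del / (96 * a))%R; first by rewrite divr_gt0// mulr_gt0.
move=> l m b c f g f' g' mf mg mf' mg' sf sg sf' sg' gM f'M df dg.
have mdf : mker (l + (m + b)) (fun x => f' x - f x)%R by exact: (measurable_funB mf' mf).
have mdg : mker (l + (m + c)) (fun x => g' x - g x)%R by exact: (measurable_funB mg' mg).
apply: (le_trans (contraction_compare mu mf mg mf' mg')).
have rot n (u : seq Z -> R) (e : R) : mker (l + (m + n)) u -> ae_symmetric mu (l + (m + n)) u ->
    mixed u (l + n) m 0 <= e%:E -> mixed u l m n <= (8 * e)%:E.
  by move=> m1 s1 h; apply: (le_trans (mixed_rotate m1 s1)); rewrite EFinM; apply: lee_wpmul2l.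
have h1 := abs_contraction_le mu a0 mdf mg.
have ia0 : (0 < a^-1)%R by rewrite invr_gt0.
have h2 := abs_contraction_le mu ia0 mf' mdg.
rewrite invrK in h2.
have r1 := rot _ _ _ mdf (ae_symmetricB sf' sf) df.
have r2 := rot _ _ _ mg sg gM.
have r3 := rot _ _ _ mf' sf' f'M.
have r4 := rot _ _ _ mdg (ae_symmetricB sg' sg) dg.
have bound : (a * (8 * (del / (96 * a))) + a^-1 * (8 * M) <= del / 6)%R.
  have -> : (a * (8 * (del / (96 * a))) = del / 12)%R by field; rewrite gt_eqF.
  have -> : (a^-1 * (8 * M) = del / 12 * (M / (M + 1)))%R.
    rewrite /a; field; rewrite gt_eqF//= ?gt_eqF//; by lra.
  have : (M / (M + 1) <= 1)%R by rewrite ler_pdivrMr ?mul1r; lra.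
  move=> h; have : (del / 12 * (M / (M + 1)) <= del / 12 * 1)%R by rewrite ler_wpM2l// divr_ge0// ltW.
  by lra.
have c1 : contraction_sqr mu (fun x => `|f' x - f x|%R) (fun x => `|g x|%R) l m b c <= (del / 6)%:E.
  apply: (le_trans h1); apply: (@le_trans _ _ ((a * (8 * (del / (96 * a))) + a^-1 * (8 * M))%:E)); last by rewrite lee_fin.
  by rewrite EFinD !(EFinM _ (8 * _)); apply: leeD; apply: lee_wpmul2l => //; rewrite lee_fin ltW.
have c2 : contraction_sqr mu (fun x => `|f' x|%R) (fun x => `|g' x - g x|%R) l m b c <= (del / 6)%:E.
  apply: (le_trans h2); apply: (@le_trans _ _ ((a * (8 * (del / (96 * a))) + a^-1 * (8 * M))%:E)); last by rewrite lee_fin.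
  rewrite EFinD !(EFinM _ (8 * _)) [leRHS]addeC.
  by apply: leeD; apply: lee_wpmul2l => //; rewrite lee_fin ltW.
have -> : del%:E = 3%:E * ((del / 6)%:E + (del / 6)%:E) by rewrite -EFinD -EFinM; congr EFin; field.
rewrite -ge0_muleDr; [|exact: contraction_sqr_ge0|by rewrite -EFinD lee_fin addr_ge0 ?divr_ge0 ?(ltW d0)].
apply: lee_wpmul2l; first by [].
by rewrite -addeA; apply: leeD; [exact: lexx|exact: leeD c1 c2].
Qed.

End contraction_closeness.

Section elementary_families.
Context {d d'} {Z : measurableType d} {Omega : measurableType d'} {R : realType}.
Variables (P : probability Omega R) (mu : {sigma_finite_measure set Z -> \bar R}) (eta : R.-ker Omega ~> Z).
Hypotheses (hZ : borel_space Z R) (hA : no_atoms mu) (hP : poisson_measure P mu eta).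
Variables (k : nat) (q : 'I_k -> nat).
Hypothesis q_ge1 : forall i, (1 <= q i)%N.
Hypothesis q_incr : forall i j : 'I_k, (i < j)%N -> (q i < q j)%N.
Notation pm := (power_measure mu).
Notation ekernel e := (app_seq (elem_kernel e)).
Arguments elem_set {d Z R mu q} e c j.
Implicit Types es : forall i, elementary mu (q i).

Definition total_integral es (w : Omega) : R := (\sum_i elem_integral eta (es i) w)%R.

Definition symmetric_family es :=
  forall i (x y : (q i).-tuple Z), perm_eq x y -> elem_kernel (es i) x = elem_kernel (es i) y.

Lemma measurable_total_integral es : measurable_fun setT (total_integral es).
Proof. by apply: measurable_sum => i; exact: measurable_elem_integral. Qed.

(** The sets of all the kernels of both families generate one finite grid, on which every integral
    is almost surely a polynomial in the same counts. Two families are treated at once so that their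
    difference is such a polynomial too. *)
Lemma transport es es' : symmetric_family es -> symmetric_family es' ->
  exists (T : finType) (lam : T -> R) (E : (config T -> R) -> R)
    (G G' : 'I_k -> seq T -> R) (N : Omega -> config T),
  [/\ (forall t, 0 <= lam t)%R /\ poisson_functional lam E,
      (forall i, symmetric_kernel (q i) (G i)) /\ (forall i, symmetric_kernel (q i) (G' i)),
      (forall i j r l, (l <= r)%N -> (r <= q i)%N -> (r <= q j)%N ->
        contraction_sqr mu (ekernel (es i)) (ekernel (es j)) l (r - l) (q i - r) (q j - r) =
        (dstar lam (q i) (q j) (G i) (G j) r l)%:E) /\
      (forall i r l, (l <= r)%N -> (r <= q i)%N ->
        contraction_sqr mu (fun x => ekernel (es i) x - ekernel (es' i) x)%R
          (fun x => ekernel (es i) x - ekernel (es' i) x)%R l (r - l) (q i - r) (q i - r) =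
        (dstar lam (q i) (q i) (fun x => G i x - G' i x)%R (fun x => G i x - G' i x)%R r l)%:E),
      (forall i, (forall x, 0 <= elem_kernel (es i) x)%R -> forall x, (0 <= G i x)%R) &
      [/\ {ae P, forall w, total_integral es w = total_sum lam q G (N w)},
      {ae P, forall w, total_integral es' w = total_sum lam q G' (N w)} &
      forall g, tame g -> P.-integrable setT (EFin \o (fun w => g (N w))) /\
        (E g)%:E = \int[P]_w (g (N w))%:E]].
Proof.
move=> sym sym'.
pose I := ({i : 'I_k & ('I_(elem_size (es i)) * 'I_(q i))%type} +
  {i : 'I_k & ('I_(elem_size (es' i)) * 'I_(q i))%type})%type.
pose A (x : I) := match x with
  | inl p => elem_set (es (tag p)) (tagged p).1 (tagged p).2
  | inr p => elem_set (es' (tag p)) (tagged p).1 (tagged p).2 end.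
have mA x : measurable (A x) by case: x => p; exact: elem_measurable.
have fA x : mu (A x) < +oo by case: x => p; exact: elem_finite.
have gP := grid_atoms mA fA; set kappa := atom_of A in gP; set t0 := no_atom _ in gP.
have se i : elem_saturated kappa t0 (es i).
  by move=> c j; exact: (saturated_atoms A (inl (Tagged (fun i => ('I_(elem_size (es i)) * 'I_(q i))%type) (c, j)))).
have se' i : elem_saturated kappa t0 (es' i).
  by move=> c j; exact: (saturated_atoms A (inr (Tagged (fun i => ('I_(elem_size (es' i)) * 'I_(q i))%type) (c, j)))).
pose cell := grid_cell kappa t0.
have mc : forall t, measurable (cell t) by exact: measurable_grid_cell gP.
have fc : forall t, mu (cell t) < +oo by exact: grid_cell_finite gP.
have dc : forall s t, s != t -> cell s `&` cell t = set0 by exact: grid_cell_disjoint.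
pose G i := grid_kernel kappa t0 (ekernel (es i)).
pose G' i := grid_kernel kappa t0 (ekernel (es' i)).
have liftE i x : size x = q i -> ekernel (es i) x = lift_kernel kappa (G i) x.
  by move=> /eqP sx; rewrite -[x]/(tval (Tuple sx)) app_seqE /G lift_elem.
have liftE' i x : size x = q i -> ekernel (es' i) x = lift_kernel kappa (G' i) x.
  by move=> /eqP sx; rewrite -[x]/(tval (Tuple sx)) app_seqE /G' lift_elem.
have vG i : vanishing t0 (G i) by exact: grid_kernel_vanishing.
have vG' i : vanishing t0 (G' i) by exact: grid_kernel_vanishing.
exists {ffun I -> bool}, (cell_mass mu cell), (mean_counts P eta cell), G, G', (counts eta cell).
split.
- by split; [move=> t; exact: cell_mass_ge0|exact: counts_poisson_grid].
- by split=> i; [exact: (egrid_symmetric (se i) (sym i))|exact: (egrid_symmetric (se' i) (sym' i))].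
- split=> [i j r l lr ri rj|i r l lr ri].
    rewrite -(contraction_lift gP (q i) (q j) r l (vG i) (vG j)).
    by apply: contraction_ext => x sx; apply: liftE; rewrite sx; move: lr ri rj; clear; lia.
  have vD : vanishing t0 (fun x => G i x - G' i x)%R by move=> x xt; rewrite vG// vG'// subrr.
  rewrite -(contraction_lift gP (q i) (q i) r l vD vD).
  have sz (x : seq Z) : size x = (l + (r - l + (q i - r)))%N -> size x = q i.
    by move=> ->; move: lr ri; clear; lia.
  by apply: contraction_ext => x /sz sx; rewrite (liftE i _ sx) (liftE' i _ sx).
- move=> i e0 x; rewrite /G /grid_kernel; case: ifP => // _.
  by rewrite /app_seq; case: insub => //= y; exact: e0.
have tot (es1 : forall i, elementary mu (q i)) : (forall i, elem_saturated kappa t0 (es1 i)) ->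
    {ae P, forall w, total_integral es1 w = total_sum (cell_mass mu cell) q
      (fun i => grid_kernel kappa t0 (ekernel (es1 i))) (counts eta cell w)}.
  move=> s1.
  have : {ae P, forall w, forall i, elem_integral eta (es1 i) w =
    (\sum_(x : (q i).-tuple {ffun I -> bool}) grid_kernel kappa t0 (ekernel (es1 i)) x *
      compensated_product (cell_mass mu cell) (counts eta cell w) x)%R}.
    by apply: filter_forall => i; exact: elem_integral_grid.
  by apply: filterS => w H; apply: eq_bigr => i _; rewrite H.
split; [exact: tot|exact: tot|].
move=> g tg; split; first exact: (integrable_tame hZ hA hP mc fc dc tg).
exact: (mean_countsE hZ hA hP mc fc dc tg).
Qed.

Lemma total_integral_fourth es : symmetric_family es ->
  \int[P]_w (total_integral es w ^+ 4)%:E < +oo.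
Proof.
move=> s; have [T [lam [E [G [G' [N [[l0 pE] [sG _] _ _ [a1 _ H]]]]]]]] := transport s s.
have [ig e4] := H _ (tame_exp 4 (tame_total lam sG)).
have <- : (E (fun n => total_sum lam q G n ^+ 4)%R)%:E = \int[P]_w (total_integral es w ^+ 4)%:E; last exact: ltry.
rewrite e4; apply: ae_eq_integral => //; first exact: (measurable_int _ ig).
  by apply/measurable_EFinP/measurable_funX; exact: measurable_total_integral.
by move: a1; apply: filterS => w -> _.
Qed.

Lemma total_integral_cumulant es i j r l : symmetric_family es ->
  (forall i x, 0 <= elem_kernel (es i) x)%R ->
  (0 < r)%N -> (r <= q i)%N -> (r <= q j)%N -> (l <= r)%N -> ~~ [&& q i == q j, q j == r & r == l] ->
  contraction_sqr mu (ekernel (es i)) (ekernel (es j)) l (r - l) (q i - r) (q j - r) <=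
  (fact_bound R (q i) (q j) * (fine (\int[P]_w (total_integral es w ^+ 4)%:E) -
     3 * fine (\int[P]_w (total_integral es w ^+ 2)%:E) ^+ 2))%:E.
Proof.
move=> s e0 r0 ri rj lr nt.
have [T [lam [E [G [G' [N [[l0 pE] [sG _] [cE _] nG [a1 _ H]]]]]]]] := transport s s.
have int m : \int[P]_w (total_integral es w ^+ m)%:E = (E (fun n => total_sum lam q G n ^+ m)%R)%:E.
  have [ig ->] := H _ (tame_exp m (tame_total lam sG)).
  apply: ae_eq_integral => //; last by move: a1; apply: filterS => w -> _.
    by apply/measurable_EFinP/measurable_funX; exact: measurable_total_integral.
  exact: (measurable_int _ ig).
rewrite cE// !int lee_fin /=.
by apply: (energy_le_cumulant q_ge1 l0 sG pE) => // i0 x; exact: nG.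
Qed.

Definition fourth_constant : R := (k%:R ^+ 3 * (\sum_i (8 ^ (q i + q i) * (q i).+1 * 2 ^ (q i))%N%:R *
  fact_bound R (q i) (q i) * ((q i).+1 ^ 2)%N%:R))%R.

Lemma total_integral_difference es es' (b : R) : symmetric_family es -> symmetric_family es' ->
  (0 <= b)%R ->
  (forall i r l, (l <= r)%N -> (r <= q i)%N ->
    contraction_sqr mu (fun x => ekernel (es i) x - ekernel (es' i) x)%R
      (fun x => ekernel (es i) x - ekernel (es' i) x)%R l (r - l) (q i - r) (q i - r) <= b%:E) ->
  \int[P]_w ((total_integral es w - total_integral es' w) ^+ 4)%:E <= (fourth_constant * b)%:E.
Proof.
move=> s s' b0 cb.
have [T [lam [E [G [G' [N [[l0 pE] [sG sG'] [_ cE] _ [a1 a2 H]]]]]]]] := transport s s'.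
pose D i x := (G i x - G' i x)%R.
have sD i : symmetric_kernel (q i) (D i).
  split=> [x y sx pxy|x sx ux]; rewrite /D.
    by rewrite (sk_perm (sG i) sx pxy) (sk_perm (sG' i) sx pxy).
  by rewrite (sk_uniq (sG i) sx ux) (sk_uniq (sG' i) sx ux) subrr.
have [ig e4] := H _ (tame_exp 4 (tame_total lam sD)).
have -> : \int[P]_w ((total_integral es w - total_integral es' w) ^+ 4)%:E =
    (E (fun n => total_sum lam q D n ^+ 4)%R)%:E.
  rewrite e4; apply: ae_eq_integral => //; last first.
  - move: a1 a2; apply: filterS2 => w e1 e2 _; rewrite e1 e2; congr ((_ ^+ 4)%:E).
    rewrite /total_sum -sumrB; apply: eq_bigr => i _; rewrite -sumrB.
    by apply: eq_bigr => x _; rewrite -mulrBl.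
  - exact: (measurable_int _ ig).
  - by apply/measurable_EFinP/measurable_funX/measurable_funB; exact: measurable_total_integral.
rewrite lee_fin; apply: (le_trans (total_fourth l0 sD pE)).
rewrite /fourth_constant -[X in (_ <= X)%R]mulrA ler_wpM2l ?exprn_ge0// mulr_suml; apply: ler_sum => i _.
rewrite -[X in (_ <= X)%R]mulrA ler_wpM2l//; first by rewrite mulr_ge0// ltW// fact_bound_gt0.
apply: (@le_trans _ _ (\sum_(r < (q i).+1) \sum_(l < (q i).+1) b)%R).
  apply: ler_sum => r _; rewrite (big_ord_widen _ (fun l => dstar lam (q i) (q i) (D i) (D i) r l) (ltn_ord r)) big_mkcond.
  apply: ler_sum => l _; case: ifP => // lr.
  have lr' : (l <= r)%N by rewrite -ltnS.
  have rq : (r <= q i)%N by rewrite -ltnS ltn_ord.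
  by rewrite -lee_fin -cE// cb.
under eq_bigr do rewrite sumr_const card_ord.
by rewrite sumr_const card_ord -mulrnA [X in (_ <= X)%R]mulr_natl expnS expn1.
Qed.

(** The indices behind [B3]: pairs i <= j with l > 0, the total contraction excluded, and for i = j
    the case r = [q i], l = 0, which stands for the L^4 norm. *)
Definition relevant (i j : 'I_k) r l :=
  [&& (0 < r)%N, (l <= r)%N, (r <= q i)%N, (r <= q j)%N & ~~ [&& q i == q j, q j == r & r == l] &&
    ((0 < l)%N && (i <= j)%N || [&& i == j, r == q i & l == 0%N])].

Definition energy_count : R :=
  (\sum_i \sum_(r < (q i).+1) \sum_(l < r.+1) 1 +
   \sum_i \sum_(j < k) \sum_(r < (q i).+1) \sum_(l < r.+1) 1 + \sum_(i < k) 1)%R.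

Lemma energy_le_count (T : finType) (lam : T -> R) (G : 'I_k -> seq T -> R) (b : R) : (0 <= b)%R ->
  (forall i j r l, relevant i j r l -> dstar lam (q i) (q j) (G i) (G j) r l <= b)%R ->
  (energy lam q G <= energy_count * b)%R.
Proof.
move=> b0 H; rewrite /energy /energy_count !mulrDl !mulr_suml; apply: lerD; first apply: lerD.
- apply: ler_sum => i _; rewrite mulr_suml; apply: ler_sum => r _; rewrite mulr_suml big_mkcond.
  apply: ler_sum => l _; rewrite mul1r; case: ifP => // /andP[l0 nt]; apply: H.
  have lr : (l <= r)%N by rewrite -ltnS ltn_ord.
  rewrite /relevant lr (leq_trans l0 lr) -ltnS ltn_ord /= eqxx /=.
  by rewrite nt l0 leqnn.
- apply: ler_sum => i _; rewrite mulr_suml [X in (X <= _)%R]big_mkcond; apply: ler_sum => j _.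
  rewrite mulr_suml; case: ifP => ij; last first.
    by apply: sumr_ge0 => r _; rewrite mulr_ge0// sumr_ge0.
  apply: ler_sum => r _; rewrite mulr_suml big_mkcond.
  apply: ler_sum => l _; rewrite mul1r; case: ifP => // l0; apply: H.
  have lr : (l <= r)%N by rewrite -ltnS ltn_ord.
  have rq : (r <= q i)%N by rewrite -ltnS ltn_ord.
  have qq := q_incr ij.
  rewrite /relevant lr (leq_trans l0 lr) rq (leq_trans rq (ltnW qq)) /=.
  by rewrite (ltn_eqF qq) l0 (ltnW ij).
- apply: ler_sum => i _; rewrite mul1r -dstar_full; apply: H.
  by apply/and5P; split=> //; rewrite !eqxx /= -lt0n q_ge1.
Qed.

Lemma gamma_bound_ge0 : (0 <= gamma_bound R q)%R.
Proof.
rewrite mulr_ge0 ?exprn_ge0// sumr_ge0// => i _; apply: sumr_ge0 => j _.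
by apply: addr_ge0; exact: chaos_bound_ge0.
Qed.

Lemma difference_bound_ge0 : (0 <= difference_bound R q)%R.
Proof.
rewrite mulr_ge0 ?exprn_ge0// sumr_ge0// => i _; apply: mulr_ge0; first exact: chaos_bound_ge0.
by rewrite exprn_ge0.
Qed.

Lemma tame_affine (T : finType) (g : config T -> R) (phi : R -> R) (a b : R) : tame g -> (0 <= b)%R ->
  (forall x, `|phi x| <= a + b * `|x|)%R -> tame (fun n => phi (g n)).
Proof.
move=> tg b0 H.
have ta : tame (fun n => a + b * `|g n|)%R.
  by apply: tame_add; [exact: tame_cst|apply: tame_scale; exact: tame_norm].
apply: (tame_le ta) => n; rewrite (le_trans (H _))// ler_norm//.
Qed.

(** Stein's equation is taken for the target variance [s ^+ 2], not for the second moment of the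
    elementary integral; the gap between the two multiplies the mean of psi', which [stein_constant]
    bounds. *)
Lemma total_integral_stein es (h : R -> R) (s b : R) : symmetric_family es -> lip1 h -> (0 < s)%R -> (0 <= b)%R ->
  (forall i j r l, relevant i j r l ->
    contraction_sqr mu (ekernel (es i)) (ekernel (es j)) l (r - l) (q i - r) (q j - r) <= b%:E) ->
  `|\int[P]_w (s * (h (total_integral es w) - gauss_mean (fun x => h (s * x))))%:E| <=
  (@stein_constant R * (`|s ^+ 2 - fine (\int[P]_w (total_integral es w ^+ 2)%:E)| +
    Num.sqrt (gamma_bound R q * (energy_count * b)) +
    s^-1 * (Num.sqrt (fine (\int[P]_w (total_integral es w ^+ 2)%:E)) *
      Num.sqrt (difference_bound R q * (energy_count * b)))))%:E.
Proof.
move=> sy hl s0 b0 cb.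
have [T [lam [E [G [G' [N [[l0 pE] [sG _] [cE _] _ [a1 _ H]]]]]]]] := transport sy sy.
have [psi [psi' [eq b1 l1 l2 b2]]] := stein_scaled hl s0.
set c1 := @stein_constant R in b1 l1 l2 b2 *.
have c10 : (0 <= c1)%R by exact: le_trans (b1 0%R).
pose S := total_sum lam q G; have tS : tame S := tame_total lam sG.
have mint (phi : config T -> R) (phi' : R -> R) : tame phi -> measurable_fun setT phi' ->
    (forall n, phi n = phi' (S n)) -> \int[P]_w (phi' (total_integral es w))%:E = (E phi)%:E.
  move=> tp mp pp; have [ig ->] := H _ tp; apply: ae_eq_integral => //.
  - by apply/measurable_EFinP; apply: measurableT_comp mp _; exact: measurable_total_integral.
  - exact: (measurable_int _ ig).
  - by move: a1; apply: filterS => w e _; rewrite e pp.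
have m2 : \int[P]_w (total_integral es w ^+ 2)%:E = (E (fun n => S n ^+ 2)%R)%:E.
  by apply: (mint _ (fun x => x ^+ 2)%R) => //; exact: tame_exp.
set s2 := E (fun n => S n ^+ 2)%R in m2.
have tpsi' : tame (fun n => psi' (S n)).
  apply: (tame_le (tame_cst T c1)) => n; rewrite (le_trans (b1 _))//; exact: ler_norm.
have tpsi : tame (fun n => psi (S n)).
  apply: (@tame_affine _ _ psi `|psi 0%R| c1 tS c10) => x.
  have := l1 x 0%R; rewrite subr0 => h1.
  by rewrite -[psi x](subrK (psi 0%R)) addrC (le_trans (ler_normD _ _))// lerD2l.
have tSp : tame (fun n => S n * psi (S n))%R by exact: tame_mul.
have tst : tame (fun n => s2 * psi' (S n) - S n * psi (S n))%R.
  by apply: tame_sub => //; exact: tame_scale.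
have th : tame (fun n => s * (h (S n) - gauss_mean (fun x => h (s * x))))%R.
  apply: (tame_ext (tame_sub (tame_scale (s ^+ 2) tpsi') tSp)) => n.
  by rewrite eq.
have mh : measurable_fun setT h by exact: continuous_measurable_fun (lip1_continuous hl).
rewrite (mint _ (fun x => s * (h x - gauss_mean (fun x => h (s * x))))%R th); last 2 first.
- by apply: measurable_funM => //; exact: measurable_funB.
- by [].
rewrite m2 /= lee_fin.
have -> : E (fun n => s * (h (S n) - gauss_mean (fun x => h (s * x))))%R =
    (E (fun n => s2 * psi' (S n) - S n * psi (S n)) + (s ^+ 2 - s2) * E (fun n => psi' (S n)))%R.
  rewrite -(pf_scale pE)// -(pf_add pE)//; last exact: tame_scale.
  by apply: (pf_ext pE th) => n; rewrite eq; ring.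
have Ep : (`|E (fun n => psi' (S n))| <= c1)%R.
  have b1' n := b1 (S n); rewrite ler_norml -{1}(pf_cst pE (- c1)%R) -{2}(pf_cst pE c1).
  by apply/andP; split; apply: (pf_mono pE) => //; try exact: tame_cst;
    move=> n; have := b1' n; rewrite ler_norml => /andP[].
have St := total_stein q_ge1 q_incr l0 sG pE b1 l1 b2.
have en : (energy lam q G <= energy_count * b)%R.
  apply: energy_le_count => // i j r l rel; have := cb i j r l rel.
  by move: rel => /and5P[r0 lr ri rj _]; rewrite cE// lee_fin.
have gb0 : (0 <= gamma_bound R q)%R by exact: gamma_bound_ge0.
have db0 : (0 <= difference_bound R q)%R by exact: difference_bound_ge0.
have e1 : (Num.sqrt (gamma_bound R q * energy lam q G) <= Num.sqrt (gamma_bound R q * (energy_count * b)))%R.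
  by rewrite ler_wsqrtr// ler_wpM2l.
have e2 : (Num.sqrt (difference_bound R q * energy lam q G) <= Num.sqrt (difference_bound R q * (energy_count * b)))%R.
  by rewrite ler_wsqrtr// ler_wpM2l.
apply: (le_trans (ler_normD _ _)); rewrite normrM.
have d0 : (0 <= `|s ^+ 2 - s2|)%R by [].
have h1 : (`|s ^+ 2 - s2| * `|E (fun n => psi' (S n))| <= c1 * `|s ^+ 2 - s2|)%R by rewrite mulrC ler_wpM2r.
have h2 : (c1 * Num.sqrt (gamma_bound R q * energy lam q G) <= c1 * Num.sqrt (gamma_bound R q * (energy_count * b)))%R by rewrite ler_wpM2l.
have h3 : (c1 / s * (Num.sqrt s2 * Num.sqrt (difference_bound R q * energy lam q G)) <=
    c1 * (s^-1 * (Num.sqrt s2 * Num.sqrt (difference_bound R q * (energy_count * b)))))%R.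
  by rewrite -mulrA ler_wpM2l// ler_wpM2l ?invr_ge0 ?(ltW s0)// ler_wpM2l ?sqrtr_ge0.
have St' := le_trans St (lerD h2 h3).
rewrite [X in (X <= _)%R]addrC [X in (_ <= X)%R]mulrDr [X in (_ <= X + _)%R]mulrDr -[X in (_ <= X)%R]addrA.
exact: lerD h1 St'.
Qed.

End elementary_families.

Lemma le_integral_truncated {d} {V : measurableType d} {R : realType} (nu : {measure set V -> \bar R})
    (g : V -> R) (c : \bar R) : measurable_fun setT g -> (forall x, 0 <= g x)%R ->
  (forall n : nat, \int[nu]_x (Num.min (g x) (n%:R ^+ 2))%:E <= c) -> \int[nu]_x (g x)%:E <= c.
Proof.
move=> mg g0 H.
pose u (n : nat) x := (Num.min (g x) (n%:R ^+ 2))%:E.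
have mu1 n : measurable_fun setT (u n).
  by apply/measurable_EFinP; apply: measurable_minr => //; exact: measurable_cst.
have u0 n x : setT x -> 0 <= u n x by move=> _; rewrite lee_fin le_min g0 sqr_ge0.
have nd x : setT x -> {homo u ^~ x : n m / (n <= m)%N >-> n <= m}.
  move=> _ n m nm; rewrite lee_fin le_min ge_min lexx /= ge_min; apply/orP; right.
  by rewrite lerXn2r ?nnegrE// ler_nat.
have lu x : limn (u ^~ x) = (g x)%:E.
  apply: cvg_lim => //; apply/cvg_ballP => e e0; near=> n.
  rewrite (_ : u n x = (g x)%:E); first exact: ballxx.
  congr EFin; apply: min_l; have h : (g x <= n%:R)%R by apply: ltW; near: n; exact: nbhs_infty_gtr.
  have n1 : (1 <= n%:R :> R)%R by rewrite ler1n; near: n; exact: nbhs_infty_gt.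
  by rewrite (le_trans h)// expr2 ler_peMl.
have -> : \int[nu]_x (g x)%:E = \int[nu]_x limn (u ^~ x) by apply: eq_integral => x _; rewrite lu.
rewrite monotone_convergence//; apply: lime_le; last by apply: nearW => n; exact: H.
apply: ereal_nondecreasing_is_cvgn => n m nm; apply: ge0_le_integral => //.
- by move=> x _; exact: u0.
- by move=> x _; exact: nd.
Unshelve. all: by end_near. Qed.

(** Either [b ^+ 2 <= kappa], and the fourth power of b is at most [kappa * b ^+ 2], or the
    truncation level itself is below the right side. A truncated fourth moment is thus controlled
    when b is small in L^2 only. *)
Lemma truncated_fourth_le {R : realType} (a b kappa : R) : (0 <= kappa)%R ->
  (Num.min ((a + b) ^+ 4) (kappa ^+ 2) <= 8 * a ^+ 4 + 8 * kappa * b ^+ 2)%R.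
Proof.
move=> k0; have a4 : (0 <= a ^+ 4)%R by rewrite exprn_even_ge0.
have b2 := sqr_ge0 b; rewrite ge_min; apply/orP.
have [h|h] := leP (b ^+ 2)%R kappa.
  left; have e4 (x : R) : (x ^+ 4 = (x ^+ 2) ^+ 2)%R by rewrite -exprM.
  have h1 : ((a + b) ^+ 2 <= 2 * a ^+ 2 + 2 * b ^+ 2)%R by have := sqr_ge0 (a - b)%R; rewrite !expr2; nra.
  have h2 : ((a + b) ^+ 4 <= (2 * a ^+ 2 + 2 * b ^+ 2) ^+ 2)%R by rewrite e4 lerXn2r ?nnegrE ?sqr_ge0// addr_ge0// mulr_ge0 ?sqr_ge0.
  have h3 : ((2 * a ^+ 2 + 2 * b ^+ 2) ^+ 2 <= 8 * (a ^+ 2) ^+ 2 + 8 * (b ^+ 2) ^+ 2)%R.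
    by have := sqr_ge0 (a ^+ 2 - b ^+ 2)%R; nra.
  have h4 : ((b ^+ 2) ^+ 2 <= kappa * b ^+ 2)%R by rewrite [X in (X <= _)%R]expr2 ler_wpM2r.
  by rewrite !e4 in h2 *; lra.
by right; rewrite expr2; nra.
Qed.

(** * Simultaneous approximation of all the kernels *)

Section approximants.
Context {d d'} {Z : measurableType d} {Omega : measurableType d'} {R : realType}.
Variables (P : probability Omega R) (mu : {sigma_finite_measure set Z -> \bar R}) (eta : R.-ker Omega ~> Z).
Hypotheses (hZ : borel_space Z R) (hA : no_atoms mu) (hP : poisson_measure P mu eta).
Variables (k : nat) (q : 'I_k -> nat).
Hypothesis q_ge1 : forall i, (1 <= q i)%N.
Hypothesis q_incr : forall i j : 'I_k, (i < j)%N -> (q i < q j)%N.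
Notation pm := (power_measure mu).
Notation mixed := (mixed_norm mu).
Notation ekernel e := (app_seq (elem_kernel e)).
Variables (f : forall i, (q i).-tuple Z -> R) (X : 'I_k -> Omega -> R) (F : Omega -> R).
Arguments f : clear implicits.
Hypotheses (L2f : forall i, L2s mu (f i)) (fi : assumption_i mu f).
Hypothesis mX : forall i, measurable_fun setT (X i).
Hypothesis fX : forall i, is_multiple_integral P mu eta (f i) (X i).
Hypothesis mF : measurable_fun setT F.
Hypothesis FE : {ae P, forall w, F w = (\sum_i X i w)%R}.
Variable nn : bool.
Hypothesis fnn : nn -> forall i, {ae pm (q i), forall x, 0 <= f i x}%R.
Notation K i := (app_seq (f i)).
Notation T es := (total_integral eta es).

Lemma measurable_kernel_f i : measurable_fun setT (f i).
Proof. by have [] := L2f i; rewrite inE => /andP[/[!inE] + _ _]. Qed.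

Lemma kernel_sqr_mass i : sqr_mass mu (q i) (K i) < +oo.
Proof.
have [] := L2f i; rewrite inE => /andP[_ /[!inE] fn _].
have -> : sqr_mass mu (q i) (K i) = \int[pm (q i)]_x ((f i x) ^+ 2)%:E.
  by apply: eq_integral => x _; rewrite app_seqE.
rewrite -Lnorm2_sqr expe2; move: fn; rewrite /finite_norm => fn.
by apply: lte_mul_pinfty; rewrite ?Lnorm_ge0// ge0_fin_numE ?Lnorm_ge0.
Qed.

(** For m > 0 this is the squared norm of the contraction with r = [q i] and [q i - m] integrations,
    which assumption (i) makes finite; for m = 0 it is the square of the L^2 mass. *)
Lemma kernel_mixed i l m : (l + m = q i)%N -> mixed (K i) l m 0 < +oo.
Proof.
move=> lm; have mK := mker_app_seq (@measurable_kernel_f i).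
case: m lm => [|m] lm.
  move: lm; rewrite addn0 => ->; rewrite (mixed_q00 mu mK) expe2.
  have := kernel_sqr_mass i; have := sqr_mass_ge0 mu (q i) (K i).
  by case: (sqr_mass _ _ _) => [r| |] // _ _; rewrite ltry.
have mq : (1 <= m.+1 <= q i)%N by rewrite -lm leq_addl.
have [_] := fi mq.
have S := @star_norm_sqr _ _ _ mu _ _ _ _ (q i) (q i - m.+1) (@measurable_kernel_f i) (@measurable_kernel_f i) (leq_subr _ _) (leqnn _) (leqnn _).
move: S; rewrite subnn subKn; last by rewrite -lm leq_addl.
have -> : (q i - m.+1 = l)%N by rewrite -lm addnK.
rewrite contraction_self0; last by rewrite addn0 lm.
move=> <-; have := Lnorm_ge0 (pm (q i + q i - q i - l)) 2%:E (star mu (f i) (f i) (q i) l).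
by rewrite -/(star_norm mu (f i) (f i) (q i) l) expe2; case: (star_norm _ _ _ _ _) => [r| |] // _ _; rewrite ltry.
Qed.

Lemma close_family (eps : R) : (0 < eps)%R -> exists es : forall i, elementary mu (q i),
  [/\ symmetric_family es, nn -> forall i x, (0 <= elem_kernel (es i) x)%R,
    forall i l m, (l + m = q i)%N -> mixed (fun x => ekernel (es i) x - K i x)%R l m 0 <= eps%:E &
    \int[P]_w ((T es w - F w) ^+ 2)%:E <= eps%:E].
Proof.
move=> e0; pose eps' := (eps / (1 + k%:R ^+ 2))%R.
have k2 : (0 <= k%:R ^+ 2 :> R)%R by exact: sqr_ge0.
have e'0 : (0 < eps')%R by rewrite divr_gt0// ltr_pwDl.
have fnn' i : nn -> {ae pm (q i), forall x, 0 <= f i x}%R by move=> n1; exact: fnn.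
have H i := cid (elementary_approximation hZ hA hP (@measurable_kernel_f i) (L2f i) (kernel_sqr_mass i)
  (@kernel_mixed i) (fnn' i) (mX i) (fX i) e'0).
exists (fun i => projT1 (H i)); split.
- by move=> i; have [] := projT2 (H i).
- by move=> n1 i; have [_ /(_ n1)] := projT2 (H i).
- move=> i l m lm; have [_ _ /(_ _ _ lm) h _] := projT2 (H i); apply: (le_trans h).
  by rewrite lee_fin /eps' ler_pdivrMr ?ltr_pwDl// ler_peMr ?(ltW e0)// ?lerDl.
pose es i := projT1 (H i).
have mI i : measurable_fun setT (elem_integral eta (es i)) by exact: measurable_elem_integral.
have mS : measurable_fun setT (fun w => (k%:R)%:E * \sum_i (((elem_integral eta (es i) w - X i w) ^+ 2)%R)%:E).
  apply: emeasurable_funM => //; apply: emeasurable_sum => i; apply/measurable_EFinP/measurable_funX.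
  exact: measurable_funB.
apply: (@le_trans _ _ (\int[P]_w ((k%:R)%:E * \sum_i (((elem_integral eta (es i) w - X i w) ^+ 2)%R)%:E))).
  apply: ae_ge0_le_integral => //.
  - by move=> w _; rewrite lee_fin sqr_ge0.
  - apply/measurable_EFinP/measurable_funX/measurable_funB => //; exact: measurable_total_integral.
  - by move=> w _; apply: mule_ge0; rewrite ?lee_fin//; apply: sume_ge0 => i _; rewrite lee_fin sqr_ge0.
  move: FE; apply: filterS => w -> _; rewrite sumEFin -EFinM lee_fin /total_integral -sumrB.
  have := sqr_sum_le (pred_of_simpl predT) (fun i : 'I_k => elem_integral eta (es i) w - X i w)%R.
  by rewrite (_ : #|_| = k)// -[RHS](card_ord k); exact: eq_card.
rewrite ge0_integralZl_EFin//; last 2 first.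
- by move=> w _; apply: sume_ge0 => i _; rewrite lee_fin sqr_ge0.
- apply: emeasurable_sum => i; apply/measurable_EFinP/measurable_funX; exact: measurable_funB.
rewrite ge0_integral_sum//; last 2 first.
- by move=> i; apply/measurable_EFinP/measurable_funX; exact: measurable_funB.
- by move=> i w _; rewrite lee_fin sqr_ge0.
apply: (@le_trans _ _ ((k%:R)%:E * \sum_(i < k) eps'%:E)).
  by apply: lee_wpmul2l => //; apply: lee_sum => i _; have [_ _ _] := projT2 (H i).
rewrite sumEFin sumr_const card_ord -EFinM lee_fin -[(eps' *+ k)%R]mulr_natl mulrA -expr2 /eps' mulrA.
by rewrite ler_pdivrMr ?ltr_pwDl// [X in (X <= _)%R]mulrC ler_wpM2l ?(ltW e0)// lerDr.
Qed.

Definition mixed_total : R := (\sum_i \sum_(l < (q i).+1) fine (mixed (K i) l (q i - l) 0))%R.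

Lemma kernel_mixed_le i l m : (l + m = q i)%N -> mixed (K i) l m 0 <= mixed_total%:E.
Proof.
move=> lm; have lq : (l < (q i).+1)%N by rewrite ltnS -lm leq_addr.
rewrite -[mixed _ _ _ _]fineK; last by rewrite ge0_fin_numE ?mixed_norm_ge0// kernel_mixed.
have -> : m = (q i - l)%N by rewrite -lm addKn.
have f0 (j : 'I_k) (l' : nat) : (0 <= fine (mixed (K j) l' (q j - l') 0))%R by rewrite fine_ge0// mixed_norm_ge0.
rewrite lee_fin /mixed_total (bigD1 i)//= (bigD1 (Ordinal lq))//= -addrA lerDl.
by rewrite addr_ge0// sumr_ge0// => j _; rewrite sumr_ge0.
Qed.

Lemma symmetric_elem_ae (es : forall i, elementary mu (q i)) i : symmetric_family es -> ae_symmetric mu (q i) (ekernel (es i)).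
Proof.
move=> s; apply: ae_symmetric_perm => x y /eqP sx pxy.
have sy : size y == q i by rewrite -(perm_size pxy).
by rewrite -[x]/(tval (Tuple sx)) -[y]/(tval (Tuple sy)) !app_seqE; exact: s.
Qed.

(** Since F is a limit in L^2 only, the L^4 bound is reached through a second family [es'],
    arbitrarily close to F. The difference of the two integrals is a polynomial with small
    contractions, hence small in L^4, while L^2 closeness of [es'] to F suffices for truncated
    fourth powers. *)
Lemma approximants (t : R) : (0 < t)%R -> (t <= 1)%R -> exists es : forall i, elementary mu (q i),
  [/\ symmetric_family es, nn -> forall i x, (0 <= elem_kernel (es i) x)%R,
    \int[P]_w ((T es w - F w) ^+ 2)%:E <= (t ^+ 2)%:E,
    \int[P]_w ((T es w - F w) ^+ 4)%:E <= (t ^+ 4)%:E &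
    forall i j r l, (l <= r)%N -> (r <= q i)%N -> (r <= q j)%N ->
      contraction_sqr mu (ekernel (es i)) (ekernel (es j)) l (r - l) (q i - r) (q j - r) <=
        3%:E * contraction_sqr mu (K i) (K j) l (r - l) (q i - r) (q j - r) + t%:E /\
      contraction_sqr mu (K i) (K j) l (r - l) (q i - r) (q j - r) <=
        3%:E * contraction_sqr mu (ekernel (es i)) (ekernel (es j)) l (r - l) (q i - r) (q j - r) + t%:E].
Proof.
move=> t0 t1; pose M := (8 * (mixed_total + 1))%R.
have MT0 : (0 <= mixed_total)%R by apply: sumr_ge0 => i _; apply: sumr_ge0 => l _; rewrite fine_ge0// mixed_norm_ge0.
have M0 : (0 <= M)%R by rewrite mulr_ge0// addr_ge0.
have [e1 e10 H1] := contraction_close mu M0 t0.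
have fc0 : (0 <= @fourth_constant R k q)%R.
  rewrite mulr_ge0 ?exprn_ge0// sumr_ge0// => i _.
  by rewrite mulr_ge0// mulr_ge0// ltW// fact_bound_gt0.
pose del := (t ^+ 4 / (8 * (@fourth_constant R k q + 1)))%R.
have t40 : (0 < t ^+ 4)%R by rewrite exprn_gt0.
have den : (0 < 8 * (@fourth_constant R k q + 1))%R by rewrite mulr_gt0// ltr_wpDl.
have del0 : (0 < del)%R by rewrite divr_gt0.
have [e2 e20 H2] := contraction_close mu M0 del0.
(* The kernels of two approximating families differ by at most [8 * (eps + eps)] in the mixed norms:
   [e2 / 16] makes this at most e2, and [2^-1] keeps it below M, which is at least 8. *)
pose eps : R := (Num.min (Num.min 2^-1 (t ^+ 2)) (Num.min e1 (e2 / 16)))%R.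
have eps0 : (0 < eps)%R by rewrite !lt_min invr_gt0 ltr0n exprn_gt0// e10 divr_gt0.
have le12 : (eps <= 2^-1)%R by rewrite !ge_min lexx.
have le1 : (eps <= 1)%R by lra.
have let2 : (eps <= t ^+ 2)%R by rewrite !ge_min lexx orbT.
have lee1 : (eps <= e1)%R by rewrite !ge_min lexx !orbT.
have lee2 : (eps <= e2 / 16)%R by rewrite !ge_min lexx !orbT.
have mE es i : mker (q i) (ekernel (es i : elementary mu (q i))).
  by apply: mker_app_seq; exact: measurable_elem_kernel.
have mK i : mker (q i) (K i) := mker_app_seq (@measurable_kernel_f i).
have mD es i : mker (q i) (fun x => ekernel (es i : elementary mu (q i)) x - K i x)%R.
  exact: (measurable_funB (mE es i) (mK i)).
have mneg (u v : seq Z -> R) l m : mixed (fun x => u x - v x)%R l m 0 = mixed (fun x => v x - u x)%R l m 0.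
  rewrite -(mixed_norm_abs mu l m 0 (fun x => u x - v x)%R) -(mixed_norm_abs mu l m 0 (fun x => v x - u x)%R).
  by apply: (congr1 (fun w => mixed w l m 0)); apply/funext => x; rewrite distrC.
have bnd es i l m : (l + m = q i)%N -> mixed (fun x => ekernel (es i : elementary mu (q i)) x - K i x)%R l m 0 <= eps%:E ->
    mixed (ekernel (es i)) l m 0 <= M%:E.
  move=> lm h.
  have ad : (l + (m + 0) = q i)%N by rewrite addn0.
  have mK' : mker (l + (m + 0)) (K i) by rewrite ad.
  have mD' : mker (l + (m + 0)) (fun x => ekernel (es i) x - K i x)%R by rewrite ad.
  have -> : mixed (ekernel (es i)) l m 0 = mixed (fun x => K i x + (ekernel (es i) x - K i x))%R l m 0.
    by apply: (congr1 (fun u => mixed u l m 0)); apply/funext => x; rewrite addrC subrK.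
  apply: (le_trans (mixedD mu mK' mD')); rewrite /M EFinM; apply: lee_wpmul2l => //.
  rewrite EFinD; apply: leeD; first exact: kernel_mixed_le.
  by apply: (le_trans h); rewrite lee_fin.
have [es [s es0 cm cI]] := close_family eps0.
exists es; split=> //.
- by apply: (le_trans cI); rewrite lee_fin.
- have mT es1 : measurable_fun setT (T es1) by exact: measurable_total_integral.
  apply: le_integral_truncated; [by apply: measurable_funX; exact: measurable_funB|by move=> w; rewrite exprn_even_ge0|].
  move=> n; apply/lee_addgt0Pr => r r0.
  pose eps3 : R := Num.min eps (r / (8 * n%:R + 1))%R.
  have den3 : (0 < 8 * n%:R + 1 :> R)%R by rewrite ltr_wpDl// mulr_ge0.
  have eps30 : (0 < eps3)%R by rewrite lt_min eps0 divr_gt0.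
  have [es' [s' _ cm' cI']] := close_family eps30.
  have diff : \int[P]_w ((T es w - T es' w) ^+ 4)%:E <= (@fourth_constant R k q * del)%:E.
    apply: total_integral_difference => //; first exact: ltW.
    move=> i r' l lr ri.
    have eq1 : (l + (r' - l + (q i - r')) = q i)%N by move: lr ri; clear; lia.
    have eq2 : (l + (q i - r') + (r' - l) = q i)%N by move: lr ri; clear; lia.
    have mz n1 : mker n1 (fun _ : seq Z => 0%R : R) by exact: measurable_cst.
    have sz n1 : ae_symmetric mu n1 (fun _ : seq Z => 0%R : R) by move=> ? _; exact: aeW.
    have z0 l' m' : mixed (fun _ : seq Z => 0%R : R) l' m' 0 = 0.
      by apply: mixed_null => //; apply: sqr_mass_null => //; exact: aeW.
    pose D x := (ekernel (es i) x - ekernel (es' i) x)%R.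
    have mDD : mker (q i) D by exact: (measurable_funB (mE es i) (mE es' i)).
    have sDD : ae_symmetric mu (q i) D by apply: ae_symmetricB; exact: symmetric_elem_ae.
    have D16 l' m' : (l' + m' = q i)%N -> mixed D l' m' 0 <= (16 * eps)%:E.
      move=> lm; have ad : (l' + (m' + 0) = q i)%N by rewrite addn0.
      have m1 : mker (l' + (m' + 0)) (fun x => ekernel (es i) x - K i x)%R by rewrite ad.
      have m2 : mker (l' + (m' + 0)) (fun x => K i x - ekernel (es' i) x)%R.
        by rewrite ad; exact: (measurable_funB (mK i) (mE es' i)).
      have -> : mixed D l' m' 0 = mixed (fun x => (ekernel (es i) x - K i x) + (K i x - ekernel (es' i) x))%R l' m' 0.
        by apply: (congr1 (fun u => mixed u l' m' 0)); apply/funext => x; rewrite addrA subrK.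
      apply: (le_trans (mixedD mu m1 m2)).
      have -> : (16 * eps)%:E = 8%:E * (eps%:E + eps%:E) by rewrite -EFinD -EFinM; congr EFin; ring.
      apply: lee_wpmul2l => //; apply: leeD; first exact: cm.
      rewrite mneg; apply: (le_trans (cm' i l' m' lm)); rewrite lee_fin /eps3 ge_min lexx //.
    have D2 : mixed D (l + (q i - r')) (r' - l) 0 <= e2%:E.
      by apply: (le_trans (D16 _ _ eq2)); rewrite lee_fin; lra.
    have DM : mixed D (l + (q i - r')) (r' - l) 0 <= M%:E.
      by apply: (le_trans (D16 _ _ eq2)); rewrite lee_fin /M; lra.
    have subD : (fun x => D x - 0)%R = D by apply/funext => x; rewrite subr0.
    (* Closeness to the zero kernels bounds the contraction of D with itself. *)
    have := H2 l (r' - l)%N (q i - r')%N (q i - r')%N (fun=> 0%R) (fun=> 0%R) D D.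
    rewrite eq1 subD !z0 => /(_ (mz _) (mz _) mDD mDD (sz _) (sz _) sDD sDD) h.
    apply: (le_trans (h _ DM D2 D2)); first by rewrite lee_fin.
    rewrite [contraction_sqr _ _ _ _ _ _ _](_ : _ = 0) ?mule0 ?add0e//.
    apply: integral0_eq => x _; apply: integral0_eq => y _; apply: integral0_eq => z _.
    by rewrite [inner _ _ _ _ _ _ _]integral0_eq ?expe2 ?mule0// => ? _; rewrite mul0r.
  have mDT : measurable_fun setT (fun w => (T es w - T es' w) ^+ 4)%R by apply: measurable_funX; exact: measurable_funB.
  have mDF : measurable_fun setT (fun w => (T es' w - F w) ^+ 2)%R by apply: measurable_funX; exact: measurable_funB.
  have m8 : measurable_fun setT (fun w => 8%:E * ((T es w - T es' w) ^+ 4)%:E) by apply: emeasurable_funM => //; exact/measurable_EFinP.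
  have m9 : measurable_fun setT (fun w => (8 * n%:R)%:E * ((T es' w - F w) ^+ 2)%:E) by apply: emeasurable_funM => //; exact/measurable_EFinP.
  have p4 w : 0 <= ((T es w - T es' w) ^+ 4)%:E by rewrite lee_fin exprn_even_ge0.
  have p2 w : 0 <= ((T es' w - F w) ^+ 2)%:E by rewrite lee_fin sqr_ge0.
  apply: (@le_trans _ _ (\int[P]_w (8%:E * ((T es w - T es' w) ^+ 4)%:E + (8 * n%:R)%:E * ((T es' w - F w) ^+ 2)%:E))).
    apply: ge0_le_integral => //.
    - by move=> w _; rewrite lee_fin le_min exprn_even_ge0// sqr_ge0.
    - apply/measurable_EFinP; apply: measurable_minr => //; apply: measurable_funX; exact: measurable_funB.
    - exact: emeasurable_funD.
    - move=> w _; rewrite -!EFinM -EFinD lee_fin.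
      have := @truncated_fourth_le R (T es w - T es' w) (T es' w - F w) n%:R (ler0n _ _).
      by rewrite addrA subrK.
  rewrite ge0_integralD//; last 2 first.
  - by move=> w _; apply: mule_ge0.
  - by move=> w _; apply: mule_ge0; [rewrite lee_fin mulr_ge0|exact: p2].
  rewrite ge0_integralZl_EFin//; last exact/measurable_EFinP.
  rewrite ge0_integralZl_EFin ?mulr_ge0//; last exact/measurable_EFinP.
  apply: leeD.
    apply: (@le_trans _ _ (8%:E * (@fourth_constant R k q * del)%:E)); first exact: lee_wpmul2l.
    rewrite -EFinM lee_fin /del; set c := @fourth_constant R k q in fc0 *.
    have c1 : (0 < c + 1)%R by rewrite ltr_wpDl.
    have -> : (8 * (c * (t ^+ 4 / (8 * (c + 1)))) = t ^+ 4 * (c / (c + 1)))%R.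
      by field; rewrite gt_eqF.
    by rewrite ler_piMr ?(ltW t40)// ler_pdivrMr// mul1r lerDl.
  apply: (@le_trans _ _ ((8 * n%:R)%:E * eps3%:E)); first by apply: lee_wpmul2l => //; rewrite lee_fin mulr_ge0.
  rewrite -EFinM lee_fin; have h3 : (eps3 <= r / (8 * n%:R + 1))%R by rewrite ge_min lexx orbT.
  have n80 : (0 <= 8 * n%:R :> R)%R by rewrite mulr_ge0.
  apply: (le_trans (ler_wpM2l n80 h3)); rewrite mulrCA ler_piMr ?(ltW r0)//.
  by rewrite ler_pdivrMr// mul1r lerDl.
move=> i j r l lr ri rj.
have q1 : (l + (r - l + (q i - r)) = q i)%N by move: lr ri; clear; lia.
have q2 : (l + (r - l + (q j - r)) = q j)%N by move: lr rj; clear; lia.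
have q3 : (l + (q i - r) + (r - l) = q i)%N by move: lr ri; clear; lia.
have q4 : (l + (q j - r) + (r - l) = q j)%N by move: lr rj; clear; lia.
have sK i1 : ae_symmetric mu (q i1) (K i1) by exact: L2s_ae_symmetric (L2f i1).
have sE i1 : ae_symmetric mu (q i1) (ekernel (es i1)) by exact: symmetric_elem_ae.
have KM i1 l' m' : (l' + m' = q i1)%N -> mixed (K i1) l' m' 0 <= M%:E.
  by move=> lm; apply: (le_trans (kernel_mixed_le lm)); rewrite lee_fin /M; lra.
have EM i1 l' m' : (l' + m' = q i1)%N -> mixed (ekernel (es i1)) l' m' 0 <= M%:E.
  by move=> lm; apply: bnd => //; exact: cm.
have cd i1 l' m' : (l' + m' = q i1)%N -> mixed (fun x => ekernel (es i1) x - K i1 x)%R l' m' 0 <= e1%:E.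
  by move=> lm; apply: (le_trans (cm _ _ _ lm)); rewrite lee_fin.
have cd' i1 l' m' : (l' + m' = q i1)%N -> mixed (fun x => K i1 x - ekernel (es i1) x)%R l' m' 0 <= e1%:E.
  by move=> lm; rewrite mneg; exact: cd.
split.
- have := H1 l (r - l)%N (q i - r)%N (q j - r)%N (K i) (K j) (ekernel (es i)) (ekernel (es j)).
  rewrite q1 q2; apply=> //; [exact: KM|exact: EM|exact: cd|exact: cd].
- have := H1 l (r - l)%N (q i - r)%N (q j - r)%N (ekernel (es i)) (ekernel (es j)) (K i) (K j).
  rewrite q1 q2; apply=> //; [exact: EM|exact: KM|exact: cd'|exact: cd'].
Qed.

End approximants.

Lemma integral_le_comb {d} {V : measurableType d} {R : realType} (nu : {measure set V -> \bar R})
    (u v w : V -> R) (a b : R) : (0 <= a)%R -> (0 <= b)%R ->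
  measurable_fun setT u -> measurable_fun setT v -> measurable_fun setT w ->
  (forall x, 0 <= u x)%R -> (forall x, 0 <= v x)%R -> (forall x, 0 <= w x)%R ->
  (forall x, u x <= a * v x + b * w x)%R ->
  \int[nu]_x (u x)%:E <= a%:E * \int[nu]_x (v x)%:E + b%:E * \int[nu]_x (w x)%:E.
Proof.
move=> a0 b0 mu1 mv mw u0 v0 w0 H.
have mm (c : R) (g : V -> R) : measurable_fun setT g -> measurable_fun setT (fun x => c%:E * (g x)%:E).
  by move=> mg; apply: emeasurable_funM => //; exact/measurable_EFinP.
rewrite -ge0_integralZl_EFin//; [|by move=> x _; rewrite lee_fin|exact/measurable_EFinP].
rewrite -ge0_integralZl_EFin//; [|by move=> x _; rewrite lee_fin|exact/measurable_EFinP].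
rewrite -ge0_integralD//; first last.
- exact: mm.
- by move=> x _; rewrite -EFinM lee_fin mulr_ge0.
- exact: mm.
- by move=> x _; rewrite -EFinM lee_fin mulr_ge0.
apply: ge0_le_integral => //.
- by move=> x _; rewrite lee_fin.
- exact/measurable_EFinP.
- by apply: emeasurable_funD; exact: mm.
- by move=> x _; rewrite -!EFinM -EFinD lee_fin.
Qed.

Lemma sqr_split {R : realFieldType} (x y t : R) : (0 < t)%R ->
  ((x + y) ^+ 2 <= (1 + t) * x ^+ 2 + (1 + t^-1) * y ^+ 2)%R.
Proof.
move=> t0; have -> : ((1 + t) * x ^+ 2 + (1 + t^-1) * y ^+ 2 = (x + y) ^+ 2 + t^-1 * (t * x - y) ^+ 2)%R.
  by field; rewrite gt_eqF.
by rewrite lerDl mulr_ge0 ?sqr_ge0// invr_ge0 ltW.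
Qed.

Lemma fourth_split {R : realFieldType} (x y t : R) : (0 < t)%R ->
  ((x + y) ^+ 4 <= (1 + t) ^+ 3 * x ^+ 4 + (1 + t^-1) ^+ 3 * y ^+ 4)%R.
Proof.
move=> t0; have it0 : (0 < t^-1)%R by rewrite invr_gt0.
have e4 (z : R) : (z ^+ 4 = (z ^+ 2) ^+ 2)%R by rewrite -exprM.
rewrite !e4; set X := (x ^+ 2)%R; set Y := (y ^+ 2)%R.
have X0 : (0 <= X)%R by exact: sqr_ge0.
have Y0 : (0 <= Y)%R by exact: sqr_ge0.
apply: (@le_trans _ _ (((1 + t) * X + (1 + t^-1) * Y) ^+ 2)%R).
  rewrite lerXn2r ?nnegrE ?sqr_ge0//; last exact: sqr_split.
  by rewrite addr_ge0// mulr_ge0// addr_ge0// ltW.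
apply: le_trans (sqr_split _ _ t0) _; rewrite !exprMn.
by rewrite le_eqVlt; apply/orP; left; apply/eqP; rewrite !exprS; ring.
Qed.

Lemma sqrt_add_le {R : rcfType} (x y : R) : (0 <= x)%R -> (0 <= y)%R ->
  (Num.sqrt (x + y) <= Num.sqrt x + Num.sqrt y)%R.
Proof.
move=> x0 y0; rewrite -[leRHS]ger0_norm ?addr_ge0 ?sqrtr_ge0// -sqrtr_sqr ler_wsqrtr//.
by rewrite sqrrD !sqr_sqrtr// addrAC lerDl mulrn_wge0// mulr_ge0 ?sqrtr_ge0.
Qed.

Lemma sqrt_quadratic_le {R : rcfType} (c x y : R) : (0 <= c)%R -> (0 <= x)%R -> (0 <= y)%R ->
  (Num.sqrt (c * (3 * x ^+ 2 + y ^+ 2)) <= Num.sqrt (3 * c) * x + Num.sqrt c * y)%R.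
Proof.
move=> c0 x0 y0; rewrite (_ : c * (3 * x ^+ 2 + y ^+ 2) = 3 * c * x ^+ 2 + c * y ^+ 2)%R; last by ring.
apply: le_trans (sqrt_add_le _ _) _; rewrite ?mulr_ge0 ?sqr_ge0//.
by rewrite (@sqrtrM _ (3 * c)%R) ?mulr_ge0// (@sqrtrM _ c)// !sqrtr_sqr !ger0_norm.
Qed.

Lemma le_small_error {R : realType} (x : \bar R) (y c : R) : (0 <= c)%R ->
  (forall t : R, (0 < t)%R -> (t <= 1)%R -> x <= (y + t * c)%:E) -> x <= y%:E.
Proof.
move=> c0 H; apply/lee_addgt0Pr => e e0; have c1 : (0 < c + 1)%R by rewrite ltr_wpDl.
pose t := Num.min 1%R (e / (c + 1))%R.
have t0 : (0 < t)%R by rewrite lt_min ltr01 divr_gt0.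
have t1 : (t <= 1)%R by rewrite ge_min lexx.
apply: le_trans (H t t0 t1) _; rewrite -EFinD lee_fin lerD2l.
have t2 : (t <= e / (c + 1))%R by rewrite ge_min lexx orbT.
apply: (le_trans (ler_wpM2r c0 t2)); rewrite -mulrA ler_piMr ?(ltW e0)//.
by rewrite mulrC ler_pdivrMr// mul1r lerDl.
Qed.

(** * Passage to the limit in the two estimates *)

Section limit_bounds.
Context {d d'} {Z : measurableType d} {Omega : measurableType d'} {R : realType}.
Variables (P : probability Omega R) (mu : {sigma_finite_measure set Z -> \bar R}) (eta : R.-ker Omega ~> Z).
Hypotheses (hZ : borel_space Z R) (hA : no_atoms mu) (hP : poisson_measure P mu eta).
Variables (k : nat) (q : 'I_k -> nat).
Hypothesis q_ge1 : forall i, (1 <= q i)%N.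
Hypothesis q_incr : forall i j : 'I_k, (i < j)%N -> (q i < q j)%N.
Notation ekernel e := (app_seq (elem_kernel e)).
Notation T es := (total_integral eta es).
Variables (K : 'I_k -> seq Z -> R) (F : Omega -> R) (nn : bool) (s : R).
Hypothesis mF : measurable_fun setT F.
Hypotheses (s0 : (0 < s)%R) (F2 : \int[P]_w (F w ^+ 2)%:E = (s ^+ 2)%:E).
Hypothesis approx : forall t : R, (0 < t)%R -> (t <= 1)%R -> exists es : forall i, elementary mu (q i),
  [/\ symmetric_family es, nn -> forall i x, (0 <= elem_kernel (es i) x)%R,
    \int[P]_w ((T es w - F w) ^+ 2)%:E <= (t ^+ 2)%:E,
    \int[P]_w ((T es w - F w) ^+ 4)%:E <= (t ^+ 4)%:E &
    forall i j r l, (l <= r)%N -> (r <= q i)%N -> (r <= q j)%N ->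
      contraction_sqr mu (ekernel (es i)) (ekernel (es j)) l (r - l) (q i - r) (q j - r) <=
        3%:E * contraction_sqr mu (K i) (K j) l (r - l) (q i - r) (q j - r) + t%:E /\
      contraction_sqr mu (K i) (K j) l (r - l) (q i - r) (q j - r) <=
        3%:E * contraction_sqr mu (ekernel (es i)) (ekernel (es j)) l (r - l) (q i - r) (q j - r) + t%:E].

Lemma second_moment_close (G : Omega -> R) (t : R) : measurable_fun setT G -> (0 < t)%R -> (t <= 1)%R ->
  \int[P]_w ((G w - F w) ^+ 2)%:E <= (t ^+ 2)%:E ->
  (`|s ^+ 2 - fine (\int[P]_w (G w ^+ 2)%:E)| <= t * (2 * s ^+ 2 + 4))%R.
Proof.
move=> mG t0 t1 H; have it0 : (0 < t^-1)%R by rewrite invr_gt0.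
have mD : measurable_fun setT (fun w => G w - F w)%R by exact: measurable_funB.
have m2 (g : Omega -> R) : measurable_fun setT g -> measurable_fun setT (fun w => g w ^+ 2)%R by exact: measurable_funX.
have p1 : (0 <= 1 + t)%R by rewrite addr_ge0// ltW.
have p2 : (0 <= 1 + t^-1)%R by rewrite addr_ge0// ltW.
have sq0 (g : Omega -> R) w : (0 <= g w ^+ 2)%R by exact: sqr_ge0.
have A := integral_le_comb P p1 p2 (m2 _ mG) (m2 _ mF) (m2 _ mD) (sq0 G) (sq0 F) (sq0 (fun w => G w - F w)%R)
  (fun w => _).
have {}A : \int[P]_w (G w ^+ 2)%:E <= (1 + t)%:E * \int[P]_w (F w ^+ 2)%:E +
    (1 + t^-1)%:E * \int[P]_w ((G w - F w) ^+ 2)%:E.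
  by apply: A => w; have := sqr_split (F w) (G w - F w) t0; rewrite addrC subrK.
have B := integral_le_comb P p1 p2 (m2 _ mF) (m2 _ mG) (m2 _ mD) (sq0 F) (sq0 G) (sq0 (fun w => G w - F w)%R)
  (fun w => _).
have {}B : \int[P]_w (F w ^+ 2)%:E <= (1 + t)%:E * \int[P]_w (G w ^+ 2)%:E +
    (1 + t^-1)%:E * \int[P]_w ((G w - F w) ^+ 2)%:E.
  by apply: B => w; have := sqr_split (G w) (- (G w - F w))%R t0; rewrite sqrrN subKr.
have g0 : 0 <= \int[P]_w (G w ^+ 2)%:E by apply: integral_ge0 => w _; rewrite lee_fin sqr_ge0.
have e1 : ((1 + t^-1) * t ^+ 2 = t ^+ 2 + t)%R by field; rewrite gt_eqF.
have D1 : (1 + t^-1)%:E * \int[P]_w ((G w - F w) ^+ 2)%:E <= (t ^+ 2 + t)%:E.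
  by rewrite -e1 EFinM; apply: lee_wpmul2l => //; rewrite lee_fin.
have {}A := le_trans A (leeD (lexx _) D1); have {}B := le_trans B (leeD (lexx _) D1).
move: A B g0; rewrite F2; case: (\int[P]_w (G w ^+ 2)%:E) => [r| |] //.
rewrite -!EFinM -!EFinD !lee_fin /= => A B r0.
have tt : (t ^+ 2 <= t)%R by rewrite expr2 ler_piMl// ltW.
have s2 := sqr_ge0 s; rewrite ler_norml; apply/andP; split; first by nra.
have hs : (t * s ^+ 2 <= s ^+ 2)%R by rewrite ler_piMl.
have h : (t * r <= t * (2 * s ^+ 2 + 2))%R by rewrite ler_wpM2l ?(ltW t0)//; lra.
by lra.
Qed.

Definition distance_constant : R :=
  (@stein_constant R * (Num.sqrt (3 * (gamma_bound R q * @energy_count R k q)) +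
    Num.sqrt (3 * (difference_bound R q * @energy_count R k q))))%R.

Lemma energy_count_ge0 : (0 <= @energy_count R k q)%R.
Proof.
rewrite /energy_count !addr_ge0//; apply: sumr_ge0 => i _ //; apply: sumr_ge0 => j _; apply: sumr_ge0 => // r _.
exact: sumr_ge0.
Qed.

Lemma stein_constant_ge0 : (0 <= @stein_constant R)%R.
Proof.
have hl : lip1 (fun x : R => x) by move=> x y.
by have [psi [psi' [_ b1 _ _ _]]] := stein_scaled hl ltr01; exact: le_trans (b1 0%R).
Qed.

(** The approximation is taken at precision [tau ^+ 2] because the bounds contain square roots of
    it; all errors are then linear in tau, which tends to 0. The factor 3 lost in comparing
    contractions remains under the square roots of [distance_constant]. *)
Lemma lipschitz_distance (h : R -> R) (b : R) : lip1 h -> (0 <= b)%R ->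
  (forall i j r l, relevant q i j r l ->
    contraction_sqr mu (K i) (K j) l (r - l) (q i - r) (q j - r) <= (b ^+ 2)%:E) ->
  `|\int[P]_w (s * (h (F w) - gauss_mean (fun x => h (s * x))))%:E| <= (distance_constant * b)%:E.
Proof.
move=> hl b0 cb; set gm := gauss_mean _.
have c10 := stein_constant_ge0; set c1 := @stein_constant R in c10.
have cnt0 := energy_count_ge0; set cnt := @energy_count R k q in cnt0.
have gb0 : (0 <= gamma_bound R q * cnt)%R by rewrite mulr_ge0// gamma_bound_ge0.
have db0 : (0 <= difference_bound R q * cnt)%R by rewrite mulr_ge0// difference_bound_ge0.
set gc := (gamma_bound R q * cnt)%R in gb0; set dc := (difference_bound R q * cnt)%R in db0.
pose c3 := (2 * s ^+ 2 + 4)%R; have c30 : (0 <= c3)%R by rewrite addr_ge0// mulr_ge0// sqr_ge0.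
pose A1 := (Num.sqrt (3 * gc) * b)%R; pose A2 := Num.sqrt gc.
pose B1 := (Num.sqrt (3 * dc) * b)%R; pose B2 := Num.sqrt dc.
pose u := (s^-1 * Num.sqrt c3)%R.
have [A10 A20 B10 B20] : [/\ 0 <= A1, 0 <= A2, 0 <= B1 & 0 <= B2]%R.
  by split; rewrite ?mulr_ge0 ?sqrtr_ge0.
have u0 : (0 <= u)%R by rewrite mulr_ge0 ?sqrtr_ge0// invr_ge0 ltW.
apply: (@le_small_error _ _ _ (c1 * (c3 + A2 + (B2 + u * B1 + u * B2)) + 2 * s)%R).
  have uB1 : (0 <= u * B1)%R by rewrite mulr_ge0.
  have uB2 : (0 <= u * B2)%R by rewrite mulr_ge0.
  have s20 : (0 <= 2 * s)%R by rewrite mulr_ge0// ltW.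
  have w1 := addr_ge0 c30 A20; have w2 := addr_ge0 (addr_ge0 B20 uB1) uB2.
  exact: addr_ge0 (mulr_ge0 c10 (addr_ge0 w1 w2)) s20.
move=> tau tau0 tau1; pose t := (tau ^+ 2)%R.
have t0 : (0 < t)%R by rewrite exprn_gt0.
have tt : (t <= tau)%R by rewrite /t expr2 ler_piMl// ltW.
have t1 : (t <= 1)%R by exact: le_trans tau1.
have [es [sy _ d2 _ cc]] := approx t0 t1.
have mT : measurable_fun setT (T es) by exact: measurable_total_integral.
have mh : measurable_fun setT h by exact: continuous_measurable_fun (lip1_continuous hl).
have mhg (g : Omega -> R) : measurable_fun setT g -> measurable_fun setT (fun w => s * (h (g w) - gm))%R.
  move=> mg; apply: measurable_funM => //; apply: measurable_funB => //.
  exact: (measurableT_comp mh mg).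
apply: (le_trans (abse_integral_le P (mhg _ mF) (mhg _ mT))).
have b20 : (0 <= 3 * b ^+ 2 + t)%R by rewrite addr_ge0 ?mulr_ge0 ?sqr_ge0// ltW.
have St := total_integral_stein hZ hA hP q_ge1 q_incr sy hl s0 b20.
rewrite -/gm in St.
have St1 : `|\int[P]_w (s * (h (T es w) - gm))%:E| <= (c1 * (t * c3 + (A1 + A2 * tau) + (1 + tau * u) * (B1 + B2 * tau)))%:E.
  apply: le_trans (St _) _.
    move=> i j r l rel; have := cb i j r l rel; move: rel => /and5P[r0 lr ri rj _] h1.
    have [h2 _] := cc i j r l lr ri rj; apply: (le_trans h2).
    rewrite (_ : (3 * b ^+ 2 + t)%:E = 3%:E * (b ^+ 2)%:E + t%:E); last by rewrite -EFinM -EFinD.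
    by apply: leeD => //; apply: lee_wpmul2l.
  have a2 := second_moment_close mT t0 t1 d2.
  set a := fine _ in a2 *.
  have a0 : (0 <= a)%R by rewrite fine_ge0// integral_ge0// => w _; rewrite lee_fin sqr_ge0.
  rewrite lee_fin ler_wpM2l// -/cnt !(mulrA _ cnt) -/gc -/dc.
  have q1 : (Num.sqrt (gc * (3 * b ^+ 2 + t)) <= A1 + A2 * tau)%R.
    by apply: sqrt_quadratic_le => //; exact: ltW.
  have q2 : (Num.sqrt (dc * (3 * b ^+ 2 + t)) <= B1 + B2 * tau)%R.
    by apply: sqrt_quadratic_le => //; exact: ltW.
  have q3 : (Num.sqrt a <= s + tau * Num.sqrt c3)%R.
    have h1 : (a <= s ^+ 2 + c3 * tau ^+ 2)%R.
      by move: a2; rewrite ler_norml -/c3 -/t mulrC => /andP[hh _]; lra.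
    apply: (le_trans (ler_wsqrtr h1)).
    apply: (le_trans (@sqrt_add_le _ (s ^+ 2)%R (c3 * tau ^+ 2)%R (sqr_ge0 _) (mulr_ge0 c30 (sqr_ge0 _)))).
    by rewrite (@sqrtrM _ c3)// !sqrtr_sqr !ger0_norm ?(ltW s0) ?(ltW tau0)// [(tau * _)%R]mulrC.
  apply: lerD; first by apply: lerD.
  have -> : (1 + tau * u = s^-1 * (s + tau * Num.sqrt c3))%R by rewrite /u; field; rewrite gt_eqF.
  rewrite -[X in (_ <= X)%R]mulrA ler_wpM2l ?invr_ge0 ?(ltW s0)//.
  by apply: ler_pM; rewrite ?sqrtr_ge0.
have am (y z : R) : (y * z <= z ^+ 2 + y * y)%R.
  by have := sqr_ge0 (z - y)%R; have := sqr_ge0 z; have := sqr_ge0 y; rewrite !expr2; nra.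
have St2 : \int[P]_w `|(s * (h (F w) - gm) - s * (h (T es w) - gm))|%:E <= (s * (2 * t))%:E.
  have mD : measurable_fun setT (fun w => T es w - F w)%R by exact: measurable_funB.
  have it0 : (0 <= s * t^-1)%R by rewrite mulr_ge0 ?invr_ge0// ltW.
  have st0 : (0 <= s * t)%R by rewrite mulr_ge0// ltW.
  have -> : (s * (2 * t))%:E = (s * t^-1)%:E * (t ^+ 2)%:E + (s * t)%:E * 1.
    by rewrite -!EFinM -EFinD; congr EFin; field; rewrite gt_eqF.
  apply: (@le_trans _ _ ((s * t^-1)%:E * \int[P]_w ((T es w - F w) ^+ 2)%:E + (s * t)%:E * \int[P]_w (1%R)%:E)).
    apply: integral_le_comb => //.
    - by apply: measurableT_comp => //; apply: measurable_funB; exact: mhg.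
    - exact: measurable_funX.
    - by move=> w; exact: sqr_ge0.
    - move=> w; rewrite -mulrBr opprB addrA subrK normrM (ger0_norm (ltW s0)) -!mulrA -mulrDr ler_wpM2l ?(ltW s0)//.
      rewrite mulr1; apply: (le_trans (hl _ _)); rewrite distrC.
      set x := (T es w - F w)%R; have x2 := sqr_ge0 (`|x| - t)%R.
      have n2 : (`|x| ^+ 2 = x ^+ 2)%R by rewrite real_normK ?num_real.
      rewrite -(ler_pM2l t0) mulrDr mulrA divff ?gt_eqF// mul1r -n2.
      exact: am.
  apply: leeD; apply: lee_wpmul2l => //.
  by rewrite integral_cst//= probability_setT mule1.
apply: (le_trans (leeD St1 St2)); rewrite -EFinD lee_fin.
have -> : (distance_constant * b = c1 * (A1 + B1))%R by rewrite /distance_constant /A1 /B1 -/c1 -/cnt -/gc -/dc; ring.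
have h1 : ((1 + tau * u) * (B1 + B2 * tau) <= B1 + tau * (B2 + u * B1 + u * B2))%R.
  have h2 : (tau * u * (B2 * tau) <= tau * (u * B2))%R.
    by rewrite -mulrA ler_wpM2l ?(ltW tau0)// mulrA ler_piMr// mulr_ge0.
  by nra.
have h3 : (t * c3 <= tau * c3)%R by rewrite ler_wpM2r.
have h4 : (s * (2 * t) <= tau * (2 * s))%R.
  by have hh := ler_wpM2l (ltW s0) tt; lra.
have h5 : (c1 * (t * c3 + (A1 + A2 * tau) + (1 + tau * u) * (B1 + B2 * tau)) <=
   c1 * (tau * c3 + (A1 + A2 * tau) + (B1 + tau * (B2 + u * B1 + u * B2))))%R.
  by rewrite ler_wpM2l//; apply: lerD => //; rewrite lerD2r.
by apply: (le_trans (lerD h5 h4)); rewrite le_eqVlt; apply/orP; left; apply/eqP; ring.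
Qed.

(** If the fourth moment of F is infinite the bound is trivial. Otherwise the cumulant inequality
    holds for the approximations, whose fourth moments are bounded above by [fourth_split] and whose
    squared second moments are bounded below, with errors linear in t. *)
Lemma contraction_le_cumulant i j r l : nn -> relevant q i j r l ->
  contraction_sqr mu (K i) (K j) l (r - l) (q i - r) (q j - r) <=
  (3 * fact_bound R (q i) (q j))%:E * (\int[P]_w (F w ^+ 4)%:E - (3 * s ^+ 4)%:E).
Proof.
move=> n1 rel.
have fb0 : (0 < fact_bound R (q i) (q j))%R by exact: fact_bound_gt0.
set fb := fact_bound R (q i) (q j) in fb0 *.
have V0 : 0 <= \int[P]_w (F w ^+ 4)%:E by apply: integral_ge0 => w _; rewrite lee_fin exprn_even_ge0.
case VE : (\int[P]_w (F w ^+ 4)%:E) V0 => [v| |] // v0; last by rewrite gt0_muley ?leey// lte_fin mulr_gt0.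
rewrite lee_fin in v0.
pose c3 := (2 * s ^+ 2 + 4)%R; have c30 : (0 <= c3)%R by rewrite addr_ge0// mulr_ge0// sqr_ge0.
rewrite -EFinB -EFinM.
apply: (@le_small_error _ _ _ (3 * fb * (7 * v + 8 + 6 * s ^+ 2 * c3) + 1)%R).
  have s2 := sqr_ge0 s; have f3 : (0 <= 3 * fb)%R by rewrite mulr_ge0// ltW.
  have m7 : (0 <= 7 * v)%R by rewrite mulr_ge0.
  have m6 : (0 <= 6 * s ^+ 2 * c3)%R by rewrite mulr_ge0// mulr_ge0.
  by rewrite addr_ge0// mulr_ge0// !addr_ge0.
move=> t t0 t1; have [es [sy es0 d2 d4 cc]] := approx t0 t1.
have mT : measurable_fun setT (T es) by exact: measurable_total_integral.
have it0 : (0 < t^-1)%R by rewrite invr_gt0.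
move: (rel) => /and5P[r0 lr ri rj /andP[nt _]]; have [_ h1] := cc i j r l lr ri rj.
have h2 := total_integral_cumulant hZ hA hP q_ge1 sy (es0 n1) r0 ri rj lr nt.
apply: (le_trans h1); set cum := (fine _ - _)%R in h2.
apply: (@le_trans _ _ (3%:E * (fb * cum)%:E + t%:E)); first by rewrite leeD2r// lee_wpmul2l.
rewrite -EFinM -EFinD lee_fin.
have a2 := second_moment_close mT t0 t1 d2; rewrite -/c3 in a2.
have A4 : (fine (\int[P]_w (T es w ^+ 4)%:E) <= v + t * (7 * v + 8))%R.
  have A : \int[P]_w (T es w ^+ 4)%:E <= ((1 + t) ^+ 3)%:E * \int[P]_w (F w ^+ 4)%:E +
      ((1 + t^-1) ^+ 3)%:E * \int[P]_w ((T es w - F w) ^+ 4)%:E.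
    apply: integral_le_comb; rewrite ?exprn_ge0 ?addr_ge0 ?(ltW t0) ?(ltW it0)//.
    - exact: measurable_funX.
    - exact: measurable_funX.
    - by apply: measurable_funX; exact: measurable_funB.
    - by move=> w; rewrite exprn_even_ge0.
    - by move=> w; rewrite exprn_even_ge0.
    - by move=> w; rewrite exprn_even_ge0.
    - by move=> w; have := fourth_split (F w) (T es w - F w) t0; rewrite addrC subrK.
  have {}A : \int[P]_w (T es w ^+ 4)%:E <= ((1 + t) ^+ 3 * v + (1 + t^-1) ^+ 3 * t ^+ 4)%:E.
    apply: (le_trans A); rewrite VE EFinD (EFinM ((1 + t) ^+ 3)) (EFinM ((1 + t^-1) ^+ 3)); apply: leeD => //; apply: lee_wpmul2l => //.
    by rewrite lee_fin exprn_ge0// addr_ge0// ltW.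
  have f4 := total_integral_fourth hZ hA hP sy.
  have g4 : 0 <= \int[P]_w (T es w ^+ 4)%:E by apply: integral_ge0 => w _; rewrite lee_fin exprn_even_ge0.
  move: A f4 g4; case: (\int[P]_w (T es w ^+ 4)%:E) => [x| |] //=; rewrite lee_fin => A _ _.
  apply: (le_trans A).
  have e1 : ((1 + t^-1) ^+ 3 * t ^+ 4 = t * (1 + t) ^+ 3)%R by field; rewrite gt_eqF.
  have e2 : ((1 + t) ^+ 3 <= 1 + 7 * t)%R by rewrite !exprS expr0; nra.
  have e3 : ((1 + t) ^+ 3 <= 8)%R by lra.
  have e5 : ((1 + t) ^+ 3 * v <= (1 + 7 * t) * v)%R by rewrite ler_wpM2r.
  have e6 : (t * (1 + t) ^+ 3 <= t * 8)%R by rewrite ler_wpM2l// ltW.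
  by rewrite e1; lra.
have B2 : (s ^+ 4 - t * (2 * s ^+ 2 * c3) <= fine (\int[P]_w (T es w ^+ 2)%:E) ^+ 2)%R.
  set a := fine _ in a2 *.
  have ha : (s ^+ 2 - t * c3 <= a)%R by move: a2; rewrite ler_norml => /andP[_ ?]; lra.
  have e4 : (s ^+ 4 = (s ^+ 2) ^+ 2)%R by rewrite -exprM.
  have := sqr_ge0 (a - s ^+ 2)%R; have s2 := sqr_ge0 s; rewrite e4.
  have : (s ^+ 2 * (s ^+ 2 - t * c3) <= s ^+ 2 * a)%R by rewrite ler_wpM2l.
  by nra.
have hc : (cum <= (v - 3 * s ^+ 4) + t * (7 * v + 8 + 6 * s ^+ 2 * c3))%R by rewrite /cum; lra.
have : (3 * fb * cum <= 3 * fb * ((v - 3 * s ^+ 4) + t * (7 * v + 8 + 6 * s ^+ 2 * c3)))%R.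
  by rewrite ler_wpM2l// mulr_ge0// ltW.
by rewrite -mulrA; lra.
Qed.

End limit_bounds.

Lemma near_cvg0 {R : realType} (u : (\bar R)^nat) :
  (forall eps : R, (0 < eps)%R -> \forall n \near \oo, `|u n| <= eps%:E) -> u @ \oo --> 0.
Proof.
move=> H A [/= e e0 Ae]; have e2 : (0 < e / 2)%R by rewrite divr_gt0.
apply: (@filterS _ \oo _ (fun n => `|u n| <= (e / 2)%:E)); last exact: H.
move=> n /=; case: (u n) => [r| |] //; rewrite lee_fin => re.
by apply: Ae => /=; rewrite sub0r normrN; have : (0 < e)%R := e0; lra.
Qed.

(** * Means under the normal law *)

Section normal_target.
Context {R : realType} {dN} {OmegaN : measurableType dN} (PN : probability OmegaN R).
Variables (N : {RV PN >-> R}) (s : R).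
Hypotheses (s0 : (0 < s)%R)
  (NE : forall A, measurable A -> distribution PN N A = normal_prob 0%R s A).

Lemma lip1_max0 (h : R -> R) : lip1 h -> lip1 (fun x => Num.max (h x) 0%R).
Proof.
move=> hl x y; apply: le_trans (hl x y).
case: (leP (h x) (0:R)%R) => a; case: (leP (h y) (0:R)%R) => b.
- by rewrite subrr normr0.
- by rewrite sub0r normrN (gtr0_norm b) ler0_norm; lra.
- by rewrite subr0 (gtr0_norm a) ger0_norm; lra.
- by [].
Qed.

Lemma lip1_opp (h : R -> R) : lip1 h -> lip1 (fun x => - h x)%R.
Proof. by move=> hl x y; rewrite opprK addrC distrC; exact: hl. Qed.

Lemma expectation_lip1_normal (h : R -> R) : lip1 h ->
  \int[PN]_w (h (N w))%:E = (gauss_mean (fun x => h (s * x)))%:E.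
Proof.
move=> hl; rewrite /gauss_mean /Rintegral fineK; last exact: integrable_fin_num (integrable_lip1_gauss s hl).
rewrite [LHS]integralE [RHS]integralE; congr (_ - _).
- rewrite (eq_integral (fun w => (Num.max (h (N w)) 0%R)%:E)); last first.
    by move=> w _; rewrite funeposE EFin_max.
  rewrite (ge0_expectation_normal (f := fun x => Num.max (h x) 0%R) s0 NE); last 2 first.
  - exact: lip1_continuous (lip1_max0 hl).
  - by move=> x; rewrite le_max lexx orbT.
  apply: eq_integral => x _; rewrite funeposE -EFin_max; congr EFin.
  by rewrite maxr_pMl ?gpdf_ge0// mul0r.
- rewrite (eq_integral (fun w => (Num.max (- h (N w)) 0)%R%:E)); last first.
    by move=> w _; rewrite funenegE EFin_max.
  rewrite (ge0_expectation_normal (f := fun x => Num.max (- h x)%R 0%R) s0 NE); last 2 first.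
  - exact: lip1_continuous (lip1_max0 (lip1_opp hl)).
  - by move=> x; rewrite le_max lexx orbT.
  apply: eq_integral => x _; rewrite funenegE -EFinN -EFin_max; congr EFin.
  by rewrite maxr_pMl ?gpdf_ge0// mul0r mulNr.
Qed.

Lemma expectation_fourth_normal : \int[PN]_w (N w ^+ 4)%:E = (3 * s ^+ 4)%:E.
Proof.
rewrite (ge0_expectation_normal (f := fun x => x ^+ 4)%R s0 NE); last 2 first.
- exact: exprn_continuous.
- by move=> x; rewrite exprn_even_ge0.
under eq_integral do rewrite exprMn -mulrA EFinM.
rewrite ge0_integralZl_EFin ?exprn_ge0 ?(ltW s0)//.
- by rewrite integral_pow4_gauss -EFinM mulrC.
- by move=> x _; rewrite lee_fin mulr_ge0 ?gpdf_ge0// exprn_even_ge0.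
- apply/measurable_EFinP; apply: continuous_measurable_fun => x.
  by apply: cvgM; [exact: exprn_continuous|exact: continuous_gpdf].
Qed.

End normal_target.

(** The constant is the mean modulus of a standard normal variable; it is the source of the second
    term in the distance bound. *)
Lemma gauss_mean_scaling {R : realType} (h : R -> R) (a b : R) : lip1 h ->
  (`|gauss_mean (fun x => h (a * x)) - gauss_mean (fun x => h (b * x))| <= `|a - b| * Num.sqrt (2 / pi))%R.
Proof.
move=> hl; have ia := integrable_lip1_gauss a hl; have ib := integrable_lip1_gauss b hl.
rewrite -lee_fin -abse_EFin EFinB /gauss_mean /Rintegral !fineK; [|exact: integrable_fin_num ib|exact: integrable_fin_num ia].
rewrite -integralB//.
have iab := integrableB measurableT ia ib.
apply: (le_trans (le_abse_integral _ measurableT (measurable_int _ iab))).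
rewrite EFinM -integral_abs_gauss -ge0_integralZl_EFin//; last 2 first.
- by move=> x _; rewrite lee_fin mulr_ge0 ?gpdf_ge0.
- apply/measurable_EFinP; apply: continuous_measurable_fun => x.
  by apply: cvgM; [exact: norm_continuous|exact: continuous_gpdf].
apply: ge0_le_integral => //.
- by apply: measurableT_comp => //; exact: (measurable_int _ iab).
- apply: emeasurable_funM => //; apply/measurable_EFinP; apply: continuous_measurable_fun => x.
  by apply: cvgM; [exact: norm_continuous|exact: continuous_gpdf].
move=> x _; rewrite -EFinB -EFinM abse_EFin lee_fin -mulrBl normrM (ger0_norm (gpdf_ge0 _)).
rewrite mulrA ler_wpM2r ?gpdf_ge0//; apply: (le_trans (hl _ _)).
by rewrite -mulrBl normrM.
Qed.

(** * Lipschitz envelopes, convergence in law and of fourth moments *)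

Section lipschitz_regularization.
Context {R : realType}.
Variables (h : R -> R) (M : R).
Hypotheses (ch : continuous h) (hM : forall x, (`|h x| <= M)%R).

(** The largest L-Lipschitz function below h. In [lower_envelope_lip] it is divided by [1 + L%:R],
    because only 1-Lipschitz functions are tested and L may be 0. *)
Definition lower_envelope (L : nat) (x : R) : R := inf [set (h y + L%:R * `|x - y|)%R | y in setT].

Let low L x y : (- M <= h y + L%:R * `|x - y|)%R.
Proof. by have := hM y; rewrite ler_norml => /andP[h1 _]; apply: (le_trans h1); rewrite lerDl mulr_ge0. Qed.

Lemma lower_envelope_le L x y : (lower_envelope L x <= h y + L%:R * `|x - y|)%R.
Proof.
apply: ge_inf; last by exists y.
by exists (- M)%R => _ [z _ <-].
Qed.

Lemma le_lower_envelope L x c : (forall y, c <= h y + L%:R * `|x - y|)%R -> (c <= lower_envelope L x)%R.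
Proof.
move=> H; apply: lb_le_inf; first by exists (h x + L%:R * `|x - x|)%R; exists x.
by move=> _ [y _ <-].
Qed.

Lemma lower_envelope_le_fun L x : (lower_envelope L x <= h x)%R.
Proof. by have := lower_envelope_le L x x; rewrite subrr normr0 mulr0 addr0. Qed.

Lemma lower_envelope_lip L : lip1 (fun x => (1 + L%:R)^-1 * lower_envelope L x)%R.
Proof.
have one x y : (lower_envelope L x <= lower_envelope L y + L%:R * `|x - y|)%R.
  rewrite -lerBlDr; apply: le_lower_envelope => z; rewrite lerBlDr.
  apply: (le_trans (lower_envelope_le L x z)); rewrite -addrA lerD2l -mulrDr ler_wpM2l//.
  by rewrite [leRHS]addrC (le_trans _ (ler_normD _ _))// addrA subrK.
have L0 : (0 < 1 + L%:R :> R)%R by rewrite ltr_pwDl.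
move=> x y; rewrite -mulrBr normrM (ger0_norm (_ : 0 <= (1 + L%:R)^-1)%R) ?invr_ge0 ?(ltW L0)//.
rewrite ler_pdivrMl//; apply: (@le_trans _ _ (L%:R * `|x - y|)%R); last by rewrite ler_wpM2r// lerDr.
have h1 := one x y; have h2 := one y x; rewrite distrC in h2.
by rewrite ler_norml; apply/andP; split; lra.
Qed.

Lemma lower_envelope_cvg x : (fun L => lower_envelope L x) @ \oo --> h x.
Proof.
apply/cvgrPdist_le => e e0.
have /cvgrPdist_le H : h y @[y --> x] --> h x by exact: ch.
have := H e e0; rewrite -nbhs_nearE => /nbhs_ballP[dl /= dl0 Hd].
near=> L; rewrite ger0_norm ?subr_ge0 ?lower_envelope_le_fun//.
rewrite lerBlDr -lerBlDl; apply: le_lower_envelope => y.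
have M0 : (0 <= M)%R by exact: le_trans (hM 0%R).
case: (ltP `|x - y|%R dl) => xy.
  have := Hd y xy; rewrite /= ler_norml => /andP[_ h1].
  by have : (0 <= L%:R * `|x - y|)%R by []; lra.
have L1 : (2 * M / dl <= L%:R)%R by apply: ltW; near: L; exact: nbhs_infty_gtr.
have L2 : (2 * M <= L%:R * `|x - y|)%R.
  rewrite -[leLHS](@divfK _ dl) ?(gt_eqF dl0)//.
  by apply: ler_pM => //; [rewrite divr_ge0 ?mulr_ge0// ltW|exact: ltW].
have := hM x; have := hM y; rewrite !ler_norml => /andP[h1 _] /andP[_ h2].
by have e0' : (0 < e)%R := e0; lra.
Unshelve. all: by end_near. Qed.

Lemma lower_envelope_bounded L x : (`|lower_envelope L x| <= M)%R.
Proof.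
rewrite ler_norml; apply/andP; split; first exact: le_lower_envelope.
by apply: (le_trans (lower_envelope_le_fun L x)); have := hM x; rewrite ler_norml => /andP[].
Qed.

End lipschitz_regularization.

Lemma integrable_bounded {R : realType} dV (V : measurableType dV) (Q : probability V R) (g : V -> R) (M : R) :
  measurable_fun setT g -> (forall x, `|g x| <= M)%R -> Q.-integrable setT (EFin \o g).
Proof.
move=> mg gM; apply: (@le_integrable _ _ _ Q _ measurableT _ (EFin \o cst M)) => //.
- exact/measurable_EFinP.
- by move=> x _ /=; rewrite lee_fin (le_trans (gM x))// ler_norm.
- exact: finite_measure_integrable_cst.
Qed.

Section law_convergence.
Context {R : realType} {d} {Omega : nat -> measurableType d} (P : forall n, probability (Omega n) R).
Context {d'} {Omega' : measurableType d'} (P' : probability Omega' R).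
Variables (X : forall n, Omega n -> R) (Y : Omega' -> R).
Arguments X : clear implicits.
Hypotheses (mX : forall n, measurable_fun setT (X n)) (mY : measurable_fun setT Y).
Hypothesis lipXY : forall h : R -> R, lip1 h -> forall eps : R, (0 < eps)%R ->
  \forall n \near \oo, `|\int[P n]_w (h (X n w))%:E - \int[P']_w (h (Y w))%:E| <= eps%:E.

(** An envelope is below h under every law, while its mean needs to be close to that of h under the
    limit law only. This gives one inequality; the other comes from - h. *)
Lemma lower_limit (h : R -> R) (M : R) : continuous h -> (forall x, `|h x| <= M)%R ->
  forall eps : R, (0 < eps)%R ->
  \forall n \near \oo, (fine (\int[P']_w (h (Y w))%:E) - eps <= fine (\int[P n]_w (h (X n w))%:E))%R.
Proof.
move=> ch hM eps e0.
have mh : measurable_fun setT h by exact: continuous_measurable_fun.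
have me L : measurable_fun setT (lower_envelope h L).
  have := continuous_measurable_fun (lip1_continuous (lower_envelope_lip hM L)) => m1.
  have L0 : (1 + L%:R != 0 :> R)%R by rewrite gt_eqF// ltr_pwDl.
  apply: (eq_measurable_fun (fun x => (1 + L%:R) * ((1 + L%:R)^-1 * lower_envelope h L x))%R).
    by move=> x _; rewrite mulrA divff// mul1r.
  exact: measurable_funM.
have iY : P'.-integrable setT (EFin \o (fun w => h (Y w))).
  by apply: (@integrable_bounded _ _ _ _ _ M) => //; exact: measurableT_comp.
have iYL L : P'.-integrable setT (EFin \o (fun w => lower_envelope h L (Y w))).
  by apply: (@integrable_bounded _ _ _ _ _ M) => [|x]; [exact: measurableT_comp|exact: lower_envelope_bounded].
have [L HL] : exists L, (fine (\int[P']_w (h (Y w))%:E) - eps / 2 <= fine (\int[P']_w (lower_envelope h L (Y w))%:E))%R.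
  have iM : P'.-integrable setT (EFin \o cst M) by exact: finite_measure_integrable_cst.
  have cE w : [set: Omega'] w -> (lower_envelope h L (Y w))%:E @[L --> \oo] --> (h (Y w))%:E.
    move=> _; apply/fine_cvgP; split; first exact: nearW.
    have H := @lower_envelope_cvg _ _ _ ch hM (Y w).
    exact H.
  have mYL L : measurable_fun setT (fun w => (lower_envelope h L (Y w))%:E).
    by apply/measurable_EFinP; exact: measurableT_comp.
  have mhY : measurable_fun setT (fun w => (h (Y w))%:E).
    by apply/measurable_EFinP; exact: measurableT_comp.
  have bE w L : [set: Omega'] w -> `|(lower_envelope h L (Y w))%:E| <= (EFin \o cst M) w.
    by move=> _; rewrite abse_EFin lee_fin; exact: lower_envelope_bounded.
  have [_ _ cv] := dominated_convergence measurableT mYL mhY (aeW _ cE) iM (aeW _ bE).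
  have fY : \int[P']_w (h (Y w))%:E \is a fin_num by exact: integrable_fin_num iY.
  have := cv; rewrite /= -[X in _ --> X](fineK fY) => /fine_cvgP[_ /cvgrPdist_le/(_ _ (divr_gt0 e0 (ltr0n R 2)))].
  case=> L _ /(_ L (leqnn L)) /=; rewrite ler_norml => /andP[_ h1].
  by exists L; lra.
have l0 : (0 < 1 + L%:R :> R)%R by rewrite ltr_pwDl.
have := lipXY (lower_envelope_lip hM L) (divr_gt0 (divr_gt0 e0 (ltr0n R 2)) l0).
apply: filterS => n.
have iX : (P n).-integrable setT (EFin \o (fun w => h (X n w))).
  by apply: (@integrable_bounded _ _ _ _ _ M) => //; exact: measurableT_comp.
have iXL : (P n).-integrable setT (EFin \o (fun w => lower_envelope h L (X n w))).
  by apply: (@integrable_bounded _ _ _ _ _ M) => [|x]; [exact: measurableT_comp|exact: lower_envelope_bounded].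
under eq_integral do rewrite EFinM.
under [X in `|_ - X|]eq_integral do rewrite EFinM.
rewrite !integralZl//; last exact: iYL.
move: (integrable_fin_num measurableT iXL) (integrable_fin_num measurableT (iYL L)) HL.
have le : \int[P n]_w (lower_envelope h L (X n w))%:E <= \int[P n]_w (h (X n w))%:E.
  by apply: le_integral => // w _; rewrite lee_fin (lower_envelope_le_fun hM).
move: le (integrable_fin_num measurableT iX) => /=.
case: (\int[P n]_w (h (X n w))%:E) => [a| |] //; case: (\int[P n]_w (lower_envelope h L (X n w))%:E) => [b| |] //.
case: (\int[P']_w (lower_envelope h L (Y w))%:E) => [c| |] //=.
rewrite lee_fin => ba _ _ _ HL; rewrite lee_fin -mulrBr normrM.
rewrite ger0_norm ?invr_ge0 ?(ltW l0)// mulrC ler_pM2r ?invr_gt0// ler_norml => /andP[h1 _].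
by lra.
Qed.

Lemma law_convergence (h : R -> R) : continuous h -> bounded_fun h ->
  \int[P n]_w (h (X n w))%:E @[n --> \oo] --> \int[P']_w (h (Y w))%:E.
Proof.
move=> ch [M0 [_ HM]].
have hM x : (`|h x| <= M0 + 1)%R by apply: (HM (M0 + 1)%R) => //; rewrite ltrDl.
have mh : measurable_fun setT h by exact: continuous_measurable_fun.
have iY : P'.-integrable setT (EFin \o (fun w => h (Y w))).
  by apply: (@integrable_bounded _ _ _ _ _ (M0 + 1)%R) => //; exact: measurableT_comp.
have iX n : (P n).-integrable setT (EFin \o (fun w => h (X n w))).
  by apply: (@integrable_bounded _ _ _ _ _ (M0 + 1)%R) => //; exact: measurableT_comp.
have fY := integrable_fin_num measurableT iY; rewrite -(fineK fY).
apply/fine_cvgP; split; first by apply: nearW => n; exact: integrable_fin_num (iX n).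
apply/cvgrPdist_le => e e0 /=.
have chN : continuous (fun x => - h x)%R by move=> x; apply: cvgN; exact: ch.
have hMN x : (`|- h x| <= M0 + 1)%R by rewrite normrN.
have H1 := lower_limit ch hM e0; have H2 := lower_limit chN hMN e0.
near=> n; rewrite ler_norml.

have g1 : (fine (\int[P']_w (h (Y w))%:E) - e <= fine (\int[P n]_w (h (X n w))%:E))%R by near: n.
have g2 : (fine (\int[P']_w (- h (Y w))%:E) - e <= fine (\int[P n]_w (- h (X n w))%:E))%R by near: n.
have eN dV (V : measurableType dV) (Q : probability V R) (g : V -> R) : Q.-integrable setT (EFin \o g) ->
    fine (\int[Q]_w (- g w)%:E) = (- fine (\int[Q]_w (g w)%:E))%R.
  move=> ig; under eq_integral do rewrite EFinN.
  by rewrite integralN ?fineN//; apply: integrable_add_def.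
rewrite !eN// in g2.
by apply/andP; split; lra.
Unshelve. all: by end_near. Qed.

End law_convergence.

Lemma cvge_near {R : realType} (u : (\bar R)^nat) (v : \bar R) (eps : R) : u @ \oo --> v ->
  v \is a fin_num -> (0 < eps)%R -> \forall n \near \oo, `|u n - v| <= eps%:E.
Proof.
case: v => // v /fine_cvgP[fu /cvgrPdist_le H] _ /H; apply: filterS2 fu => n /=.
by case: (u n) => //= r _; rewrite distrC.
Qed.

(** The truncated power [Num.min (x ^+ 4) K] is bounded and continuous, so its means converge.
    Uniform integrability bounds what truncation loses under all the [P n] at once, and monotone
    convergence under the limit law supplies the level for the lower bound. *)
Lemma fourth_convergence {R : realType} {d} {Omega : nat -> measurableType d}
    (P : forall n, probability (Omega n) R) {d'} {Omega' : measurableType d'} (P' : probability Omega' R)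
    (X : forall n, Omega n -> R) (Y : Omega' -> R) (c : R) :
  (forall n, measurable_fun setT (X n)) -> measurable_fun setT Y ->
  (forall h : R -> R, lip1 h -> forall eps : R, (0 < eps)%R ->
    \forall n \near \oo, `|\int[P n]_w (h (X n w))%:E - \int[P']_w (h (Y w))%:E| <= eps%:E) ->
  \int[P']_w (Y w ^+ 4)%:E = c%:E -> uniformly_integrable P (fun n w => (X n w ^+ 4)%R) ->
  forall eps : R, (0 < eps)%R -> \forall n \near \oo, `|\int[P n]_w (X n w ^+ 4)%:E - c%:E| <= eps%:E.
Proof.
move=> mX mY lipXY Yc ui eps e0.
have e2 : (0 < eps / 2)%R by rewrite divr_gt0.
pose h (K x : R) := Num.min (x ^+ 4)%R K.
have p4 (x : R) : (0 <= x ^+ 4)%R by rewrite exprn_even_ge0.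
have h0 K x : (0 <= K)%R -> (0 <= h K x)%R by move=> K0; rewrite le_min p4.
have h4 K x : (h K x <= x ^+ 4)%R by rewrite ge_min lexx.
have mX4 n : measurable_fun setT (fun w => (X n w ^+ 4)%R) by exact: measurable_funX.
have mY4 : measurable_fun setT (fun w => (Y w ^+ 4)%R) by exact: measurable_funX.
have mhX K n : measurable_fun setT (fun w => (h K (X n w))%:E).
  by apply/measurable_EFinP; apply: measurable_minr => //; exact: measurable_cst.
have mhY K : measurable_fun setT (fun w => (h K (Y w))%:E).
  by apply/measurable_EFinP; apply: measurable_minr => //; exact: measurable_cst.
have ch K : continuous (h K).
  move=> x; exact: (@continuous_min R R (fun y => y ^+ 4)%R (cst K) x (@exprn_continuous R 4 x) (@cst_continuous _ _ K x)).
have bh K : (0 <= K)%R -> bounded_fun (h K).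
  move=> K0; exists K; split=> [|M KM x _ /=]; first exact: num_real.
  by rewrite ger0_norm ?h0// (le_trans _ (ltW KM))// ge_min lexx orbT.
have LY K : (0 <= K)%R -> \int[P']_w (h K (Y w))%:E <= c%:E.
  move=> K0; rewrite -Yc; apply: ge0_le_integral => //.
  - by move=> w _; rewrite lee_fin h0.
  - exact/measurable_EFinP.
  - by move=> w _; rewrite lee_fin.
have fY K : (0 <= K)%R -> \int[P']_w (h K (Y w))%:E \is a fin_num.
  move=> K0; rewrite ge0_fin_numE; first exact: le_lt_trans (LY _ K0) (ltry c).
  by apply: integral_ge0 => w _; rewrite lee_fin h0.
have near_h K : (0 <= K)%R ->
    \forall n \near \oo, `|\int[P n]_w (h K (X n w))%:E - \int[P']_w (h K (Y w))%:E| <= (eps / 2)%:E.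
  move=> K0; apply: cvge_near => //; last exact: fY.
  exact: (law_convergence mX mY lipXY (ch K) (bh K K0)).
have [M HM] := ui _ e2.
pose K := Num.max M 0%R; have K0 : (0 <= K)%R by rewrite le_max lexx orbT.
have [j Hj] : exists j : nat, (c - eps / 2)%:E < \int[P']_w (h (j%:R ^+ 2)%R (Y w))%:E.
  apply: contrapT => nex; have : \int[P']_w (Y w ^+ 4)%:E <= (c - eps / 2)%:E.
    apply: le_integral_truncated => // n; rewrite leNgt; apply/negP => Hn.
    by apply: nex; exists n.
  by rewrite Yc lee_fin => le1; move: e2; clear -le1; lra.
have j0 : (0 <= j%:R ^+ 2 :> R)%R by rewrite exprn_ge0.
have up n : \int[P n]_w (X n w ^+ 4)%:E <= \int[P n]_w (h K (X n w))%:E + (eps / 2)%:E.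
  pose A := [set w | (M < `|X n w ^+ 4|)%R].
  have mA : measurable A.
    rewrite (_ : A = setT `&` (fun w => X n w ^+ 4)%R @^-1` [set` `]M, +oo[]); first exact: mX4.
    by apply/seteqP; split=> w; rewrite /A /= in_itv/= andbT ger0_norm//; case.
  have mAC : measurable (~` A) by exact: measurableC.
  rewrite -[X in integral _ X _](setvU A) ge0_integral_setU//; last 3 first.
  - by rewrite setvU; exact/measurable_EFinP.
  - by move=> w _; rewrite lee_fin.
  - by rewrite disj_set2E setICl.
  apply: leeD.
    apply: (@le_trans _ _ (\int[P n]_(w in ~` A) (h K (X n w))%:E)).
      apply: ge0_le_integral => //.
      + by move=> w _; rewrite lee_fin.
      + by apply: measurable_funTS; exact/measurable_EFinP.
      + by apply: measurable_funTS.
      + move=> w; rewrite /A /= ger0_norm// => /negP; rewrite -leNgt => wM.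
        by rewrite lee_fin le_min lexx le_max wM.
    by apply: ge0_subset_integral => // w _; rewrite lee_fin h0.
  apply: le_trans (HM n); rewrite le_eqVlt; apply/orP; left; apply/eqP.
  by apply: eq_integral => w _; rewrite ger0_norm.
have low n : \int[P n]_w (h (j%:R ^+ 2)%R (X n w))%:E <= \int[P n]_w (X n w ^+ 4)%:E.
  apply: ge0_le_integral => //.
  - by move=> w _; rewrite lee_fin h0.
  - exact/measurable_EFinP.
  - by move=> w _; rewrite lee_fin.
apply: filterS2 (near_h _ K0) (near_h _ j0) => n.
move: (up n) (low n) Hj (LY _ K0) (fY _ K0) (fY _ j0).
case: (\int[P']_w (h K (Y w))%:E) => [y1| |] //; case: (\int[P']_w (h (j%:R ^+ 2)%R (Y w))%:E) => [y2| |] //.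
case: (\int[P n]_w (h K (X n w))%:E) => [x1| |] //; case: (\int[P n]_w (h (j%:R ^+ 2)%R (X n w))%:E) => [x2| |] //.
case: (\int[P n]_w (X n w ^+ 4)%:E) => [a| |] //.
rewrite !lee_fin lte_fin => h1 h2 h3 h5 _ _; rewrite !ler_norml => /andP[h6 h7] /andP[h8 h9].
by apply/andP; split; lra.
Qed.

(** * The quantity B3 in terms of contractions *)

Section contractions_B3.
Context d {Z : measurableType d} {R : realType}.
Variables (mu : {sigma_finite_measure set Z -> \bar R}) (k : nat) (q : 'I_k -> nat).
Hypothesis q_ge1 : forall i, (1 <= q i)%N.
Hypothesis q_incr : forall i j : 'I_k, (i < j)%N -> (q i < q j)%N.
Variable f : forall i, (q i).-tuple Z -> R.
Arguments f : clear implicits.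
Hypothesis mf : forall i, measurable_fun setT (f i).
Notation K i := (app_seq (f i)).

Lemma bigmaxe_ge0 (I : Type) (r : seq I) (Q : pred I) (G : I -> \bar R) :
  0 <= \big[maxe/0]_(i <- r | Q i) G i.
Proof. by elim/big_rec: _ => // i x _ x0; rewrite le_max x0 orbT. Qed.

Lemma bigmaxe_le (I : eqType) (r : seq I) (Q : pred I) (G : I -> \bar R) x : 0 <= x ->
  (forall i, i \in r -> Q i -> G i <= x) -> \big[maxe/0]_(i <- r | Q i) G i <= x.
Proof. by move=> x0 H; rewrite big_seq_cond; apply: bigmax_le => // i /andP[]; exact: H. Qed.

Lemma le_of_sqr (x : \bar R) (c : R) : (0 <= c)%R -> 0 <= x -> x ^+ 2 <= (c ^+ 2)%:E -> x <= c%:E.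
Proof.
move=> c0; case: x => [r| |] //.
by rewrite lee_fin => r0; rewrite expe2 -EFinM -expr2 !lee_fin ler_sqr.
Qed.

Lemma Lnorm4_sqr i : (('N[power_measure mu (q i)]_(4%:E)[EFin \o f i]) ^+ 2) ^+ 2 =
  contraction_sqr mu (K i) (K i) 0 (q i) 0 0.
Proof.
have mK : mker (q i) (K i) by exact: mker_app_seq.
rewrite contraction_self0 ?add0n ?addn0// mixed_0q0//.
have p4 (x : \bar R) : 0 <= x -> x `^ 4 = (x ^+ 2) ^+ 2.
  case: x => [r| |]// r0; rewrite !expe2.
    by rewrite poweR_EFin -!EFinM powR_mulrn// -!expr2 -exprM.
  by rewrite poweRyr// !mulyy.
rewrite -p4 ?Lnorm_ge0// poweR_Lnorm//; apply: eq_integral => x _.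
rewrite p4 ?abse_ge0// sqe_abs app_seqE !expe2 /= -?EFinM; congr EFin; ring.
Qed.

Lemma B3_ge0 (s : R) : (0 < s)%R -> 0 <= B3 mu f s.
Proof.
by move=> s0; rewrite mule_ge0 ?lee_fin ?invr_ge0 ?(ltW s0)// !adde_ge0// bigmaxe_ge0.
Qed.

(** The value l = 0 falls under the third maximum. For i = j a contraction that is not total has
    [l < q i] and falls under the first one, and i < j under the second. *)
Lemma contraction_le_B3 (s : R) i j r l : (0 < s)%R -> relevant q i j r l ->
  contraction_sqr mu (K i) (K j) l (r - l) (q i - r) (q j - r) <= (s%:E * B3 mu f s) ^+ 2.
Proof.
move=> s0 /and5P[r0 lr ri rj /andP[ne cs]].
rewrite /B3 muleA -EFinM divff ?gt_eqF// mul1e.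
set m1 := (X in X + _ + _); set m2 := (X in _ + X + _); set m3 := (X in _ + _ + X).
have m10 : 0 <= m1 by exact: bigmaxe_ge0.
have m20 : 0 <= m2 by exact: bigmaxe_ge0.
have m30 : 0 <= m3 by exact: bigmaxe_ge0.
case: (posnP l) cs => [l0|l0] /=.
  rewrite l0 andbT /= => /andP[/eqP ij /eqP rq]; rewrite -ij rq subn0 subnn -Lnorm4_sqr.
  apply: sqe_le; first exact: sqe_ge0.
  by apply: (@le_trans _ _ m3); [exact: (@bigmax_sup _ _ _ _ i)|rewrite leeDr ?adde_ge0].
rewrite !andbF orbF => ij; rewrite -star_norm_sqr//; apply: sqe_le; first exact: Lnorm_ge0.
have [/val_inj ij2|ij2] := eqVneq (i : nat) j.
  move: ne rj; rewrite -ij2 eqxx /= => ne _.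
  have lq : (l < q i)%N.
    rewrite ltn_neqAle (leq_trans lr ri) andbT; apply: contra ne => /eqP lq.
    have rq : r = q i by apply/eqP; rewrite eqn_leq ri -lq.
    by rewrite rq lq !eqxx.
  have l1 : (1 < q i)%N by exact: leq_trans lq.
  apply: (@le_trans _ _ m1); last by rewrite -addeA leeDl// adde_ge0.
  apply: (@bigmax_sup _ _ _ _ i) => //.
  apply: (le_trans _ (@le_bigmax_seq _ _ _ _ _ r xpredT _ _ _)) => //; last by rewrite mem_index_iota r0.
  apply: (le_trans _ (@le_bigmax_seq _ _ _ _ _ l xpredT _ _ _)) => //.
  by rewrite mem_index_iota l0 ltnS leq_min lr -ltnS prednK// (leq_trans _ l1).
apply: (@le_trans _ _ m2); last by rewrite addeAC leeDr ?adde_ge0.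
apply: (@bigmax_sup _ _ _ _ i) => //; apply: (@bigmax_sup _ _ _ _ j).
  by rewrite ltn_neqAle ij2.
apply: (le_trans _ (@le_bigmax_seq _ _ _ _ _ r xpredT _ _ _)) => //; last by rewrite mem_index_iota r0.
apply: (le_trans _ (@le_bigmax_seq _ _ _ _ _ l xpredT _ _ _)) => //.
by rewrite mem_index_iota l0.
Qed.

Lemma B3_le (s c : R) : (0 < s)%R -> (0 <= c)%R ->
  (forall i j r l, relevant q i j r l ->
    contraction_sqr mu (K i) (K j) l (r - l) (q i - r) (q j - r) <= (c ^+ 2)%:E) ->
  B3 mu f s <= (s^-1 * (3 * c))%:E.
Proof.
move=> s0 c0 H; rewrite /B3 EFinM lee_wpmul2l ?lee_fin ?invr_ge0 ?(ltW s0)//.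
rewrite (_ : 3 * c = c + c + c)%R; last by ring.
have star_le i j r l : relevant q i j r l -> star_norm mu (f i) (f j) r l <= c%:E.
  move=> rel; apply: le_of_sqr => //; first exact: Lnorm_ge0.
  have /and5P[_ lr ri rj _] := rel.
  by rewrite star_norm_sqr//; exact: H.
rewrite !EFinD; apply: leeD; first apply: leeD.
- apply: bigmaxe_le; rewrite ?lee_fin// => i _ qi; apply: bigmaxe_le; rewrite ?lee_fin// => r.
  rewrite mem_index_iota ltnS => /andP[r1 rq] _; apply: bigmaxe_le; rewrite ?lee_fin// => l.
  rewrite mem_index_iota ltnS leq_min => /andP[l1 /andP[lr lq]] _; apply: star_le.
  rewrite /relevant r1 lr rq l1 leqnn eqxx /= andbT; apply/negP => /andP[/eqP e1 /eqP e2].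
  by move: lq qi l1; rewrite -e2 -e1; case: (q i) => // n /= /ltn_geF; rewrite leqnn.
- apply: bigmaxe_le; rewrite ?lee_fin// => i _ _; apply: bigmaxe_le; rewrite ?lee_fin// => j _ ij.
  apply: bigmaxe_le; rewrite ?lee_fin// => r.
  rewrite mem_index_iota ltnS => /andP[r1 rq] _; apply: bigmaxe_le; rewrite ?lee_fin// => l.
  rewrite mem_index_iota ltnS => /andP[l1 lr] _; apply: star_le.
  have qij := q_incr ij.
  by rewrite /relevant r1 lr rq (leq_trans rq (ltnW qij)) l1 (ltnW ij) (ltn_eqF qij).
- apply: bigmaxe_le; rewrite ?lee_fin// => i _ _; apply: le_of_sqr => //; first exact: sqe_ge0.
  have := H i i (q i) 0%N; rewrite subn0 subnn Lnorm4_sqr; apply.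
  by rewrite /relevant q_ge1 leqnn !eqxx (gtn_eqF (q_ge1 i)).
Qed.

End contractions_B3.

Lemma klipschitz1E {R : realType} (h : R -> R) : 1.-lipschitz (h : R^o -> R^o) <-> lip1 h.
Proof.
split=> [H x y|H [x y] _ /=]; last by rewrite mul1r; exact: H.
by have := H (x, y) (conj Logic.I Logic.I); rewrite /= mul1r.
Qed.

Lemma expectationE {R : realType} d (Omega : measurableType d) (P : probability Omega R) (X : Omega -> R) :
  'E_P[X] = \int[P]_w (X w)%:E.
Proof. by rewrite unlock. Qed.

(** * Distance and cumulant bounds for a single functional *)

Section normal_approximation.
Context {dZ dO dN} {Z : measurableType dZ} {Omega : measurableType dO} {OmegaN : measurableType dN} {R : realType}.
Variables (P : probability Omega R) (mu : {sigma_finite_measure set Z -> \bar R}) (eta : R.-ker Omega ~> Z).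
Hypotheses (hZ : borel_space Z R) (hA : no_atoms mu) (hP : poisson_measure P mu eta).
Variables (k : nat) (q : 'I_k -> nat).
Hypothesis q_ge1 : forall i, (1 <= q i)%N.
Hypothesis q_incr : forall i j : 'I_k, (i < j)%N -> (q i < q j)%N.
Variables (f : forall i, (q i).-tuple Z -> R) (X : 'I_k -> Omega -> R) (F : Omega -> R).
Arguments f : clear implicits.
Hypotheses (L2f : forall i, L2s mu (f i)) (fi : assumption_i mu f).
Hypothesis mX : forall i, measurable_fun setT (X i).
Hypothesis fX : forall i, is_multiple_integral P mu eta (f i) (X i).
Hypothesis mF : measurable_fun setT F.
Hypothesis FE : {ae P, forall w, F w = (\sum_i X i w)%R}.
Variable s : R.
Hypotheses (s0 : (0 < s)%R) (F2 : \int[P]_w (F w ^+ 2)%:E = (s ^+ 2)%:E).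

Let mf i : measurable_fun setT (f i).
Proof. exact: (measurable_kernel_f L2f). Qed.

Lemma integrable_lip1 (h : R -> R) : lip1 h -> P.-integrable setT (EFin \o (fun w => h (F w))).
Proof.
move=> hl; have mhF : measurable_fun setT (fun w => h (F w)).
  exact: measurableT_comp (continuous_measurable_fun (lip1_continuous hl)) mF.
have mF2 : measurable_fun setT (fun w => (F w ^+ 2)%:E) by apply/measurable_EFinP; exact: measurable_funX.
have iF2 : P.-integrable setT (fun w => (F w ^+ 2)%:E).
  apply/integrableP; split => //.
  rewrite (eq_integral (fun w => (F w ^+ 2)%:E)) ?F2 ?ltry// => w _.
  by rewrite abse_EFin ger0_norm ?sqr_ge0.
have ic : P.-integrable setT (EFin \o cst (`|h 0| + 1)%R) by exact: finite_measure_integrable_cst.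
apply: (le_integrable measurableT _ _ (integrableD measurableT ic iF2)); first exact/measurable_EFinP.
move=> w _; rewrite /= -?EFinD ?abse_EFin lee_fin.
have := hl (F w) 0%R; rewrite subr0 => h1.
have h2 : (`|h (F w)| <= `|h 0| + `|F w|)%R.
  by rewrite -[h (F w)](subrK (h 0%R)) addrC (le_trans (ler_normD _ _))// lerD2l.
apply: (le_trans h2); rewrite [leRHS]ger0_norm ?addr_ge0 ?sqr_ge0// -addrA lerD2l -real_normK ?num_real//.
have := sqr_ge0 (`|F w| - 1 / 2)%R; rewrite !expr2 => ?; nra.
Qed.

Lemma lip1_distance_le (PN : probability OmegaN R) (N : {RV PN >-> R}) (sl : R) (h : R -> R) :
  (0 < sl)%R -> (forall A, measurable A -> distribution PN N A = normal_prob 0%R sl A) ->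
  lip1 h -> B3 mu f s < +oo ->
  `|\int[P]_w (h (F w))%:E - \int[PN]_w (h (N w))%:E| <= (@distance_constant R k q)%:E * B3 mu f s +
    (Num.sqrt (2 / pi) / Num.max s sl * `|s ^+ 2 - sl ^+ 2|)%:E.
Proof.
move=> sl0 NE hl Boo.
have nf : false -> forall i, {ae power_measure mu (q i), forall x, 0 <= f i x}%R by [].
have ap := approximants hZ hA hP L2f fi mX fX mF FE nf.
have B0 := B3_ge0 mu f s0.
case BE : (B3 mu f s) B0 Boo => [b| |] // b0 _; rewrite lee_fin in b0.
have cb i j r l : relevant q i j r l ->
    contraction_sqr mu (app_seq (f i)) (app_seq (f j)) l (r - l) (q i - r) (q j - r) <= ((s * b) ^+ 2)%:E.
  by move=> rel; have := contraction_le_B3 mu q_ge1 mf s0 rel; rewrite BE expe2 -!EFinM -expr2.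
have := lipschitz_distance hZ hA hP q_ge1 q_incr mF s0 F2 ap hl (mulr_ge0 (ltW s0) b0) cb.
rewrite (expectation_lip1_normal sl0 NE hl).
set g1 := gauss_mean (fun x => h (s * x))%R; set g2 := gauss_mean (fun x => h (sl * x))%R.
have g12 : (`|g1 - g2| <= `|s - sl| * Num.sqrt (2 / pi))%R := gauss_mean_scaling s sl hl.
have iF := integrable_lip1 hl.
have ig : P.-integrable setT (EFin \o cst g1) by exact: finite_measure_integrable_cst.
have Eg : \int[P]_x (EFin \o cst g1) x = g1%:E.
  by rewrite -[RHS]mule1 -(probability_setT P) -integral_cst.
have -> : \int[P]_w (s * (h (F w) - g1))%:E = s%:E * (\int[P]_w (h (F w))%:E - g1%:E).
  rewrite (eq_integral (fun w => s%:E * ((EFin \o (fun w => h (F w))) w - (EFin \o cst g1) w))) => [|w _]; last first.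
    by rewrite EFinM EFinB.
  rewrite integralZl//; last exact: integrableB.
  by rewrite integralB// Eg.
move: (integrable_fin_num measurableT iF) => /=; case: (\int[P]_w (h (F w))%:E) => [a| |] // _.
rewrite -!EFinB -!EFinM -EFinD !abse_EFin !lee_fin normrM (gtr0_norm s0) mulrCA ler_pM2l// => h1.
apply: (@le_trans _ _ (`|a - g1| + `|g1 - g2|)%R).
  by rewrite (le_trans _ (ler_normD _ _))// addrA subrK.
apply: lerD => //; apply: (le_trans g12).
(* Since [s + sl] is at least the maximum of both, [|s - sl|] is at most [|s ^+ 2 - sl ^+ 2|]
   divided by that maximum. *)
have mx0 : (0 < Num.max s sl)%R by rewrite lt_max s0.
rewrite subr_sqr normrM (gtr0_norm (addr_gt0 s0 sl0)) mulrC -mulrA ler_wpM2l ?sqrtr_ge0//.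
rewrite mulrCA ler_peMr// ler_pdivlMl// mulr1 ge_max.
by rewrite lerDl lerDr !ltW.
Qed.

Lemma distance_constant_ge0 : (0 <= @distance_constant R k q)%R.
Proof. by rewrite mulr_ge0 ?stein_constant_ge0// addr_ge0 ?sqrtr_ge0. Qed.

(** Adding 1 makes the constant positive, so that the bound holds trivially when [B3] is
    infinite. *)
Lemma wasserstein_le (PN : probability OmegaN R) (N : {RV PN >-> R}) (sl : R) : (0 < sl)%R ->
  (forall A, measurable A -> distribution PN N A = normal_prob 0%R sl A) ->
  wasserstein P PN F N <= (@distance_constant R k q + 1)%:E * B3 mu f s +
    (Num.sqrt (2 / pi) / Num.max s sl * `|s ^+ 2 - sl ^+ 2|)%:E.
Proof.
move=> sl0 NE; have dc0 := distance_constant_ge0.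
have B0 := B3_ge0 mu f s0.
have [Boo|] := ltP (B3 mu f s) +oo; last first.
  rewrite leye_eq => /eqP ->; rewrite gt0_muley ?lte_fin ?ltr_wpDl//.
  by rewrite addye// leey.
apply: ge_ereal_sup => _ [h /klipschitz1E hl <-]; rewrite !expectationE.
apply: (le_trans (lip1_distance_le sl0 NE hl Boo)); apply: leeD => //.
by rewrite lee_wpmul2r// lee_fin lerDl.
Qed.

Definition cumulant_constant : R := (\sum_i \sum_j 3 * fact_bound R (q i) (q j))%R.

Lemma cumulant_constant_ge0 : (0 <= cumulant_constant)%R.
Proof. by apply: sumr_ge0 => i _; apply: sumr_ge0 => j _; rewrite mulr_ge0// ltW// fact_bound_gt0. Qed.

Lemma B3_le_cumulant (c e : R) :
  (forall i, {ae power_measure mu (q i), forall x, 0 <= f i x}%R) ->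
  (0 <= c)%R -> (0 <= e)%R -> (cumulant_constant * e <= c ^+ 2)%R ->
  \int[P]_w (F w ^+ 4)%:E - (3 * s ^+ 4)%:E <= e%:E -> B3 mu f s <= (s^-1 * (3 * c))%:E.
Proof.
move=> fnn c0 e0 ce H.
have ap := approximants hZ hA hP L2f fi mX fX mF FE (fun _ : true => fnn).
have fb0 i j : (0 <= 3 * fact_bound R (q i) (q j))%R by rewrite mulr_ge0// ltW// fact_bound_gt0.
apply: B3_le => // i j r l rel.
apply: (le_trans (contraction_le_cumulant hZ hA hP q_ge1 mF F2 ap isT rel)).
apply: (@le_trans _ _ ((3 * fact_bound R (q i) (q j))%:E * e%:E)); first by rewrite lee_wpmul2l ?lee_fin.
rewrite -EFinM lee_fin (le_trans _ ce)// ler_wpM2r// /cumulant_constant (bigD1 i)//= (bigD1 j)//=.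
by rewrite -addrA lerDl addr_ge0// sumr_ge0// => i' _; rewrite ?fb0// sumr_ge0.
Qed.

End normal_approximation.

Theorem theorem3p12 (R : realType) (k : nat) (q : 'I_k -> nat)
    (k_ge1 : (1 <= k)%N) (q_ge1 : forall i, (1 <= q i)%N)
    (q_incr : forall i j : 'I_k, (i < j)%N -> (q i < q j)%N) :
  exists2 C0 : R, (0 < C0)%R &
  forall (dZ dO dN : measure_display)
    (Z : nat -> measurableType dZ)
    (mu : forall n, {sigma_finite_measure set (Z n) -> \bar R})
    (Omega : nat -> measurableType dO)
    (P : forall n, probability (Omega n) R)
    (eta : forall n, R.-ker (Omega n) ~> (Z n))
    (f : forall n (i : 'I_k), (q i).-tuple (Z n) -> R)
    (I : forall n (i : 'I_k), {RV (P n) >-> R})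
    (F : forall n, {RV (P n) >-> R})
    (sigma : nat -> R) (sigma_lim : R)
    (OmegaN : measurableType dN) (PN : probability OmegaN R)
    (N : {RV PN >-> R}),
  (forall n, borel_space (Z n) R) ->
  (forall n, no_atoms (mu n)) ->
  (forall n, poisson_measure (P n) (mu n) (eta n)) ->
  (forall n i, L2s (mu n) (f n i)) ->
  (forall n i, ~ {ae power_measure (mu n) (q i), forall x, f n i x = 0%R}) ->
  (forall n, assumption_i (mu n) (f n)) ->
  (forall n, assumption_ii (mu n) (f n)) ->
  (forall n, assumption_iii (mu n) (f n)) ->
  (forall n i, is_multiple_integral (P n) (mu n) (eta n) (f n i) (I n i)) ->
  (forall n, {ae P n, forall w, F n w = (\sum_(i < k) I n i w)%R}) ->
  (forall n, (0 < sigma n)%R) ->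
  (forall n, 'E_(P n)[fun w => (F n w ^+ 2)%R] = ((sigma n) ^+ 2)%:E) ->
  (0 < sigma_lim)%R ->
  ((sigma n ^+ 2)%R @[n --> \oo] --> (sigma_lim ^+ 2)%R) ->
  (forall A, measurable A ->
     distribution PN N A = normal_prob 0%R sigma_lim A) ->
  let dW n := wasserstein (P n) PN (F n) N in
  let b n := B3 (mu n) (f n) (sigma n) in
  let fourth n :=
    'E_(P n)[fun w => (F n w ^+ 4)%R] - (3 * sigma n ^+ 4)%:E in
  let dW_to_0 := dW n @[n --> \oo] --> 0 in
  let b_to_0 := b n @[n --> \oo] --> 0 in
  let fourth_to_0 := fourth n @[n --> \oo] --> 0 in
  let nonneg := forall n i,
    {ae power_measure (mu n) (q i), forall x, (0 <= f n i x)%R} in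
  [/\ forall n, dW n <= C0%:E * b n +
        (Num.sqrt (2 / pi) / Num.max (sigma n) sigma_lim *
           `|sigma n ^+ 2 - sigma_lim ^+ 2|)%:E,
      b_to_0 -> dW_to_0 /\ cvg_in_law P PN F N,
      nonneg -> fourth_to_0 -> b_to_0 &
      nonneg -> uniformly_integrable P (fun n w => (F n w ^+ 4)%R) ->
        (dW_to_0 <-> b_to_0) /\ (b_to_0 <-> fourth_to_0)].
Proof.
have dc0 := @distance_constant_ge0 R k q.
have C00 : (0 < @distance_constant R k q + 1)%R by rewrite ltr_wpDl.
exists (@distance_constant R k q + 1)%R => // dZ dO dN Z mu Omega P eta f I F sigma sl OmegaN PN N.
move=> hZ hA hP L2f _ fi _ _ fX FE s0 EF2 sl0 slim NE dW b fourth dW0 b0 fo0 nonneg.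
have F2 n : \int[P n]_w (F n w ^+ 2)%:E = (sigma n ^+ 2)%:E by rewrite -expectationE.
have mF n : measurable_fun setT (F n) by [].
have mN : measurable_fun setT N by [].
have mI n i : measurable_fun setT (I n i) by [].
have bound n : dW n <= (@distance_constant R k q + 1)%:E * b n +
    (Num.sqrt (2 / pi) / Num.max (sigma n) sl * `|sigma n ^+ 2 - sl ^+ 2|)%:E.
  exact: (wasserstein_le (hZ n) (hA n) (hP n) q_ge1 q_incr (L2f n) (fi n) (mI n) (fX n) (mF n) (FE n) (s0 n) (F2 n) sl0 NE).
have b_ge0 n : 0 <= b n := B3_ge0 (mu n) (f n) (s0 n).
have dW_ge0 n : 0 <= dW n.
  apply: (@le_trans _ _ `|'E_(P n)[cst 0%R \o F n] - 'E_PN[cst 0%R \o N]|) => //.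
  apply: ereal_sup_ubound; exists (cst 0%R) => //.
  by apply/klipschitz1E => x y; rewrite subrr normr0.
have lipXY : dW0 -> forall h : R -> R, lip1 h -> forall eps : R, (0 < eps)%R ->
    \forall n \near \oo, `|\int[P n]_w (h (F n w))%:E - \int[PN]_w (h (N w))%:E| <= eps%:E.
  move=> cv h hl eps e0; apply: filterS (cvge0_near cv e0) => n; apply: le_trans.
  by apply: ereal_sup_ubound; exists h; [exact/klipschitz1E|rewrite !expectationE].
have sq_near eps : (0 < eps)%R -> \forall n \near \oo, (`|sl ^+ 2 - sigma n ^+ 2| <= eps)%R.
  by move=> e0; move/cvgrPdist_le : slim => /(_ _ e0).
have b_dW : b0 -> dW0.
  move=> cb; apply: near_cvge0 => // eps e0.
  pose rt := Num.sqrt (2 / pi : R); have rt0 : (0 <= rt)%R by exact: sqrtr_ge0.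
  pose C := (@distance_constant R k q + 1)%R.
  have e1 : (0 < eps / 2 / C)%R by rewrite !divr_gt0.
  (* The maximum in the second term is at least sl, so this term is at most [rt / sl] times the
     variance gap; [rt + 1] in place of rt avoids a discussion of positivity. *)
  have e2 : (0 < eps / 2 * (sl / (rt + 1)))%R by rewrite mulr_gt0 ?divr_gt0// ltr_wpDl.
  apply: filterS2 (cvge0_near cb e1) (sq_near _ e2) => n h1 h2.
  apply: (le_trans (bound n)); rewrite [in leRHS](splitr eps) [leRHS]EFinD; apply: leeD.
    apply: (@le_trans _ _ (C%:E * (eps / 2 / C)%:E)); first by rewrite lee_wpmul2l// lee_fin ltW.
    by rewrite -EFinM mulrCA divff ?mulr1// gt_eqF.
  rewrite lee_fin distrC; apply: (@le_trans _ _ (rt / sl * (eps / 2 * (sl / (rt + 1))))%R).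
    apply: ler_pM => //; first by rewrite divr_ge0// le_max (ltW sl0) orbT.
    by rewrite ler_wpM2l// lef_pV2 ?posrE ?lt_max ?sl0 ?orbT// le_max lexx orbT.
  rewrite (_ : (rt / sl * (eps / 2 * (sl / (rt + 1))) = eps / 2 * (rt / (rt + 1)))%R); last first.
    by field; rewrite !gt_eqF// ltr_wpDl.
  by rewrite ler_piMr ?divr_ge0 ?(ltW e0)// ler_pdivrMr ?ltr_wpDl// mul1r lerDl.
have fo_b : nonneg -> fo0 -> b0.
  move=> nn cf; apply: near_cvge0 => // eps e0.
  have Cm0 := @cumulant_constant_ge0 R k q; set Cm := @cumulant_constant R k q in Cm0.
  (* Eventually [sigma n >= sl / 2], and then [3 * c / sigma n <= eps]. *)
  pose c := (eps * sl / 6)%R; have c0 : (0 < c)%R by rewrite divr_gt0// mulr_gt0.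
  have Cm1 : (0 < Cm + 1)%R by rewrite ltr_wpDl.
  have e1 : (0 < c ^+ 2 / (Cm + 1))%R by rewrite divr_gt0 ?exprn_gt0.
  have e2 : (0 < (sl / 2) ^+ 2)%R by rewrite exprn_gt0// divr_gt0.
  apply: filterS2 (cvge0_near cf e1) (sq_near _ e2) => n h1 h2.
  have hs : (sl / 2 <= sigma n)%R.
    rewrite -ler_sqr ?nnegrE ?(ltW (s0 n)) ?divr_ge0 ?(ltW sl0)//.
    move: h2; rewrite ler_norml => /andP[_]; rewrite exprMn exprVn.
    by have := sqr_ge0 sl; lra.
  have h3 : (Cm * (c ^+ 2 / (Cm + 1)) <= c ^+ 2)%R.
    by rewrite mulrCA ler_piMr ?sqr_ge0// ler_pdivrMr// mul1r lerDl.
  move: h1; rewrite /fourth expectationE => h1.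
  apply: (le_trans (B3_le_cumulant (hZ n) (hA n) (hP n) q_ge1 q_incr (L2f n) (fi n) (mI n) (fX n) (mF n) (FE n)
    (s0 n) (F2 n) (nn n) (ltW c0) (ltW e1) h3 h1)).
  rewrite lee_fin mulrC ler_pdivrMr//.
  have := ler_wpM2l (ltW e0) hs; rewrite /c; lra.
have dW_fo : uniformly_integrable P (fun n w => (F n w ^+ 4)%R) -> dW0 -> fo0.
  move=> ui cv; apply: near_cvg0 => eps e0; have e2 : (0 < eps / 2)%R by rewrite divr_gt0.
  have e6 : (0 < eps / 6)%R by rewrite divr_gt0.
  (* The normal law has fourth moment [3 * sl ^+ 4] while the cumulant subtracts [3 * sigma n ^+ 4]:
     the gap is at most 3 eps / 6, and the other half of eps is for the fourth moments. *)
  have s4 : \forall n \near \oo, (`|sl ^+ 4 - sigma n ^+ 4| <= eps / 6)%R.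
    have cv4 : (sigma n ^+ 2 * sigma n ^+ 2)%R @[n --> \oo] --> (sl ^+ 2 * sl ^+ 2)%R by exact: cvgM.
    move/cvgrPdist_le : cv4 => /(_ _ e6); apply: filterS => n /=.
    by rewrite -!exprD.
  have Nf := expectation_fourth_normal sl0 NE.
  apply: filterS2 (fourth_convergence mF mN (lipXY cv) Nf ui e2) s4 => n.
  rewrite /fourth expectationE; case: (\int[P n]_w (F n w ^+ 4)%:E) => [a| |] //.
  rewrite -?EFinB ?abse_EFin ?lee_fin !ler_norml => /andP[h1 h2] /andP[h3 h4].
  by apply/andP; split; lra.
split=> // [cb|nn ui].
  split; first exact: b_dW.
  move=> h ch bh; rewrite expectationE.
  have := law_convergence mF mN (lipXY (b_dW cb)) ch bh.
  by apply: cvg_trans; apply: near_eq_cvg; apply: nearW => n /=; rewrite expectationE.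
split; split=> [h|h].
- by apply: fo_b => //; exact: dW_fo.
- exact: b_dW.
- by apply: dW_fo => //; exact: b_dW.
- exact: fo_b.
Qed.
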